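(* There is a uniquely determined strongly bicovariant exterior algebra $\Omega(\mathbb C_\lambda[\mathrm{Poinc}_{1,1}])$ on $\mathbb C_\lambda[\mathrm{Poinc}_{1,1}]=\mathbb C[SO_{1,1}]\blacktriangleright\!\!\!\triangleleft U(b_+)$ such that the coaction $\Delta_R:U(b_+)\to U(b_+)\otimes\mathbb C_\lambda[\mathrm{Poinc}_{1,1}]$, $\Delta_Rt=1\otimes a_0+t\otimes c+x\otimes s$, $\Delta_Rx=1\otimes a_1+t\otimes s+x\otimes c$, is differentiable. It contains $\Omega(U(b_+))$ (in generators $a_0,a_1,\theta'$ in place of $t,x,\theta'$) as sub-exterior algebra and has the additional relations on degree 1 and 2, $$(dc)s=s\,dc,\quad(ds)c=c\,ds,\quad(dc)c=c\,dc=s\,ds=(ds)s,$$ $$[da_0,\begin{pmatrix}c \\ s\end{pmatrix}]=\lambda c\begin{pmatrix}dc \\ ds\end{pmatrix},\quad[da_1,\begin{pmatrix}c \\ s\end{pmatrix}]=\lambda s\begin{pmatrix}dc \\ ds\end{pmatrix},$$ $$[a_0,\begin{pmatrix}dc \\ ds\end{pmatrix}]=\lambda s\begin{pmatrix}ds \\ dc\end{pmatrix},\quad[a_1,\begin{pmatrix}dc \\ ds\end{pmatrix}]=\lambda(c-1)\begin{pmatrix}ds \\ dc\end{pmatrix},\quad[\theta',\begin{pmatrix}c \\ s\end{pmatrix}]=\lambda(c-1)\begin{pmatrix}dc \\ ds\end{pmatrix},$$ $$\{da_0,\begin{pmatrix}dc \\ ds\end{pmatrix}\}=\begin{pmatrix}0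 \\ \lambda\,ds\,dc\end{pmatrix},\quad\{da_1,\begin{pmatrix}dc \\ ds\end{pmatrix}\}=\begin{pmatrix}\lambda\,dc\,ds \\ 0\end{pmatrix}.$$ Moreover, $\Omega(\mathbb C_\lambda[\mathrm{Poinc}_{1,1}])=\Omega(\mathbb C[SO_{1,1}])\blacktriangleright\!\!\!\triangleleft\Omega(U(b_+))$ with coproduct that of $\mathbb C_\lambda[\mathrm{Poinc}_{1,1}]$ on degree 0 and $$\Delta_*dc=dc\otimes c+ds\otimes s+c\otimes dc+s\otimes ds,\quad\Delta_*ds=dc\otimes s+ds\otimes c+c\otimes ds+s\otimes dc,$$ $$\Delta_*da_0=1\otimes da_0+da_0\otimes c+da_1\otimes s+a_0\otimes dc+a_1\otimes ds,$$ $$\Delta_*da_1=1\otimes da_1+da_0\otimes s+da_1\otimes c+a_0\otimes ds+a_1\otimes dc,$$ $$\Delta_*\theta'=1\otimes\theta'+\theta'\otimes1-1\otimes da_0-da_0\otimes1+\Delta_*da_0.$$ Here uniquely determined is meant in the universal sense: the relations are those following from differentiability of $\Delta_R$ alone (other calculi with this property being quotients).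
   Context: Work over $\mathbb C$ with $\lambda\in\mathbb C$ nonzero; $\{\ ,\ \}$ is the anticommutator. $\mathbb C[SO_{1,1}]$ is the commutative Hopf algebra generated by $c,s$ with $c^2-s^2=1$, $\Delta c=c\otimes c+s\otimes s$, $\Delta s=c\otimes s+s\otimes c$, $\epsilon(c)=1$, $\epsilon(s)=0$, $Sc=c$, $Ss=-s$. $U(b_+)$ is generated by primitive $a_0,a_1$ with $[a_0,a_1]=\lambda a_1$. $U(b_+)$ acts on $\mathbb C[SO_{1,1}]$ by $a_0\triangleright c=\lambda s^2$, $a_0\triangleright s=\lambda sc$, $a_1\triangleright c=\lambda(cs-s)$, $a_1\triangleright s=\lambda(c^2-c)$ and $\mathbb C[SO_{1,1}]$ coacts on $U(b_+)$ by $\beta(a_0)=a_0\otimes c+a_1\otimes s$, $\beta(a_1)=a_0\otimes s+a_1\otimes c$. The bicrossproduct $\mathbb C_\lambda[\mathrm{Poinc}_{1,1}]$ contains $\mathbb C[SO_{1,1}]$ as sub-Hopf algebra and $U(b_+)$ as subalgebra, with cross relations $[a_0,c]=\lambda s^2$, $[a_0,s]=\lambda sc$, $[a_1,c]=\lambda(c-1)s$, $[a_1,s]=\lambda(c-1)c$ and $\Delta a_i=1\otimes a_i+\beta(a_i)$. The quantum spacetime is another copy of $U(b_+)$ with generators $t,x$ in place of $a_0,a_1$ (so $[t,x]=\lambda x$) and exterior algebra $\Omega(U(b_+))$ with $$[dx,x]=\lambda\theta',\ [dx,t]=0,\ [dt,x]=\lambda dx,\ [dt,t]=\lambda(dt-\theta'),\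 [\theta',x]=0,\ [\theta',t]=-\lambda\theta',$$ $$d\theta'=0,\ (dx)^2=(dt)^2=0,\ dx\,dt=-dt\,dx,\ dx\,\theta'=-\theta'dx,\ dt\,\theta'=-\theta'dt.$$ An exterior algebra on an algebra $A$ is a DGA $\Omega(A)=\oplus_{n\ge0}\Omega^n(A)$ with $\Omega^0=A$, generated by $A$ and $\Omega^1=\mathrm{span}\{a\,db\}$, $d^2=0$, graded Leibniz rule. The super tensor product $\underline\otimes$ has product $(a\otimes b)(e\otimes f)=(-1)^{|b||e|}ae\otimes bf$ and differential $d\otimes\mathrm{id}+(-1)^{|\ |}\mathrm{id}\otimes d$. For a Hopf algebra, $\Omega(A)$ is strongly bicovariant if it is a super-Hopf algebra (grade = form degree mod 2) with $\Delta_*$ preserving total degree, restricting to $\Delta$, and $\Delta_*d=(d\otimes\mathrm{id}+(-1)^{|\ |}\mathrm{id}\otimes d)\Delta_*$. A coaction $B\to B\otimes K$ (comodule algebra) is differentiable if it extends to a degree-preserving DGA map $\Omega(B)\to\Omega(B)\underline\otimes\Omega(K)$. In the super bicrossproduct, $\Omega(\mathbb C[SO_{1,1}])$ has the displayed relations among $c,s,dc,ds$; the extended action is $da_0\triangleright c=\lambda c\,dc$, $da_0\triangleright s=\lambda c\,ds$, $da_1\triangleright c=\lambda s\,dc$, $da_1\triangleright s=\lambda s\,ds$, $a_0\triangleright dc=\lambda s\,ds$, $a_0\triangleright ds=\lambda s\,dc$, $a_1\triangleright dc=\lambda(c-1)ds$, $a_1\triangleright ds=\lambda(c-1)dc$,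 $\theta'\triangleright c=\lambda(c-1)dc$, $\theta'\triangleright s=\lambda(c-1)ds$; the extended coaction is $\beta_*(da_0)=da_0\otimes c+da_1\otimes s+a_0\otimes dc+a_1\otimes ds$, $\beta_*(da_1)=da_0\otimes s+da_1\otimes c+a_0\otimes ds+a_1\otimes dc$, $\beta_*(\theta')=\theta'\otimes1-da_0\otimes1+\beta_*(da_0)$. In general $\Omega(A)\blacktriangleright\!\!\!\triangleleft\Omega(H)$ is $\Omega(A)\otimes\Omega(H)$ with $(\omega\otimes\eta)(\tau\otimes\xi)=(-1)^{|\eta_{(2)}||\tau|}\omega(\eta_{(1)}\triangleright\tau)\otimes\eta_{(2)}\xi$, $\Delta_*(\omega\otimes\eta)=(-1)^{|\omega_{(2)}||\eta_{(1)}{}^{(0)}|}\omega_{(1)}\otimes\eta_{(1)}{}^{(0)}\otimes\omega_{(2)}\eta_{(1)}{}^{(1)}\otimes\eta_{(2)}$ with $\beta_*(\eta)=\eta^{(0)}\otimes\eta^{(1)}$, and $d(\omega\otimes\eta)=d\omega\otimes\eta+(-1)^{|\omega|}\omega\otimes d\eta$. *)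

(* Defs.v *)
From HB Require Import structures.
From mathcomp Require Import all_boot all_order all_algebra.
From mathcomp Require Import boolp classical_sets reals.
From mathcomp Require Import ring.
From mathcomp Require Export complex.

Set Implicit Arguments.
Unset Strict Implicit.
Unset Printing Implicit Defensive.

Import GRing.Theory.
Local Open Scope ring_scope.
Local Open Scope quotient_scope.

Section Tensor.
Variables (K : fieldType) (V W : lmodType K).

Definition bilin (U : lmodType K) (f : V -> W -> U) : Prop :=
  (forall w, linear (f^~ w)) /\ (forall v, linear (f v)).

Definition fsum (U : lmodType K) (f : V -> W -> U) (l : seq (V * W)) : U :=
  \sum_(p <- l) f p.1 p.2.

(* Formal sums of pairs are identified when no bilinear map separates them. *)
Definition tequiv : rel (seq (V * W)) := fun l l' =>
  `[< forall (U : lmodType K) (f : V -> W -> U), bilin f -> fsum f l = fsum f l' >].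

Lemma tequiv_refl : reflexive tequiv.
Proof. by move=> l; apply/asboolP. Qed.
Lemma tequiv_sym : symmetric tequiv.
Proof.
by move=> l l'; apply/asboolP/asboolP => h U f bf; rewrite h.
Qed.
Lemma tequiv_trans : transitive tequiv.
Proof.
by move=> l l' l'' /asboolP h /asboolP h'; apply/asboolP => U f bf; rewrite h ?h'.
Qed.

Canonical tequiv_equiv := EquivRel tequiv tequiv_refl tequiv_sym tequiv_trans.

Definition tensor := {eq_quot tequiv}.
HB.instance Definition _ : EqQuotient _ tequiv tensor := EqQuotient.on tensor.
HB.instance Definition _ := Choice.on tensor.

Definition tpi (l : seq (V * W)) : tensor := \pi_tensor l.

Definition tlift (U : lmodType K) (f : V -> W -> U) (z : tensor) : U :=
  fsum f (repr z).

Lemma fsum_repr (U : lmodType K) (f : V -> W -> U) l :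
  bilin f -> tlift f (tpi l) = fsum f l.
Proof.
move=> bf; rewrite /tlift.
have : repr (tpi l) = l %[mod tensor] by rewrite reprK.
by move=> /eqmodP /asboolP h; apply: h.
Qed.

Lemma tensorE (y z : tensor) :
  (forall (U : lmodType K) (f : V -> W -> U), bilin f -> tlift f y = tlift f z) ->
  y = z.
Proof.
move=> h; rewrite -[y]reprK -[z]reprK; apply/eqmodP; apply/asboolP => U f bf.
exact: h.
Qed.

Definition tadd (y z : tensor) := tpi (repr y ++ repr z).
Definition topp (y : tensor) := tpi [seq (- p.1, p.2) | p <- repr y].
Definition tscale (k : K) (y : tensor) := tpi [seq (k *: p.1, p.2) | p <- repr y].

Section lift.
Variables (U : lmodType K) (f : V -> W -> U) (bf : bilin f).
Lemma bilinDl v v' w : f (v + v') w = f v w + f v' w.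
Proof. by have := bf.1 w 1 v v'; rewrite !scale1r. Qed.
Lemma bilinDr v w w' : f v (w + w') = f v w + f v w'.
Proof. by have := bf.2 v 1 w w'; rewrite !scale1r. Qed.
Lemma bilin0l w : f 0 w = 0.
Proof. by apply: (addrI (f 0 w)); rewrite -bilinDl !addr0. Qed.
Lemma bilin0r v : f v 0 = 0.
Proof. by apply: (addrI (f v 0)); rewrite -bilinDr !addr0. Qed.
Lemma bilinZl k v w : f (k *: v) w = k *: f v w.
Proof. by have := bf.1 w k v 0; rewrite /= bilin0l !addr0. Qed.
Lemma bilinZr k v w : f v (k *: w) = k *: f v w.
Proof. by have := bf.2 v k w 0; rewrite /= bilin0r !addr0. Qed.
Lemma tlift0_ : tlift f (tpi [::]) = 0.
Proof. by rewrite fsum_repr // /fsum big_nil. Qed.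
Lemma tliftD_ y z : tlift f (tadd y z) = tlift f y + tlift f z.
Proof. by rewrite fsum_repr // /fsum big_cat. Qed.
Lemma tliftN_ y : tlift f (topp y) = - tlift f y.
Proof.
rewrite fsum_repr // /fsum big_map -sumrN; apply: eq_bigr => p _ /=.
by rewrite -scaleN1r bilinZl scaleN1r.
Qed.
Lemma tliftZ_ k y : tlift f (tscale k y) = k *: tlift f y.
Proof.
rewrite fsum_repr // /fsum big_map scaler_sumr; apply: eq_bigr => p _ /=.
by rewrite bilinZl.
Qed.
End lift.

Lemma taddA : associative tadd.
Proof. by move=> x y z; apply: tensorE => U f bf; rewrite !tliftD_ // addrA. Qed.
Lemma taddC : commutative tadd.
Proof. by move=> x y; apply: tensorE => U f bf; rewrite !tliftD_ // addrC. Qed.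
Lemma tadd0 : left_id (tpi [::]) tadd.
Proof. by move=> x; apply: tensorE => U f bf; rewrite !tliftD_ // tlift0_ // add0r. Qed.
Lemma taddN : left_inverse (tpi [::]) topp tadd.
Proof.
by move=> x; apply: tensorE => U f bf; rewrite tliftD_ // tliftN_ // tlift0_ // addNr.
Qed.

HB.instance Definition _ := GRing.isZmodule.Build tensor taddA taddC tadd0 taddN.

Lemma tscaleA a b v : tscale a (tscale b v) = tscale (a * b) v.
Proof. by apply: tensorE => U f bf; rewrite !tliftZ_ // scalerA. Qed.
Lemma tscale1 : left_id 1 tscale.
Proof. by move=> x; apply: tensorE => U f bf; rewrite !tliftZ_ // scale1r. Qed.
Lemma tscaleDr : right_distributive tscale +%R.
Proof.
move=> k x y; apply: tensorE => U f bf.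
by rewrite !(tliftD_ bf, tliftZ_ bf) scalerDr.
Qed.
Lemma tscaleDl v : {morph tscale^~ v : a b / a + b}.
Proof.
move=> a b; apply: tensorE => U f bf.
by rewrite !(tliftD_ bf, tliftZ_ bf) scalerDl.
Qed.

HB.instance Definition _ :=
  GRing.Zmodule_isLmodule.Build K tensor tscaleA tscale1 tscaleDr tscaleDl.

Definition tens (v : V) (w : W) : tensor := tpi [:: (v, w)].

Lemma tlift_linear (U : lmodType K) (f : V -> W -> U) : bilin f -> linear (tlift f).
Proof. by move=> bf k x y; rewrite tliftD_ // tliftZ_. Qed.

Lemma tlift_tens (U : lmodType K) (f : V -> W -> U) v w :
  bilin f -> tlift f (tens v w) = f v w.
Proof. by move=> bf; rewrite fsum_repr // /fsum big_seq1. Qed.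

Lemma tens_bilin : bilin tens.
Proof.
split=> [w|v] k x y /=; apply: tensorE => U f bf;
  rewrite tliftD_ // tliftZ_ // !tlift_tens //.
- by rewrite bilinDl // bilinZl.
- by rewrite bilinDr // bilinZr.
Qed.

Lemma tensor_ind (P : tensor -> Prop) :
  P 0 -> (forall v w z, P z -> P (tens v w + z)) -> forall z, P z.
Proof.
move=> P0 PD z; rewrite -[z]reprK; elim: (repr z) => [//|[v w] l IH].
suff -> : \pi_tensor ((v, w) :: l) = tens v w + \pi_tensor l by apply: PD.
apply: tensorE => U f bf; rewrite tliftD_ // tlift_tens // !fsum_repr //.
by rewrite /fsum big_cons.
Qed.

End Tensor.
Arguments tens {K V W}.

Notation "v \ox w" := (tens v w) (at level 40, left associativity) : ring_scope.

Section TensorTheory.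
Variable K : fieldType.
Implicit Types U V W : lmodType K.

Lemma lin0 V W (f : V -> W) : linear f -> f 0 = 0.
Proof.
by move=> h; have := h 1 0 0; rewrite !scale1r !addr0 => /eqP; rewrite -subr_eq subrr => /eqP.
Qed.
Lemma linD V W (f : V -> W) : linear f -> {morph f : x y / x + y}.
Proof. by move=> h x y; have := h 1 x y; rewrite !scale1r. Qed.
Lemma linZ V W (f : V -> W) k x : linear f -> f (k *: x) = k *: f x.
Proof. by move=> h; have := h k x 0; rewrite (lin0 h) !addr0. Qed.

Lemma tlift_ext V W U (f g : tensor V W -> U) : linear f -> linear g ->
  (forall v w, f (v \ox w) = g (v \ox w)) -> forall z, f z = g z.
Proof.
move=> lf lg fg; elim/tensor_ind => [|v w z IH]; first by rewrite (lin0 lf) (lin0 lg).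
by rewrite (linD lf) (linD lg) fg IH.
Qed.

Definition tlift2 V W V' W' U (f : V -> W -> V' -> W' -> U)
    (z : tensor V W) (z' : tensor V' W') : U :=
  tlift (fun v w => tlift (f v w) z') z.

Section Lift2.
Variables (V W V' W' U : lmodType K) (f : V -> W -> V' -> W' -> U).
Hypothesis fr : forall v w, bilin (f v w).
Hypothesis fl : forall v' w', bilin (fun v w => f v w v' w').

Lemma tlift2_bilinl z' : bilin (fun v w => tlift (f v w) z').
Proof.
split=> [w|v] k x y /=.
- elim/tensor_ind: z' => [|v' w' z' IH].
    by rewrite !(lin0 (tlift_linear (fr _ _))) scaler0 addr0.
  rewrite !(linD (tlift_linear (fr _ _))) IH !tlift_tens //.
  by rewrite (bilinDl (fl v' w')) (bilinZl (fl v' w')) scalerDr addrACA.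
- elim/tensor_ind: z' => [|v' w' z' IH].
    by rewrite !(lin0 (tlift_linear (fr _ _))) scaler0 addr0.
  rewrite !(linD (tlift_linear (fr _ _))) IH !tlift_tens //.
  by rewrite (bilinDr (fl v' w')) (bilinZr (fl v' w')) scalerDr addrACA.
Qed.

Lemma tlift2_bilin : bilin (tlift2 f).
Proof.
split=> [z'|z] k x y /=; first exact: tlift_linear (tlift2_bilinl z') _ _ _.
elim/tensor_ind: z => [|v w z IH]; rewrite /tlift2.
  by rewrite !(lin0 (tlift_linear (tlift2_bilinl _))) scaler0 addr0.
rewrite !(linD (tlift_linear (tlift2_bilinl _))) [X in _ + X]IH.
rewrite !(tlift_tens _ _ (tlift2_bilinl _)) (tlift_linear (fr v w)).
by rewrite scalerDr addrACA.
Qed.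

Lemma tlift2E v w v' w' : tlift2 f (v \ox w) (v' \ox w') = f v w v' w'.
Proof. by rewrite /tlift2 (tlift_tens _ _ (tlift2_bilinl _)) tlift_tens. Qed.

End Lift2.

Lemma linear_form_exists V (v : V) : v != 0 ->
  exists phi : V -> K^o, linear phi /\ phi v = 1.
Proof.
move=> v0.
pose P (S : set V) := (forall k x y, S x -> S y -> S (k *: x + y)) /\ ~ S v.
have [F FP Ftot|M [[Mlin Mv] Mmax]] := @Zorn_bigcup V P.
  split=> [k x y [X FX Xx] [Y FY Yy]|[X FX Xv]]; last by case: (FP _ FX).
  have [XY|YX] := Ftot X Y FX FY.
  - by exists Y => //; apply: (FP _ FY).1 => //; apply: XY.
  - by exists X => //; apply: (FP _ FX).1 => //; apply: YX.
have M0 : M 0.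
  have [[m Mm]|nM] := pselect (exists m, M m).
    by have := Mlin (-1) m m Mm Mm; rewrite scaleN1r addNr.
  exfalso; apply: (Mmax [set 0]%classic).
    split=> [x Mx|h]; first by exfalso; apply: nM; exists x.
    by apply: nM; exists 0; apply: h.
  split=> [k x y -> ->|]; first by rewrite /= scaler0 addr0.
  by move=> /= ve; move: v0; rewrite ve eqxx.
have MZ k x : M x -> M (k *: x).
  by move=> Mx; have := Mlin k x 0 Mx M0; rewrite addr0.
have MD x y : M x -> M y -> M (x + y).
  by move=> Mx My; have := Mlin 1 x y Mx My; rewrite scale1r.
have ex u : exists k : K, M (u - k *: v).
  have [Mu|nMu] := pselect (M u); first by exists 0; rewrite scale0r subr0.
  pose S := [set x | exists m k, M m /\ x = m + k *: u]%classic.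
  have [[m [k [Mm vE]]]|nSv] := pselect (S v).
    have k0 : k != 0.
      by apply/eqP => k0; apply: Mv; rewrite vE k0 scale0r addr0.
    exists k^-1; rewrite vE scalerDr scalerA mulVf // scale1r opprD addrCA subrr addr0.
    by rewrite -scaleN1r; apply: (MZ); apply: (MZ).
  exfalso; apply: (Mmax S); last first.
    split=> // a x y [m [k [Mm ->]]] [m' [k' [Mm' ->]]].
    exists (a *: m + m'), (a * k + k'); split; first exact: Mlin.
    by rewrite scalerDr scalerA scalerDl addrACA.
  split=> [x Mx|h]; first by exists x, 0; rewrite scale0r addr0.
  by apply: nMu; apply: h; exists 0, 1; rewrite scale1r add0r.
have uniq u k k' : M (u - k *: v) -> M (u - k' *: v) -> k = k'.
  move=> h h'; apply: contrapT => kk'; apply: Mv.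
  have kk0 : k' - k != 0 by rewrite subr_eq0; apply/eqP => e; apply: kk'.
  have := MD _ _ h (MZ (-1) _ h'); rewrite scaleN1r opprB addrC addrA subrK -scalerBl.
  by move=> /(MZ (k' - k)^-1); rewrite scalerA mulVf // scale1r.
exists (fun u => projT1 (cid (ex u))); split.
  move=> a x y /=; case: (cid (ex x)) (cid (ex y)) (cid (ex _)) => k hk [k' hk'] [k'' hk''] /=.
  apply: uniq hk'' _.
  have -> : a *: x + y - (a *: (k : K^o) + k') *: v = a *: (x - k *: v) + (y - k' *: v).
    by rewrite scalerBr scalerA scalerDl opprD addrACA.
  exact: Mlin.
case: cid => k /= hk; apply: uniq hk _.
by rewrite scale1r subrr.
Qed.


Lemma tens_neq0 V W (v : V) (w : W) : v != 0 -> w != 0 -> v \ox w != 0.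
Proof.
move=> /linear_form_exists[phi [lphi p1]] /linear_form_exists[psi [lpsi q1]].
pose f (x : V) (y : W) : K^o := (phi x : K) * (psi y : K).
have bf : bilin f.
  split=> [y|x] k a b; rewrite /f.
  - by rewrite lphi [LHS]mulrDl -!mulrA.
  - by rewrite lpsi [LHS]mulrDr mulrCA.
apply/eqP => e; have := congr1 (tlift f) e.
rewrite tlift_tens // (lin0 (tlift_linear bf)) /f p1 q1 mulr1 => /eqP.
by rewrite oner_eq0.
Qed.

Lemma tensDl V W v v' (w : W) : (v + v' : V) \ox w = v \ox w + v' \ox w.
Proof. exact: bilinDl (tens_bilin V W) _ _ _. Qed.
Lemma tensDr V W (v : V) (w w' : W) : v \ox (w + w') = v \ox w + v \ox w'.
Proof. exact: bilinDr (tens_bilin V W) _ _ _. Qed.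
Lemma tensZl V W k (v : V) (w : W) : (k *: v) \ox w = k *: (v \ox w).
Proof. exact: bilinZl (tens_bilin V W) _ _ _. Qed.
Lemma tensZr V W k (v : V) (w : W) : v \ox (k *: w) = k *: (v \ox w).
Proof. exact: bilinZr (tens_bilin V W) _ _ _. Qed.
Lemma tens0l V W (w : W) : (0 : V) \ox w = 0.
Proof. exact: bilin0l (tens_bilin V W) _. Qed.
Lemma tens0r V W (v : V) : v \ox (0 : W) = 0.
Proof. exact: bilin0r (tens_bilin V W) _. Qed.

End TensorTheory.

(* [tensor] itself carries only the vector space structure; the usual product
   is put on the alias [atensor], the super product on the alias [stensor]. *)
Definition atensor (K : fieldType) (A B : algType K) : Type := tensor A B.
HB.instance Definition _ (K : fieldType) (A B : algType K) :=
  GRing.Lmodule.on (atensor A B).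

Section TensorAlgebra.
Variables (K : fieldType) (A B : algType K).
Local Notation T := (atensor A B).

Definition tmul : T -> T -> T :=
  tlift2 (fun a b e f => (a * e) \ox (b * f)).

Let fr (a : A) (b : B) : bilin (fun e f => (a * e) \ox (b * f)).
Proof.
split=> e k x y /=.
- by rewrite mulrDr -scalerAr tensDl tensZl.
- by rewrite mulrDr -scalerAr tensDr tensZr.
Qed.

Let fl (e : A) (f : B) : bilin (fun a b => (a * e) \ox (b * f)).
Proof.
split=> a k x y /=.
- by rewrite mulrDl -scalerAl tensDl tensZl.
- by rewrite mulrDl -scalerAl tensDr tensZr.
Qed.

Let tmulE a b e f : tmul (a \ox b) (e \ox f) = (a * e) \ox (b * f).
Proof. exact: tlift2E. Qed.

Let tmul_bilin : bilin (tmul : tensor A B -> tensor A B -> tensor A B). Proof. exact: tlift2_bilin. Qed.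

Let tmulDl : left_distributive tmul +%R.
Proof. by move=> x y z; rewrite (bilinDl tmul_bilin). Qed.
Let tmulDr : right_distributive tmul +%R.
Proof. by move=> x y z; rewrite (bilinDr tmul_bilin). Qed.

Let tmulA : associative tmul.
Proof.
move=> x y z; elim/tensor_ind: x => [|a b x IHx].
  by rewrite !(bilin0l tmul_bilin).
rewrite !tmulDl IHx; congr (_ + _); clear IHx; elim/tensor_ind: y => [|e f y IHy].
  by rewrite (bilin0r tmul_bilin) !(bilin0l tmul_bilin) (bilin0r tmul_bilin).
rewrite tmulDl !tmulDr tmulDl IHy; congr (_ + _); clear IHy.
elim/tensor_ind: z => [|g h z IHz]; first by rewrite !(bilin0r tmul_bilin).
by rewrite !tmulDr IHz !tmulE !mulrA.
Qed.

Let tmul1l : left_id (1 \ox 1) tmul.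
Proof.
elim/tensor_ind => [|a b x IH]; first by rewrite (bilin0r tmul_bilin).
by rewrite tmulDr IH tmulE !mul1r.
Qed.
Let tmul1r : right_id (1 \ox 1) tmul.
Proof.
elim/tensor_ind => [|a b x IH]; first by rewrite (bilin0l tmul_bilin).
by rewrite tmulDl IH tmulE !mulr1.
Qed.

Let tmul_neq0 : 1 \ox 1 != 0 :> T.
Proof. by apply: tens_neq0; rewrite oner_eq0. Qed.

HB.instance Definition _ := GRing.Zmodule_isNzRing.Build T
  tmulA tmul1l tmul1r tmulDl tmulDr tmul_neq0.

Let tscalerAl k (x y : T) : k *: (x * y) = (k *: x) * y.
Proof. exact: (esym (bilinZl tmul_bilin k x y)). Qed.
Let tscalerAr k (x y : T) : k *: (x * y) = x * (k *: y).
Proof. exact: (esym (bilinZr tmul_bilin k x y)). Qed.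

HB.instance Definition _ := GRing.Lmodule_isLalgebra.Build K T tscalerAl.
HB.instance Definition _ := GRing.Lalgebra_isAlgebra.Build K T tscalerAr.

Lemma tensM (a e : A) (b f : B) : (a \ox b : T) * (e \ox f : T) = (a * e) \ox (b * f).
Proof. exact: tmulE. Qed.

End TensorAlgebra.

(* Differential graded algebras, with the grading given by the projections
   [gpr n] onto the component of degree [n]. *)
HB.mixin Record Algebra_isDGA (K : fieldType) (W : Type) of GRing.Algebra K W := {
  gpr : nat -> W -> W;
  dif : W -> W;
  gpr_linear : forall n, linear (gpr n);
  gprK : forall m n x, gpr m (gpr n x) = if m == n then gpr n x else 0;
  gpr_sum : forall x, exists N, x = \sum_(n < N) gpr n x;
  gpr1 : gpr 0 1 = 1;
  gprM : forall m n x y, gpr (m + n) (gpr m x * gpr n y) = gpr m x * gpr n y;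
  dif_linear : linear dif;
  gpr0_dif : forall x, gpr 0 (dif x) = 0;
  gprS_dif : forall n x, gpr n.+1 (dif x) = dif (gpr n x);
  difK : forall x, dif (dif x) = 0;
  difM : forall m x y,
    dif (gpr m x * y) = dif (gpr m x) * y + (-1) ^+ m *: (gpr m x * dif y)
}.
#[short(type="dgaType")]
HB.structure Definition DGA (K : fieldType) :=
  {W of GRing.Algebra K W & Algebra_isDGA K W}.

Definition homog (K : fieldType) (W : dgaType K) (n : nat) (x : W) : Prop :=
  gpr n x = x.

Section Homogeneous.
Variables (K : fieldType) (W : dgaType K).
Implicit Types (x y : W) (m n : nat) (U : lmodType K).

Definition gbound x : nat := projT1 (cid (gpr_sum x)).

(* Extends additively to [W] the formula [F n x] given for [x] homogeneous of
   degree [n]. *)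
Definition hsum U (F : nat -> W -> U) x : U := \sum_(n < gbound x) F n (gpr n x).

Lemma gbound_sum x : x = \sum_(n < gbound x) gpr n x.
Proof. by rewrite /gbound; case: cid. Qed.

Lemma gpr_homog n x : homog n (gpr n x).
Proof. by rewrite /homog gprK eqxx. Qed.

Lemma gprE m n x : homog n x -> gpr m x = if m == n then x else 0.
Proof. by move=> <-; rewrite gprK. Qed.

Lemma gpr_gt_bound n x : (gbound x <= n)%N -> gpr n x = 0.
Proof.
move=> hn; rewrite {1}(gbound_sum x) (big_morph _ (linD (gpr_linear n)) (lin0 (gpr_linear n))).
by apply: big1 => i _; rewrite gprK; case: eqP => // e; move: (ltn_ord i); rewrite -e ltnNge hn.
Qed.

Section Hsum.
Variables (U : lmodType K) (F : nat -> W -> U).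
Hypothesis lF : forall n, linear (F n).

Lemma hsum_bound N x : (gbound x <= N)%N -> hsum F x = \sum_(n < N) F n (gpr n x).
Proof.
move=> hN; rewrite /hsum -(big_mkord xpredT (fun n => F n (gpr n x))).
rewrite -(big_mkord xpredT (fun n => F n (gpr n x))) [RHS](big_cat_nat _ hN) //=.
rewrite [X in _ + X]big_nat_cond [X in _ + X]big1 ?addr0 // => i /andP[/andP[hi _] _].
by rewrite gpr_gt_bound // (lin0 (lF i)).
Qed.

Lemma hsum_linear : linear (hsum F).
Proof.
move=> k x y; set N := maxn (gbound (k *: x + y)) (maxn (gbound x) (gbound y)).
rewrite !(@hsum_bound N) ?leq_max ?leqnn ?orbT // scaler_sumr -big_split /=.
by apply: eq_bigr => n _; rewrite gpr_linear lF.
Qed.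

Lemma hsumE n x : homog n x -> hsum F x = F n x.
Proof.
move=> hx; rewrite (@hsum_bound (maxn (gbound x) n.+1)) ?leq_maxl //.
have hn : (n < maxn (gbound x) n.+1)%N by rewrite leq_max ltnSn orbT.
rewrite (bigD1 (Ordinal hn)) //= hx big1 ?addr0 // => i ni.
rewrite (gprE _ hx) (_ : (i == n :> nat) = false) ?(lin0 (lF i)) //.
by apply/negbTE.
Qed.
End Hsum.

Lemma homog_ind (P : W -> Prop) :
  P 0 -> (forall n x y, homog n x -> P y -> P (x + y)) -> forall x, P x.
Proof.
move=> P0 PD x; rewrite (gbound_sum x); elim/big_rec: _ => // i y _.
by apply: PD; exact: gpr_homog.
Qed.

Lemma homog_ext U (f g : W -> U) : linear f -> linear g ->
  (forall n x, homog n x -> f x = g x) -> forall x, f x = g x.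
Proof.
move=> lf lg fg; elim/homog_ind => [|n x y hx IH]; first by rewrite (lin0 lf) (lin0 lg).
by rewrite (linD lf) (linD lg) IH (fg n).
Qed.

Lemma sum_gpr N x : (forall n, (N <= n)%N -> gpr n x = 0) -> x = \sum_(n < N) gpr n x.
Proof.
move=> hN; pose M := maxn N (gbound x).
have e : hsum (fun _ y => y : W) x = \sum_(n < M) gpr n x.
  by apply: hsum_bound; rewrite ?leq_maxr // => n k a b.
rewrite {1}(gbound_sum x) [LHS]e -(big_mkord xpredT (fun n => gpr n x)).
rewrite -(big_mkord xpredT (fun n => gpr n x)) (big_cat_nat _ (leq_maxl N _)) //=.
rewrite [X in _ + X]big_nat_cond [X in _ + X]big1 ?addr0 // => i /andP[/andP[hi _] _].
exact: hN.
Qed.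

Lemma homog0 n : homog n (0 : W).
Proof. by rewrite /homog (lin0 (gpr_linear n)). Qed.
Lemma homogD n x y : homog n x -> homog n y -> homog n (x + y).
Proof. by move=> hx hy; rewrite /homog (linD (gpr_linear n)) hx hy. Qed.
Lemma homogZ n k x : homog n x -> homog n (k *: x).
Proof. by move=> hx; rewrite /homog (linZ k x (gpr_linear n)) hx. Qed.
Lemma homogM m n x y : homog m x -> homog n y -> homog (m + n) (x * y).
Proof. by move=> hx hy; rewrite /homog -hx -hy gprM. Qed.
Lemma homog1 : homog 0 (1 : W).
Proof. exact: gpr1. Qed.
Lemma homog_dif n x : homog n x -> homog n.+1 (dif x).
Proof. by move=> hx; rewrite /homog gprS_dif hx. Qed.
Lemma difMh m x y : homog m x -> dif (x * y) = dif x * y + (-1) ^+ m *: (x * dif y).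
Proof. by move=> <-; exact: difM. Qed.

End Homogeneous.

(* The super tensor product of two differential graded algebras. *)
Definition stensor (K : fieldType) (V W : dgaType K) : Type := tensor V W.
HB.instance Definition _ (K : fieldType) (V W : dgaType K) :=
  GRing.Lmodule.on (stensor V W).

Section SuperTensor.
Variables (K : fieldType) (V W : dgaType K).
Local Notation T := (stensor V W).

Definition smul4 (a : V) (b : W) (e : V) (f : W) : tensor V W :=
  hsum (fun m b => hsum (fun n e => (-1) ^+ (m * n) *: ((a * e) \ox (b * f))) e) b.

Definition smul : T -> T -> T := tlift2 smul4.

(* Total degree. *)
Definition sgpr (n : nat) : T -> T :=
  tlift (fun (a : V) (b : W) => \sum_(i < n.+1) gpr i a \ox gpr (n - i) b).

Definition sdif : T -> T :=
  tlift (fun (a : V) (b : W) =>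
    dif a \ox b + hsum (fun m a => (-1) ^+ m *: (a \ox dif b)) a).

Let hsum_param (U P : lmodType K) (Z : dgaType K) (F : P -> nat -> Z -> U) x :
  (forall n y, linear (fun p => F p n y)) -> linear (fun p => hsum (F p) x).
Proof.
move=> h k p q; rewrite /hsum scaler_sumr -big_split /=.
by apply: eq_bigr => n _; rewrite h.
Qed.

Let scalerCC (U : lmodType K) (a b : K) (u : U) : a *: (b *: u) = b *: (a *: u).
Proof. by rewrite !scalerA mulrC. Qed.

Let smul4_e m (a : V) (b : W) f :
  forall n, linear (fun e => (-1) ^+ (m * n) *: ((a * e) \ox (b * f))).
Proof.
move=> n k x y; rewrite mulrDr -scalerAr tensDl tensZl scalerDr.
by congr (_ + _); rewrite scalerCC.
Qed.

Let smul4_b (a : V) e f :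
  forall m, linear (fun b : W => hsum (fun n (e : V) => (-1) ^+ (m * n) *: ((a * e) \ox (b * f))) e).
Proof.
move=> m; apply: (@hsum_param _ W V
  (fun b n e => (-1) ^+ (m * n) *: ((a * e) \ox (b * f)))) => n y k b b'.
rewrite mulrDl -scalerAl tensDr tensZr scalerDr.
by congr (_ + _); rewrite scalerCC.
Qed.

Let smul4_r a b : bilin (smul4 a b : V -> W -> _).
Proof.
split=> x; rewrite /smul4.
- apply: (@hsum_param _ V W (fun e m b => hsum (fun n e =>
    (-1) ^+ (m * n) *: ((a * e) \ox (b * x))) e)) => m c.
  exact/hsum_linear/smul4_e.
- apply: (@hsum_param _ W W (fun f m b => hsum (fun n e =>
    (-1) ^+ (m * n) *: ((a * e) \ox (b * f))) x)) => m c.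
  apply: (@hsum_param _ W V (fun f n e =>
    (-1) ^+ (m * n) *: ((a * e) \ox (c * f)))) => n e k f f'.
  rewrite mulrDr -scalerAr tensDr tensZr scalerDr.
  by congr (_ + _); rewrite scalerCC.
Qed.

Let smul4_l e f : bilin (fun a b => smul4 a b e f).
Proof.
split=> x; rewrite /smul4; last exact/hsum_linear/smul4_b.
apply: (@hsum_param _ V W (fun a m b => hsum (fun n e =>
    (-1) ^+ (m * n) *: ((a * e) \ox (b * f))) e)) => m c.
apply: (@hsum_param _ V V (fun a n e =>
    (-1) ^+ (m * n) *: ((a * e) \ox (c * f)))) => n y k a a'.
rewrite mulrDl -scalerAl tensDl tensZl scalerDr.
by congr (_ + _); rewrite scalerCC.
Qed.

Let smul_bilin : bilin (smul : tensor V W -> tensor V W -> tensor V W).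
Proof. exact: tlift2_bilin. Qed.

Let smulE n m a b e f : homog n b -> homog m e ->
  smul (a \ox b) (e \ox f) = (-1) ^+ (n * m) *: ((a * e) \ox (b * f)).
Proof.
move=> hb he; rewrite /smul tlift2E // /smul4 (hsumE _ hb); last exact: smul4_b.
by rewrite (hsumE _ he) //; exact: smul4_e.
Qed.

Let sgpr_bilin n : bilin (fun (a : V) (b : W) => \sum_(i < n.+1) gpr i a \ox gpr (n - i) b).
Proof.
split=> z k x y; rewrite scaler_sumr -big_split /=; apply: eq_bigr => i _.
- by rewrite gpr_linear tensDl tensZl.
- by rewrite gpr_linear tensDr tensZr.
Qed.

Let sgpr_lin n : linear (sgpr n : tensor V W -> tensor V W).
Proof. exact: tlift_linear. Qed.

Let sgprE n p q (a : V) (b : W) : homog p a -> homog q b ->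
  sgpr n (a \ox b) = if n == (p + q)%N then a \ox b else 0.
Proof.
move=> ha hb; rewrite /sgpr tlift_tens //; case: eqP => [->|ne].
  have hp : (p < (p + q).+1)%N by rewrite ltnS leq_addr.
  rewrite (bigD1 (Ordinal hp)) //= ha addKn hb big1 ?addr0 // => i ni.
  rewrite (gprE _ ha) (_ : (i == p :> nat) = false) ?tens0l //; exact/negbTE.
apply: big1 => i _; rewrite (gprE _ ha) (gprE _ hb).
case: eqP => [ip|_]; last by rewrite tens0l.
case: eqP => [iq|_]; last by rewrite tens0r.
by case: ne; rewrite -ip -iq subnKC // -ltnS.
Qed.

Let sdif_r a : linear (fun b : W => hsum (fun m (a : V) => (-1) ^+ m *: (a \ox dif b)) a).
Proof.
apply: (@hsum_param _ W V (fun b m a => (-1) ^+ m *: (a \ox dif b))) => n y k b b'.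
rewrite dif_linear tensDr tensZr scalerDr.
by congr (_ + _); rewrite scalerCC.
Qed.

Let sdif_l (b : W) : forall m, linear (fun a : V => (-1) ^+ m *: (a \ox dif b)).
Proof.
move=> m k x y; rewrite tensDl tensZl scalerDr.
by congr (_ + _); rewrite scalerCC.
Qed.

Let sdif_bilin : bilin (fun (a : V) (b : W) =>
    dif a \ox b + hsum (fun m a => (-1) ^+ m *: (a \ox dif b)) a).
Proof.
split=> z k x y /=.
- rewrite dif_linear tensDl tensZl (hsum_linear (sdif_l z)) scalerDr.
  by rewrite addrACA.
- by rewrite sdif_r tensDr tensZr scalerDr addrACA.
Qed.

Let sdif_lin : linear (sdif : tensor V W -> tensor V W).
Proof. exact: tlift_linear. Qed.

Let sdifE m (a : V) (b : W) : homog m a ->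
  sdif (a \ox b) = dif a \ox b + (-1) ^+ m *: (a \ox dif b).
Proof. by move=> ha; rewrite /sdif tlift_tens // (hsumE _ ha) //; exact: sdif_l. Qed.

Let hind (P : tensor V W -> Prop) : P 0 ->
  (forall m n a b z, homog m a -> homog n b -> P z -> P (a \ox b + z)) ->
  forall z, P z.
Proof.
move=> P0 PD; elim/tensor_ind => // v w z; move: z.
elim/homog_ind: v => [|n x y hx IH] z Pz; first by rewrite tens0l add0r.
rewrite tensDl -addrA; move: (IH z Pz); move: (y \ox w + z) => {}z {}Pz.
elim/homog_ind: w {IH} z Pz => [|m w y' hw IH] z Pz; first by rewrite tens0r add0r.
by rewrite tensDr -addrA; apply: (PD n m) => //; apply: IH.
Qed.

Let hext (U : lmodType K) (f g : tensor V W -> U) : linear f -> linear g ->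
  (forall m n a b, homog m a -> homog n b -> f (a \ox b) = g (a \ox b)) ->
  forall z, f z = g z.
Proof.
move=> lf lg fg; elim/hind => [|m n a b z ha hb IH]; first by rewrite (lin0 lf) (lin0 lg).
by rewrite (linD lf) (linD lg) IH (fg m n).
Qed.

Let sgn_odd m n : odd m = odd n -> (-1) ^+ m = (-1) ^+ n :> K.
Proof. by move=> e; rewrite -signr_odd e signr_odd. Qed.

Let smulDl : left_distributive smul +%R.
Proof. by move=> x y z; rewrite (bilinDl smul_bilin). Qed.
Let smulDr : right_distributive smul +%R.
Proof. by move=> x y z; rewrite (bilinDr smul_bilin). Qed.

Let smulA : associative smul.
Proof.
move=> x y z; elim/hind: x => [|p q a b x ha hb IHx].
  by rewrite !(bilin0l smul_bilin).
rewrite !smulDl IHx; congr (_ + _); clear IHx; elim/hind: y => [|r s e f y he hf IHy].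
  by rewrite (bilin0r smul_bilin) !(bilin0l smul_bilin) (bilin0r smul_bilin).
rewrite smulDl !smulDr smulDl IHy; congr (_ + _); clear IHy.
elim/hind: z => [|u v g h z hg hh IHz]; first by rewrite !(bilin0r smul_bilin).
rewrite !smulDr IHz; congr (_ + _).
rewrite (smulE _ _ hf hg) (smulE _ _ hb he) (bilinZr smul_bilin) (bilinZl smul_bilin).
rewrite (smulE _ _ hb (homogM he hg)) (smulE _ _ (homogM hb hf) hg) !scalerA !mulrA -!exprD.
by congr (_ *: _); apply: sgn_odd; rewrite mulnDl mulnDr addnC -addnA.
Qed.

Let smul1l : left_id (1 \ox 1) smul.
Proof.
elim/hind => [|m n a b x ha hb IH]; first by rewrite (bilin0r smul_bilin).
by rewrite smulDr IH (smulE _ _ (homog1 _) ha) !mul1r mul0n scale1r.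
Qed.
Let smul1r : right_id (1 \ox 1) smul.
Proof.
elim/hind => [|m n a b x ha hb IH]; first by rewrite (bilin0l smul_bilin).
by rewrite smulDl IH (smulE _ _ hb (homog1 _)) !mulr1 muln0 scale1r.
Qed.

Let smul_neq0 : 1 \ox 1 != 0 :> T.
Proof. by apply: tens_neq0; rewrite oner_eq0. Qed.

HB.instance Definition _ := GRing.Zmodule_isNzRing.Build T
  smulA smul1l smul1r smulDl smulDr smul_neq0.

Let sscalerAl k (x y : T) : k *: (x * y) = (k *: x) * y.
Proof. exact: (esym (bilinZl smul_bilin k x y)). Qed.
Let sscalerAr k (x y : T) : k *: (x * y) = x * (k *: y).
Proof. exact: (esym (bilinZr smul_bilin k x y)). Qed.

HB.instance Definition _ := GRing.Lmodule_isLalgebra.Build K T sscalerAl.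
HB.instance Definition _ := GRing.Lalgebra_isAlgebra.Build K T sscalerAr.

Let sgprK m n (x : T) : sgpr m (sgpr n x) = if m == n then sgpr n x else 0.
Proof.
elim/hind: x => [|p q a b x ha hb IH].
  by rewrite !(lin0 (sgpr_lin _)) if_same.
rewrite !(linD (sgpr_lin _)) IH (sgprE _ ha hb).
have [->|nm] := eqVneq m n.
  case: eqP => [e|_]; last by rewrite (lin0 (sgpr_lin _)).
  by rewrite (sgprE _ ha hb) e eqxx.
rewrite addr0; case: eqP => [e|_]; last by rewrite (lin0 (sgpr_lin _)).
by rewrite (sgprE _ ha hb) -e (negbTE nm).
Qed.

Let sgpr_sum (x : T) : exists N, x = \sum_(n < N) sgpr n x.
Proof.
suff [N h] : exists N, forall M, (N <= M)%N -> x = \sum_(n < M) sgpr n x by exists N; apply: h.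
elim/hind: x => [|p q a b x ha hb [N IH]].
  by exists 0%N => M _; rewrite big1 // => i _; rewrite (lin0 (sgpr_lin _)).
exists (maxn N (p + q).+1) => M; rewrite geq_max => /andP[NM pqM].
under eq_bigr do rewrite (linD (sgpr_lin _)).
rewrite big_split /= -(IH M NM); congr (_ + _).
rewrite (bigD1 (Ordinal pqM)) //= (sgprE _ ha hb) eqxx big1 ?addr0 // => i ni.
by rewrite (sgprE _ ha hb) (_ : (i == (p + q)%N :> nat) = false) //; exact/negbTE.
Qed.

Let sgpr1 : sgpr 0 (1 : T) = 1.
Proof. exact: (sgprE 0 (homog1 V) (homog1 W)). Qed.

Let sgprM m n (x y : T) : sgpr (m + n) (sgpr m x * sgpr n y) = sgpr m x * sgpr n y.
Proof.
elim/hind: x => [|p q a b x ha hb IHx].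
  by rewrite (lin0 (sgpr_lin _)) mul0r (lin0 (sgpr_lin _)).
rewrite (linD (sgpr_lin m)) mulrDl (linD (sgpr_lin _)) IHx; congr (_ + _); clear IHx.
elim/hind: y => [|r s e f y he hf IHy].
  by rewrite (lin0 (sgpr_lin _)) mulr0 (lin0 (sgpr_lin _)).
rewrite (linD (sgpr_lin n)) mulrDr (linD (sgpr_lin _)) IHy; congr (_ + _); clear IHy.
rewrite (sgprE _ ha hb) (sgprE _ he hf).
case: eqP => [->|_]; last by rewrite mul0r (lin0 (sgpr_lin _)).
case: eqP => [->|_]; last by rewrite mulr0 (lin0 (sgpr_lin _)).
rewrite [_ * _](smulE _ _ hb he) (linZ _ _ (sgpr_lin _)).
by rewrite (sgprE _ (homogM ha he) (homogM hb hf)) addnACA eqxx.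
Qed.

Let sgpr0_dif (x : T) : sgpr 0 (sdif x) = 0.
Proof.
elim/hind: x => [|p q a b x ha hb IH].
  by rewrite (lin0 sdif_lin) (lin0 (sgpr_lin _)).
rewrite (linD sdif_lin) (linD (sgpr_lin _)) IH addr0 (sdifE _ ha).
rewrite (linD (sgpr_lin _)) (linZ _ _ (sgpr_lin _)).
rewrite (sgprE _ (homog_dif ha) hb) (sgprE _ ha (homog_dif hb)).
by rewrite addnS addSn /= add0r scaler0.
Qed.

Let sgprS_dif n (x : T) : sgpr n.+1 (sdif x) = sdif (sgpr n x).
Proof.
elim/hind: x => [|p q a b x ha hb IH].
  by rewrite (lin0 sdif_lin) !(lin0 (sgpr_lin _)) (lin0 sdif_lin).
rewrite (linD sdif_lin) !(linD (sgpr_lin _)) (linD sdif_lin) IH; congr (_ + _).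
rewrite (sdifE _ ha) (linD (sgpr_lin _)) (linZ _ _ (sgpr_lin _)).
rewrite (sgprE _ (homog_dif ha) hb) (sgprE _ ha (homog_dif hb)) (sgprE _ ha hb).
rewrite addnS addSn eqSS; case: eqP => _; first by rewrite (sdifE _ ha).
by rewrite (lin0 sdif_lin) scaler0 addr0.
Qed.

Let sdifK (x : T) : sdif (sdif x) = 0.
Proof.
elim/hind: x => [|p q a b x ha hb IH].
  by rewrite !(lin0 sdif_lin).
rewrite !(linD sdif_lin) IH addr0 (sdifE _ ha) (linD sdif_lin) (linZ _ _ sdif_lin).
rewrite (sdifE _ ha) (sdifE _ (homog_dif ha)) !difK tens0l tens0r scaler0 add0r addr0.
by rewrite exprS mulN1r scaleNr addNr.
Qed.

Let sdifM m (x y : T) :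
  sdif (sgpr m x * y) = sdif (sgpr m x) * y + (-1) ^+ m *: (sgpr m x * sdif y).
Proof.
elim/hind: x => [|p q a b x ha hb IHx].
  by rewrite (lin0 (sgpr_lin _)) !mul0r (lin0 sdif_lin) mul0r scaler0 addr0.
rewrite (linD (sgpr_lin m)) !mulrDl !(linD sdif_lin) IHx mulrDl scalerDr [RHS]addrACA.
congr (_ + _); clear IHx; rewrite (sgprE _ ha hb); case: eqP => [->|_]; last first.
  by rewrite !mul0r (lin0 sdif_lin) mul0r scaler0 addr0.
elim/hind: y => [|r s e f y he hf IHy].
  by rewrite !mulr0 !(lin0 sdif_lin) mulr0 scaler0 addr0.
rewrite !mulrDr !(linD sdif_lin) mulrDr IHy scalerDr [RHS]addrACA; congr (_ + _).
clear IHy; pose mE n k a' b' e' f' (hb' : homog n b') (he' : homog k e') :=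
  smulE a' f' hb' he' : (a' \ox b' : T) * (e' \ox f' : T) = _.
rewrite (mE _ _ _ _ _ _ hb he) (linZ _ _ sdif_lin) (sdifE _ (homogM ha he)).
rewrite (sdifE _ ha) (sdifE _ he) mulrDl mulrDr -scalerAl -scalerAr.
rewrite (mE _ _ _ _ _ _ hb he) (mE _ _ _ _ _ _ (homog_dif hb) he).
rewrite (mE _ _ _ _ _ _ hb (homog_dif he)) (mE _ _ _ _ _ _ hb he).
rewrite (difMh _ ha) (difMh _ hb) tensDl tensDr tensZl tensZr.
rewrite !scalerDr !scalerA -!exprD -!addrA; congr (_ + _).
rewrite addrCA; congr (_ + _); last congr (_ + _); congr (_ *: _); apply: sgn_odd.
- by rewrite mulSn !oddD; case: (odd p); case: (odd r); case: (odd (q * r)).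
- by rewrite mulnS !oddD; case: (odd p); case: (odd q); case: (odd (q * r)).
- by rewrite !oddD; case: (odd p); case: (odd q); case: (odd r); case: (odd (q * r)).
Qed.

HB.instance Definition _ := Algebra_isDGA.Build K T sgpr_lin sgprK sgpr_sum sgpr1
  sgprM sdif_lin sgpr0_dif sgprS_dif sdifK sdifM.

Lemma stensM n m (a e : V) (b f : W) : homog n b -> homog m e ->
  (a \ox b : T) * (e \ox f : T) = (-1) ^+ (n * m) *: ((a * e) \ox (b * f) : T).
Proof. exact: smulE. Qed.

Lemma stens_gpr n p q (a : V) (b : W) : homog p a -> homog q b ->
  gpr n (a \ox b : T) = if n == (p + q)%N then a \ox b else 0.
Proof. exact: sgprE. Qed.

Lemma stens_dif m (a : V) (b : W) : homog m a ->
  dif (a \ox b : T) = dif a \ox b + (-1) ^+ m *: (a \ox dif b).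
Proof. exact: sdifE. Qed.

End SuperTensor.

(* Algebras given by generators and relations: formal expressions in the
   generators, modulo the equations that hold in every algebra whose chosen
   elements satisfy the relations. *)
Inductive aterm (K X : Type) :=
  AGen of X | AZero | AOne | AAdd of aterm K X & aterm K X
| AScale of K & aterm K X | AMul of aterm K X & aterm K X.
Arguments AZero {K X}. Arguments AOne {K X}.
HB.instance Definition _ (K X : Type) := gen_eqMixin (aterm K X).
HB.instance Definition _ (K X : Type) := gen_choiceMixin (aterm K X).

(* [amodel] ensures 1 <> 0 in the presented algebra. *)
Record apres (K : fieldType) := APres {
  agen : Type;
  arel : forall B : algType K, (agen -> B) -> Prop;
  amodel : exists (B : algType K) (f : agen -> B), arel f
}.

Section PresentedAlgebra.
Variables (K : fieldType) (P : apres K).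
Local Notation term := (aterm K (agen P)).

Fixpoint aeval (B : algType K) (f : agen P -> B) (t : term) : B :=
  match t with
  | AGen x => f x | AZero => 0 | AOne => 1
  | AAdd t u => aeval f t + aeval f u
  | AScale k t => k *: aeval f t
  | AMul t u => aeval f t * aeval f u
  end.

Definition aequiv : rel term := fun t u =>
  `[< forall (B : algType K) (f : agen P -> B), arel f -> aeval f t = aeval f u >].

Let aequiv_refl : reflexive aequiv.
Proof. by move=> t; apply/asboolP. Qed.
Let aequiv_sym : symmetric aequiv.
Proof. by move=> t u; apply/asboolP/asboolP => h B f hf; rewrite h. Qed.
Let aequiv_trans : transitive aequiv.
Proof.
by move=> t u v /asboolP h /asboolP h'; apply/asboolP => B f hf; rewrite h ?h'.
Qed.
Canonical aequiv_equiv := EquivRel aequiv aequiv_refl aequiv_sym aequiv_trans.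

Definition palg := {eq_quot aequiv}.
HB.instance Definition _ : EqQuotient _ aequiv palg := EqQuotient.on palg.
HB.instance Definition _ := Choice.on palg.

Definition api (t : term) : palg := \pi_palg t.
Definition pgen (x : agen P) : palg := api (AGen K x).

Definition alift (B : algType K) (f : agen P -> B) (hf : arel f) (x : palg) : B :=
  aeval f (repr x).

Section lift.
Variables (B : algType K) (f : agen P -> B) (hf : arel f).

Lemma alift_pi t : alift hf (api t) = aeval f t.
Proof.
rewrite /alift; have : repr (api t) = t %[mod palg] by rewrite reprK.
by move=> /eqmodP /asboolP h; apply: h.
Qed.

Lemma alift_gen x : alift hf (pgen x) = f x.
Proof. exact: alift_pi. Qed.

End lift.

Lemma palgE (x y : palg) :
  (forall (B : algType K) (f : agen P -> B) (hf : arel f), alift hf x = alift hf y) ->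
  x = y.
Proof.
move=> h; rewrite -[x]reprK -[y]reprK; apply/eqmodP; apply/asboolP => B f hf.
exact: h hf.
Qed.

Definition padd (x y : palg) := api (AAdd (repr x) (repr y)).
Definition pscale k (x : palg) := api (AScale k (repr x)).
Definition pmul (x y : palg) := api (AMul (repr x) (repr y)).
Definition popp (x : palg) := pscale (-1) x.
Definition pzero := api AZero.
Definition pone := api AOne.

Section lift2.
Variables (B : algType K) (f : agen P -> B) (hf : arel f).
Lemma alift_add x y : alift hf (padd x y) = alift hf x + alift hf y.
Proof. exact: alift_pi. Qed.
Lemma alift_scale k x : alift hf (pscale k x) = k *: alift hf x.
Proof. exact: alift_pi. Qed.
Lemma alift_opp x : alift hf (popp x) = - alift hf x.
Proof. by rewrite alift_scale scaleN1r. Qed.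
Lemma alift_mul x y : alift hf (pmul x y) = alift hf x * alift hf y.
Proof. exact: alift_pi. Qed.
Lemma alift_zero : alift hf pzero = 0.
Proof. exact: alift_pi. Qed.
Lemma alift_one : alift hf pone = 1.
Proof. exact: alift_pi. Qed.
Definition aliftE :=
  (alift_add, alift_scale, alift_opp, alift_mul, alift_zero, alift_one).
End lift2.

Local Tactic Notation "palg_eq" := apply: palgE => B f hf; rewrite !aliftE.

Let paddA : associative padd. Proof. by move=> x y z; palg_eq; rewrite addrA. Qed.
Let paddC : commutative padd. Proof. by move=> x y; palg_eq; rewrite addrC. Qed.
Let padd0 : left_id pzero padd. Proof. by move=> x; palg_eq; rewrite add0r. Qed.
Let paddN : left_inverse pzero popp padd. Proof. by move=> x; palg_eq; rewrite addNr. Qed.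
HB.instance Definition _ := GRing.isZmodule.Build palg paddA paddC padd0 paddN.

Let pscaleA a b v : pscale a (pscale b v) = pscale (a * b) v.
Proof. by palg_eq; rewrite scalerA. Qed.
Let pscale1 : left_id 1 pscale. Proof. by move=> x; palg_eq; rewrite scale1r. Qed.
Let pscaleDr : right_distributive pscale +%R.
Proof. by move=> k x y; palg_eq; rewrite scalerDr. Qed.
Let pscaleDl v : {morph pscale^~ v : a b / a + b}.
Proof. by move=> a b; palg_eq; rewrite scalerDl. Qed.
HB.instance Definition _ :=
  GRing.Zmodule_isLmodule.Build K palg pscaleA pscale1 pscaleDr pscaleDl.

Let pmulA : associative pmul. Proof. by move=> x y z; palg_eq; rewrite mulrA. Qed.
Let pmul1l : left_id pone pmul. Proof. by move=> x; palg_eq; rewrite mul1r. Qed.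
Let pmul1r : right_id pone pmul. Proof. by move=> x; palg_eq; rewrite mulr1. Qed.
Let pmulDl : left_distributive pmul +%R.
Proof. by move=> x y z; palg_eq; rewrite mulrDl. Qed.
Let pmulDr : right_distributive pmul +%R.
Proof. by move=> x y z; palg_eq; rewrite mulrDr. Qed.
Let pone_neq0 : pone != 0 :> palg.
Proof.
have [B [f hf]] := amodel P; apply/eqP => /(congr1 (alift hf)) /eqP.
by rewrite !aliftE oner_eq0.
Qed.
HB.instance Definition _ := GRing.Zmodule_isNzRing.Build palg
  pmulA pmul1l pmul1r pmulDl pmulDr pone_neq0.

Let pscaleAl k (x y : palg) : k *: (x * y) = (k *: x) * y.
Proof. by palg_eq; rewrite scalerAl. Qed.
Let pscaleAr k (x y : palg) : k *: (x * y) = x * (k *: y).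
Proof. by palg_eq; rewrite scalerAr. Qed.
HB.instance Definition _ := GRing.Lmodule_isLalgebra.Build K palg pscaleAl.
HB.instance Definition _ := GRing.Lalgebra_isAlgebra.Build K palg pscaleAr.

Section lift3.
Variables (B : algType K) (f : agen P -> B) (hf : arel f).
Let alift_is_linear : linear (alift hf). Proof. by move=> k x y; rewrite !aliftE. Qed.
Let alift_is_monoid : monoid_morphism (alift hf).
Proof. by split=> [|x y]; rewrite !aliftE. Qed.
HB.instance Definition _ := GRing.isLinear.Build K palg B *:%R (alift hf) alift_is_linear.
HB.instance Definition _ := GRing.isMonoidMorphism.Build palg B (alift hf) alift_is_monoid.
End lift3.

End PresentedAlgebra.

(* Likewise for differential graded algebras given by homogeneous generators
   and relations, which may involve the differential. *)
Inductive dterm (K X : Type) :=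
  DGen of X | DZero | DOne | DAdd of dterm K X & dterm K X
| DScale of K & dterm K X | DMul of dterm K X & dterm K X
| DGpr of nat & dterm K X | DDif of dterm K X.
Arguments DZero {K X}. Arguments DOne {K X}.
HB.instance Definition _ (K X : Type) := gen_eqMixin (dterm K X).
HB.instance Definition _ (K X : Type) := gen_choiceMixin (dterm K X).

Record dpres (K : fieldType) := DPres {
  dgen : Type;
  ddeg : dgen -> nat;
  drel : forall W : dgaType K, (dgen -> W) -> Prop;
  dmodel : exists (W : dgaType K) (f : dgen -> W),
    (forall x, homog (ddeg x) (f x)) /\ drel f
}.

Section PresentedDGA.
Variables (K : fieldType) (P : dpres K).
Local Notation term := (dterm K (dgen P)).

Definition dsat (W : dgaType K) (f : dgen P -> W) : Prop :=
  (forall x, homog (ddeg x) (f x)) /\ drel f.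

Fixpoint deval (W : dgaType K) (f : dgen P -> W) (t : term) : W :=
  match t with
  | DGen x => f x | DZero => 0 | DOne => 1
  | DAdd t u => deval f t + deval f u
  | DScale k t => k *: deval f t
  | DMul t u => deval f t * deval f u
  | DGpr n t => gpr n (deval f t)
  | DDif t => dif (deval f t)
  end.

Definition dequiv : rel term := fun t u =>
  `[< forall (W : dgaType K) (f : dgen P -> W), dsat f -> deval f t = deval f u >].

Let dequiv_refl : reflexive dequiv.
Proof. by move=> t; apply/asboolP. Qed.
Let dequiv_sym : symmetric dequiv.
Proof. by move=> t u; apply/asboolP/asboolP => h W f hf; rewrite h. Qed.
Let dequiv_trans : transitive dequiv.
Proof.
by move=> t u v /asboolP h /asboolP h'; apply/asboolP => W f hf; rewrite h ?h'.
Qed.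
Canonical dequiv_equiv := EquivRel dequiv dequiv_refl dequiv_sym dequiv_trans.

Definition pdga := {eq_quot dequiv}.
HB.instance Definition _ : EqQuotient _ dequiv pdga := EqQuotient.on pdga.
HB.instance Definition _ := Choice.on pdga.

Definition dpi (t : term) : pdga := \pi_pdga t.
Definition pdgen (x : dgen P) : pdga := dpi (DGen K x).

Definition dlift (W : dgaType K) (f : dgen P -> W) (hf : dsat f) (x : pdga) : W :=
  deval f (repr x).

Lemma pdgaE (x y : pdga) :
  (forall (W : dgaType K) (f : dgen P -> W) (hf : dsat f), dlift hf x = dlift hf y) ->
  x = y.
Proof.
move=> h; rewrite -[x]reprK -[y]reprK; apply/eqmodP; apply/asboolP => W f hf.
exact: h hf.
Qed.

Definition pdadd (x y : pdga) := dpi (DAdd (repr x) (repr y)).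
Definition pdscale k (x : pdga) := dpi (DScale k (repr x)).
Definition pdmul (x y : pdga) := dpi (DMul (repr x) (repr y)).
Definition pdopp (x : pdga) := pdscale (-1) x.
Definition pdzero := dpi DZero.
Definition pdone := dpi DOne.
Definition pdgpr n (x : pdga) := dpi (DGpr n (repr x)).
Definition pddif (x : pdga) := dpi (DDif (repr x)).

Section lift.
Variables (W : dgaType K) (f : dgen P -> W) (hf : dsat f).

Lemma dlift_pi t : dlift hf (dpi t) = deval f t.
Proof.
rewrite /dlift; have : repr (dpi t) = t %[mod pdga] by rewrite reprK.
by move=> /eqmodP /asboolP h; apply: h.
Qed.

Lemma dlift_gen x : dlift hf (pdgen x) = f x.
Proof. exact: dlift_pi. Qed.
Lemma dlift_add x y : dlift hf (pdadd x y) = dlift hf x + dlift hf y.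
Proof. exact: dlift_pi. Qed.
Lemma dlift_scale k x : dlift hf (pdscale k x) = k *: dlift hf x.
Proof. exact: dlift_pi. Qed.
Lemma dlift_opp x : dlift hf (pdopp x) = - dlift hf x.
Proof. by rewrite dlift_scale scaleN1r. Qed.
Lemma dlift_mul x y : dlift hf (pdmul x y) = dlift hf x * dlift hf y.
Proof. exact: dlift_pi. Qed.
Lemma dlift_zero : dlift hf pdzero = 0.
Proof. exact: dlift_pi. Qed.
Lemma dlift_one : dlift hf pdone = 1.
Proof. exact: dlift_pi. Qed.
Lemma dlift_pgpr n x : dlift hf (pdgpr n x) = gpr n (dlift hf x).
Proof. exact: dlift_pi. Qed.
Lemma dlift_pdif x : dlift hf (pddif x) = dif (dlift hf x).
Proof. exact: dlift_pi. Qed.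
Definition dliftE := (dlift_add, dlift_scale, dlift_opp, dlift_mul, dlift_zero,
  dlift_one, dlift_pgpr, dlift_pdif).
End lift.

Local Tactic Notation "pdga_eq" := apply: pdgaE => W f hf; rewrite !dliftE.

Let paddA : associative pdadd. Proof. by move=> x y z; pdga_eq; rewrite addrA. Qed.
Let paddC : commutative pdadd. Proof. by move=> x y; pdga_eq; rewrite addrC. Qed.
Let padd0 : left_id pdzero pdadd. Proof. by move=> x; pdga_eq; rewrite add0r. Qed.
Let paddN : left_inverse pdzero pdopp pdadd.
Proof. by move=> x; pdga_eq; rewrite addNr. Qed.
HB.instance Definition _ := GRing.isZmodule.Build pdga paddA paddC padd0 paddN.

Let pscaleA a b v : pdscale a (pdscale b v) = pdscale (a * b) v.
Proof. by pdga_eq; rewrite scalerA. Qed.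
Let pscale1 : left_id 1 pdscale. Proof. by move=> x; pdga_eq; rewrite scale1r. Qed.
Let pscaleDr : right_distributive pdscale +%R.
Proof. by move=> k x y; pdga_eq; rewrite scalerDr. Qed.
Let pscaleDl v : {morph pdscale^~ v : a b / a + b}.
Proof. by move=> a b; pdga_eq; rewrite scalerDl. Qed.
HB.instance Definition _ :=
  GRing.Zmodule_isLmodule.Build K pdga pscaleA pscale1 pscaleDr pscaleDl.

Let pmulA : associative pdmul. Proof. by move=> x y z; pdga_eq; rewrite mulrA. Qed.
Let pmul1l : left_id pdone pdmul. Proof. by move=> x; pdga_eq; rewrite mul1r. Qed.
Let pmul1r : right_id pdone pdmul. Proof. by move=> x; pdga_eq; rewrite mulr1. Qed.
Let pmulDl : left_distributive pdmul +%R.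
Proof. by move=> x y z; pdga_eq; rewrite mulrDl. Qed.
Let pmulDr : right_distributive pdmul +%R.
Proof. by move=> x y z; pdga_eq; rewrite mulrDr. Qed.
Let pone_neq0 : pdone != 0 :> pdga.
Proof.
have [W [f hf]] := dmodel P; apply/eqP => /(congr1 (dlift (hf : dsat f))) /eqP.
by rewrite !dliftE oner_eq0.
Qed.
HB.instance Definition _ := GRing.Zmodule_isNzRing.Build pdga
  pmulA pmul1l pmul1r pmulDl pmulDr pone_neq0.

Let pscaleAl k (x y : pdga) : k *: (x * y) = (k *: x) * y.
Proof. by pdga_eq; rewrite scalerAl. Qed.
Let pscaleAr k (x y : pdga) : k *: (x * y) = x * (k *: y).
Proof. by pdga_eq; rewrite scalerAr. Qed.
HB.instance Definition _ := GRing.Lmodule_isLalgebra.Build K pdga pscaleAl.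
HB.instance Definition _ := GRing.Lalgebra_isAlgebra.Build K pdga pscaleAr.

Let dlift_sum (W : dgaType K) (f : dgen P -> W) (hf : dsat f) N (F : nat -> pdga) :
  dlift hf (\sum_(n < N) F n) = \sum_(n < N) dlift hf (F n).
Proof.
by apply: (big_morph (dlift hf)) => [x y|]; rewrite dliftE.
Qed.

Let pgpr_linear n : linear (pdgpr n).
Proof. by move=> k x y; pdga_eq; rewrite gpr_linear. Qed.
Let pgprK m n x : pdgpr m (pdgpr n x) = if m == n then pdgpr n x else 0.
Proof. by pdga_eq; rewrite gprK; case: eqP => _; rewrite !dliftE. Qed.
Let pgpr1 : pdgpr 0 1 = 1. Proof. by pdga_eq; rewrite gpr1. Qed.
Let pgprM m n x y : pdgpr (m + n) (pdgpr m x * pdgpr n y) = pdgpr m x * pdgpr n y.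
Proof. by pdga_eq; rewrite gprM. Qed.
Let pdif_linear : linear pddif.
Proof. by move=> k x y; pdga_eq; rewrite dif_linear. Qed.
Let pgpr0_dif x : pdgpr 0 (pddif x) = 0. Proof. by pdga_eq; rewrite gpr0_dif. Qed.
Let pgprS_dif n x : pdgpr n.+1 (pddif x) = pddif (pdgpr n x).
Proof. by pdga_eq; rewrite gprS_dif. Qed.
Let pdifK x : pddif (pddif x) = 0. Proof. by pdga_eq; rewrite difK. Qed.
Let pdifM m x y : pddif (pdgpr m x * y) =
  pddif (pdgpr m x) * y + (-1) ^+ m *: (pdgpr m x * pddif y).
Proof. by pdga_eq; rewrite difM. Qed.

Let deval_bound (t : term) : exists N, forall (W : dgaType K) (f : dgen P -> W),
  dsat f -> forall n, (N <= n)%N -> gpr n (deval f t) = 0.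
Proof.
elim: t => [x|||t [N hN] u [M hM]|k t [N hN]|t [N hN] u [M hM]|m t [N hN]|t [N hN]] /=.
- exists (ddeg x).+1 => W f [hf _] n hn; rewrite (gprE _ (hf x)).
  by case: eqP => // e; move: hn; rewrite e ltnn.
- by exists 0%N => W f hf n _; rewrite (lin0 (gpr_linear n)).
- by exists 1%N => W f hf [//|n] _; rewrite (gprE _ (homog1 W)).
- exists (maxn N M) => W f hf n; rewrite geq_max => /andP[hn hm].
  by rewrite (linD (gpr_linear n)) hN // hM // addr0.
- by exists N => W f hf n hn; rewrite (linZ _ _ (gpr_linear n)) hN // scaler0.
- exists (N + M)%N => W f hf n hn.
  rewrite (gbound_sum (deval f t)) (gbound_sum (deval f u)) mulr_suml.
  rewrite (big_morph _ (linD (gpr_linear n)) (lin0 (gpr_linear n))) big1 // => i _.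
  rewrite mulr_sumr (big_morph _ (linD (gpr_linear n)) (lin0 (gpr_linear n))).
  apply: big1 => j _.
  rewrite (gprE _ (homogM (gpr_homog i _) (gpr_homog j _))); case: eqP => // e.
  have [Ni|iN] := leqP N i; first by rewrite hN // mul0r.
  have [Mj|jM] := leqP M j; first by rewrite (hM _ _ hf j) // mulr0.
  by move: hn; rewrite e leqNgt => /negP[]; rewrite -addSn leq_add // ltnW.
- exists N => W f hf n hn; rewrite gprK; case: eqP => // <-; exact: hN.
- exists N.+1 => W f hf [//|n] hn; rewrite gprS_dif hN //; exact: lin0 dif_linear.
Qed.

Let pgpr_sum x : exists N, x = \sum_(n < N) pdgpr n x.
Proof.
have [N hN] := deval_bound (repr x); exists N; apply: pdgaE => W f hf.
rewrite (@dlift_sum W f hf N (fun n => pdgpr n x)); under eq_bigr do rewrite dliftE.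
by apply: sum_gpr; apply: hN.
Qed.

HB.instance Definition _ := Algebra_isDGA.Build K pdga pgpr_linear pgprK pgpr_sum
  pgpr1 pgprM pdif_linear pgpr0_dif pgprS_dif pdifK pdifM.

Section lift2.
Variables (W : dgaType K) (f : dgen P -> W) (hf : dsat f).
Let dlift_is_linear : linear (dlift hf).
Proof. by move=> k x y; rewrite !dliftE. Qed.
Let dlift_is_monoid : monoid_morphism (dlift hf).
Proof. by split=> [|x y]; rewrite !dliftE. Qed.
HB.instance Definition _ := GRing.isLinear.Build K pdga W *:%R (dlift hf) dlift_is_linear.
HB.instance Definition _ := GRing.isMonoidMorphism.Build pdga W (dlift hf) dlift_is_monoid.
Lemma dlift_gpr n x : dlift hf (gpr n x) = gpr n (dlift hf x).
Proof. exact: dlift_pgpr. Qed.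
Lemma dlift_dif x : dlift hf (dif x) = dif (dlift hf x).
Proof. exact: dlift_pdif. Qed.
End lift2.

End PresentedDGA.

(* An algebra as a differential graded algebra concentrated in degree 0. *)
Definition conc0 (K : fieldType) (A : algType K) : Type := A.
HB.instance Definition _ (K : fieldType) (A : algType K) := GRing.Algebra.on (conc0 A).

Section Conc0.
Variables (K : fieldType) (A : algType K).
Local Notation W := (conc0 A).
Let g (n : nat) (x : W) : W := if n == 0%N then x else 0.
Let d (x : W) : W := 0.
Let g_linear n : linear (g n).
Proof. by move=> k x y; rewrite /g; case: eqP => // _; rewrite scaler0 addr0. Qed.
Let gK m n x : g m (g n x) = if m == n then g n x else 0.
Proof. by rewrite /g; case: m n => [|m] [|n] //=; rewrite if_same. Qed.
Let g_sum x : exists N, x = \sum_(n < N) g n x.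
Proof. by exists 1%N; rewrite big_ord1. Qed.
Let g1 : g 0 1 = 1. Proof. by []. Qed.
Let gM m n x y : g (m + n) (g m x * g n y) = g m x * g n y.
Proof. by rewrite /g; case: m n => [|m] [|n] //=; rewrite ?mulr0 ?mul0r. Qed.
Let d_linear : linear d. Proof. by move=> k x y; rewrite /d scaler0 addr0. Qed.
Let g0d x : g 0 (d x) = 0. Proof. by []. Qed.
Let gSd n x : g n.+1 (d x) = d (g n x). Proof. by []. Qed.
Let dK x : d (d x) = 0. Proof. by []. Qed.
Let dM m x y : d (g m x * y) = d (g m x) * y + (-1) ^+ m *: (g m x * d y).
Proof. by rewrite /d mul0r mulr0 scaler0 addr0. Qed.
HB.instance Definition _ := Algebra_isDGA.Build K W g_linear gK g_sum g1 gM
  d_linear g0d gSd dK dM.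
End Conc0.

Definition dga_map (K : fieldType) (V W : dgaType K) (f : {lrmorphism V -> W}) : Prop :=
  (forall n x, f (gpr n x) = gpr n (f x)) /\ (forall x, f (dif x) = dif (f x)).

Section Coalgebra.
Variable K : fieldType.
Implicit Types U V W : lmodType K.

Definition tmap V W V' W' (f : V -> V') (g : W -> W') : tensor V W -> tensor V' W' :=
  tlift (fun v w => f v \ox g w).

Definition tassoc U V W : tensor (tensor U V) W -> tensor U (tensor V W) :=
  tlift (fun z w => tlift (fun u v => u \ox (v \ox w)) z).

Record coalgebra V (D : V -> tensor V V) (e : V -> K^o) : Prop := {
  coassoc : forall x, tassoc (tmap D id (D x)) = tmap id D (D x);
  counitl : forall x, tlift (fun a b => (e a : K) *: b) (D x) = x;
  counitr : forall x, tlift (fun a b => (e b : K) *: a) (D x) = x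
}.

(* Right coaction of the coalgebra [C] on [V]. *)
Record comodule V (C : lmodType K) (D : C -> tensor C C) (e : C -> K^o) (r : V -> tensor V C) : Prop := {
  comodule_coassoc : forall x, tassoc (tmap r id (r x)) = tmap id D (r x);
  comodule_counit : forall x, tlift (fun v c => (e c : K) *: v) (r x) = x
}.

Definition antipode (A : algType K) (D : A -> tensor A A) (e : A -> K^o) (S : A -> A) : Prop :=
  forall x, tlift (fun a b => S a * b) (D x) = (e x : K)%:A /\
            tlift (fun a b => a * S b) (D x) = (e x : K)%:A.

(* The antipode is unique, hence only its existence is required. *)
Definition hopf (A : algType K) (D : {lrmorphism A -> atensor A A})
    (e : {lrmorphism A -> K^o}) : Prop :=
  coalgebra D e /\ exists S : {linear A -> A}, antipode D e S.

Definition parity (W : dgaType K) : W -> W := hsum (fun n x => (-1) ^+ n *: x).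

Definition super_hopf (W : dgaType K) (D : {lrmorphism W -> stensor W W})
    (e : {lrmorphism W -> K^o}) : Prop :=
  [/\ coalgebra D e,
      forall x, D (parity x) = parity (D x),
      forall x, e (parity x) = e x
    & exists2 S : {linear W -> W},
        antipode D e S & forall x, S (parity x) = parity (S x)].

End Coalgebra.

Section Exterior.
Variable K : fieldType.

(* [i : A -> W] makes the differential graded algebra [W] an exterior algebra
   on [A]. *)
Record exterior (A : algType K) (W : dgaType K) (i : {lrmorphism A -> W}) : Prop := {
  exterior_inj : injective i;
  exterior_deg0 : forall x, homog 0 x <-> exists a, x = i a;
  exterior_deg1 : forall x, homog 1 x <->
    exists l : seq (A * A), x = \sum_(p <- l) i p.1 * dif (i p.2);
  exterior_gen : forall P : W -> Prop,
    (forall x, homog 0 x -> P x) -> (forall x, homog 1 x -> P x) ->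
    (forall k x y, P x -> P y -> P (k *: x + y)) ->
    (forall x y, P x -> P y -> P (x * y)) ->
    forall x, P x
}.

(* [Ds] and [es] are the super coproduct and counit; [Ds] extends the coproduct
   [D] of [A]. *)
Record strongly_bicovariant (A : algType K) (D : {lrmorphism A -> atensor A A})
    (W : dgaType K) (i : {lrmorphism A -> W}) (Ds : {lrmorphism W -> stensor W W})
    (es : {lrmorphism W -> K^o}) : Prop := {
  sbc_hopf : super_hopf Ds es;
  sbc_restr : forall a, Ds (i a) = tmap i i (D a);
  sbc_dga : dga_map Ds
}.

Definition differentiable (A B : algType K) (r : {lrmorphism B -> atensor B A})
    (WB : dgaType K) (iB : {lrmorphism B -> WB}) (WA : dgaType K) (iA : {lrmorphism A -> WA}) :
    Prop :=
  exists2 rs : {lrmorphism WB -> stensor WB WA},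
    dga_map rs & forall b, rs (iB b) = tmap iB iA (r b).

End Exterior.

Section Bicrossproduct.
Variables (K : fieldType) (S U : dgaType K).
Variables (DS : {lrmorphism S -> stensor S S}) (DU : {lrmorphism U -> stensor U U}).
Variables (eS : {lrmorphism S -> K^o}) (eU : {lrmorphism U -> K^o}).
Variables (act : U -> S -> S) (beta : U -> stensor U S).

(* [koszul F x y] extends bilinearly [(-1)^(|x||y|) F x y]. *)
Definition koszul (V W : dgaType K) (T : lmodType K) (F : V -> W -> T) (x : V) (y : W) : T :=
  hsum (fun m x => hsum (fun n y => (-1) ^+ (m * n) *: F x y) y) x.

Record super_module_algebra : Prop := {
  act_bilin : bilin act;
  act_one : forall w, act 1 w = w;
  act_mul : forall h g w, act (h * g) w = act h (act g w);
  act1 : forall h, act h 1 = (eU h : K)%:A;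
  actM : forall h w v, act h (w * v) =
    tlift (fun h1 h2 => koszul (fun h2 w => act h1 w * act h2 v) h2 w) (DU h);
  act_homog : forall m n h w, homog m h -> homog n w -> homog (m + n) (act h w);
  act_dif : forall m h w, homog m h ->
    dif (act h w) = act (dif h) w + (-1) ^+ m *: act h (dif w)
}.

Record super_comodule_coalgebra : Prop := {
  beta_linear : linear beta;
  beta_comodule : comodule DS eS beta;
  beta_coprod : forall h, tmap DU id (beta h) =
    tlift (fun h1 h2 =>
      tlift2 (fun p v q w => koszul (fun v q => (p \ox q) \ox (v * w)) v q)
        (beta h1) (beta h2)) (DU h);
  beta_counit : forall h, tlift (fun p v => (eU p : K) *: v) (beta h) = (eU h : K)%:A;
  beta_gpr : forall n h, beta (gpr n h) = gpr n (beta h);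
  beta_dif : forall h, beta (dif h) = dif (beta h)
}.

(* The product and coproduct of the super bicrossproduct on the tensor product
   of [S] and [U]; its differential is that of [stensor S U]. *)
Definition bicross_mul : tensor S U -> tensor S U -> tensor S U :=
  tlift2 (fun w h v g =>
    tlift (fun h1 h2 => koszul (fun h2 v => (w * act h1 v) \ox (h2 * g)) h2 v) (DU h)).

Definition bicross_cop : tensor S U -> tensor (tensor S U) (tensor S U) :=
  tlift (fun w h =>
    tlift2 (fun w1 w2 h1 h2 =>
      tlift (fun p v => koszul (fun w2 p => (w1 \ox p) \ox ((w2 * v) \ox h2)) w2 p)
        (beta h1)) (DS w) (DU h)).

(* The multiplication map [S \ox U -> W] of two subalgebras of [W]. *)
Definition mul_map (W : dgaType K) (iS : {lrmorphism S -> W}) (iU : {lrmorphism U -> W}) :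
  tensor S U -> W := tlift (fun w h => iS w * iU h).

(* The multiplication map identifies the super bicrossproduct of [S] and [U]
   with the super Hopf algebra [W]. *)
Record super_bicrossproduct (W : dgaType K) (DW : {lrmorphism W -> stensor W W})
    (iS : {lrmorphism S -> W}) (iU : {lrmorphism U -> W}) : Prop := {
  bicross_bij : bijective (mul_map iS iU);
  bicross_mulE : forall y z,
    mul_map iS iU (bicross_mul y z) = mul_map iS iU y * mul_map iS iU z;
  bicross_copE : forall z,
    DW (mul_map iS iU z) = tmap (mul_map iS iU) (mul_map iS iU) (bicross_cop z);
  bicross_gprE : forall n (z : stensor S U),
    mul_map iS iU (gpr n z) = gpr n (mul_map iS iU z);
  bicross_difE : forall z : stensor S U,
    mul_map iS iU (dif z) = dif (mul_map iS iU z)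
}.

End Bicrossproduct.

Definition com (A : pzRingType) (a b : A) : A := a * b - b * a.
Definition anticom (A : pzRingType) (a b : A) : A := a * b + b * a.

Lemma scalar_ext (K : fieldType) (V : lmodType K) (x y : V) :
  (forall phi : {scalar V}, phi x = phi y) -> x = y.
Proof.
move=> h; apply/eqP; rewrite -subr_eq0; apply/negPn/negP.
move=> /linear_form_exists[phi [lphi]].
pose i := GRing.isLinear.Build K V K *%R phi lphi.
pose p : {scalar V} := HB.pack phi i.
have := h p; rewrite (linD lphi) -scaleN1r (linZ _ _ lphi) => e /eqP.
by rewrite [phi x]e scaleN1r subrr eq_sym oner_eq0.
Qed.

Section Relations.
Variables (K : fieldType) (lam : K).

Definition Ub_rel (B : algType K) (a0 a1 : B) : Prop := com a0 a1 = lam *: a1.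

Definition SO_rel (B : algType K) (c s : B) : Prop :=
  c * s = s * c /\ c ^+ 2 - s ^+ 2 = 1.

Record Poinc_rel (B : algType K) (c s a0 a1 : B) : Prop := {
  Poinc_SO : SO_rel c s;
  Poinc_Ub : Ub_rel a0 a1;
  Poinc_a0c : com a0 c = lam *: s ^+ 2;
  Poinc_a0s : com a0 s = lam *: (s * c);
  Poinc_a1c : com a1 c = lam *: ((c - 1) * s);
  Poinc_a1s : com a1 s = lam *: ((c - 1) * c)
}.

(* In all the exterior algebras [th] stands for theta'. *)
Record OmegaUb_rel (W : dgaType K) (a0 a1 th : W) : Prop := {
  OUb_Ub : Ub_rel a0 a1;
  OUb_d1_1 : com (dif a1) a1 = lam *: th;
  OUb_d1_0 : com (dif a1) a0 = 0;
  OUb_d0_1 : com (dif a0) a1 = lam *: dif a1;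
  OUb_d0_0 : com (dif a0) a0 = lam *: (dif a0 - th);
  OUb_th_1 : com th a1 = 0;
  OUb_th_0 : com th a0 = - (lam *: th);
  OUb_dth : dif th = 0;
  OUb_d1d1 : dif a1 ^+ 2 = 0;
  OUb_d0d0 : dif a0 ^+ 2 = 0;
  OUb_d1d0 : dif a1 * dif a0 = - (dif a0 * dif a1);
  OUb_d1th : dif a1 * th = - (th * dif a1);
  OUb_d0th : dif a0 * th = - (th * dif a0)
}.

Record OmegaSO_rel (W : dgaType K) (c s : W) : Prop := {
  OSO_SO : SO_rel c s;
  OSO_dcs : dif c * s = s * dif c;
  OSO_dsc : dif s * c = c * dif s;
  OSO_dcc : dif c * c = c * dif c;
  OSO_cdc : c * dif c = s * dif s;
  OSO_sds : s * dif s = dif s * s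
}.

Record OmegaPoinc_rel (W : dgaType K) (c s a0 a1 th : W) : Prop := {
  OP_Poinc : Poinc_rel c s a0 a1;
  OP_Ub : OmegaUb_rel a0 a1 th;
  OP_SO : OmegaSO_rel c s;
  OP_d0_c : com (dif a0) c = lam *: (c * dif c);
  OP_d0_s : com (dif a0) s = lam *: (c * dif s);
  OP_d1_c : com (dif a1) c = lam *: (s * dif c);
  OP_d1_s : com (dif a1) s = lam *: (s * dif s);
  OP_0_dc : com a0 (dif c) = lam *: (s * dif s);
  OP_0_ds : com a0 (dif s) = lam *: (s * dif c);
  OP_1_dc : com a1 (dif c) = lam *: ((c - 1) * dif s);
  OP_1_ds : com a1 (dif s) = lam *: ((c - 1) * dif c);
  OP_th_c : com th c = lam *: ((c - 1) * dif c);
  OP_th_s : com th s = lam *: ((c - 1) * dif s);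
  OP_d0_dc : anticom (dif a0) (dif c) = 0;
  OP_d0_ds : anticom (dif a0) (dif s) = lam *: (dif s * dif c);
  OP_d1_dc : anticom (dif a1) (dif c) = lam *: (dif c * dif s);
  OP_d1_ds : anticom (dif a1) (dif s) = 0
}.

Inductive Ub_gen := Ua0 | Ua1.
Inductive SO_gen := Sc | Ss.
Inductive Poinc_gen := Pc | Ps | Pa0 | Pa1.
Inductive OUb_gen := OUa0 | OUa1 | OUth.

Let Ub_model : exists (B : algType K) (f : Ub_gen -> B), Ub_rel (f Ua0) (f Ua1).
Proof.
by exists K^o, (fun _ => 0); rewrite /Ub_rel /com mulr0 subrr scaler0.
Qed.

Let SO_rel10 (B : algType K) : SO_rel (1 : B) 0.
Proof. by split; rewrite ?mulr0 ?mul0r // expr1n expr0n subr0. Qed.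

Let SO_model : exists (B : algType K) (f : SO_gen -> B), SO_rel (f Sc) (f Ss).
Proof. by exists K^o, (fun x => if x is Sc then 1 else 0); exact: SO_rel10. Qed.

Let Poinc_model : exists (B : algType K) (f : Poinc_gen -> B),
  Poinc_rel (f Pc) (f Ps) (f Pa0) (f Pa1).
Proof.
exists K^o, (fun x => if x is Pc then 1 else 0); split; first exact: SO_rel10.
all: by rewrite /Ub_rel /com ?expr0n ?mulr0 ?mul0r ?subrr ?mul0r ?scaler0.
Qed.

Let OUb_model : exists (W : dgaType K) (f : OUb_gen -> W),
  (forall x, homog (if x is OUth then 1%N else 0%N) (f x)) /\
  OmegaUb_rel (f OUa0) (f OUa1) (f OUth).
Proof.
exists (conc0 K^o), (fun _ => 0); split; first by move=> x; exact: homog0.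
split; rewrite /Ub_rel /com ?(lin0 dif_linear) ?expr0n ?mulr0 ?mul0r ?subrr ?scaler0 ?oppr0 //.
Qed.

Let OSO_model : exists (W : dgaType K) (f : SO_gen -> W),
  (forall x, homog 0 (f x)) /\ OmegaSO_rel (f Sc) (f Ss).
Proof.
exists (conc0 K^o), (fun x => if x is Sc then 1 else 0); split.
  by case; [exact: homog1 | exact: homog0].
have e (x : conc0 K^o) : dif x = 0 by [].
by split; rewrite ?e ?mulr0 ?mul0r //; exact: SO_rel10.
Qed.

Definition Ub_pres := APres Ub_model.
Definition SO_pres := APres SO_model.
Definition Poinc_pres := APres Poinc_model.
Definition OmegaUb_pres := DPres OUb_model.
Definition OmegaSO_pres := DPres OSO_model.

(* U(b_+), C[SO_{1,1}] and C_lam[Poinc_{1,1}]. The quantum spacetime is also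
   [Ub], with [t = ua0] and [x = ua1]. *)
Definition Ub : algType K := palg Ub_pres.
Definition SO : algType K := palg SO_pres.
Definition Poinc : algType K := palg Poinc_pres.

(* Omega(U(b_+)) and Omega(C[SO_{1,1}]). *)
Definition OmegaUb : dgaType K := pdga OmegaUb_pres.
Definition OmegaSO : dgaType K := pdga OmegaSO_pres.

Definition ua0 : Ub := pgen (P := Ub_pres) Ua0.
Definition ua1 : Ub := pgen (P := Ub_pres) Ua1.
Definition soc : SO := pgen (P := SO_pres) Sc.
Definition sos : SO := pgen (P := SO_pres) Ss.
Definition pc : Poinc := pgen (P := Poinc_pres) Pc.
Definition ps : Poinc := pgen (P := Poinc_pres) Ps.
Definition pa0 : Poinc := pgen (P := Poinc_pres) Pa0.
Definition pa1 : Poinc := pgen (P := Poinc_pres) Pa1.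
Definition oua0 : OmegaUb := pdgen (P := OmegaUb_pres) OUa0.
Definition oua1 : OmegaUb := pdgen (P := OmegaUb_pres) OUa1.
Definition outh : OmegaUb := pdgen (P := OmegaUb_pres) OUth.
Definition osoc : OmegaSO := pdgen (P := OmegaSO_pres) Sc.
Definition osos : OmegaSO := pdgen (P := OmegaSO_pres) Ss.

Lemma Ub_sat : Ub_rel ua0 ua1.
Proof.
apply: palgE => B f hf; rewrite !(rmorphB, rmorphM, linearZ) /= !alift_gen.
exact: hf.
Qed.

Lemma SO_sat : SO_rel soc sos.
Proof.
split; apply: palgE => B f hf; rewrite !(rmorphB, rmorphM, rmorphXn, rmorph1) /= !alift_gen;
  by case: hf.
Qed.

Lemma Poinc_sat : Poinc_rel pc ps pa0 pa1.
Proof.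
split; first split; apply: palgE => B f hf; case: (hf) => -[? ?] ? ? ? ? ?;
  by rewrite !(rmorphB, rmorphM, rmorphXn, linearZ, rmorph1) /=
       ?(rmorphB, rmorphM, rmorphXn, linearZ, rmorph1) /= !alift_gen.
Qed.

Lemma OmegaUb_sat : OmegaUb_rel oua0 oua1 outh.
Proof.
split; apply: pdgaE => W f hf; have [_ [? ? ? ? ? ? ? ? ? ? ? ? ?]] := hf;
  rewrite ?(rmorphB, rmorphN, rmorphM, rmorphXn, linearZ, rmorph0) /=
          ?dlift_dif ?(rmorphB, rmorphN) /= ?dlift_dif ?dlift_gen //. 
by rewrite [dlift _ _]linearZ /= dlift_gen.
Qed.

Lemma OmegaSO_sat : OmegaSO_rel osoc osos.
Proof.
split; first split; apply: pdgaE => W f hf; have [_ [[? ?] ? ? ? ? ?]] := hf;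
  by rewrite ?(rmorphB, rmorphM, rmorphXn, rmorph1) /= ?dlift_dif ?dlift_gen.
Qed.

Lemma homog_oua0 : homog 0 oua0.
Proof.
by apply: pdgaE => W f hf; rewrite dlift_gpr dlift_gen; case: hf => h _; apply: (h OUa0).
Qed.
Lemma homog_oua1 : homog 0 oua1.
Proof.
by apply: pdgaE => W f hf; rewrite dlift_gpr dlift_gen; case: hf => h _; apply: (h OUa1).
Qed.
Lemma homog_outh : homog 1 outh.
Proof.
by apply: pdgaE => W f hf; rewrite dlift_gpr dlift_gen; case: hf => h _; apply: (h OUth).
Qed.
Lemma homog_osoc : homog 0 osoc.
Proof.
by apply: pdgaE => W f hf; rewrite dlift_gpr dlift_gen; case: hf => h _; apply: (h Sc).
Qed.
Lemma homog_osos : homog 0 osos.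
Proof.
by apply: pdgaE => W f hf; rewrite dlift_gpr dlift_gen; case: hf => h _; apply: (h Ss).
Qed.

Section Coproducts.
Implicit Types A B : algType K.

Local Ltac expand := rewrite /com ?expr2
  ?(mulrBl, mulrBr, mulrDl, mulrDr, tensM, mul1r, mulr1).
Let tensBl (V W : lmodType K) (v v' : V) (w : W) :
  (v - v') \ox w = v \ox w - v' \ox w.
Proof. by rewrite tensDl -scaleN1r tensZl scaleN1r. Qed.
Let tensBr (V W : lmodType K) (v : V) (w w' : W) :
  v \ox (w - w') = v \ox w - v \ox w'.
Proof. by rewrite tensDr -scaleN1r tensZr scaleN1r. Qed.

Local Ltac collect :=
  rewrite ?(mulrBl, mulrBr, mulrDl, mulrDr, mul1r, mulr1, tensBl, tensBr, tensDl, tensDr, tensZl, tensZr,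
            scalerDr, scalerBr);
  apply: scalar_ext => phi;
  rewrite ?(linearD, linearB, linearN, linearZ) /=; ring.

Let comE B (x y z : B) : com x y = z -> x * y = y * x + z.
Proof. by move=> <-; rewrite addrC subrK. Qed.

Lemma primitive_rel B (a0 a1 : B) : Ub_rel a0 a1 ->
  Ub_rel (a0 \ox 1 + 1 \ox a0 : atensor B B) (a1 \ox 1 + 1 \ox a1).
Proof.
move=> h; rewrite /Ub_rel; expand; rewrite !(comE h).
collect.
Qed.

Lemma SO_cop_rel B (c s : B) : SO_rel c s ->
  SO_rel (c \ox c + s \ox s : atensor B B) (c \ox s + s \ox c).
Proof.
move=> [cs h]; split; expand; rewrite -!cs.
  collect.
have e : c * c = s * s + 1 by rewrite -!expr2 -h addrC subrK.
rewrite !e; collect.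
Qed.

Lemma coaction_rel A B (c s a0 a1 : A) (t x : B) : Poinc_rel c s a0 a1 -> Ub_rel t x ->
  Ub_rel (1 \ox a0 + t \ox c + x \ox s : atensor B A) (1 \ox a1 + t \ox s + x \ox c).
Proof.
move=> [[cs h] h01 h0c h0s h1c h1s] tx; rewrite /Ub_rel; expand.
rewrite !(comE h01, comE h0c, comE h0s, comE h1c, comE h1s, comE tx) ?expr2 -?cs.
collect.
Qed.

Lemma Poinc_cop_rel A (c s a0 a1 : A) : Poinc_rel c s a0 a1 ->
  Poinc_rel (c \ox c + s \ox s : atensor A A) (c \ox s + s \ox c)
    (1 \ox a0 + a0 \ox c + a1 \ox s) (1 \ox a1 + a0 \ox s + a1 \ox c).
Proof.
move=> h; case: (h) => -[cs hh] h01 h0c h0s h1c h1s; split.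
- exact: SO_cop_rel.
- exact: coaction_rel.
- expand; rewrite !(comE h01, comE h0c, comE h0s, comE h1c, comE h1s) ?expr2 -?cs; collect.
- expand; rewrite !(comE h01, comE h0c, comE h0s, comE h1c, comE h1s) ?expr2 -?cs; collect.
- expand; rewrite !(comE h01, comE h0c, comE h0s, comE h1c, comE h1s) ?expr2 -?cs; collect.
- expand; rewrite !(comE h01, comE h0c, comE h0s, comE h1c, comE h1s) ?expr2 -?cs; collect.
Qed.
End Coproducts.

Definition Ub_cop : {lrmorphism Ub -> atensor Ub Ub} :=
  alift (P := Ub_pres)
    (f := fun g => match g with
      | Ua0 => ua0 \ox 1 + 1 \ox ua0
      | Ua1 => ua1 \ox 1 + 1 \ox ua1
      end : atensor Ub Ub)
    (primitive_rel Ub_sat).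

Definition SO_cop : {lrmorphism SO -> atensor SO SO} :=
  alift (P := SO_pres)
    (f := fun g => match g with
      | Sc => soc \ox soc + sos \ox sos
      | Ss => soc \ox sos + sos \ox soc
      end : atensor SO SO)
    (SO_cop_rel SO_sat).

Definition Poinc_cop : {lrmorphism Poinc -> atensor Poinc Poinc} :=
  alift (P := Poinc_pres)
    (f := fun g => match g with
      | Pc => pc \ox pc + ps \ox ps
      | Ps => pc \ox ps + ps \ox pc
      | Pa0 => 1 \ox pa0 + pa0 \ox pc + pa1 \ox ps
      | Pa1 => 1 \ox pa1 + pa0 \ox ps + pa1 \ox pc
      end : atensor Poinc Poinc)
    (Poinc_cop_rel Poinc_sat).

Definition DeltaR : {lrmorphism Ub -> atensor Ub Poinc} :=
  alift (P := Ub_pres)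
    (f := fun g => match g with
      | Ua0 => 1 \ox pa0 + ua0 \ox pc + ua1 \ox ps
      | Ua1 => 1 \ox pa1 + ua0 \ox ps + ua1 \ox pc
      end : atensor Ub Poinc)
    (coaction_rel Poinc_sat Ub_sat).

Definition Ub_inc : {lrmorphism Ub -> OmegaUb} :=
  alift (P := Ub_pres)
    (f := fun g => match g with Ua0 => oua0 | Ua1 => oua1 end : OmegaUb)
    (OUb_Ub OmegaUb_sat).

Definition SO_inc : {lrmorphism SO -> OmegaSO} :=
  alift (P := SO_pres)
    (f := fun g => match g with Sc => osoc | Ss => osos end : OmegaSO)
    (OSO_SO OmegaSO_sat).

Let Poinc_counit_rel : Poinc_rel (1 : K^o) 0 0 0.
Proof.
split; first exact: SO_rel10.
all: by rewrite /Ub_rel /com ?expr0n ?mulr0 ?mul0r ?subrr ?mul0r ?scaler0.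
Qed.

Definition Poinc_counit : {lrmorphism Poinc -> K^o} :=
  alift (P := Poinc_pres)
    (f := fun g => match g with Pc => 1 | _ => 0 end : K^o) Poinc_counit_rel.

Definition SO_counit : {lrmorphism SO -> K^o} :=
  alift (P := SO_pres)
    (f := fun g => match g with Sc => 1 | Ss => 0 end : K^o) (SO_rel10 K^o).

Let Ub_counit_rel : Ub_rel (0 : K^o) 0.
Proof. by rewrite /Ub_rel /com mulr0 subrr scaler0. Qed.

Definition Ub_counit : {lrmorphism Ub -> K^o} :=
  alift (P := Ub_pres) (f := fun _ => 0 : K^o) Ub_counit_rel.

(* The action of Omega(U(b_+)) on Omega(C[SO_{1,1}]), on generators. *)
Record extended_action (act : OmegaUb -> OmegaSO -> OmegaSO) : Prop := {
  ea_0_c : act oua0 osoc = lam *: osos ^+ 2;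
  ea_0_s : act oua0 osos = lam *: (osos * osoc);
  ea_1_c : act oua1 osoc = lam *: (osoc * osos - osos);
  ea_1_s : act oua1 osos = lam *: (osoc ^+ 2 - osoc);
  ea_d0_c : act (dif oua0) osoc = lam *: (osoc * dif osoc);
  ea_d0_s : act (dif oua0) osos = lam *: (osoc * dif osos);
  ea_d1_c : act (dif oua1) osoc = lam *: (osos * dif osoc);
  ea_d1_s : act (dif oua1) osos = lam *: (osos * dif osos);
  ea_0_dc : act oua0 (dif osoc) = lam *: (osos * dif osos);
  ea_0_ds : act oua0 (dif osos) = lam *: (osos * dif osoc);
  ea_1_dc : act oua1 (dif osoc) = lam *: ((osoc - 1) * dif osos);
  ea_1_ds : act oua1 (dif osos) = lam *: ((osoc - 1) * dif osoc);
  ea_th_c : act outh osoc = lam *: ((osoc - 1) * dif osoc);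
  ea_th_s : act outh osos = lam *: ((osoc - 1) * dif osos)
}.

(* The coaction of Omega(C[SO_{1,1}]) on Omega(U(b_+)), on generators. *)
Record extended_coaction (beta : OmegaUb -> stensor OmegaUb OmegaSO) : Prop := {
  ec_0 : beta oua0 = oua0 \ox osoc + oua1 \ox osos;
  ec_1 : beta oua1 = oua0 \ox osos + oua1 \ox osoc;
  ec_d0 : beta (dif oua0) = dif oua0 \ox osoc + dif oua1 \ox osos
                          + oua0 \ox dif osoc + oua1 \ox dif osos;
  ec_d1 : beta (dif oua1) = dif oua0 \ox osos + dif oua1 \ox osoc
                          + oua0 \ox dif osos + oua1 \ox dif osoc;
  ec_th : beta outh = outh \ox 1 - dif oua0 \ox 1 + beta (dif oua0)
}.

End Relations.

(* Main.v *)
Require Import Defs.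
From HB Require Import structures.
From mathcomp Require Import all_boot all_order all_algebra.
From mathcomp Require Import boolp reals complex.
From mathcomp Require Import ring.

Set Implicit Arguments.
Unset Strict Implicit.
Unset Printing Implicit Defensive.

Import GRing.Theory.
Local Open Scope ring_scope.

(* In terms of z = c + s, the action of U(b_+) on C[SO_{1,1}] is by differential
   operators: a_0 = lam s D and a_1 = lam (c - 1) D with D = z d/dz. Hence the
   differential graded algebra presented by the relations acts on Omega(C[SO_{1,1}]),
   and acting on 1 gives a projection of it onto that subalgebra. Together with
   the quotient map c |-> 1, s |-> 0 onto Omega(U(b_+)), this projection splits
   the multiplication map, which yields the super bicrossproduct.

   Conversely, applying an extension of Delta_R to the relations of
   Omega(U(b_+)), and the functionals reading off the coefficients of 1, t, x,
   xt, xx, dt and dx to the result, gives all the relations of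
   Omega(C_lam[Poinc_{1,1}]), whence universality. Applied to the iterated
   coaction of the presented algebra, the same argument gives its coproduct. *)

(** * Generation by elements *)

(** The presented algebras are quotients by whatever holds in every model: a map out of one only
    needs the relations in its target, but injectivity of anything must be exhibited by such a map.
    Sending forms to 0 retracts each exterior algebra onto its degree 0 part; the operator
    representation exists because d is realised as b |-> [D, b] w with w, in the role of dz/z,
    central of degree 1.

    Since lam is invertible, theta' = lam^-1 [dx, x]. So degree 0 generators and their differentials
    suffice, and identities between DGA maps are tested on c, s, a_0, a_1 alone; the values of
    theta' under the representation, the coproduct and the antipode are all forced by this
    commutator.

    That 2 is invertible makes the two-forms of C[SO_{1,1}] vanish, normalises the functional
    reading off t, and excludes a nonzero commutator [dc, c] in the converse direction.

    Antipodes are built on the two factors, as DGA maps to the super-opposite algebras, and combined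
    by convolution. The Hopf algebra structures in degree 0 are then deduced from those on forms
    through the retractions. *)

Section Packing.
Variable K : fieldType.

Definition lin_of (V W : lmodType K) (f : V -> W) (lf : linear f) : {linear V -> W} :=
  HB.pack f (GRing.isLinear.Build K V W *:%R f lf).

Definition lrm_of (A B : algType K) (f : A -> B) (lf : linear f)
    (mf : monoid_morphism f) : {lrmorphism A -> B} :=
  HB.pack f (GRing.isLinear.Build K A B *:%R f lf) (GRing.isMonoidMorphism.Build A B f mf).

End Packing.

Section Generation.
Variable K : fieldType.

Definition lin_closed (V : lmodType K) (P : V -> Prop) : Prop :=
  forall k x y, P x -> P y -> P (k *: x + y).

Section LinClosed.
Variables (V : lmodType K) (P : V -> Prop) (lP : lin_closed P) (P0 : P 0).
Lemma lin_closedD x y : P x -> P y -> P (x + y).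
Proof. by move=> px py; rewrite -[x]scale1r; apply: lP. Qed.
Lemma lin_closedZ k x : P x -> P (k *: x).
Proof. by move=> px; rewrite -[_ *: _]addr0; apply: lP. Qed.
Lemma lin_closedN x : P x -> P (- x).
Proof. by move=> px; rewrite -scaleN1r; apply: lin_closedZ. Qed.
Lemma lin_closedB x y : P x -> P y -> P (x - y).
Proof. by move=> px py; apply: lin_closedD => //; apply: lin_closedN. Qed.
End LinClosed.

(** Generation is stated as induction on words: only left multiplication by a generator has to be
    handled, never a product of two arbitrary elements. *)
Definition alg_generated (A : algType K) (X : Type) (g : X -> A) : Prop :=
  forall P : A -> Prop, P 0 -> P 1 -> lin_closed P ->
    (forall k x, P x -> P (g k * x)) -> forall x, P x.

(** No closure under [dif] is required of [P]: by the Leibniz rule and d^2 = 0, words in the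
    generators and their differentials already span. *)
Definition dga_generated (W : dgaType K) (X : Type) (g : X -> W) : Prop :=
  forall P : W -> Prop, P 0 -> P 1 -> lin_closed P ->
    (forall k x, P x -> P (g k * x)) ->
    (forall k x, P x -> P (dif (g k) * x)) -> forall x, P x.

Lemma palg_generated (P : apres K) : alg_generated (@pgen K P).
Proof.
move=> Q Q0 Q1 lQ gQ x.
(* Strengthening the claim to left multiplication operators makes it stable under products of formal
   expressions. *)
pose R y := forall x, Q x -> Q (y * x).
suff h : R x by rewrite -[x]mulr1; apply: h.
have -> : x = api (repr x) by rewrite /api reprK.
elim: (repr x) => [k|||t IHt u IHu|k t IHt|t IHt u IHu] y Qy.
- exact: gQ.
- suff -> : api AZero * y = 0 by [].
  by apply: palgE => B f hf; rewrite rmorphM rmorph0 /= alift_pi mul0r.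
- suff -> : api AOne * y = y by [].
  by apply: palgE => B f hf; rewrite rmorphM /= alift_pi mul1r.
- suff -> : api (AAdd t u) * y = api t * y + api u * y.
    by apply: lin_closedD; [|exact: IHt|exact: IHu].
  by apply: palgE => B f hf; rewrite rmorphD !rmorphM /= !alift_pi -mulrDl.
- suff -> : api (AScale k t) * y = k *: (api t * y).
    by apply: lin_closedZ => //; apply: IHt.
  by apply: palgE => B f hf; rewrite linearZ !rmorphM /= !alift_pi -scalerAl.
- suff -> : api (AMul t u) * y = api t * (api u * y).
    by apply: IHt; apply: IHu.
  by apply: palgE => B f hf; rewrite !rmorphM /= !alift_pi -mulrA.
Qed.

Section HomogMul.
Variable W : dgaType K.

Lemma gpr_mull m n (y x : W) : homog m y ->
  gpr n (y * x) = if (m <= n)%N then y * gpr (n - m) x else 0.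
Proof.
move=> hy; elim/(@homog_ind K W): x => [|k x z hx IH].
  by rewrite mulr0 !(lin0 (gpr_linear _)) mulr0 if_same.
rewrite mulrDr !(linD (gpr_linear _)) IH mulrDr (gprE _ (homogM hy hx)) (gprE _ hx).
case: leqP => h; first by rewrite -[n in n == _](subnKC h) eqn_add2l; case: eqP; rewrite ?mulr0.
by rewrite addr0 ltn_eqF // (leq_trans h) // leq_addr.
Qed.
End HomogMul.

Lemma dga_map_homog (V W : dgaType K) (f : {lrmorphism V -> W}) n x :
  dga_map f -> homog n x -> homog n (f x).
Proof. by move=> [gf _] hx; rewrite /homog -gf hx. Qed.

Section PdgaGeneration.
Variable P : dpres K.
Local Notation W := (pdga P).

Lemma homog_pdgen (k : dgen P) : homog (ddeg k) (pdgen k).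
Proof.
by apply: pdgaE => V f hf; rewrite dlift_gpr dlift_gen; case: (hf) => h _; apply: h.
Qed.

(** Words in the generators and their differentials. The index records the degree, so that a
    projection [gpr] keeps a word or kills it. *)
Inductive mono : nat -> W -> Prop :=
| mono1 : mono 0 1
| monoG k n x : mono n x -> mono (ddeg k + n) (pdgen k * x)
| monoD k n x : mono n x -> mono ((ddeg k).+1 + n) (dif (pdgen k) * x).

Lemma mono_homog n x : mono n x -> homog n x.
Proof.
elim=> [|k m y _ IH|k m y _ IH]; first exact: homog1.
- exact: homogM (homog_pdgen k) IH.
- exact: homogM (homog_dif (homog_pdgen k)) IH.
Qed.

(** The linear span of the words, as the least linearly closed predicate containing them. *)
Definition mspan (x : W) : Prop :=
  forall Q : W -> Prop, Q 0 -> lin_closed Q -> (forall n x, mono n x -> Q x) -> Q x.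

Lemma mspan0 : mspan 0. Proof. by []. Qed.
Lemma mspan_lin : lin_closed mspan.
Proof. by move=> k x y hx hy Q Q0 lQ mQ; apply: (lQ k); [exact: (hx Q)|exact: (hy Q)]. Qed.
Lemma mspan_mono n x : mono n x -> mspan x.
Proof. by move=> mx Q Q0 lQ mQ; exact: mQ mx. Qed.

Lemma mspan_map (f : W -> W) : linear f -> (forall n x, mono n x -> mspan (f x)) ->
  forall x, mspan x -> mspan (f x).
Proof.
move=> lf mf x hx; apply: (hx (fun x => mspan (f x))) => //.
- by rewrite (lin0 lf); exact: mspan0.
- by move=> k a b ha hb; rewrite lf; apply: mspan_lin.
Qed.

Lemma mull_linear (A : algType K) (a : A) : linear (fun x => a * x).
Proof. by move=> k x y; rewrite mulrDr scalerAr. Qed.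

Lemma mspanG k x : mspan x -> mspan (pdgen k * x).
Proof.
by apply: (@mspan_map (fun x => _ * x)); [exact: mull_linear|move=> n y my; exact: mspan_mono (monoG k my)].
Qed.
Lemma mspanD k x : mspan x -> mspan (dif (pdgen k) * x).
Proof.
by apply: (@mspan_map (fun x => _ * x)); [exact: mull_linear|move=> n y my; exact: mspan_mono (monoD k my)].
Qed.

Lemma mspanM x y : mspan x -> mspan y -> mspan (x * y).
Proof.
move=> hx hy; apply: (hx (fun x => mspan (x * y))).
- by rewrite mul0r; exact: mspan0.
- by move=> k a b ha hb; rewrite mulrDl -scalerAl; apply: mspan_lin.
- move=> n z; elim=> [|k m t _ IH|k m t _ IH]; first by rewrite mul1r.
  + by rewrite -mulrA; apply: mspanG.
  + by rewrite -mulrA; apply: mspanD.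
Qed.

Lemma dif1 (V : dgaType K) : dif (1 : V) = 0.
Proof.
have := difMh 1 (homog1 V); rewrite !mul1r mulr1 expr0 scale1r => e.
by apply: (addrI (dif (1 : V))); rewrite -e addr0.
Qed.

Lemma mspan_gpr n x : mspan x -> mspan (gpr n x).
Proof.
apply: mspan_map => [|m y my]; first exact: gpr_linear.
rewrite (gprE _ (mono_homog my)); case: eqP => _; [exact: mspan_mono my|exact: mspan0].
Qed.

Lemma mspan_dif x : mspan x -> mspan (dif x).
Proof.
apply: mspan_map => [|n y]; first exact: dif_linear.
elim=> [|k m t mt IH|k m t mt IH]; first by rewrite dif1; exact: mspan0.
- rewrite (difMh _ (homog_pdgen k)) addrC; apply: mspan_lin.
    exact: mspanG.
  exact: mspanD (mspan_mono mt).
- rewrite (difMh _ (homog_dif (homog_pdgen k))) difK mul0r add0r -[_ *: _]addr0.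
  by apply: mspan_lin => //; apply: mspanD.
Qed.

Lemma mspanT x : mspan x.
Proof.
have -> : x = dpi (repr x) by rewrite /dpi reprK.
have m1 : mspan 1 by exact: mspan_mono mono1.
elim: (repr x) => [k|||t IHt u IHu|k t IHt|t IHt u IHu|n t IHt|t IHt].
- by rewrite -[dpi _]mulr1; apply: mspanG.
- exact: mspan0.
- exact: m1.
- suff -> : dpi (DAdd t u) = 1 *: dpi t + dpi u by exact: mspan_lin.
  by rewrite scale1r; apply: pdgaE => V f hf; rewrite rmorphD /= !dlift_pi.
- suff -> : dpi (DScale k t) = k *: dpi t + 0 by apply: mspan_lin => //; exact: mspan0.
  by rewrite addr0; apply: pdgaE => V f hf; rewrite linearZ /= !dlift_pi.
- suff -> : dpi (DMul t u) = dpi t * dpi u by exact: mspanM.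
  by apply: pdgaE => V f hf; rewrite rmorphM /= !dlift_pi.
- suff -> : dpi (DGpr n t) = gpr n (dpi t) by exact: mspan_gpr.
  by apply: pdgaE => V f hf; rewrite dlift_gpr /= !dlift_pi.
- suff -> : dpi (DDif t) = dif (dpi t) by exact: mspan_dif.
  by apply: pdgaE => V f hf; rewrite dlift_dif /= !dlift_pi.
Qed.

Lemma pdga_generated : dga_generated (@pdgen K P).
Proof.
move=> Q Q0 Q1 lQ gQ dQ x; apply: mspanT => // n y.
by elim=> [|k m t _ IH|k m t _ IH] //; [exact: gQ|exact: dQ].
Qed.

End PdgaGeneration.

Lemma alg_generated_ext (A B : algType K) X (g : X -> A) (f h : {lrmorphism A -> B}) :
  alg_generated g -> (forall k, f (g k) = h (g k)) -> forall x, f x = h x.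
Proof.
move=> gen e; apply: gen => [||k x y ex ey|k x ex]; rewrite ?rmorph0 ?rmorph1 //.
- by rewrite !linearP /= ex ey.
- by rewrite !rmorphM /= e ex.
Qed.

Lemma dga_generated_ext (A B : dgaType K) X (g : X -> A) (f h : {lrmorphism A -> B}) :
  dga_map f -> dga_map h ->
  dga_generated g -> (forall k, f (g k) = h (g k)) -> forall x, f x = h x.
Proof.
move=> [_ df] [_ dh] gen e; apply: gen => [||k x y ex ey|k x ex|k x ex];
  rewrite ?rmorph0 ?rmorph1 //.
- by rewrite !linearP /= ex ey.
- by rewrite !rmorphM /= e ex.
- by rewrite !rmorphM /= df dh e ex.
Qed.

Lemma dlift_dga_map (P : dpres K) (W : dgaType K) (f : dgen P -> W) (hf : dsat f) :
  dga_map (dlift hf).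
Proof. by split=> *; [exact: dlift_gpr|exact: dlift_dif]. Qed.

Section GeneratedExterior.
Variables (A : algType K) (W : dgaType K) (i : {lrmorphism A -> W}).
Hypothesis hi : forall a, homog 0 (i a).
Hypothesis gen : dga_generated i.

Let one_forms (x : W) :=
  exists l : seq (A * A), x = \sum_(p <- l) i p.1 * dif (i p.2).

Let one_forms0 : one_forms 0. Proof. by exists [::]; rewrite big_nil. Qed.
Let one_formsD x y : one_forms x -> one_forms y -> one_forms (x + y).
Proof. by move=> [l ->] [l' ->]; exists (l ++ l'); rewrite big_cat. Qed.
Let one_forms_mul a x : one_forms x -> one_forms (i a * x).
Proof.
move=> [l ->]; exists [seq (a * p.1, p.2) | p <- l].
by rewrite big_map mulr_sumr; apply: eq_bigr => p _ /=; rewrite rmorphM mulrA.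
Qed.
Let one_formsZ k x : one_forms x -> one_forms (k *: x).
Proof.
move=> /(one_forms_mul (k *: 1)); rewrite linearZ /= rmorph1 -scalerAl mul1r //.
Qed.
Let one_forms_dif a b : one_forms (dif (i a) * i b).
Proof.
(* The Leibniz rule read as (da) b = d(ab) - a db. *)
exists [:: (1, a * b); (- a, b)]; rewrite big_cons big_seq1 /= !rmorph1 mul1r rmorphN /=.
by rewrite rmorphM (difMh _ (hi a)) expr0 scale1r mulNr addrK.
Qed.

(** Degrees 0 and 1 have to be treated together: left multiplication by [dif (i a)] carries the
    degree 0 part, known to be some [i b], into degree 1. *)
Let low x : (exists a, gpr 0 x = i a) /\ one_forms (gpr 1 x).
Proof.
elim/gen: x => [||k x y [[a ha] hx] [[b hb] hy]|a x [[b hb] hx]|a x [[b hb] hx]].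
- rewrite !(lin0 (gpr_linear _)); split=> //; by exists 0; rewrite rmorph0.
- by rewrite gpr1 (gprE _ (homog1 W)); split=> //; exists 1; rewrite rmorph1.
- rewrite !gpr_linear; split; last by apply: one_formsD => //; apply: one_formsZ.
  by exists (k *: a + b); rewrite ha hb linearP.
- rewrite !(gpr_mull _ _ (hi a)) !subn0; split; last exact: one_forms_mul.
  by exists (a * b); rewrite hb rmorphM.
- rewrite !(gpr_mull _ _ (homog_dif (hi a))) subnn hb; split; last exact: one_forms_dif.
  by exists 0; rewrite rmorph0.
Qed.

Lemma generated_exterior : injective i -> exterior i.
Proof.
move=> inji; split=> // [x|x|P P0 P1 lP mP x].
- split=> [<-|[a ->]]; [by have [] := low x|exact: hi].
- split=> [<-|[l ->]]; first by have [] := low x.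
  elim/big_ind: _ => [|y z|p _]; [exact: homog0|exact: homogD|].
  exact: homogM (hi _) (homog_dif (hi _)).
- elim/gen: x => [||k x y|a x|a x].
  + exact/P0/homog0.
  + exact/P0/homog1.
  + exact: lP.
  + by apply: mP; apply: P0.
  + by apply: mP; apply/P1/homog_dif.
Qed.

End GeneratedExterior.

End Generation.

(** * Super tensor products *)

Section TensorMaps.
Variable K : fieldType.
Implicit Types U V W : lmodType K.

Lemma lin_comp U V W (f : V -> W) (g : U -> V) : linear f -> linear g ->
  linear (fun x => f (g x)).
Proof. by move=> lf lg k x y; rewrite lg lf. Qed.

Lemma lin_id V : linear (fun x : V => x). Proof. by []. Qed.

Lemma bilin_comp V W V' W' U (F : V' -> W' -> U) (f : V -> V') (g : W -> W') :
  bilin F -> linear f -> linear g -> bilin (fun v w => F (f v) (g w)).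
Proof. by move=> [Fl Fr] lf lg; split=> x k a b; rewrite /= ?lf ?lg ?Fl ?Fr. Qed.

Lemma lin_bilin V W U U' (F : V -> W -> U) (f : U -> U') :
  bilin F -> linear f -> bilin (fun v w => f (F v w)).
Proof. by move=> [Fl Fr] lf; split=> x k a b; rewrite /= ?Fl ?Fr lf. Qed.

Lemma mul_bilin (A : algType K) : bilin (fun x y : A => x * y).
Proof. by split=> x k a b /=; rewrite ?mulrDl ?mulrDr -?scalerAl -?scalerAr. Qed.

Section Tmap.
Variables (V W V' W' : lmodType K) (f : {linear V -> V'}) (g : {linear W -> W'}).

Lemma tmap_bilin : bilin (fun v w => f v \ox g w).
Proof. exact: (bilin_comp (tens_bilin _ _) (linearP f) (linearP g)). Qed.
Lemma tmapE v w : tmap f g (v \ox w) = f v \ox g w.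
Proof. by rewrite /tmap tlift_tens //; exact: tmap_bilin. Qed.
Lemma tmap_linear : linear (tmap f g).
Proof. exact/tlift_linear/tmap_bilin. Qed.
End Tmap.

Section Tassoc.
Variables U V W : lmodType K.
Let bil1 (w : W) : bilin (fun (u : U) (v : V) => u \ox (v \ox w)).
Proof.
split=> x k a b; first by rewrite tensDl tensZl.
by rewrite tensDl tensZl tensDr tensZr.
Qed.
Lemma tassoc_bilin : bilin (fun z (w : W) => tlift (fun (u : U) (v : V) => u \ox (v \ox w)) z).
Proof.
split=> [w|z]; first exact: tlift_linear (bil1 w).
move=> k a b /=; elim/tensor_ind: z => [|u v z IH].
  by rewrite !(lin0 (tlift_linear (bil1 _))) scaler0 addr0.
rewrite !(linD (tlift_linear (bil1 _))) IH !(tlift_tens _ _ (bil1 _)).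
by rewrite !(tensDr, tensZr) scalerDr addrACA.
Qed.
Lemma tassocE (u : U) (v : V) (w : W) : tassoc ((u \ox v) \ox w) = u \ox (v \ox w).
Proof. by rewrite /tassoc (tlift_tens _ _ tassoc_bilin) (tlift_tens _ _ (bil1 w)). Qed.
Lemma tassoc_linear : linear (@tassoc K U V W).
Proof. exact/tlift_linear/tassoc_bilin. Qed.
End Tassoc.

Lemma tensor3_ext U V W (P : lmodType K) (f g : tensor (tensor U V) W -> P) : linear f -> linear g ->
  (forall u v w, f ((u \ox v) \ox w) = g ((u \ox v) \ox w)) -> forall z, f z = g z.
Proof.
move=> lf lg fg; apply: tlift_ext => // z w; elim/tensor_ind: z => [|u v z IH].
  by rewrite tens0l (lin0 lf) (lin0 lg).
by rewrite tensDl (linD lf) (linD lg) IH fg.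
Qed.

(* Values of degree 0 make all the Koszul signs trivial. *)
Section TmapAlg.
Variables (A B : algType K) (V W : dgaType K).
Variables (f : {lrmorphism A -> V}) (g : {lrmorphism B -> W}).
Hypothesis hf : forall a, homog 0 (f a).
Hypothesis hg : forall b, homog 0 (g b).
Let t : atensor A B -> stensor V W := tmap f g.
Lemma tmap0_linear : linear t. Proof. exact: tmap_linear. Qed.
Lemma tmap0_monoid : monoid_morphism t.
Proof.
split=> [|x y]; first by rewrite /t [LHS]tmapE !rmorph1.
elim/tensor_ind: x => [|a b x IHx]; first by rewrite mul0r (lin0 tmap0_linear) mul0r.
rewrite mulrDl !(linD tmap0_linear) mulrDl IHx; congr (_ + _); clear IHx.
elim/tensor_ind: y => [|a' b' y IHy]; first by rewrite mulr0 (lin0 tmap0_linear) mulr0.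
rewrite mulrDr !(linD tmap0_linear) mulrDr IHy; congr (_ + _); clear IHy.
by rewrite tensM /t !tmapE (stensM _ _ (hg b) (hf a')) muln0 scale1r !rmorphM.
Qed.
Definition tmap0 : {lrmorphism atensor A B -> stensor V W} :=
  lrm_of tmap0_linear tmap0_monoid.
End TmapAlg.

Section Super.
Implicit Types A B C : dgaType K.

Lemma stens_ind A B (P : tensor A B -> Prop) : P 0 ->
  (forall m n a b z, homog m a -> homog n b -> P z -> P (a \ox b + z)) ->
  forall z, P z.
Proof.
move=> P0 PD; elim/tensor_ind => // v w z; move: z.
elim/(@homog_ind K A): v => [|n x y hx IH] z Pz; first by rewrite tens0l add0r.
rewrite tensDl -addrA; move: (IH z Pz); move: (y \ox w + z) => {}z {}Pz.
elim/(@homog_ind K B): w {IH} z Pz => [|m w y' hw IH] z Pz; first by rewrite tens0r add0r.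
by rewrite tensDr -addrA; apply: (PD n m) => //; apply: IH.
Qed.

Lemma stens_ext A B (U : lmodType K) (f g : tensor A B -> U) : linear f -> linear g ->
  (forall m n a b, homog m a -> homog n b -> f (a \ox b) = g (a \ox b)) ->
  forall z, f z = g z.
Proof.
move=> lf lg fg; elim/stens_ind => [|m n a b z ha hb IH]; first by rewrite (lin0 lf) (lin0 lg).
by rewrite (linD lf) (linD lg) IH (fg m n).
Qed.

Lemma homog_tens A B m n (a : A) (b : B) : homog m a -> homog n b ->
  homog (m + n) (a \ox b : stensor A B).
Proof. by move=> ha hb; rewrite /homog (stens_gpr _ ha hb) eqxx. Qed.

(** Homogeneous pure tensors span, and on them the Koszul sign of the product is explicit. *)
Lemma stensor_monoid A B (C : algType K) (t : stensor A B -> C) : linear t ->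
  t (1 \ox 1) = 1 ->
  (forall m n a b m' n' a' b', homog m a -> homog n b -> homog m' a' -> homog n' b' ->
     t ((a \ox b : stensor A B) * (a' \ox b' : stensor A B)) = t (a \ox b) * t (a' \ox b')) ->
  monoid_morphism t.
Proof.
move=> lt t1 tM; split=> // x y.
elim/stens_ind: x => [|m n a b x ha hb IHx]; first by rewrite mul0r (lin0 lt) mul0r.
rewrite mulrDl !(linD lt) mulrDl IHx; congr (_ + _); clear IHx.
elim/stens_ind: y => [|m' n' a' b' y ha' hb' IHy]; first by rewrite mulr0 (lin0 lt) mulr0.
rewrite mulrDr !(linD lt) mulrDr IHy; congr (_ + _); clear IHy.
exact: tM ha hb ha' hb'.
Qed.

Lemma stensor_dga_map A B C (t : {lrmorphism stensor A B -> C}) :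
  (forall m n a b, homog m a -> homog n b -> homog (m + n) (t (a \ox b))) ->
  (forall m n a b, homog m a -> homog n b -> t (dif (a \ox b : stensor A B)) = dif (t (a \ox b))) ->
  dga_map t.
Proof.
move=> ht dt; have lt : linear t by exact: linearP.
split=> [n|]; apply: stens_ext.
- exact: lin_comp lt (gpr_linear n).
- exact: lin_comp (gpr_linear n) lt.
- move=> p q a b ha hb; rewrite (stens_gpr _ ha hb) (gprE _ (ht _ _ _ _ ha hb)).
  by case: eqP => // _; rewrite rmorph0.
- exact: lin_comp lt dif_linear.
- exact: lin_comp dif_linear lt.
- exact: dt.
Qed.

Section Stmap.
Variables (A B A' B' : dgaType K).
Variables (f : {lrmorphism A -> A'}) (g : {lrmorphism B -> B'}).
Hypothesis df : dga_map f.
Hypothesis dg : dga_map g.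
Let t : stensor A B -> stensor A' B' := tmap f g.
Let lt : linear t. Proof. exact: tmap_linear. Qed.
Let mt : monoid_morphism t.
Proof.
apply: stensor_monoid => //; first by rewrite /t [LHS]tmapE !rmorph1.
move=> m n a b m' n' a' b' ha hb ha' hb'.
rewrite (stensM _ _ hb ha') (linZ _ _ lt) /t !tmapE.
by rewrite (stensM _ _ (dga_map_homog dg hb) (dga_map_homog df ha')) !rmorphM.
Qed.
Definition stmap : {lrmorphism stensor A B -> stensor A' B'} := lrm_of lt mt.
Lemma stmapE a b : stmap (a \ox b) = f a \ox g b. Proof. exact: tmapE. Qed.
Lemma stmap_dga : dga_map stmap.
Proof.
have ll : linear stmap by exact: lt.
apply: stensor_dga_map => m n a b ha hb; rewrite !stmapE.
  exact: homog_tens (dga_map_homog df ha) (dga_map_homog dg hb).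
rewrite (stens_dif _ ha) (linD ll) (linZ _ _ ll) !stmapE.
by rewrite (stens_dif _ (dga_map_homog df ha)) df.2 dg.2.
Qed.
End Stmap.

Definition idlrm (A : algType K) : {lrmorphism A -> A} :=
  [the {lrmorphism A -> A} of idfun].
Lemma idlrm_dga A : dga_map (idlrm A). Proof. by []. Qed.

Section Stassoc.
Variables A B C : dgaType K.
Let t : stensor (stensor A B) C -> stensor A (stensor B C) := @tassoc K A B C.
Let lt : linear t. Proof. exact: tassoc_linear. Qed.
Let tE a b c : t ((a \ox b) \ox c) = a \ox (b \ox c). Proof. exact: tassocE. Qed.

Lemma stens3_ind (P : tensor (tensor A B) C -> Prop) : P 0 ->
  (forall m n p a b c z, homog m a -> homog n b -> homog p c -> P z ->
     P ((a \ox b) \ox c + z)) ->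
  forall z, P z.
Proof.
move=> P0 PD; apply: (@stens_ind (stensor A B) C) => // _ p x c z _ hc Pz.
elim/stens_ind: x z Pz => [|m n a b x ha hb IH] z Pz; first by rewrite tens0l add0r.
by rewrite tensDl -addrA; apply: (PD m n p) => //; apply: IH.
Qed.

Let mt : monoid_morphism t.
Proof.
split=> [|x y]; first exact: tE.
elim/stens3_ind: x => [|m n p a b c x ha hb hc IHx]; first by rewrite mul0r (lin0 lt) mul0r.
rewrite mulrDl !(linD lt) mulrDl IHx; congr (_ + _); clear IHx.
elim/stens3_ind: y => [|m' n' p' a' b' c' y ha' hb' hc' IHy]; first by rewrite mulr0 (lin0 lt) mulr0.
rewrite mulrDr !(linD lt) mulrDr IHy; congr (_ + _); clear IHy.
rewrite (stensM _ _ hc (homog_tens ha' hb')) (stensM _ _ hb ha') tensZl !(linZ _ _ lt) !tE.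
rewrite (stensM _ _ (homog_tens hb hc) ha') (stensM _ _ hc hb') tensZr !scalerA -!exprD.
by congr (_ *: _); congr (_ ^+ _); rewrite mulnDr mulnDl -addnA addnCA addnA [RHS]addnAC addnC addnA.
Qed.
Definition stassoc : {lrmorphism stensor (stensor A B) C -> stensor A (stensor B C)} := lrm_of lt mt.
Lemma stassocE a b c : stassoc ((a \ox b) \ox c) = a \ox (b \ox c).
Proof. exact: tE. Qed.
Lemma stassoc_dga : dga_map stassoc.
Proof.
have ll : linear stassoc by exact: lt.
split=> [n|] z; elim/stens3_ind: z => [|m m' p a b c z ha hb hc IH].
- by rewrite (lin0 (gpr_linear _)) (lin0 ll) (lin0 (gpr_linear _)).
- rewrite !(linD (gpr_linear _)) !(linD ll) !(linD (gpr_linear _)) IH; congr (_ + _).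
  rewrite (stens_gpr _ (homog_tens ha hb) hc) stassocE (stens_gpr _ ha (homog_tens hb hc)) addnA.
  by case: eqP => _; rewrite ?stassocE ?(lin0 ll).
- by rewrite (lin0 dif_linear) (lin0 ll) (lin0 dif_linear).
- rewrite !(linD dif_linear) !(linD ll) !(linD dif_linear) IH; congr (_ + _).
  rewrite (stens_dif _ (homog_tens ha hb)) (stens_dif _ ha) stassocE (stens_dif _ ha).
  rewrite (stens_dif _ hb) tensDl tensZl tensDr tensZr !(linD ll) !(linZ _ _ ll) !stassocE.
  by rewrite scalerDr scalerA -exprD addrA.
Qed.
End Stassoc.

Section Koszul.
Variables (A B : dgaType K) (U : lmodType K).
Variables (F : A -> B -> U).
Hypothesis bF : bilin F.

Lemma hsum_scale_linear (W : dgaType K) (f : W -> U) (s : nat -> K) : linear f ->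
  linear (hsum (fun n x => s n *: f x)).
Proof.
by move=> lf; apply: hsum_linear => n k x y; rewrite lf scalerDr !scalerA mulrC.
Qed.

Let inner_lin m x : linear (hsum (fun n y => (-1) ^+ (m * n) *: F x y)).
Proof. by apply: (@hsum_scale_linear _ _ (fun n => (-1) ^+ (m * n))); exact: bF.2. Qed.

Let outer_lin y m : linear (fun x => hsum (fun n y => (-1) ^+ (m * n) *: F x y) y).
Proof.
move=> k a b; rewrite /hsum scaler_sumr -big_split /=; apply: eq_bigr => n _.
by rewrite (bilinDl bF) (bilinZl bF) scalerDr !scalerA mulrC.
Qed.

Lemma koszul_bilin : bilin (koszul F).
Proof.
split=> [y|x]; first exact: (hsum_linear (outer_lin y)).
move=> k a b; rewrite /koszul /hsum scaler_sumr -big_split /=; apply: eq_bigr => n _.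
exact: inner_lin.
Qed.

Lemma koszulE m n x y : homog m x -> homog n y -> koszul F x y = (-1) ^+ (m * n) *: F x y.
Proof.
move=> hx hy; rewrite /koszul (hsumE (outer_lin y) hx) (hsumE _ hy) // => p.
by move=> k a b; rewrite (bilinDr bF) (bilinZr bF) scalerDr !scalerA mulrC.
Qed.
End Koszul.

Lemma parity_linear A : linear (@parity K A).
Proof. by apply: (@hsum_scale_linear A A id (fun n => (-1) ^+ n)). Qed.
Lemma parityE A n (x : A) : homog n x -> parity x = (-1) ^+ n *: x.
Proof. by apply: hsumE => m k a b; rewrite scalerDr !scalerA mulrC. Qed.

Lemma graded_parity A B (f : A -> B) : linear f ->
  (forall n x, homog n x -> homog n (f x)) -> forall x, f (parity x) = parity (f x).
Proof.
move=> lf hf; apply: homog_ext.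
- exact: lin_comp lf (@parity_linear A).
- exact: lin_comp (@parity_linear B) lf.
- by move=> n x hx; rewrite (parityE hx) (parityE (hf _ _ hx)) (linZ _ _ lf).
Qed.

End Super.
End TensorMaps.

(** * Derivations and differential operators *)

Section Derivations.
Variable K : fieldType.

Record derivation (B : algType K) := Derivation {
  der :> B -> B;
  der_linear : linear der;
  derM : forall x y, der (x * y) = der x * y + x * der y
}.

(* [B + B w] with [w] central of degree 1, [w ^ 2 = 0] and [dif b = der b w]. *)
Record ddual (B : algType K) (d : derivation B) := Ddual { dd0 : B; dd1 : B }.
HB.instance Definition _ (B : algType K) (d : derivation B) := gen_eqMixin (ddual d).
HB.instance Definition _ (B : algType K) (d : derivation B) := gen_choiceMixin (ddual d).

Section Ddual.
Variables (B : algType K) (d : derivation B).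
Local Notation T := (ddual d).
Local Notation DD := (@Ddual B d).
Lemma ddualP (x y : T) : dd0 x = dd0 y -> dd1 x = dd1 y -> x = y.
Proof. by case: x y => a a' [b b'] /= -> ->. Qed.
Let add (x y : T) := DD (dd0 x + dd0 y) (dd1 x + dd1 y).
Let opp (x : T) := DD (- dd0 x) (- dd1 x).
Let scale k (x : T) := DD (k *: dd0 x) (k *: dd1 x).
Let addA : associative add. Proof. by move=> x y z; apply: ddualP; rewrite /= addrA. Qed.
Let addC : commutative add. Proof. by move=> x y; apply: ddualP; rewrite /= addrC. Qed.
Let add0 : left_id (DD 0 0) add. Proof. by move=> x; apply: ddualP; rewrite /= add0r. Qed.
Let addN : left_inverse (DD 0 0) opp add.
Proof. by move=> x; apply: ddualP; rewrite /= addNr. Qed.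
HB.instance Definition _ := GRing.isZmodule.Build T addA addC add0 addN.
Let scaleA a b x : scale a (scale b x) = scale (a * b) x.
Proof. by apply: ddualP; rewrite /= scalerA. Qed.
Let scale1 : left_id 1 scale. Proof. by move=> x; apply: ddualP; rewrite /= scale1r. Qed.
Let scaleDr : right_distributive scale +%R.
Proof. by move=> k x y; apply: ddualP; rewrite /= scalerDr. Qed.
Let scaleDl x : {morph scale^~ x : a b / a + b}.
Proof. by move=> a b; apply: ddualP; rewrite /= scalerDl. Qed.
HB.instance Definition _ :=
  GRing.Zmodule_isLmodule.Build K T scaleA scale1 scaleDr scaleDl.
Let pmul (x y : T) : T := DD (dd0 x * dd0 y) (dd0 x * dd1 y + dd1 x * dd0 y).
Let pmulA : associative pmul.
Proof.
by move=> x y z; apply: ddualP; rewrite /= ?mulrDr ?mulrDl !mulrA ?addrA.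
Qed.
Let pmul1l : left_id (DD 1 0) pmul.
Proof. by move=> x; apply: ddualP; rewrite /= !mul1r ?mul0r ?addr0. Qed.
Let pmul1r : right_id (DD 1 0) pmul.
Proof. by move=> x; apply: ddualP; rewrite /= !mulr1 ?mulr0 ?add0r. Qed.
Let pmulDl : left_distributive pmul +%R.
Proof. by move=> x y z; apply: ddualP; rewrite /= !mulrDl // addrACA. Qed.
Let pmulDr : right_distributive pmul +%R.
Proof. by move=> x y z; apply: ddualP; rewrite /= !mulrDr // addrACA. Qed.
Let pmul_neq0 : DD 1 0 != 0 :> T.
Proof. by apply/eqP => /(congr1 (@dd0 _ _)) /= /eqP; rewrite oner_eq0. Qed.
HB.instance Definition _ := GRing.Zmodule_isNzRing.Build T
  pmulA pmul1l pmul1r pmulDl pmulDr pmul_neq0.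
Let pscaleAl k (x y : T) : k *: (x * y) = (k *: x) * y.
Proof. by apply: ddualP; rewrite /= -!scalerAl // scalerDr. Qed.
Let pscaleAr k (x y : T) : k *: (x * y) = x * (k *: y).
Proof. by apply: ddualP; rewrite /= -!scalerAr // scalerDr. Qed.
HB.instance Definition _ := GRing.Lmodule_isLalgebra.Build K T pscaleAl.
HB.instance Definition _ := GRing.Lalgebra_isAlgebra.Build K T pscaleAr.

Let g (n : nat) (x : T) : T := DD (if n == 0%N then dd0 x else 0) (if n == 1%N then dd1 x else 0).
Let df (x : T) : T := DD 0 (d (dd0 x)).
Let g_linear n : linear (g n).
Proof.
by move=> k x y; apply: ddualP => /=; case: ifP; rewrite ?scaler0 ?addr0.
Qed.
Let gK m n x : g m (g n x) = if m == n then g n x else 0.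
Proof.
case: (eqVneq m n) => [->|mn]; apply: ddualP => /=; try by case: eqP.
  by case: eqP => // m0; case: eqP => // n0; rewrite m0 n0 eqxx in mn.
by case: eqP => // m0; case: eqP => // n0; rewrite m0 n0 eqxx in mn.
Qed.
Let g_sum x : exists N, x = \sum_(n < N) g n x.
Proof.
exists 2%N; rewrite !big_ord_recl big_ord0 addr0.
by apply: ddualP; rewrite /= ?addr0 ?add0r.
Qed.
Let g1 : g 0 1 = 1. Proof. by []. Qed.
Let gM m n x y : g (m + n) (g m x * g n y) = g m x * g n y.
Proof.
by case: m n => [|[|m]] [|[|n]]; apply: ddualP; rewrite /= ?mulr0 ?mul0r ?addr0.
Qed.
Let d_linear : linear df.
Proof. by move=> k x y; apply: ddualP; rewrite /= ?scaler0 ?addr0 ?der_linear. Qed.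
Let g0d x : g 0 (df x) = 0. Proof. by []. Qed.
Let d0 : d 0 = 0. Proof. exact: lin0 (der_linear d). Qed.
Let gSd n x : g n.+1 (df x) = df (g n x).
Proof. by apply: ddualP => //=; rewrite eqSS; case: ifP => // _; rewrite d0. Qed.
Let dK x : df (df x) = 0. Proof. by apply: ddualP => //=; rewrite ?d0. Qed.
Let dM m x y : df (g m x * y) = df (g m x) * y + (-1) ^+ m *: (g m x * df y).
Proof.
apply: ddualP; rewrite /= ?mul0r ?mulr0 ?scaler0 ?addr0 //.
by case: eqP => [->|_]; rewrite ?mul0r ?d0 ?mul0r ?scaler0 ?add0r ?scale1r ?derM ?addr0 // addrC.
Qed.
HB.instance Definition _ := Algebra_isDGA.Build K T g_linear gK g_sum g1 gM
  d_linear g0d gSd dK dM.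

Lemma dd0D (x y : T) : dd0 (x + y) = dd0 x + dd0 y. Proof. by []. Qed.
Lemma dd1D (x y : T) : dd1 (x + y) = dd1 x + dd1 y. Proof. by []. Qed.
Lemma dd0N (x : T) : dd0 (- x) = - dd0 x. Proof. by []. Qed.
Lemma dd1N (x : T) : dd1 (- x) = - dd1 x. Proof. by []. Qed.
Lemma dd0Z k (x : T) : dd0 (k *: x) = k *: dd0 x. Proof. by []. Qed.
Lemma dd1Z k (x : T) : dd1 (k *: x) = k *: dd1 x. Proof. by []. Qed.
Lemma dd0M (x y : T) : dd0 (x * y) = dd0 x * dd0 y. Proof. by []. Qed.
Lemma dd1M (x y : T) : dd1 (x * y) = dd0 x * dd1 y + dd1 x * dd0 y. Proof. by []. Qed.
Lemma dd0d (x : T) : dd0 (dif x) = 0. Proof. by []. Qed.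
Lemma dd1d (x : T) : dd1 (dif x) = d (dd0 x). Proof. by []. Qed.
Lemma dd0g n (x : T) : dd0 (gpr n x) = if n == 0%N then dd0 x else 0. Proof. by []. Qed.
Lemma dd1g n (x : T) : dd1 (gpr n x) = if n == 1%N then dd1 x else 0. Proof. by []. Qed.
Lemma dd_one : dd0 (1 : T) = 1 /\ dd1 (1 : T) = 0. Proof. by []. Qed.
Lemma dd_zero : dd0 (0 : T) = 0 /\ dd1 (0 : T) = 0. Proof. by []. Qed.
Definition ddE := (dd0D, dd1D, dd0N, dd1N, dd0Z, dd1Z, dd0M, dd1M, dd0d, dd1d, dd0g, dd1g,
  dd_one.1, dd_one.2, dd_zero.1, dd_zero.2).
End Ddual.

Section InnerDerivation.
Variables (B : algType K) (D : B).
Let ad x := D * x - x * D.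
Let ad_linear : linear ad.
Proof.
move=> k x y; rewrite /ad mulrDr mulrDl -scalerAr -scalerAl scalerBr opprD.
by rewrite addrACA.
Qed.
Let adM x y : ad (x * y) = ad x * y + x * ad y.
Proof. by rewrite /ad mulrBl mulrBr !mulrA addrA subrK. Qed.
Definition inner := Derivation ad_linear adM.
Lemma innerE x : inner x = D * x - x * D. Proof. by []. Qed.
Let zd (x : B) : B := 0.
Let zd_linear : linear zd. Proof. by move=> k x y; rewrite /zd scaler0 addr0. Qed.
Let zdM x y : zd (x * y) = zd x * y + x * zd y.
Proof. by rewrite /zd mul0r mulr0 addr0. Qed.
(** With the zero derivation [ddual] is the ring of dual numbers over [B], through which derivations
    of presented algebras are obtained as algebra maps. *)
Definition der0 := Derivation zd_linear zdM.
End InnerDerivation.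

Section Endomorphisms.
Variable A : algType K.
(** Linear endomorphisms under composition, the algebra in which differential operators on [A]
    live. *)
Record aend := Aend { aend_fun :> A -> A; aend_linear : linear aend_fun }.
Lemma aendP (f g : aend) : (forall x, f x = g x) -> f = g.
Proof.
case: f g => f lf [g lg] /= /funext e; rewrite e in lf *.
by rewrite (Prop_irrelevance lf lg).
Qed.
HB.instance Definition _ := gen_eqMixin aend.
HB.instance Definition _ := gen_choiceMixin aend.

Implicit Types f g h : aend.
Let add_lin f g : linear (fun x => f x + g x).
Proof. by move=> k x y; rewrite !aend_linear scalerDr addrACA. Qed.
Let opp_lin f : linear (fun x => - f x).
Proof. by move=> k x y; rewrite aend_linear opprD scalerN. Qed.
Let zero_lin : linear (fun _ : A => 0 : A).
Proof. by move=> k x y; rewrite scaler0 addr0. Qed.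
Let scale_lin k f : linear (fun x => k *: f x).
Proof. by move=> j x y; rewrite aend_linear scalerDr !scalerA mulrC. Qed.
Let comp_lin f g : linear (fun x => f (g x)).
Proof. by move=> k x y; rewrite !aend_linear. Qed.
Let id_lin : linear (fun x : A => x). Proof. by []. Qed.
Let add f g := Aend (add_lin f g).
Let opp f := Aend (opp_lin f).
Let zero := Aend zero_lin.
Let scale k f := Aend (scale_lin k f).
Let comp f g := Aend (comp_lin f g).
Let one := Aend id_lin.
Let addA : associative add. Proof. by move=> f g h; apply: aendP => x /=; rewrite addrA. Qed.
Let addC : commutative add. Proof. by move=> f g; apply: aendP => x /=; rewrite addrC. Qed.
Let add0 : left_id zero add. Proof. by move=> f; apply: aendP => x /=; rewrite add0r. Qed.
Let addN : left_inverse zero opp add.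
Proof. by move=> f; apply: aendP => x /=; rewrite addNr. Qed.
HB.instance Definition _ := GRing.isZmodule.Build aend addA addC add0 addN.
Let scaleA a b f : scale a (scale b f) = scale (a * b) f.
Proof. by apply: aendP => x /=; rewrite scalerA. Qed.
Let scale1 : left_id 1 scale. Proof. by move=> f; apply: aendP => x /=; rewrite scale1r. Qed.
Let scaleDr : right_distributive scale +%R.
Proof. by move=> k f g; apply: aendP => x /=; rewrite scalerDr. Qed.
Let scaleDl f : {morph scale^~ f : a b / a + b}.
Proof. by move=> a b; apply: aendP => x /=; rewrite scalerDl. Qed.
HB.instance Definition _ :=
  GRing.Zmodule_isLmodule.Build K aend scaleA scale1 scaleDr scaleDl.
Let compA : associative comp. Proof. by move=> f g h; apply: aendP. Qed.
Let comp1l : left_id one comp. Proof. by move=> f; apply: aendP. Qed.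
Let comp1r : right_id one comp. Proof. by move=> f; apply: aendP. Qed.
Let compDl : left_distributive comp +%R. Proof. by move=> f g h; apply: aendP. Qed.
Let compDr : right_distributive comp +%R.
Proof. by move=> f g h; apply: aendP => x /=; rewrite (linD (aend_linear f)). Qed.
Let comp_neq0 : one != 0 :> aend.
Proof.
by apply/eqP => /(congr1 (fun f : aend => f 1)) /= /eqP; rewrite oner_eq0.
Qed.
HB.instance Definition _ := GRing.Zmodule_isNzRing.Build aend
  compA comp1l comp1r compDl compDr comp_neq0.
Let compAl k f g : k *: (f * g) = (k *: f) * g. Proof. exact: aendP. Qed.
Let compAr k f g : k *: (f * g) = f * (k *: g).
Proof. by apply: aendP => x /=; rewrite -(linZ _ _ (aend_linear f)). Qed.
HB.instance Definition _ := GRing.Lmodule_isLalgebra.Build K aend compAl.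
HB.instance Definition _ := GRing.Lalgebra_isAlgebra.Build K aend compAr.

Lemma aendDE f g x : (f + g) x = f x + g x. Proof. by []. Qed.
Lemma aendNE f x : (- f) x = - f x. Proof. by []. Qed.
Lemma aend0E x : (0 : aend) x = 0. Proof. by []. Qed.
Lemma aend1E x : (1 : aend) x = x. Proof. by []. Qed.
Lemma aendZE k f x : (k *: f) x = k *: f x. Proof. by []. Qed.
Lemma aendME f g x : (f * g) x = f (g x). Proof. by []. Qed.
Definition aendE := (aendDE, aendNE, aend0E, aend1E, aendZE, aendME).

Let lmul_lin (a : A) : linear (fun x => a * x).
Proof. by move=> k x y; rewrite mulrDr -scalerAr. Qed.
Definition lmul a : aend := Aend (lmul_lin a).
Lemma lmulE a x : lmul a x = a * x. Proof. by []. Qed.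
Definition aend_of_der (d : derivation A) : aend := Aend (der_linear d).
End Endomorphisms.

End Derivations.

(** * The presented exterior algebra of C_lam[Poinc] *)

Section Dlift.
Variables (K : fieldType) (P : dpres K) (W : dgaType K) (f : dgen P -> W) (hf : dsat f).
Lemma dliftD x y : dlift hf (x + y) = dlift hf x + dlift hf y. Proof. exact: dlift_add. Qed.
Lemma dliftN x : dlift hf (- x) = - dlift hf x. Proof. exact: dlift_opp. Qed.
Lemma dliftZ k x : dlift hf (k *: x) = k *: dlift hf x. Proof. exact: dlift_scale. Qed.
Lemma dliftM x y : dlift hf (x * y) = dlift hf x * dlift hf y. Proof. exact: dlift_mul. Qed.
Lemma dlift0 : dlift hf 0 = 0. Proof. exact: dlift_zero. Qed.
Lemma dlift1 : dlift hf 1 = 1. Proof. exact: dlift_one. Qed.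
Definition dliftsE := (dliftD, dliftN, dliftZ, dliftM, dlift0, dlift1, dlift_dif hf, dlift_gen hf).
End Dlift.

Inductive OPoinc_gen := OPc | OPs | OPa0 | OPa1 | OPth.

Section OmegaPoincare.
Variables (K : fieldType) (lam : K).

Lemma conc0_dif (A : algType K) (x : conc0 A) : dif x = 0. Proof. by []. Qed.
Lemma conc0_gpr (A : algType K) (x : conc0 A) n : gpr n x = if n == 0%N then x else 0.
Proof. by []. Qed.
Lemma conc0_homog (A : algType K) (x : conc0 A) : homog 0 x. Proof. by []. Qed.

(** With zero differential and theta' = 0 the relations on forms are trivial. This and the two
    lemmas below yield the retractions onto degree 0 that make the inclusions of the algebras
    injective. *)
Lemma conc0_OmegaUb_rel (A : algType K) (a0 a1 : conc0 A) :
  Ub_rel lam a0 a1 -> OmegaUb_rel lam a0 a1 0.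
Proof.
by move=> h; split; rewrite // /com ?conc0_dif ?expr0n ?mulr0 ?mul0r ?subrr ?scaler0 ?oppr0.
Qed.

Lemma conc0_OmegaSO_rel (A : algType K) (c s : conc0 A) : SO_rel c s -> OmegaSO_rel c s.
Proof. by move=> h; split=> //; rewrite !conc0_dif ?mulr0 ?mul0r. Qed.

Lemma conc0_OmegaPoinc_rel (A : algType K) (c s a0 a1 : conc0 A) :
  Poinc_rel lam c s a0 a1 -> OmegaPoinc_rel lam c s a0 a1 0.
Proof.
move=> h; split=> //; try by rewrite /com /anticom ?conc0_dif ?mulr0 ?mul0r ?subrr ?scaler0 ?addr0.
- by apply: conc0_OmegaUb_rel; case: h.
- by apply: conc0_OmegaSO_rel; case: h.
Qed.

Lemma unit_SO_rel (B : algType K) : SO_rel (1 : B) 0.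
Proof. by split; rewrite ?mulr0 ?mul0r // expr1n expr0n subr0. Qed.

Lemma unit_OmegaSO_rel (W : dgaType K) : OmegaSO_rel (1 : W) 0.
Proof.
by split; rewrite ?(lin0 dif_linear) ?dif1 ?mulr0 ?mul0r //; exact: unit_SO_rel.
Qed.

(** Restriction to the identity of SO: at c = 1, s = 0 both sides of every cross relation vanish. It
    produces the quotient map onto Omega(U(b_+)) and, composed with zero generators, the counit. *)
Lemma unit_OmegaPoinc_rel (W : dgaType K) (a0 a1 th : W) :
  OmegaUb_rel lam a0 a1 th -> OmegaPoinc_rel lam 1 0 a0 a1 th.
Proof.
move=> h; split=> //; try by rewrite /com /anticom ?(lin0 dif_linear) ?dif1 ?subrr
  ?mulr0 ?mul0r ?mulr1 ?mul1r ?subrr ?scaler0 ?addr0.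
  split; try by rewrite /com ?subrr ?expr0n ?mulr0 ?mul0r ?mulr1 ?mul1r ?subrr ?scaler0.
  - exact: unit_SO_rel.
  - by case: h.
exact: unit_OmegaSO_rel.
Qed.

Lemma zero_OmegaUb_rel (W : dgaType K) : OmegaUb_rel lam (0 : W) 0 0.
Proof.
split; rewrite /Ub_rel /com ?(lin0 dif_linear) ?expr0n ?mulr0 ?mul0r ?subrr ?scaler0 ?oppr0 //.
Qed.

Let OPoinc_model : exists (W : dgaType K) (f : OPoinc_gen -> W),
  (forall x, homog (if x is OPth then 1%N else 0%N) (f x)) /\
  OmegaPoinc_rel lam (f OPc) (f OPs) (f OPa0) (f OPa1) (f OPth).
Proof.
exists (conc0 K^o), (fun x => if x is OPc then 1 else 0); split.
  by case; rewrite /homog conc0_gpr.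
exact: unit_OmegaPoinc_rel (zero_OmegaUb_rel _).
Qed.

Definition OmegaPoinc_pres := DPres OPoinc_model.
Definition OmegaPoinc : dgaType K := pdga OmegaPoinc_pres.
Definition opc : OmegaPoinc := pdgen (P := OmegaPoinc_pres) OPc.
Definition ops : OmegaPoinc := pdgen (P := OmegaPoinc_pres) OPs.
Definition opa0 : OmegaPoinc := pdgen (P := OmegaPoinc_pres) OPa0.
Definition opa1 : OmegaPoinc := pdgen (P := OmegaPoinc_pres) OPa1.
Definition opth : OmegaPoinc := pdgen (P := OmegaPoinc_pres) OPth.

Lemma OmegaPoinc_sat : OmegaPoinc_rel lam opc ops opa0 opa1 opth.
Proof.
have key (x y : OmegaPoinc) : (forall (W : dgaType K) (f : OPoinc_gen -> W)
    (hf : dsat (P := OmegaPoinc_pres) f),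
    OmegaPoinc_rel lam (f OPc) (f OPs) (f OPa0) (f OPa1) (f OPth) ->
    dlift hf x = dlift hf y) -> x = y.
  by move=> h; apply: pdgaE => W f hf; apply: h; case: hf.
split; [split|split|split|..]; rewrite /Ub_rel /SO_rel /com /anticom.
all: try match goal with |- _ /\ _ => split end.
all: apply: key => W f hf [[[? ?] ? ? ? ? ?] [? ? ? ? ? ? ? ? ? ? ? ? ?]
  [? ? ? ? ? ?] ? ? ? ? ? ? ? ? ? ? ? ? ? ?].
all: by rewrite ?expr2 ?dliftsE -?expr2.
Qed.

End OmegaPoincare.

(** * Inclusions, quotients, retractions and counits of the presented algebras *)

Section Maps.
Variables (K : fieldType) (lam : K).
Hypothesis lam0 : lam != 0.
Local Notation SO := (SO K).
Local Notation Ub := (Ub lam).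
Local Notation Poinc := (Poinc lam).
Local Notation OSO := (OmegaSO K).
Local Notation OUb := (OmegaUb lam).
Local Notation OP := (OmegaPoinc lam).

Local Notation gS := (@pgen K (SO_pres K)).
Local Notation gU := (@pgen K (Ub_pres lam)).
Local Notation gP := (@pgen K (Poinc_pres lam)).
Local Notation dS := (@pdgen K (OmegaSO_pres K)).
Local Notation dU := (@pdgen K (OmegaUb_pres lam)).
Local Notation dP := (@pdgen K (OmegaPoinc_pres lam)).

Section Lifts.
Variable W : dgaType K.

Definition OUb_fun (a0 a1 th : W) (g : OUb_gen) : W :=
  match g with OUa0 => a0 | OUa1 => a1 | OUth => th end.
Lemma OUb_dsat (a0 a1 th : W) : homog 0 a0 -> homog 0 a1 -> homog 1 th ->
  OmegaUb_rel lam a0 a1 th -> dsat (P := OmegaUb_pres lam) (OUb_fun a0 a1 th).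
Proof. by move=> h0 h1 ht r; split=> //; case. Qed.

Definition OSO_fun (c s : W) (g : SO_gen) : W := match g with Sc => c | Ss => s end.
Lemma OSO_dsat (c s : W) : homog 0 c -> homog 0 s ->
  OmegaSO_rel c s -> dsat (P := OmegaSO_pres K) (OSO_fun c s).
Proof. by move=> h0 h1 r; split=> //; case. Qed.

Definition OP_fun (c s a0 a1 th : W) (g : OPoinc_gen) : W :=
  match g with OPc => c | OPs => s | OPa0 => a0 | OPa1 => a1 | OPth => th end.
Lemma OP_dsat (c s a0 a1 th : W) : homog 0 c -> homog 0 s -> homog 0 a0 -> homog 0 a1 ->
  homog 1 th -> OmegaPoinc_rel lam c s a0 a1 th ->
  dsat (P := OmegaPoinc_pres lam) (OP_fun c s a0 a1 th).
Proof. by move=> hc hs h0 h1 ht r; split=> //; case. Qed.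
End Lifts.

Lemma homog_opc : homog 0 (opc lam). Proof. exact: (homog_pdgen (P := OmegaPoinc_pres lam) OPc). Qed.
Lemma homog_ops : homog 0 (ops lam). Proof. exact: (homog_pdgen (P := OmegaPoinc_pres lam) OPs). Qed.
Lemma homog_opa0 : homog 0 (opa0 lam). Proof. exact: (homog_pdgen (P := OmegaPoinc_pres lam) OPa0). Qed.
Lemma homog_opa1 : homog 0 (opa1 lam). Proof. exact: (homog_pdgen (P := OmegaPoinc_pres lam) OPa1). Qed.
Lemma homog_opth : homog 1 (opth lam). Proof. exact: (homog_pdgen (P := OmegaPoinc_pres lam) OPth). Qed.

Definition Poinc_inc : {lrmorphism Poinc -> OP} :=
  alift (P := Poinc_pres lam)
    (f := fun g => match g with Pc => opc lam | Ps => ops lam | Pa0 => opa0 lam | Pa1 => opa1 lam end : OP)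
    (OP_Poinc (OmegaPoinc_sat lam)).

Definition jS : {lrmorphism OSO -> OP} :=
  dlift (OSO_dsat homog_opc homog_ops (OP_SO (OmegaPoinc_sat lam))).
Definition jU : {lrmorphism OUb -> OP} :=
  dlift (OUb_dsat homog_opa0 homog_opa1 homog_opth (OP_Ub (OmegaPoinc_sat lam))).
Definition qU : {lrmorphism OP -> OUb} :=
  dlift (OP_dsat (homog1 _) (homog0 _ _) (homog_oua0 lam) (homog_oua1 lam) (homog_outh lam)
    (unit_OmegaPoinc_rel (OmegaUb_sat lam))).

Definition SO_ret : {lrmorphism OSO -> conc0 SO} :=
  dlift (OSO_dsat (conc0_homog _) (conc0_homog _) (conc0_OmegaSO_rel (SO_sat K))).
Definition Ub_ret : {lrmorphism OUb -> conc0 Ub} :=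
  dlift (OUb_dsat (conc0_homog _) (conc0_homog _) (homog0 _ _)
     (conc0_OmegaUb_rel (Ub_sat lam))).
Definition Poinc_ret : {lrmorphism OP -> conc0 Poinc} :=
  dlift (OP_dsat (conc0_homog _) (conc0_homog _) (conc0_homog _) (conc0_homog _)
   (homog0 _ _) (conc0_OmegaPoinc_rel (Poinc_sat lam))).

Definition OSO_counit : {lrmorphism OSO -> K^o} :=
  let f : {lrmorphism OSO -> conc0 K^o} :=
  dlift (OSO_dsat (homog1 _) (homog0 (conc0 K^o) 0) (unit_OmegaSO_rel (conc0 K^o))) in f.
Definition OUb_counit : {lrmorphism OUb -> K^o} :=
  let f : {lrmorphism OUb -> conc0 K^o} :=
  dlift (OUb_dsat (homog0 (conc0 K^o) 0) (homog0 _ _) (homog0 _ _)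
    (zero_OmegaUb_rel lam (conc0 K^o))) in f.
Definition OP_counit : {lrmorphism OP -> K^o} :=
  let f : {lrmorphism OP -> conc0 K^o} :=
  dlift (OP_dsat (homog1 (conc0 K^o)) (homog0 _ _) (homog0 _ _) (homog0 _ _) (homog0 _ _)
    (unit_OmegaPoinc_rel (zero_OmegaUb_rel lam (conc0 K^o)))) in f.

Lemma jS_dga : dga_map jS. Proof. exact: dlift_dga_map. Qed.
Lemma jU_dga : dga_map jU. Proof. exact: dlift_dga_map. Qed.
Lemma qU_dga : dga_map qU. Proof. exact: dlift_dga_map. Qed.

Lemma SO_incE k : SO_inc K (gS k) = dS k.
Proof. by rewrite [LHS]alift_gen; case: k. Qed.
Lemma Ub_incE k : Ub_inc lam (gU k) = match k with Ua0 => oua0 lam | Ua1 => oua1 lam end.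
Proof. by rewrite [LHS]alift_gen; case: k. Qed.
Lemma Poinc_incE k : Poinc_inc (gP k) =
  match k with Pc => opc lam | Ps => ops lam | Pa0 => opa0 lam | Pa1 => opa1 lam end.
Proof. by rewrite [LHS]alift_gen; case: k. Qed.
Lemma jSE k : jS (dS k) = match k with Sc => opc lam | Ss => ops lam end.
Proof. by rewrite [LHS]dlift_gen; case: k. Qed.
Lemma jUE k : jU (dU k) = match k with OUa0 => opa0 lam | OUa1 => opa1 lam | OUth => opth lam end.
Proof. by rewrite [LHS]dlift_gen; case: k. Qed.
Lemma qUE k : qU (dP k) =
  match k with OPc => 1 | OPs => 0 | OPa0 => oua0 lam | OPa1 => oua1 lam | OPth => outh lam end.
Proof. by rewrite [LHS]dlift_gen; case: k. Qed.
Lemma OSO_counitE k : OSO_counit (dS k) = match k with Sc => 1 | Ss => 0 end.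
Proof. by rewrite [LHS]dlift_gen; case: k. Qed.
Lemma OUb_counitE k : OUb_counit (dU k) = 0.
Proof. by rewrite [LHS]dlift_gen; case: k. Qed.
Lemma OP_counitE k : OP_counit (dP k) = if k is OPc then 1 else 0.
Proof. by rewrite [LHS]dlift_gen; case: k. Qed.
Lemma SO_retE k : SO_ret (dS k) = gS k :> SO.
Proof. by rewrite [LHS]dlift_gen; case: k. Qed.
Lemma Ub_retE k : Ub_ret (dU k) = match k with OUa0 => ua0 lam | OUa1 => ua1 lam | OUth => 0 end :> Ub.
Proof. by rewrite [LHS]dlift_gen; case: k. Qed.
Lemma Poinc_retE k : Poinc_ret (dP k) = match k with OPc => pc lam | OPs => ps lam
  | OPa0 => pa0 lam | OPa1 => pa1 lam | OPth => 0 end :> Poinc.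
Proof. by rewrite [LHS]dlift_gen; case: k. Qed.

Lemma counit_difS x : OSO_counit (dif x) = 0.
Proof. by rewrite /OSO_counit /= dlift_dif. Qed.
Lemma counit_difU x : OUb_counit (dif x) = 0.
Proof. by rewrite /OUb_counit /= dlift_dif. Qed.
Lemma counit_difP x : OP_counit (dif x) = 0.
Proof. by rewrite /OP_counit /= dlift_dif. Qed.
Lemma counit_gprS n x : OSO_counit (gpr n x) = if n == 0%N then OSO_counit x else 0.
Proof. by rewrite /OSO_counit /= dlift_gpr. Qed.
Lemma counit_gprU n x : OUb_counit (gpr n x) = if n == 0%N then OUb_counit x else 0.
Proof. by rewrite /OUb_counit /= dlift_gpr. Qed.
Lemma counit_gprP n x : OP_counit (gpr n x) = if n == 0%N then OP_counit x else 0.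
Proof. by rewrite /OP_counit /= dlift_gpr. Qed.

Lemma SO_generated : alg_generated (@pgen K (SO_pres K)). Proof. exact: palg_generated. Qed.
Lemma Ub_generated : alg_generated (@pgen K (Ub_pres lam)). Proof. exact: palg_generated. Qed.
Lemma Poinc_generated : alg_generated (@pgen K (Poinc_pres lam)).
Proof. exact: palg_generated. Qed.

Lemma SO_retK x : SO_ret (SO_inc K x) = x.
Proof.
elim/SO_generated: x => [||k x y ex ey|k x ex]; rewrite ?rmorph0 ?rmorph1 //.
- by rewrite !linearP /= ex ey.
- by rewrite !rmorphM /= ex SO_incE [SO_ret _]SO_retE.
Qed.
Lemma Ub_retK x : Ub_ret (Ub_inc lam x) = x.
Proof.
elim/Ub_generated: x => [||k x y ex ey|k x ex]; rewrite ?rmorph0 ?rmorph1 //.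
- by rewrite !linearP /= ex ey.
- by rewrite !rmorphM /= ex Ub_incE; case: k; rewrite [Ub_ret _]Ub_retE.
Qed.
Lemma Poinc_retK x : Poinc_ret (Poinc_inc x) = x.
Proof.
elim/Poinc_generated: x => [||k x y ex ey|k x ex]; rewrite ?rmorph0 ?rmorph1 //.
- by rewrite !linearP /= ex ey.
- by rewrite !rmorphM /= ex Poinc_incE; case: k; rewrite [Poinc_ret _]Poinc_retE.
Qed.

Lemma alg_generated_homog (A : algType K) (W : dgaType K) X (g : X -> A)
  (i : {lrmorphism A -> W}) : alg_generated g -> (forall k, homog 0 (i (g k))) ->
  forall x, homog 0 (i x).
Proof.
move=> gen hg; apply: gen => [||k x y hx hy|k x hx].
- by rewrite rmorph0; exact: homog0.
- by rewrite rmorph1; exact: homog1.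
- by rewrite linearP /=; apply: homogD => //; apply: homogZ.
- by rewrite rmorphM; exact: (homogM (hg k) hx).
Qed.
Lemma SO_inc_homog x : homog 0 (SO_inc K x).
Proof.
move: x; apply: (alg_generated_homog SO_generated) => k; rewrite SO_incE.
exact: (homog_pdgen (P := OmegaSO_pres K)).
Qed.
Lemma Ub_inc_homog x : homog 0 (Ub_inc lam x).
Proof.
move: x; apply: (alg_generated_homog Ub_generated) => k; rewrite Ub_incE.
by case: k; [exact: homog_oua0|exact: homog_oua1].
Qed.
Lemma Poinc_inc_homog x : homog 0 (Poinc_inc x).
Proof.
move: x; apply: (alg_generated_homog Poinc_generated) => k; rewrite Poinc_incE.
by case: k; [exact: homog_opc|exact: homog_ops|exact: homog_opa0|exact: homog_opa1].
Qed.

Lemma OSO_generated : dga_generated (fun k => SO_inc K (gS k)).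
Proof.
move=> Q Q0 Q1 lQ gQ dQ.
by apply: (@pdga_generated _ (OmegaSO_pres K)) => // k x qx; rewrite -SO_incE; [exact: gQ|exact: dQ].
Qed.

(* theta' is the commutator of one-forms [lam^-1 [dx, x]]. *)
Lemma generated_th (W : dgaType K) (a0 a1 th : W) (Q : W -> Prop) : OmegaUb_rel lam a0 a1 th ->
  lin_closed Q -> Q 0 ->
  (forall x, Q x -> Q (a1 * x)) -> (forall x, Q x -> Q (dif a1 * x)) ->
  forall x, Q x -> Q (th * x).
Proof.
move=> r lQ Q0 Q1 Qd x Qx.
have -> : th * x = lam^-1 *: (dif a1 * (a1 * x) - a1 * (dif a1 * x)).
  rewrite !mulrA -mulrBl (OUb_d1_1 r : dif a1 * a1 - a1 * dif a1 = _).
  by rewrite -scalerAl scalerA mulVf // scale1r.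
by apply: lin_closedZ => //; apply: lin_closedB => //; [apply/Qd/Q1|apply/Q1/Qd].
Qed.

Lemma OUb_generated : dga_generated (fun k => Ub_inc lam (gU k)).
Proof.
move=> Q Q0 Q1 lQ gQ dQ.
have h0 x : Q x -> Q (oua0 lam * x) by move=> /(gQ Ua0); rewrite Ub_incE.
have h1 x : Q x -> Q (oua1 lam * x) by move=> /(gQ Ua1); rewrite Ub_incE.
have d0 x : Q x -> Q (dif (oua0 lam) * x) by move=> /(dQ Ua0); rewrite Ub_incE.
have d1 x : Q x -> Q (dif (oua1 lam) * x) by move=> /(dQ Ua1); rewrite Ub_incE.
apply: (@pdga_generated _ (OmegaUb_pres lam)) => // -[] x qx //.
- exact: h0.
- exact: h1.
- exact: (generated_th (OmegaUb_sat lam)).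
- exact: d0.
- exact: d1.
- by rewrite (OUb_dth (OmegaUb_sat lam) : dif (pdgen _) = 0) mul0r.
Qed.

Lemma OP_generated : dga_generated (fun k => Poinc_inc (gP k)).
Proof.
move=> Q Q0 Q1 lQ gQ dQ.
have [rP rU _ _ _ _ _ _ _ _ _ _ _ _ _ _ _] := OmegaPoinc_sat lam.
apply: (@pdga_generated _ (OmegaPoinc_pres lam)) => // -[] x qx.
- by have := gQ Pc _ qx; rewrite Poinc_incE.
- by have := gQ Ps _ qx; rewrite Poinc_incE.
- by have := gQ Pa0 _ qx; rewrite Poinc_incE.
- by have := gQ Pa1 _ qx; rewrite Poinc_incE.
- apply: (generated_th rU) => // y qy; last by have := dQ Pa1 _ qy; rewrite Poinc_incE.
  by have := gQ Pa1 _ qy; rewrite Poinc_incE.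
- by have := dQ Pc _ qx; rewrite Poinc_incE.
- by have := dQ Ps _ qx; rewrite Poinc_incE.
- by have := dQ Pa0 _ qx; rewrite Poinc_incE.
- by have := dQ Pa1 _ qx; rewrite Poinc_incE.
- by rewrite (OUb_dth rU : dif (pdgen _) = 0) mul0r.
Qed.

Lemma dga_generated_sub (W : dgaType K) X Y (g : Y -> W) (h : X -> Y) :
  dga_generated (fun k => g (h k)) -> dga_generated g.
Proof. by move=> gen Q Q0 Q1 lQ gQ dQ; apply: gen => // k; [apply: gQ|apply: dQ]. Qed.

Lemma SO_exterior : exterior (SO_inc K).
Proof.
apply: generated_exterior (can_inj SO_retK); first exact: SO_inc_homog.
exact: dga_generated_sub OSO_generated.
Qed.
Lemma Ub_exterior : exterior (Ub_inc lam).
Proof.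
apply: generated_exterior (can_inj Ub_retK); first exact: Ub_inc_homog.
exact: dga_generated_sub OUb_generated.
Qed.
Lemma Poinc_exterior : exterior Poinc_inc.
Proof.
apply: generated_exterior (can_inj Poinc_retK); first exact: Poinc_inc_homog.
exact: dga_generated_sub OP_generated.
Qed.

End Maps.

Section StensorMul.
Variables (K : fieldType) (V W : dgaType K).

(** A degree 0 inner factor makes the Koszul sign trivial whatever the other inner factor is,
    homogeneous or not. *)
Lemma stensM0l (a e : V) (b f : W) : homog 0 b ->
  (a \ox b : stensor V W) * (e \ox f : stensor V W) = (a * e) \ox (b * f).
Proof.
move=> hb; elim/(@homog_ind K V): e => [|n e e' he IH].
  by rewrite tens0l !mulr0 tens0l.
rewrite mulrDr !tensDl [LHS]mulrDr IH; congr (_ + _).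
by rewrite (stensM _ _ hb he) mul0n scale1r.
Qed.

Lemma stensM0r (a e : V) (b f : W) : homog 0 e ->
  (a \ox b : stensor V W) * (e \ox f : stensor V W) = (a * e) \ox (b * f).
Proof.
move=> he; elim/(@homog_ind K W): b => [|n b b' hb IH].
  by rewrite tens0r !mul0r tens0r.
rewrite mulrDl !tensDr [LHS]mulrDl IH; congr (_ + _).
by rewrite (stensM _ _ hb he) muln0 scale1r.
Qed.

Lemma stensM11 (a e : V) (b f : W) : homog 1 b -> homog 1 e ->
  (a \ox b : stensor V W) * (e \ox f : stensor V W) = - ((a * e) \ox (b * f)).
Proof. by move=> hb he; rewrite (stensM _ _ hb he) mul1n expr1 scaleN1r. Qed.

Lemma stens_dif0 (a : V) (b : W) : homog 0 a ->
  dif (a \ox b : stensor V W) = dif a \ox b + a \ox dif b.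
Proof. by move=> ha; rewrite (stens_dif _ ha) scale1r. Qed.
Lemma stens_dif1 (a : V) (b : W) : homog 1 a ->
  dif (a \ox b : stensor V W) = dif a \ox b - a \ox dif b.
Proof. by move=> ha; rewrite (stens_dif _ ha) expr1 scaleN1r. Qed.

Lemma difD (U : dgaType K) (x y : U) : dif (x + y) = dif x + dif y.
Proof. exact: linD dif_linear _ _. Qed.
Lemma difZ (U : dgaType K) k (x : U) : dif (k *: x) = k *: dif x.
Proof. exact: linZ _ _ dif_linear. Qed.
Lemma difN (U : dgaType K) (x : U) : dif (- x) = - dif x.
Proof. by rewrite -scaleN1r difZ scaleN1r. Qed.
Lemma dif0 (U : dgaType K) : dif (0 : U) = 0.
Proof. exact: lin0 dif_linear. Qed.
Lemma dif0M (U : dgaType K) (x y : U) : homog 0 x -> dif (x * y) = dif x * y + x * dif y.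
Proof. by move=> hx; rewrite (difMh _ hx) scale1r. Qed.
Lemma dif1M (U : dgaType K) (x y : U) : homog 1 x -> dif (x * y) = dif x * y - x * dif y.
Proof. by move=> hx; rewrite (difMh _ hx) expr1 scaleN1r. Qed.

Lemma tensNl (v : V) (w : W) : (- v) \ox w = - (v \ox w).
Proof. by rewrite -scaleN1r tensZl scaleN1r. Qed.
Lemma tensNr (v : V) (w : W) : v \ox (- w) = - (v \ox w).
Proof. by rewrite -scaleN1r tensZr scaleN1r. Qed.
End StensorMul.

Lemma comE (B : pzRingType) (x y z : B) : com x y = z -> x * y = y * x + z.
Proof. by move=> <-; rewrite addrC subrK. Qed.
Lemma anticomE (B : pzRingType) (x y z : B) : anticom x y = z -> x * y = - (y * x) + z.
Proof. by move=> <-; rewrite addrC -addrA subrr addr0. Qed.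
Lemma comC_eq (B : pzRingType) (x y : B) : com x y = 0 -> x * y = y * x.
Proof. by move=> /comE ->; rewrite addr0. Qed.

(** * Vanishing of the two-forms of C[SO_{1,1}] *)

Section OmegaSOTop.
Variables (K : fieldType) (W : dgaType K) (c s : W).
Hypothesis two_neq0 : 2%:R != 0 :> K.
Hypotheses (hc : homog 0 c) (hs : homog 0 s) (r : OmegaSO_rel c s).

Lemma double_eq0 (V : lmodType K) (x : V) : x + x = 0 -> x = 0.
Proof.
rewrite -{1 2}[x]scale1r -scalerDl -[1 + 1]/(2%:R) => /eqP.
by rewrite scaler_eq0 (negbTE two_neq0) /= => /eqP.
Qed.

(** Differentiating (dc)c = c dc gives - dc dc = dc dc. *)
Lemma OSO_dcdc : dif c * dif c = 0.
Proof.
have := congr1 dif (OSO_dcc r); rewrite (dif1M _ (homog_dif hc)) (dif0M _ hc) !difK mul0r.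
by rewrite mulr0 add0r addr0 => e; apply: double_eq0; rewrite -[X in X + _]e addNr.
Qed.
Lemma OSO_dsdc_anti : dif s * dif c = - (dif c * dif s).
Proof.
have := congr1 dif (OSO_dcs r); rewrite (dif1M _ (homog_dif hc)) (dif0M _ hs) !difK mul0r.
by rewrite mulr0 add0r addr0 => ->.
Qed.
Lemma OSO_dsds : dif s * dif s = 0.
Proof.
have := congr1 dif (OSO_cdc r); rewrite !dif0M // !difK !mulr0 !addr0 => <-.
exact: OSO_dcdc.
Qed.
(** The form c ds - s dc is dz/z for z = c + s; with c^2 - s^2 = 1 it recovers dc and ds. *)
Lemma OSO_dcE : s * (c * dif s - s * dif c) = dif c.
Proof.
have [cs h] := OSO_SO r.
rewrite mulrBr !mulrA -cs -(mulrA c) -(OSO_cdc r) mulrA -mulrBl -!expr2 h mul1r //.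
Qed.
Lemma OSO_dsE : c * (c * dif s - s * dif c) = dif s.
Proof.
have [cs h] := OSO_SO r.
rewrite mulrBr !mulrA cs -(mulrA s) (OSO_cdc r) mulrA -mulrBl -!expr2 h mul1r //.
Qed.

(** Insert 1 = c^2 - s^2: moving one c through c dc = s ds produces ds ds, moving one s through s ds
    = c dc produces dc dc, and both squares vanish. *)
Lemma OSO_dcds : dif c * dif s = 0.
Proof.
have [_ h] := OSO_SO r.
rewrite -[LHS]mul1r -h mulrBl !expr2 -!mulrA [c * (dif c * _)]mulrA (OSO_cdc r).
rewrite -[s * dif s * _]mulrA OSO_dsds !mulr0 [s * (dif c * _)]mulrA -(OSO_dcs r).
by rewrite -[dif c * s * _]mulrA -(OSO_cdc r) [dif c * _]mulrA (OSO_dcc r) -mulrA OSO_dcdc !mulr0 subr0.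
Qed.
Lemma OSO_dsdc : dif s * dif c = 0.
Proof. by rewrite OSO_dsdc_anti OSO_dcds oppr0. Qed.
End OmegaSOTop.

(** * The extended coaction respects the relations of Omega(U(b_+)) *)

Section Coaction.
Variables (K : fieldType) (lam : K) (V W : dgaType K).
Hypothesis two_neq0 : 2%:R != 0 :> K.
Variables (t x v : V) (c s a0 a1 th : W).
Hypotheses (ht : homog 0 t) (hx : homog 0 x) (hv : homog 1 v).
Hypotheses (hc : homog 0 c) (hs : homog 0 s) (h0 : homog 0 a0) (h1 : homog 0 a1)
  (hth : homog 1 th).
Hypotheses (rV : OmegaUb_rel lam t x v) (rW : OmegaPoinc_rel lam c s a0 a1 th).
Local Notation T := (stensor V W).

(** [V] stays general: for V = Omega(U(b_+)) these are the images of t and x under the coaction, for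
    V = W = Omega(C_lam[Poinc]) the coproducts of a_0 and a_1. *)
Definition coact0 : T := 1 \ox a0 + t \ox c + x \ox s.
Definition coact1 : T := 1 \ox a1 + t \ox s + x \ox c.
(** The only possible image of theta', since lam theta' = [dx, x]; it is 1 \ox theta' plus the
    extended coaction [beta] of the bicrossproduct applied to theta'. *)
Definition coactth : T := 1 \ox th + v \ox 1 - dif t \ox 1
  + (dif t \ox c + dif x \ox s + t \ox dif c + x \ox dif s).

Lemma dif_coact0 : dif coact0 =
  1 \ox dif a0 + dif t \ox c + dif x \ox s + t \ox dif c + x \ox dif s.
Proof.
rewrite /coact0 !difD !(stens_dif0 _ (homog1 V)) (stens_dif0 _ ht) (stens_dif0 _ hx) dif1.
by rewrite tens0l add0r !addrA; congr (_ + _); rewrite addrAC.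
Qed.
Lemma dif_coact1 : dif coact1 =
  1 \ox dif a1 + dif t \ox s + dif x \ox c + t \ox dif s + x \ox dif c.
Proof.
rewrite /coact1 !difD !(stens_dif0 _ (homog1 V)) (stens_dif0 _ ht) (stens_dif0 _ hx) dif1.
by rewrite tens0l add0r !addrA; congr (_ + _); rewrite addrAC.
Qed.

Let dc := dif c.
Let ds := dif s.
Let b0 := dif a0.
Let b1 := dif a1.
Let dt := dif t.
Let dx := dif x.

Let hdc : homog 1 dc. Proof. exact: homog_dif. Qed.
Let hds : homog 1 ds. Proof. exact: homog_dif. Qed.
Let hb0 : homog 1 b0. Proof. exact: homog_dif. Qed.
Let hb1 : homog 1 b1. Proof. exact: homog_dif. Qed.
Let hdt : homog 1 dt. Proof. exact: homog_dif. Qed.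
Let hdx : homog 1 dx. Proof. exact: homog_dif. Qed.
Let o1 := homog1 V.
Let o1' := homog1 W.

Let M0l := (fun a b => @stensM0l K V W a b 1 ^~ o1', fun a e f => @stensM0l K V W a e c f hc,
  fun a e f => @stensM0l K V W a e s f hs, fun a e f => @stensM0l K V W a e a0 f h0,
  fun a e f => @stensM0l K V W a e a1 f h1).
Let M0r := (fun a b f => @stensM0r K V W a 1 b f o1, fun a b f => @stensM0r K V W a t b f ht,
  fun a b f => @stensM0r K V W a x b f hx).
Let M11 := (
  (fun a f => @stensM11 K V W a dt dc f hdc hdt, fun a f => @stensM11 K V W a dt ds f hds hdt,
   fun a f => @stensM11 K V W a dt b0 f hb0 hdt, fun a f => @stensM11 K V W a dt b1 f hb1 hdt,
   fun a f => @stensM11 K V W a dt th f hth hdt),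
  (fun a f => @stensM11 K V W a dx dc f hdc hdx, fun a f => @stensM11 K V W a dx ds f hds hdx,
   fun a f => @stensM11 K V W a dx b0 f hb0 hdx, fun a f => @stensM11 K V W a dx b1 f hb1 hdx,
   fun a f => @stensM11 K V W a dx th f hth hdx),
  (fun a f => @stensM11 K V W a v dc f hdc hv, fun a f => @stensM11 K V W a v ds f hds hv,
   fun a f => @stensM11 K V W a v b0 f hb0 hv, fun a f => @stensM11 K V W a v b1 f hb1 hv,
   fun a f => @stensM11 K V W a v th f hth hv)).
Let difE : (dif coact0 = 1 \ox b0 + dt \ox c + dx \ox s + t \ox dc + x \ox ds) *
  (dif coact1 = 1 \ox b1 + dt \ox s + dx \ox c + t \ox ds + x \ox dc) *
  (coactth = 1 \ox th + v \ox 1 - dt \ox 1 + (dt \ox c + dx \ox s + t \ox dc + x \ox ds)).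
Proof. by rewrite dif_coact0 dif_coact1. Qed.

Let cs := (OSO_SO (OP_SO rW)).1.
Let c2 : c * c = s * s + 1.
Proof. by have [_ <-] := OSO_SO (OP_SO rW); rewrite -!expr2 addrC subrK. Qed.

Let nV := (comE (OUb_Ub rV : com t x = lam *: x), comE (OUb_d1_1 rV : com dx x = lam *: v),
  comE (OUb_d1_0 rV : com dx t = 0), comE (OUb_d0_1 rV : com dt x = lam *: dx),
  comE (OUb_d0_0 rV : com dt t = lam *: (dt - v)), comE (OUb_th_1 rV : com v x = 0),
  comE (OUb_th_0 rV : com v t = - (lam *: v))).
Let nV2 : (dx * dx = 0) * (dt * dt = 0) * (dx * dt = - (dt * dx)) * (dx * v = - (v * dx)) *
  (dt * v = - (v * dt)).
Proof. by case: rV => *; rewrite /dx /dt -!expr2. Qed.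

Let rU := OP_Ub rW.
Let rP := OP_Poinc rW.
Let nW := (comE (Poinc_Ub rP : com a0 a1 = _), comE (Poinc_a0c rP), comE (Poinc_a0s rP),
  comE (Poinc_a1c rP), comE (Poinc_a1s rP)).
Let nW1 := (comE (OUb_d1_1 rU : com b1 a1 = lam *: th),
  comE (OUb_d1_0 rU : com b1 a0 = 0), comE (OUb_d0_1 rU : com b0 a1 = lam *: b1),
  comE (OUb_d0_0 rU : com b0 a0 = lam *: (b0 - th)), comE (OUb_th_1 rU : com th a1 = 0),
  comE (OUb_th_0 rU : com th a0 = - (lam *: th))).
Let nW1' := (comE (OP_d0_c rW : com b0 c = _ *: (_ * dc)), comE (OP_d0_s rW : com b0 s = _ *: (_ * ds)),
  comE (OP_d1_c rW : com b1 c = _ *: (_ * dc)), comE (OP_d1_s rW : com b1 s = _ *: (_ * ds)),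
  comE (OP_0_dc rW : com a0 dc = _ *: (_ * ds)), comE (OP_0_ds rW : com a0 ds = _ *: (_ * dc)),
  comE (OP_1_dc rW : com a1 dc = _ *: (_ * ds)), comE (OP_1_ds rW : com a1 ds = _ *: (_ * dc)),
  comE (OP_th_c rW : com th c = _ *: (_ * dc)), comE (OP_th_s rW : com th s = _ *: (_ * ds))).
Let nSO : (dc * s = s * dc) * (ds * c = c * ds) * (dc * c = c * dc) * (ds * s = c * dc) *
  (s * ds = c * dc).
Proof. by case: (OP_SO rW) => _ e1 e2 e3 e4 e5; rewrite /dc /ds -e5 -e4. Qed.
Let nW2 : (b1 * b1 = 0) * (b0 * b0 = 0) * (b1 * b0 = - (b0 * b1)) * (b1 * th = - (th * b1)) *
  (b0 * th = - (th * b0)).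
Proof. by case: rU => *; rewrite /b1 /b0 -!expr2. Qed.
Let nSO2 : (dc * dc = 0) * (ds * ds = 0) * (dc * ds = 0) * (ds * dc = 0).
Proof.
have rS := OP_SO rW; rewrite /dc /ds (OSO_dcdc two_neq0 hc rS) (OSO_dsds two_neq0 hc hs rS).
by rewrite (OSO_dcds two_neq0 hc hs rS) (OSO_dsdc two_neq0 hc hs rS).
Qed.
Let nW2' : (b0 * dc = - (dc * b0)) * (b0 * ds = - (ds * b0)) * (b1 * dc = - (dc * b1)) *
  (b1 * ds = - (ds * b1)).
Proof.
rewrite /b0 /b1 /dc /ds !(anticomE (OP_d0_dc rW), anticomE (OP_d0_ds rW), anticomE (OP_d1_dc rW),
  anticomE (OP_d1_ds rW)) -/dc -/ds !nSO2 scaler0 !addr0 //.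
Qed.

(** These are consequences of the listed relations: differentiate [theta', y] = lam (c - 1) dy for y
    = c, s and use dtheta' = 0 and the vanishing of dc dy. *)
Let nW2t : (th * dc = - (dc * th)) * (th * ds = - (ds * th)).
Proof.
have e y : dif th = 0 -> homog 0 y -> com th y = lam *: ((c - 1) * dif y) -> dc * dif y = 0 ->
    th * dif y = - (dif y * th).
  move=> dth hy /(congr1 dif); rewrite difD difN (dif1M _ hth) (dif0M _ hy) difZ.
  rewrite (dif0M _ (homogD hc (_ : homog 0 (- 1)))); last first.
    by rewrite -scaleN1r; exact: homogZ (homog1 W).
  rewrite difK difD difN dif1 dth oppr0 !mulr0 mul0r sub0r !addr0 => h e0.
  by move: h; rewrite [dif c * _]e0 scaler0 => /eqP; rewrite subr_eq0 eqr_oppLR => /eqP.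
split; apply: e => //; rewrite ?nSO2 //; by [case: rU|case: rW].
Qed.

(** Products are expanded into pure tensors and each leg is put into normal order. An arbitrary
    linear form then turns the identity into one between scalars, which [ring] decides. *)
Local Ltac expand := rewrite ?difE /coact0 /coact1 /com ?expr2
  ?(mulrBl, mulrBr, mulrDl, mulrDr, mulNr, mulrN, M0l, M0r, M11, mul1r, mulr1).
Local Ltac collect :=
  rewrite ?(mulrBl, mulrBr, mulrDl, mulrDr, mulNr, mulrN, mul1r, mulr1, mul0r, mulr0, addr0, scalerBr, scalerDr,
    scalerN, scalerA) -?cs ?c2;
  rewrite ?(tensDl, tensDr, tensNl, tensNr, tensZl, tensZr, tens0l, tens0r, opprK, scalerDr, scalerN, scaler0);
  apply: scalar_ext => phi; ring.
Local Ltac deg0 := expand; rewrite ?(nV, nW) ?expr2; collect.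
Local Ltac deg1 := expand; rewrite ?(nV, nW, nW1, nW1', nSO) ?expr2; collect.
Local Ltac deg2 := expand;
  rewrite ?(nV, nV2, nW, nW1, nW1', nSO, nW2, nW2', nW2t, nSO2) ?expr2
   ?(mulrDr, mulrBr, mulrN, mul0r, mulr0, mulrA) ?(nV, nV2, nW, nW1, nW1', nSO, nW2, nW2', nW2t, nSO2) ?expr2;
  collect.

Lemma dif_coactth : dif coactth = 0.
Proof.
rewrite /coactth !difD difN !(stens_dif0 _ o1) !(stens_dif0 _ ht) !(stens_dif0 _ hx).
rewrite !(stens_dif1 _ hdt) !(stens_dif1 _ hdx) (stens_dif1 _ hv) !difK !dif1.
rewrite (OUb_dth rV) (OUb_dth rU) !(tens0l, tens0r) !(addr0, add0r, subr0, sub0r, oppr0).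
by rewrite -addrA addrACA !addNr addr0.
Qed.

Let k0 : Ub_rel lam coact0 coact1.
Proof. by rewrite /Ub_rel; deg0. Qed.
Let k1 : com (dif coact1) coact1 = lam *: coactth.
Proof. deg1. Qed.
Let k2 : com (dif coact1) coact0 = 0.
Proof. deg1. Qed.
Let k3 : com (dif coact0) coact1 = lam *: dif coact1.
Proof. deg1. Qed.
Let k4 : com (dif coact0) coact0 = lam *: (dif coact0 - coactth).
Proof. deg1. Qed.
Let k5 : com coactth coact1 = 0.
Proof. deg1. Qed.
Let k6 : com coactth coact0 = - (lam *: coactth).
Proof. deg1. Qed.
Let k7 : dif coact1 ^+ 2 = 0.
Proof. deg2. Qed.
Let k8 : dif coact0 ^+ 2 = 0.
Proof. deg2. Qed.
Let k9 : dif coact1 * dif coact0 = - (dif coact0 * dif coact1).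
Proof. deg2. Qed.
Let k10 : dif coact1 * coactth = - (coactth * dif coact1).
Proof. deg2. Qed.
Let k11 : dif coact0 * coactth = - (coactth * dif coact0).
Proof. deg2. Qed.

Lemma OmegaUb_coact : OmegaUb_rel lam coact0 coact1 coactth.
Proof. by split=> //; exact: dif_coactth. Qed.
End Coaction.

(** * Differential operators as a model of the relations *)

Section DiffOpModel.
Variables (K : fieldType) (lam : K) (B : algType K) (D c s : B).
Hypotheses (hDc : D * c = c * D + s) (hDs : D * s = s * D + c) (r : SO_rel c s).
Local Notation W := (ddual (inner D)).
Let cs := r.1.
Let c2 : c * c = s * s + 1. Proof. by have [_ <-] := r; rewrite -!expr2 addrC subrK. Qed.

Let hDc' x : x * D * c = x * c * D + x * s. Proof. by rewrite -!mulrA hDc mulrDr. Qed.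
Let hDs' x : x * D * s = x * s * D + x * c. Proof. by rewrite -!mulrA hDs mulrDr. Qed.
Let cs' x : x * c * s = x * s * c. Proof. by rewrite -!mulrA cs. Qed.
Let c2' x : x * c * c = x * s * s + x. Proof. by rewrite -!mulrA c2 mulrDr mulr1. Qed.
Let nrm := (hDc, hDs, cs, c2, hDc', hDs', cs', c2').
Definition dop (x : B) : W := Ddual (inner D) x 0.
Definition dop1 (x : B) : W := Ddual (inner D) 0 x.

Lemma homog_dop x : homog 0 (dop x). Proof. exact: (@ddualP _ _ (inner D)). Qed.
Lemma homog_dop1 x : homog 1 (dop1 x). Proof. exact: (@ddualP _ _ (inner D)). Qed.

Let nrm1 := (@mulrDl B, @mulrBl B, @mul1r B, nrm).
Let dif_dop x y : D * x - x * D = y -> dif (dop x) = dop1 y.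
Proof. by move=> <-; apply: (@ddualP _ _ (inner D)); rewrite !(@ddE K B (inner D)). Qed.
Let dE : (dif (dop c) = dop1 s) * (dif (dop s) = dop1 c) *
  (dif (dop (lam *: (s * D))) = dop1 (lam *: (c * D))) *
  (dif (dop (lam *: ((c - 1) * D))) = dop1 (lam *: (s * D))) *
  (forall x, dif (dop1 x) = 0).
Proof.
do !split; last by move=> x; apply: (@ddualP _ _ (inner D)); rewrite !(@ddE K B (inner D)) //= mulr0 mul0r subrr.
all: apply: dif_dop; rewrite -?scalerAl -?scalerAr -?scalerBr ?mulrA ?(mulrBr, mulrBl, mul1r, mulr1) ?mulrA ?nrm1;
  apply: scalar_ext => phi; ring.
Qed.

(** The value of theta' comes from [dx, x] = lam theta': [s D, (c - 1) D] = (s^2 - (c - 1) c) D = (c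
    - 1) D. *)
Lemma dop_OmegaPoinc_rel : OmegaPoinc_rel lam (dop c) (dop s)
  (dop (lam *: (s * D))) (dop (lam *: ((c - 1) * D))) (dop1 (lam *: ((c - 1) * D))).
Proof.
split; [split|split|split|..]; rewrite /Ub_rel /SO_rel /com /anticom ?dE.
all: try match goal with |- _ /\ _ => split end.
all: apply: (@ddualP _ _ (inner D)); rewrite ?expr2 !(@ddE K B (inner D)) /= ?(mul0r, mulr0, addr0, add0r, subr0, subrr, oppr0, scaler0) //.
all: rewrite ?(mulrBl, mulrBr, mulrDl, mulrDr, mul1r, mulr1, scalerBr, scalerDr) -?(scalerAl, scalerAr) ?mulrA.
all: by rewrite ?nrm1; apply: scalar_ext => phi; ring.
Qed.

Lemma dif_dop_a0 : dif (dop (lam *: (s * D))) = dop1 (lam *: (c * D)). Proof. by rewrite dE. Qed.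
Lemma dif_dop_a1 : dif (dop (lam *: ((c - 1) * D))) = dop1 (lam *: (s * D)). Proof. by rewrite dE. Qed.
Lemma dif_dop_c : dif (dop c) = dop1 s. Proof. by rewrite dE. Qed.
Lemma dif_dop_s : dif (dop s) = dop1 c. Proof. by rewrite dE. Qed.
End DiffOpModel.

(** * The projection onto Omega(C[SO]) *)

Arguments SO_inc : simpl never.
Arguments Ub_inc : simpl never.
Arguments Poinc_inc : simpl never.
Arguments jS : simpl never.
Arguments jU : simpl never.
Arguments qU : simpl never.
Arguments OSO_counit : simpl never.
Arguments OUb_counit : simpl never.
Arguments OP_counit : simpl never.

Section LrmTheory.
Variables (K : fieldType) (A B : algType K) (f : {lrmorphism A -> B}).
(* Restated so that the canonical coercions need no simplification. *)
Lemma lrmP k x y : f (k *: x + y) = k *: f x + f y. Proof. exact: linearP. Qed.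
Lemma lrmD x y : f (x + y) = f x + f y. Proof. exact: rmorphD. Qed.
Lemma lrmB x y : f (x - y) = f x - f y. Proof. exact: rmorphB. Qed.
Lemma lrmN x : f (- x) = - f x. Proof. exact: rmorphN. Qed.
Lemma lrmZ k x : f (k *: x) = k *: f x. Proof. exact: linearZ. Qed.
Lemma lrmM x y : f (x * y) = f x * f y. Proof. exact: rmorphM. Qed.
Lemma lrm1 : f 1 = 1. Proof. exact: rmorph1. Qed.
Lemma lrm0 : f 0 = 0. Proof. exact: rmorph0. Qed.
Lemma lrm_linear : linear f. Proof. exact: linearP. Qed.
End LrmTheory.

Section SODerivation.
Variables (K : fieldType).
Local Notation SO := (SO K).
Let Dual := ddual (der0 SO).
(** The infinitesimal boost z |-> (1 + eps) z preserves the hyperbola. An algebra map into the dual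
    numbers lifting the identity is the same as a derivation. *)
Let dual_rel : SO_rel (Ddual (der0 SO) (soc K) (sos K) : Dual) (Ddual (der0 SO) (sos K) (soc K)).
Proof.
have [cs h] := SO_sat K; split; apply: (@ddualP _ _ (der0 SO)).
- by rewrite /= cs.
- by rewrite /= addrC.
- by rewrite !expr2 /= -!expr2 h.
- by rewrite !expr2 /= cs subrr.
Qed.

Let dual_lift : {lrmorphism SO -> Dual} :=
  alift (P := SO_pres K) (f := fun g => match g with
    | Sc => Ddual (der0 SO) (soc K) (sos K) | Ss => Ddual (der0 SO) (sos K) (soc K) end : Dual)
  dual_rel.
Let dual_liftE k : dual_lift (pgen k) = match k with
    | Sc => Ddual (der0 SO) (soc K) (sos K) | Ss => Ddual (der0 SO) (sos K) (soc K) end.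
Proof. by rewrite [LHS]alift_gen; case: k. Qed.
Let dual_lift0 x : dd0 (dual_lift x) = x.
Proof.
elim/(@SO_generated K): x => [||k x y ex ey|k x ex]; rewrite ?rmorph0 ?rmorph1 //.
- by rewrite linearP /= ex ey.
- by rewrite rmorphM /= ex dual_liftE; case: k.
Qed.
Let d x := dd1 (dual_lift x).
Let d_linear : linear d. Proof. by move=> k x y; rewrite /d linearP. Qed.
Let dM x y : d (x * y) = d x * y + x * d y.
Proof. by rewrite /d rmorphM /= !dual_lift0 addrC. Qed.
(* [z d/dz] for [z = c + s]. *)
Definition SO_der : derivation SO := Derivation d_linear dM.
Lemma SO_der_c : SO_der (soc K) = sos K. Proof. by rewrite /= /d dual_liftE. Qed.
Lemma SO_der_s : SO_der (sos K) = soc K. Proof. by rewrite /= /d dual_liftE. Qed.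
Lemma SO_der1 : SO_der 1 = 0. Proof. by rewrite /= /d rmorph1. Qed.
End SODerivation.

Section Projection.
Variables (K : fieldType) (lam : K).
Hypothesis lam0 : lam != 0.
Hypothesis two_neq0 : 2%:R != 0 :> K.
Local Notation SO := (SO K).
Local Notation OSO := (OmegaSO K).
Local Notation OUb := (OmegaUb lam).
Local Notation OP := (OmegaPoinc lam).
Local Notation gS := (@pgen K (SO_pres K)).
Local Notation gU := (@pgen K (Ub_pres lam)).
Local Notation dS := (@pdgen K (OmegaSO_pres K)).
Local Notation Dz := (aend_of_der (SO_der K)).
Local Notation c' := (lmul (soc K)).
Local Notation s' := (lmul (sos K)).
Local Notation E := (ddual (inner Dz)).

Lemma aend_of_derE (A : algType K) (d : derivation A) x : aend_of_der d x = d x.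
Proof. by []. Qed.
Lemma lmulM (A : algType K) (a b : A) : lmul (a * b) = lmul a * lmul b.
Proof. by apply: aendP => x; rewrite aendE !lmulE mulrA. Qed.
Lemma lmulD (A : algType K) (a b : A) : lmul (a + b) = lmul a + lmul b.
Proof. by apply: aendP => x; rewrite aendE !lmulE mulrDl. Qed.
Lemma lmulN (A : algType K) (a : A) : lmul (- a) = - lmul a.
Proof. by apply: aendP => x; rewrite aendE !lmulE mulNr. Qed.
Lemma lmul1 (A : algType K) : lmul (1 : A) = 1.
Proof. by apply: aendP => x; rewrite aendE !lmulE mul1r. Qed.

Lemma Dz_c : Dz * c' = c' * Dz + s'.
Proof. by apply: aendP => x; rewrite !aendE !lmulE !aend_of_derE derM SO_der_c addrC. Qed.
Lemma Dz_s : Dz * s' = s' * Dz + c'.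
Proof. by apply: aendP => x; rewrite !aendE !lmulE !aend_of_derE derM SO_der_s addrC. Qed.
Let rE : SO_rel c' s'.
Proof. by have [cs h] := SO_sat K; rewrite /SO_rel !expr2 -!lmulM -lmulN -lmulD -!expr2 h cs lmul1. Qed.

Definition rho : {lrmorphism OP -> E} :=
  dlift (OP_dsat (homog_dop Dz _) (homog_dop Dz _) (homog_dop Dz _) (homog_dop Dz _)
    (homog_dop1 Dz _) (dop_OmegaPoinc_rel lam Dz_c Dz_s rE)).
Lemma rho_dga : dga_map rho. Proof. exact: dlift_dga_map. Qed.
Lemma rhoE k : rho (pdgen k) = match k with
  OPc => dop Dz c' | OPs => dop Dz s' | OPa0 => dop Dz (lam *: (s' * Dz))
 | OPa1 => dop Dz (lam *: ((c' - 1) * Dz)) | OPth => dop1 Dz (lam *: ((c' - 1) * Dz)) end.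
Proof. by rewrite [LHS]dlift_gen; case: k. Qed.

Let c := osoc K.
Let s := osos K.
Let rS := OmegaSO_sat K.
Let hc := homog_osoc K.
Let hs := homog_osos K.
Local Notation inc := (SO_inc K).
(** The invariant one-form dz/z. It is closed, commutes with functions, has square 0, and every
    one-form dy is a multiple of it. *)
Definition omega : OSO := c * dif s - s * dif c.

Lemma s_omega : s * omega = dif c. Proof. exact: OSO_dcE rS. Qed.
Lemma c_omega : c * omega = dif s. Proof. exact: OSO_dsE rS. Qed.
Lemma homog_omega : homog 1 omega.
Proof.
rewrite /omega -scaleN1r; apply: homogD; last apply: homogZ.
- exact: homogM hc (homog_dif hs).
- exact: homogM hs (homog_dif hc).
Qed.
Lemma dif_omega : dif omega = 0.
Proof.
rewrite /omega difD difN (dif0M _ hc) (dif0M _ hs) !difK !mulr0 !addr0.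
by rewrite (OSO_dcds two_neq0 hc hs rS) (OSO_dsdc two_neq0 hc hs rS) subrr.
Qed.
Lemma inc_omegaC a : omega * inc a = inc a * omega.
Proof.
have [[cs h] e1 e2 e3 e4 e5] := rS.
have oc : omega * c = c * omega.
  by rewrite /omega mulrBl mulrBr -!mulrA e2 e3 !mulrA cs.
have os : omega * s = s * omega.
  by rewrite /omega mulrBl mulrBr -!mulrA e1 -e5 !mulrA cs.
elim/(@SO_generated K): a => [||k x y ex ey|k x ex]; rewrite ?lrm0 ?lrm1 ?mulr0 ?mul0r ?mulr1 ?mul1r //.
- by rewrite lrmP [LHS]mulrDr [RHS]mulrDl -scalerAr -scalerAl ex ey.
- by rewrite lrmM -mulrA -ex !mulrA SO_incE; case: k; rewrite [omega * _](oc, os).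
Qed.

Lemma omega_omega : omega * omega = 0.
Proof.
have h : omega * omega = c * c * (omega * omega) - s * s * (omega * omega).
  by rewrite -mulrBl -!expr2 (OSO_SO rS).2 mul1r.
have cc : c * c * (omega * omega) = dif s * dif s.
  rewrite -c_omega !mulrA; congr (_ * _); rewrite -!mulrA; congr (_ * _).
  by rewrite -[c](SO_incE Sc) inc_omegaC.
have ss : s * s * (omega * omega) = dif c * dif c.
  rewrite -s_omega !mulrA; congr (_ * _); rewrite -!mulrA; congr (_ * _).
  by rewrite -[s](SO_incE Ss) inc_omegaC.
by rewrite h cc ss (OSO_dsds two_neq0 hc hs rS) (OSO_dcdc two_neq0 hc rS) subrr.
Qed.
(** The formula da = (z da/dz) dz/z, which matches d on functions with b |-> [D, b] on operators. *)
Lemma dif_inc a : dif (inc a) = inc (SO_der K a) * omega.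
Proof.
elim/(@SO_generated K): a => [||k x y ex ey|k x ex].
- by rewrite (lin0 (der_linear _)) !lrm0 dif0 mul0r.
- by rewrite SO_der1 lrm0 lrm1 dif1 mul0r.
- by rewrite der_linear !lrmP dif_linear ex ey mulrDl scalerAl.
- rewrite derM lrmM (dif0M _ (SO_inc_homog _)) ex lrmD !lrmM mulrDl.
  rewrite mulrA; congr (_ + _); rewrite -mulrA -inc_omegaC mulrA; congr (_ * _).
  case: k.
  + by rewrite (SO_incE Sc) [SO_der K _]SO_der_c (SO_incE Ss) s_omega.
  + by rewrite (SO_incE Ss) [SO_der K _]SO_der_s (SO_incE Sc) c_omega.
Qed.

Let dopE : (forall x, dd0 (dop Dz x) = x) * (forall x, dd1 (dop Dz x) = 0) *
  (forall x, dd0 (dop1 Dz x) = 0) * (forall x, dd1 (dop1 Dz x) = x).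
Proof. by []. Qed.
Let eE := (dopE, @ddE _ _ (inner Dz)).
(* A differential operator with values in functions and one-forms, applied to 1. *)
Definition ev (Y : E) : OSO := inc (dd0 Y 1) + inc (dd1 Y 1) * omega.
Lemma ev_linear : linear ev.
Proof.
move=> k x y; rewrite /ev !eE !aendE !lrmP mulrDl scalerDr -scalerAl addrACA //.
Qed.
Lemma ev_dopl P Y : ev (dop Dz P * Y) = inc (P (dd0 Y 1)) + inc (P (dd1 Y 1)) * omega.
Proof. by congr (inc _ + inc _ * _); rewrite /= addr0. Qed.
Lemma ev_dop1l P Y : ev (dop1 Dz P * Y) = inc (P (dd0 Y 1)) * omega.
Proof.
have -> : ev (dop1 Dz P * Y) = inc 0 + inc (0 + P (dd0 Y 1)) * omega by [].
by rewrite lrm0 !add0r.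
Qed.
Lemma ev_dopr P Y : ev (Y * dop Dz P) = inc (dd0 Y (P 1)) + inc (dd1 Y (P 1)) * omega.
Proof.
have -> : ev (Y * dop Dz P) = inc (dd0 Y (P 1)) + inc (dd0 Y 0 + dd1 Y (P 1)) * omega by [].
by rewrite (lin0 (aend_linear _)) add0r.
Qed.
Lemma ev_dop1r P Y : ev (Y * dop1 Dz P) = inc (dd0 Y (P 1)) * omega.
Proof.
have -> : ev (Y * dop1 Dz P) = inc (dd0 Y 0) + inc (dd0 Y (P 1) + dd1 Y 0) * omega by [].
by rewrite !(lin0 (aend_linear _)) lrm0 add0r addr0.
Qed.
Definition proj (y : OP) : OSO := ev (rho y).
Lemma proj_linear : linear proj. Proof. exact: lin_comp ev_linear (lrm_linear rho). Qed.
Lemma proj1 : proj 1 = 1.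
Proof. by rewrite /proj lrm1 /ev !eE aend1E aend0E lrm0 mul0r lrm1 addr0. Qed.
Lemma proj_dif y : proj (dif y) = dif (proj y).
Proof.
rewrite /proj rho_dga.2 /ev difD !eE (dif0M _ (SO_inc_homog _)) dif_omega mulr0 addr0.
rewrite !dif_inc aend0E lrm0 add0r -mulrA omega_omega mulr0 addr0; congr (inc _ * _).
(* Since D 1 = 0, applying [D, Y] to 1 gives D (Y 1); so evaluation at 1 commutes with d. *)
by rewrite innerE !aendE !aend_of_derE SO_der1 (lin0 (aend_linear _)) subr0.
Qed.
Lemma proj_gpr n y : proj (gpr n y) = gpr n (proj y).
Proof.
rewrite /proj rho_dga.1 /ev (linD (gpr_linear _)).
rewrite (gprE _ (SO_inc_homog _)) (gprE _ (homogM (SO_inc_homog _) homog_omega)) !eE.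
by case: n => [|[|n]]; rewrite /= ?aend0E ?lrm0 ?mul0r ?addr0 ?add0r.
Qed.

(** Functions act by multiplication, hence commute past evaluation at 1. For dc and ds the one-form
    part of [y] drops out on both sides because [omega] has square 0. *)
Lemma proj_jS w y : proj (jS lam w * y) = w * proj y.
Proof.
have ed (k : SO_gen) : rho (jS lam (dS k)) = dop Dz (if k is Sc then c' else s').
  by rewrite jSE; case: k; rewrite [LHS]rhoE.
move: y; elim/(@OSO_generated K): w => [||k x z ex ez|k x ex|k x ex] y.
- by rewrite lrm0 !mul0r (lin0 proj_linear).
- by rewrite lrm1 !mul1r.
- by rewrite lrmP !mulrDl -!scalerAl proj_linear ex ez.
- rewrite lrmM -!mulrA -ex /proj lrmM SO_incE ed ev_dopl /ev [RHS]mulrDr [X in _ = _ + X]mulrA.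
  by case: k; rewrite !lmulE !lrmM ?[inc (soc K)](SO_incE Sc) ?[inc (sos K)](SO_incE Ss).
- rewrite lrmM -!mulrA -ex /proj lrmM SO_incE (jS_dga lam).2 rho_dga.2 ed.
  have -> : dif (dop Dz (if k is Sc then c' else s')) = dop1 Dz (if k is Sc then s' else c').
    by case: k; [exact: dif_dop_c Dz_c Dz_s|exact: dif_dop_s Dz_c Dz_s].
  have -> : dif (dS k) = inc (if k is Sc then sos K else soc K) * omega.
    case: k; first by rewrite [inc _](SO_incE Ss) s_omega.
    by rewrite [inc _](SO_incE Sc) c_omega.
  rewrite ev_dop1l /ev [RHS]mulrDr -[X in _ = _ + X]mulrA [omega * (_ * _)]mulrA inc_omegaC.
  rewrite -[X in _ = _ + _ * X]mulrA omega_omega !mulr0 addr0.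
  by rewrite -mulrA inc_omegaC mulrA -lrmM; case: k.
Qed.

(** The images of a_0, a_1 and of their differentials are operators of the form P D, and D kills the
    function 1; so a right factor from Omega(U(b_+)) acts through its counit. *)
Lemma proj_jU y h : proj (y * jU lam h) = (OUb_counit lam h : K) *: proj y.
Proof.
move: y; elim/(@OUb_generated K lam lam0): h => [||k x z ex ez|k x ex|k x ex] y.
- by rewrite !lrm0 mulr0 (lin0 proj_linear) scale0r.
- by rewrite !lrm1 mulr1 scale1r.
- by rewrite !lrmP mulrDr -!scalerAr proj_linear ex ez scalerDl scalerA.
- rewrite lrmM mulrA ex lrmM.
  have -> : proj (y * jU lam (Ub_inc lam (gU k))) = 0.
    rewrite /proj lrmM Ub_incE.
    have [P ->] : exists P, rho (jU lam (match k with Ua0 => oua0 lam | Ua1 => oua1 lam end)) =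
        dop Dz (P * Dz).
      case: k; rewrite [jU _ _]jUE [rho _]rhoE.
        by exists (lam *: s'); rewrite scalerAl.
      by exists (lam *: (c' - 1)); rewrite scalerAl.
    rewrite ev_dopr !aendME !aend_of_derE SO_der1.
    by rewrite !(lin0 (aend_linear _)) !lrm0 mul0r addr0.
  have -> : OUb_counit lam (Ub_inc lam (gU k)) = 0.
    by rewrite Ub_incE; case: k; rewrite [LHS]OUb_counitE.
  by rewrite [0 * _]mul0r scale0r scaler0.
- rewrite lrmM mulrA ex lrmM counit_difU [0 * _]mul0r scale0r.
  have -> : proj (y * jU lam (dif (Ub_inc lam (gU k)))) = 0; last by rewrite scaler0.
  rewrite /proj lrmM Ub_incE (jU_dga lam).2 rho_dga.2.
  have [P ->] : exists P, dif (rho (jU lam (match k with Ua0 => oua0 lam | Ua1 => oua1 lam end))) =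
      dop1 Dz (P * Dz).
    case: k; rewrite [jU _ _]jUE [rho _]rhoE.
      by exists (lam *: c'); rewrite -scalerAl; exact: dif_dop_a0 Dz_c Dz_s.
    by exists (lam *: s'); rewrite -scalerAl; exact: dif_dop_a1 Dz_c Dz_s.
  rewrite ev_dop1r aendME aend_of_derE SO_der1.
  by rewrite !(lin0 (aend_linear _)) !lrm0 mul0r.
Qed.

End Projection.

(** * Universality *)

Section RelationMaps.
Variables (K : fieldType) (lam : K) (V W : dgaType K) (f : {lrmorphism V -> W}).
Hypothesis df : dga_map f.

Lemma OmegaUb_rel_map a0 a1 th : OmegaUb_rel lam a0 a1 th ->
  OmegaUb_rel lam (f a0) (f a1) (f th).
Proof.
case; rewrite /Ub_rel /com => e1 e2 e3 e4 e5 e6 e7 e8 e9 e10 e11 e12 e13.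
split; rewrite /Ub_rel /com ?expr2 -?df.2 -?(lrmM, lrmB, lrmZ, lrmN);
  rewrite -?(lrmM, lrmB, lrmZ, lrmN) -?(lrmM, lrmB, lrmZ, lrmN) -1?[RHS](lrm0 f); by congr (f _).
Qed.
End RelationMaps.

(** * Functionals separating low order terms in degree 0 *)

Section Functionals.
Variables (K : fieldType) (lam : K).
Hypothesis lam0 : lam != 0.
Hypothesis two_neq0 : 2%:R != 0 :> K.
Local Notation OUb := (OmegaUb lam).
Local Notation t := (oua0 lam).
Local Notation x := (oua1 lam).
Local Notation M := 'M[K]_3.

(* [t] acts with weights lam, 0, -lam, and [x] raises the weight. *)
Let mt : M := \matrix_(i, j) (if i == j :> nat then lam *+ (i == 0%N :> nat) - lam *+ (i == 2%N :> nat) else 0).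
Let mx : M := \matrix_(i, j) (j == i.+1 :> nat)%:R.
Let mrel : Ub_rel lam mt mx.
Proof.
apply/matrixP => i j; rewrite /com !mxE !big_ord_recl !big_ord0 !mxE.
case: i => [[|[|[|i]]] hi] //; case: j => [[|[|[|j]]] hj] //=; rewrite ?(mulr0, mul0r, mulr1, mul1r, mulr0n, mulr1n); ring.
Qed.

Definition mrep : {lrmorphism OUb -> conc0 M} :=
  dlift (OUb_dsat (conc0_homog (mt : conc0 M)) (conc0_homog (mx : conc0 M)) (homog0 _ _)
    (conc0_OmegaUb_rel (mrel : Ub_rel lam (mt : conc0 M) (mx : conc0 M)))).

Definition mentry (i j : 'I_3) (v : OUb) : K := (mrep v : M) i j.
Lemma mentry_linear i j : linear (mentry i j : OUb -> K^o).
Proof. by move=> k a b; rewrite /mentry lrmP !mxE. Qed.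
Lemma mentryM i j a b : mentry i j (a * b) = \sum_k mentry i k a * mentry k j b.
Proof. by rewrite /mentry lrmM mxE. Qed.
Lemma mentry1 i j : mentry i j 1 = (i == j :> nat)%:R.
Proof. by rewrite /mentry lrm1 mxE. Qed.
Lemma mentry_t i j : mentry i j t = if i == j :> nat then lam *+ (i == 0%N :> nat) - lam *+ (i == 2%N :> nat) else 0.
Proof. by rewrite /mentry [mrep t]dlift_gen /= mxE. Qed.
Lemma mentry_x i j : mentry i j x = (j == i.+1 :> nat)%:R.
Proof. by rewrite /mentry [mrep x]dlift_gen /= mxE. Qed.
Lemma mentry_homog i j n v : homog n.+1 v -> mentry i j v = 0.
Proof.
by move=> <-; rewrite /mentry [mrep _]dlift_gpr conc0_gpr /= mxE.
Qed.

Let o0 := @Ordinal 3 0 isT.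
Let o1 := @Ordinal 3 1 isT.
Let o2 := @Ordinal 3 2 isT.

(** The values on words of length at most 2 are all that is needed when a relation quadratic in the
    coaction is sliced. Both orders of t, x are tabulated because t x = x t + lam x mixes the
    lengths. *)
Record coef0 (phi : OUb -> K^o) (v1 vt vx vtt vtx vxt vxx : K) : Prop := {
  coef0_linear : linear phi;
  coef0_homog : forall n v, homog n.+1 v -> phi v = 0;
  coef0_1 : phi 1 = v1; coef0_t : phi t = vt; coef0_x : phi x = vx;
  coef0_tt : phi (t * t) = vtt; coef0_tx : phi (t * x) = vtx;
  coef0_xt : phi (x * t) = vxt; coef0_xx : phi (x * x) = vxx
}.
Let lam2 : lam *+ 2 != 0.
Proof. by rewrite -mulr_natr mulf_neq0. Qed.

(** The weights lam and - lam of t differ by 2 lam but have equal squares, so the difference of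
    these diagonal entries detects t and kills both 1 and t t. *)
Definition coef_t (v : OUb) : K^o := (lam *+ 2)^-1 * (mentry o0 o0 v - mentry o2 o2 v).
Definition coef_x (v : OUb) : K^o := mentry o0 o1 v.
(** The two entries above the diagonal coincide for x, while their difference is lam for t x and for
    x t alike. *)
Definition coef_xt (v : OUb) : K^o := lam^-1 * (mentry o0 o1 v - mentry o1 o2 v).
Definition coef_xx (v : OUb) : K^o := mentry o0 o2 v.

Local Ltac table := rewrite ?mentryM ?big_ord_recl ?big_ord0 ?mentry1 ?mentry_t ?mentry_x /=
  ?mulr0n ?mulr1n.

Lemma coef_tE : coef0 coef_t 0 1 0 0 0 0 0.
Proof.
split; rewrite /coef_t.
- by move=> k a b; rewrite !(mentry_linear _ _ k a b) /= /GRing.scale /=; ring.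
- by move=> n v hv; rewrite !(mentry_homog _ _ hv) subrr mulr0.
- by table; rewrite subrr mulr0.
- by table; rewrite subr0 sub0r opprK -mulr2n mulVf.
all: by table; ring.
Qed.
Lemma coef_xE : coef0 coef_x 0 0 1 0 lam 0 0.
Proof.
split; rewrite /coef_x.
- exact: mentry_linear.
- by move=> n v hv; rewrite (mentry_homog _ _ hv).
all: by table; ring.
Qed.
Lemma coef_xtE : coef0 coef_xt 0 0 0 0 1 1 0.
Proof.
split; rewrite /coef_xt.
- by move=> k a b; rewrite !(mentry_linear _ _ k a b) /= /GRing.scale /=; ring.
- by move=> n v hv; rewrite !(mentry_homog _ _ hv) subrr mulr0.
all: try by table; ring.
all: by table; field.
Qed.
Lemma coef_xxE : coef0 coef_xx 0 0 0 0 0 0 1.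
Proof.
split; rewrite /coef_xx.
- exact: mentry_linear.
- by move=> n v hv; rewrite (mentry_homog _ _ hv).
all: by table; ring.
Qed.
End Functionals.

Lemma lin_opp (K : fieldType) (V W : lmodType K) (f : V -> W) : linear f -> {morph f : x / - x}.
Proof. by move=> lf a; rewrite -scaleN1r (linZ _ _ lf) scaleN1r. Qed.

(** * Functionals separating dt and dx modulo theta' *)

Section OneFormFunctionals.
Variables (K : fieldType) (lam : K).
Hypothesis lam0 : lam != 0.
Local Notation OUb := (OmegaUb lam).
Local Notation t := (oua0 lam).
Local Notation x := (oua1 lam).
Local Notation SO := (SO K).
Local Notation Dz := (aend_of_der (SO_der K)).

Record coef1 (phi : OUb -> K^o) (vt vx : K) : Prop := {
  coef1_linear : linear phi;
  coef1_homog : forall n v, homog n v -> n != 1%N -> phi v = 0;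
  coef1_dt : phi (dif t) = vt;
  coef1_dx : phi (dif x) = vx;
  coef1_th : phi (outh lam) = 0
}.

Let op v : aend SO := dd1 (rho lam (jU lam v)).
Let op_linear : linear op.
Proof. by move=> k a b; rewrite /op !lrmP. Qed.
Let op_homog n v : homog n v -> n != 1%N -> op v = 0.
Proof.
move=> hv n1; rewrite /op -hv (jU_dga lam).1 (rho_dga lam).1 (dd1g (d := inner Dz)).
by rewrite (negbTE n1).
Qed.
Let op_dt : op (dif t) = lam *: (lmul (soc K) * Dz).
Proof.
rewrite /op (jU_dga lam).2 (rho_dga lam).2 [jU _ _](@jUE K lam OUa0) [rho _ _](@rhoE K lam OPa0).
by rewrite (dif_dop_a0 lam (Dz_c K) (Dz_s K)).
Qed.
Let op_dx : op (dif x) = lam *: (lmul (sos K) * Dz).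
Proof.
rewrite /op (jU_dga lam).2 (rho_dga lam).2 [jU _ _](@jUE K lam OUa1) [rho _ _](@rhoE K lam OPa1).
by rewrite (dif_dop_a1 lam (Dz_c K) (Dz_s K)).
Qed.
Let op_th : op (outh lam) = lam *: ((lmul (soc K) - 1) * Dz).
Proof. by rewrite /op [jU _ _](@jUE K lam OUth) [rho _ _](@rhoE K lam OPth). Qed.

Local Notation eps := (SO_counit K).
Let eps_c : eps (soc K) = 1. Proof. exact: alift_gen. Qed.
Let eps_s : eps (sos K) = 0. Proof. exact: alift_gen. Qed.

(* Evaluation of the operator coefficient of a one-form at the function s, at
   the identity and to first order there. *)
Definition coef_dt (v : OUb) : K^o := lam^-1 *: eps (op v (sos K)).
Definition coef_dx (v : OUb) : K^o := lam^-1 *: eps (SO_der K (op v (sos K))).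

(** Up to lam, the operators of dt, dx and theta' send s to c c, s c and (c - 1) c. At the identity
    these functions have values 1, 0, 0 and derivatives 0, 1, 0, which also settles [coef_dx]. *)
Lemma coef_dtE : coef1 coef_dt 1 0.
Proof.
split; rewrite /coef_dt.
- by move=> k a b; rewrite op_linear !aendE lrmP scalerDr !scalerA mulrC.
- by move=> n v hv n1; rewrite (op_homog hv n1) aend0E lrm0 scaler0.
- rewrite op_dt !aendE lmulE aend_of_derE SO_der_s lrmZ lrmM eps_c mulr1.
  by rewrite scalerA mulVf // scale1r.
- by rewrite op_dx !aendE lmulE aend_of_derE SO_der_s lrmZ lrmM eps_s mul0r !scaler0.
- rewrite op_th !aendE lmulE aend_of_derE SO_der_s lrmZ lrmB lrmM eps_c mulr1 subrr.
  by rewrite !scaler0.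
Qed.

Lemma coef_dxE : coef1 coef_dx 0 1.
Proof.
split; rewrite /coef_dx.
- by move=> k a b; rewrite op_linear !aendE der_linear lrmP scalerDr !scalerA mulrC.
- by move=> n v hv n1; rewrite (op_homog hv n1) aend0E (lin0 (der_linear _)) lrm0 scaler0.
- rewrite op_dt !aendE lmulE aend_of_derE SO_der_s (linZ _ _ (der_linear _)) derM SO_der_c.
  by rewrite lrmZ lrmD !lrmM eps_s mul0r mulr0 addr0 !scaler0.
- rewrite op_dx !aendE lmulE aend_of_derE SO_der_s (linZ _ _ (der_linear _)) derM SO_der_c SO_der_s.
  rewrite lrmZ lrmD !lrmM eps_s eps_c mul0r mulr1 addr0.
  by rewrite scalerA mulVf // scale1r.
- rewrite op_th !aendE lmulE aend_of_derE SO_der_s (linZ _ _ (der_linear _)) (linD (der_linear _)).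
  rewrite derM SO_der_c (lin_opp (der_linear (SO_der K))) SO_der_c.
  by rewrite lrmZ lrmB lrmD !lrmM eps_s mul0r mulr0 addr0 subrr !scaler0.
Qed.
End OneFormFunctionals.

Section Composition.
Variable K : fieldType.
Definition lcomp (A B C : algType K) (f : {lrmorphism B -> C}) (g : {lrmorphism A -> B}) :
  {lrmorphism A -> C} := [the {lrmorphism A -> C} of f \o g].
Lemma lcompE (A B C : algType K) (f : {lrmorphism B -> C}) (g : {lrmorphism A -> B}) x :
  lcomp f g x = f (g x).
Proof. by []. Qed.
Lemma lcomp_dga (A B C : dgaType K) (f : {lrmorphism B -> C}) (g : {lrmorphism A -> B}) :
  dga_map f -> dga_map g -> dga_map (lcomp f g).
Proof. by move=> [f1 f2] [g1 g2]; split=> *; rewrite !lcompE ?g1 ?g2 ?f1 ?f2. Qed.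
End Composition.

Section Slices.
Variables (K : fieldType) (V W : lmodType K) (phi : V -> K^o).
Hypothesis lphi : linear phi.
Lemma slice_bilin : bilin (fun v (w : W) => (phi v : K) *: w).
Proof.
split=> z k a b /=; first by rewrite lphi scalerDl scalerA.
by rewrite scalerDr !scalerA mulrC.
Qed.
Definition slice : tensor V W -> W := tlift (fun v w => (phi v : K) *: w).
Lemma sliceE v w : slice (v \ox w) = (phi v : K) *: w.
Proof. exact: tlift_tens slice_bilin. Qed.
Lemma slice_linear : linear slice. Proof. exact: tlift_linear slice_bilin. Qed.
End Slices.

Section CounitSlice.
Variables (K : fieldType) (V W : dgaType K) (e : {lrmorphism V -> K^o}).
Hypothesis e_homog : forall n v, homog n.+1 v -> e v = 0.
Let cut : stensor V W -> W := slice e.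
Let l : linear cut. Proof. exact: slice_linear (lrm_linear e). Qed.
Let sE v w : cut (v \ox w) = (e v : K) *: w. Proof. exact: sliceE (lrm_linear e) _ _. Qed.
Let m : monoid_morphism cut.
Proof.
apply: stensor_monoid; first exact: l.
  by rewrite [LHS]sE lrm1 scale1r.
move=> p n a b p' n' a' b' ha hb ha' hb'.
rewrite (stensM _ _ hb ha') (linZ _ _ l) !sE lrmM.
case: p' ha' => [|p'] ha'; first by rewrite muln0 scale1r -scalerAl -scalerAr scalerA.
by rewrite (e_homog ha') mulr0 !scale0r scaler0 mulr0.
Qed.
(** Slicing along a counit is multiplicative because the counit kills positive degrees, exactly
    where a Koszul sign could occur. *)
Definition counit_slice : {lrmorphism stensor V W -> W} := lrm_of l m.
Lemma counit_sliceE v w : counit_slice (v \ox w) = (e v : K) *: w.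
Proof. exact: sE. Qed.
Lemma counit_slice_dga : dga_map counit_slice.
Proof.
apply: stensor_dga_map => p n a b ha hb; rewrite ?counit_sliceE.
  case: p ha => [|p] ha; first by rewrite add0n; apply: homogZ.
  by rewrite (e_homog ha) scale0r; exact: homog0.
rewrite (stens_dif _ ha) lrmD lrmZ !counit_sliceE (e_homog (homog_dif ha)) scale0r add0r difZ.
by case: p ha => [|p] ha; rewrite ?scale1r // (e_homog ha) !scale0r scaler0.
Qed.
End CounitSlice.

(* Slicing the relations of Omega(U(b_+)) along functionals that separate low
   order terms turns the existence of the extended coaction into relations in W. *)
Section Universality.
Variables (K : fieldType) (lam : K) (W : dgaType K) (c s a0 a1 : W).
Hypotheses (lam0 : lam != 0) (two_neq0 : 2%:R != 0 :> K).
Hypotheses (hc : homog 0 c) (hs : homog 0 s) (h0 : homog 0 a0) (h1 : homog 0 a1).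
Hypothesis rP : Poinc_rel lam c s a0 a1.
Local Notation OUb := (OmegaUb lam).
Local Notation t := (oua0 lam).
Local Notation x := (oua1 lam).
Variable f : {lrmorphism OUb -> stensor OUb W}.
Hypotheses (df : dga_map f) (f0 : f t = coact0 t x c s a0) (f1 : f x = coact1 t x c s a1).
Local Notation T := (stensor OUb W).

Let ht := homog_oua0 lam.
Let hx := homog_oua1 lam.
Let rV := OmegaUb_sat lam.
Let rF : OmegaUb_rel lam (coact0 t x c s a0) (coact1 t x c s a1) (f (outh lam)).
Proof. by rewrite -f0 -f1; apply: OmegaUb_rel_map df _ _ _ rV. Qed.

Let e_homog n v : homog n.+1 v -> OUb_counit lam v = 0.
Proof. by move=> <-; rewrite counit_gprU. Qed.
(** Applying the counit to the first leg of the coaction sends t, x to a_0, a_1. It therefore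
    defines theta' in [W] and transports all the relations of Omega(U(b_+)) at once. *)
Let cut := lcomp (@counit_slice K OUb W _ e_homog) f.
Let cut_dga : dga_map cut.
Proof. exact: lcomp_dga (@counit_slice_dga K OUb W _ e_homog) df. Qed.
Definition coact_th : W := cut (outh lam).
Let th := coact_th.
Let rU : OmegaUb_rel lam a0 a1 th.
Proof.
have e0 : cut t = a0.
  rewrite lcompE f0 /coact0 !lrmD !counit_sliceE lrm1 !(OUb_counitE (lam := lam)) scale1r.
  by rewrite !scale0r !addr0.
have e1 : cut x = a1.
  rewrite lcompE f1 /coact1 !lrmD !counit_sliceE lrm1 !(OUb_counitE (lam := lam)) scale1r.
  by rewrite !scale0r !addr0.
by rewrite -{1}e0 -{1}e1; apply: OmegaUb_rel_map cut_dga _ _ _ rV.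
Qed.
Lemma homog_coact_th : homog 1 coact_th.
Proof. exact: dga_map_homog cut_dga (homog_outh lam). Qed.

Let dc := dif c.
Let ds := dif s.
Let b0 := dif a0.
Let b1 := dif a1.
Let dt := dif t.
Let dx := dif x.
Let hdc : homog 1 dc. Proof. exact: homog_dif. Qed.
Let hds : homog 1 ds. Proof. exact: homog_dif. Qed.
Let hb0 : homog 1 b0. Proof. exact: homog_dif. Qed.
Let hb1 : homog 1 b1. Proof. exact: homog_dif. Qed.
Let hdt : homog 1 dt. Proof. exact: homog_dif. Qed.
Let hdx : homog 1 dx. Proof. exact: homog_dif. Qed.
Let o1 := homog1 OUb.
Let o1' := homog1 W.

Let M0 := (fun a e f => @stensM0l K OUb W a e c f hc,
  fun a e f => @stensM0l K OUb W a e s f hs, fun a e f => @stensM0l K OUb W a e a0 f h0,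
  fun a e f => @stensM0l K OUb W a e a1 f h1,
  fun a b f => @stensM0r K OUb W a 1 b f o1, fun a b f => @stensM0r K OUb W a t b f ht,
  fun a b f => @stensM0r K OUb W a x b f hx).
Let M11 := (
   fun a f => @stensM11 K OUb W a dt dc f hdc hdt, fun a f => @stensM11 K OUb W a dt ds f hds hdt,
   fun a f => @stensM11 K OUb W a dt b0 f hb0 hdt, fun a f => @stensM11 K OUb W a dt b1 f hb1 hdt,
   fun a f => @stensM11 K OUb W a dx dc f hdc hdx, fun a f => @stensM11 K OUb W a dx ds f hds hdx,
   fun a f => @stensM11 K OUb W a dx b0 f hb0 hdx, fun a f => @stensM11 K OUb W a dx b1 f hb1 hdx).
Let difE : (dif (coact0 t x c s a0) = 1 \ox b0 + dt \ox c + dx \ox s + t \ox dc + x \ox ds) *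
  (dif (coact1 t x c s a1) = 1 \ox b1 + dt \ox s + dx \ox c + t \ox ds + x \ox dc).
Proof. by rewrite dif_coact0 // dif_coact1. Qed.

Section Degree0.
Variables (phi : OUb -> K^o) (v1 vt vx vtt vtx vxt vxx : K).
Hypothesis h : coef0 phi v1 vt vx vtt vtx vxt vxx.
Let lphi := coef0_linear h.
Let sl := slice_linear (W := W) lphi.
Let sD := linD sl. Let sN := lin_opp sl. Let sZ k := (fun z => linZ k z sl).
Let s0 := lin0 sl.
Let kill v : homog 1 v -> phi v = 0. Proof. exact: coef0_homog h 0 v. Qed.
Let vals := (coef0_1 h, coef0_t h, coef0_x h, coef0_tt h, coef0_tx h, coef0_xt h, coef0_xx h,
  kill hdt, kill hdx, kill (homogM ht hdt), kill (homogM ht hdx), kill (homogM hx hdt),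
  kill (homogM hx hdx), kill (homogM hdt ht), kill (homogM hdt hx), kill (homogM hdx ht),
  kill (homogM hdx hx)).

(** The relation [dx, t] = 0 for the coacted elements; as [phi] vanishes on one-forms, only the
    terms whose form degree lies in [W] survive. *)
Lemma slice_dx_t : vt *: (com b1 c + com ds a0) + vx *: (com b1 s + com dc a0)
  + vtt *: com ds c + vxx *: com dc s + v1 *: com b1 a0
  + (vtx *: (ds * s) - vxt *: (s * ds)) + (vxt *: (dc * c) - vtx *: (c * dc)) = 0.
Proof.
have := congr1 (slice phi) (OUb_d1_0 rF); rewrite s0 => <-.
rewrite /com difE /coact0 ?(mulrDl, mulrDr, M0, mul1r, mulr1) !(sD, sN) !(sliceE lphi) !vals.
by rewrite ?scale0r; apply: scalar_ext => psi; ring.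
Qed.
Lemma slice_dt_x : vt *: (com b0 s + com dc a1) + vx *: (com b0 c + com ds a1)
  + vtt *: com dc s + vxx *: com ds c + v1 *: com b0 a1
  + (vtx *: (dc * c) - vxt *: (c * dc)) + (vxt *: (ds * s) - vtx *: (s * ds)) =
  lam *: (v1 *: b1 + vt *: ds + vx *: dc).
Proof.
have <- : slice phi (lam *: dif (coact1 t x c s a1)) = lam *: (v1 *: b1 + vt *: ds + vx *: dc).
  by rewrite sZ difE !sD !(sliceE lphi) !vals !scale0r !addr0.
rewrite -(OUb_d0_1 rF).
rewrite /com difE /coact1 ?(mulrDl, mulrDr, M0, mul1r, mulr1) !(sD, sN) !(sliceE lphi) !vals.
by rewrite ?scale0r; apply: scalar_ext => psi; ring.
Qed.
End Degree0.

Let dcs : dc * s = s * dc.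
Proof.
have := slice_dx_t (coef_xxE lam).
by rewrite !scale0r !scale1r !(addr0, add0r, subrr, subr0) => /comC_eq.
Qed.
Let dsc : ds * c = c * ds.
Proof.
have := slice_dt_x (coef_xxE lam).
by rewrite !scale0r !scale1r !(addr0, add0r, subrr, subr0, scaler0) => /comC_eq.
Qed.
(** The coefficient of x t only ties the two commutators together; that each vanishes takes the
    algebraic argument of [dcc]. *)
Let dss_dcc : com ds s = - com dc c.
Proof.
have := slice_dx_t (coef_xtE lam0).
rewrite !scale0r !scale1r !(addr0, add0r, subrr, subr0, scaler0) => /eqP.
by rewrite addr_eq0 => /eqP.
Qed.
Let d1c : com b1 c = com a0 ds.
Proof.
have := slice_dx_t (coef_tE lam0 two_neq0).
rewrite !scale0r !scale1r !(addr0, add0r, subrr, subr0, scaler0) => /eqP.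
by rewrite addr_eq0 /com opprB => /eqP.
Qed.
Let cs : c * s = s * c := (Poinc_SO rP).1.
Let c2 : c * c = s * s + 1.
Proof. by have [_ <-] := Poinc_SO rP; rewrite -!expr2 addrC subrK. Qed.
Let comM (u v w : W) : com u (v * w) = com u v * w + v * com u w.
Proof. by rewrite /com mulrBl mulrBr !mulrA addrA subrK. Qed.
Let com_comC (u v w : W) : com u w = 0 -> com v w = 0 -> com (com u v) w = 0.
Proof.
move=> /comC_eq uw /comC_eq vw.
by rewrite /com mulrBl mulrBr -!mulrA uw vw !mulrA uw vw subrr.
Qed.
Let com_addl (u v w : W) : com u (v + w) = com u v + com u w.
Proof. by rewrite /com mulrDr mulrDl opprD addrACA. Qed.
Let com1 (u : W) : com u 1 = 0. Proof. by rewrite /com mulr1 mul1r subrr. Qed.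
Let comC0 (u v : W) : u * v = v * u -> com u v = 0.
Proof. by rewrite /com => ->; rewrite subrr. Qed.
(* The commutator [dc, c] = - [ds, s] commutes and anticommutes with c and s. *)
Let dcc : com dc c = 0.
Proof.
set u := com dc c.
have anti y : y * u + u * y = 0 -> com u y = 0 -> y * u = 0.
  move=> h1' /comC_eq h2; apply: (double_eq0 two_neq0).
  by move: h1'; rewrite h2.
have su : s * u = 0.
  apply: anti; last by apply: com_comC; apply: comC0.
  (* As s^2 = c^2 - 1 and ds commutes with c, it commutes with s^2; expanding this commutator shows
     that s anticommutes with [ds, s] = - u. *)
  have : com ds (s * s) = 0.
    have -> : s * s = c * c + (- 1) by rewrite c2 addrK.
    by rewrite com_addl comM (comC0 dsc) mul0r mulr0 addr0 add0r /com mulrN1 mulN1r subrr.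
  by rewrite comM dss_dcc -/u mulNr mulrN -opprD addrC => /eqP; rewrite oppr_eq0 => /eqP.
have cu : c * u = 0.
  apply: anti.
    have : com dc (c * c) = 0.
      by rewrite c2 com_addl comM com1 (comC0 dcs) mul0r mulr0 !addr0.
    by rewrite comM -/u addrC.
  have -> : u = - com ds s by rewrite dss_dcc opprK.
  have h : com (com ds s) c = 0 by apply: com_comC; apply: comC0.
  by rewrite /com mulNr mulrN -opprD; move: h; rewrite /com => h; rewrite [X in - X]h oppr0.
by rewrite -[u]mul1r -(Poinc_SO rP).2 mulrBl !expr2 -!mulrA su cu !mulr0 subrr.
Qed.
Let dss : com ds s = 0. Proof. by rewrite dss_dcc dcc oppr0. Qed.
(** Differentiating c^2 = s^2 + 1 gives 2 c dc = 2 s ds once dc commutes with c and ds with s. *)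
Let cdc : c * dc = s * ds.
Proof.
apply/eqP; rewrite -subr_eq0; apply/eqP/(double_eq0 two_neq0).
have := congr1 dif c2; rewrite difD !dif0M // dif1 addr0 -/dc -/ds.
rewrite (comC_eq dcc) (comC_eq dss) => h.
by rewrite addrACA -opprD h subrr.
Qed.
Let rS : OmegaSO_rel c s.
Proof.
split; [exact: Poinc_SO rP|exact: dcs|exact: dsc| |exact: cdc|].
- exact: comC_eq dcc.
- exact: esym (comC_eq dss).
Qed.
Let d1s : com b1 s = com a0 dc.
Proof.
have := slice_dx_t (coef_xE lam).
rewrite !scale0r !scale1r !(addr0, add0r, sub0r, subr0, scaler0).
(* The functional [coef_x] takes the value lam on t x; the resulting term lam (ds s - c dc) vanishes
   by [dss] and [cdc]. *)
rewrite (comC_eq dss) cdc -addrA subrr addr0 => /eqP.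
by rewrite addr_eq0 /com opprB => /eqP.
Qed.

Section Degree1.
Variables (phi : OUb -> K^o) (vt vx : K).
Hypothesis h : coef1 phi vt vx.
Let lphi := coef1_linear h.
Let sl := slice_linear (W := W) lphi.
Let sD := linD sl. Let sN := lin_opp sl.
Let kill0 v : homog 0 v -> phi v = 0. Proof. by move=> hv; apply: (coef1_homog h hv). Qed.
Let kill2 v : homog 2 v -> phi v = 0. Proof. by move=> hv; apply: (coef1_homog h hv). Qed.
Let vals := (coef1_dt h, coef1_dx h, coef1_th h, kill0 o1, kill0 ht, kill0 hx,
  kill0 (homogM ht ht), kill0 (homogM ht hx), kill0 (homogM hx ht), kill0 (homogM hx hx),
  kill2 (homogM hdt hdx)).
Let nV := (comE (OUb_d1_1 rV : com dx x = lam *: outh lam),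
  comE (OUb_d1_0 rV : com dx t = 0), comE (OUb_d0_1 rV : com dt x = lam *: dx),
  comE (OUb_d0_0 rV : com dt t = lam *: (dt - outh lam))).
Let nV2 : (dx * dx = 0) * (dt * dt = 0) * (dx * dt = - (dt * dx)).
Proof. by case: rV => *; rewrite /dx /dt -!expr2. Qed.

(** The square of the coacted dx. Koszul signs turn its cross terms into commutators: [da_1, s] and
    [da_1, c] stand against dt and dx, while [dt, t] and [dt, x] contribute lam dt and lam dx modulo
    theta', which [phi] kills. *)
Lemma slice_dx_dx : vt *: com b1 s + vx *: com b1 c = lam *: (vt *: (s * ds) + vx *: (s * dc)).
Proof.
have := congr1 (slice phi) (OUb_d1d1 rF); rewrite (lin0 sl).
rewrite expr2 difE ?(mulrDl, mulrDr, M0, M11, mul1r, mulr1, nV, nV2, addr0).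
rewrite (comC_eq dcc) (comC_eq dss) dcs dsc cdc.
rewrite ?(scalerBr, tensDl, tensNl, tensZl, tens0l) !(sD, sN) ?(linZ _ _ sl) !(sliceE lphi).
rewrite ?(linD lphi) ?(lin_opp lphi) ?(linZ _ _ lphi) !vals => e.
apply/eqP; rewrite -subr_eq0; apply/eqP; rewrite -[RHS]oppr0 -[in RHS]e.
have s0 : slice phi (0 : T) = 0 by exact: lin0 sl.
rewrite /com ?s0 ?(lin0 sl) ?scale0r ?scaler0.
apply: scalar_ext => psi; ring.
Qed.
End Degree1.

Let d1s' : com b1 s = lam *: (s * ds).
Proof.
by have := slice_dx_dx (coef_dtE lam0); rewrite !scale0r !scale1r !addr0.
Qed.
Let d1c' : com b1 c = lam *: (s * dc).
Proof.
by have := slice_dx_dx (coef_dxE lam0); rewrite !scale0r !scale1r !add0r.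
Qed.
Let e0dc : com a0 dc = lam *: (s * ds). Proof. by rewrite -d1s. Qed.
Let e0ds : com a0 ds = lam *: (s * dc). Proof. by rewrite -d1c. Qed.
Let dif_com0 (u v : W) : homog 0 u -> homog 0 v -> dif (com u v) = com (dif u) v + com u (dif v).
Proof.
by move=> hu hv; rewrite /com difD difN !dif0M // opprD [- _ - _]addrC addrACA.
Qed.
Let dif_com1 (u v : W) : homog 0 u -> homog 0 v -> dif (com u (dif v)) = anticom (dif u) (dif v).
Proof.
move=> hu hv; rewrite /com /anticom difD difN (dif0M _ hu) (dif1M _ (homog_dif hv)) !difK.
by rewrite mulr0 addr0 mul0r sub0r opprK.
Qed.
Let homog_c1 : homog 0 (c - 1).
Proof. by rewrite -scaleN1r; apply: homogD hc (homogZ _ (homog1 W)). Qed.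
Let dif_c1 : dif (c - 1) = dc. Proof. by rewrite difD difN dif1 oppr0 addr0. Qed.
Let sds : ds * s = s * ds. Proof. exact: comC_eq dss. Qed.
Let ccd : dc * c = s * ds. Proof. by rewrite (comC_eq dcc). Qed.
Let solve (u v w : W) : u + v = w + v -> u = w. Proof. exact: addIr. Qed.

(** Differentiating a cross relation [a, y] of degree 0 gives [da, y] + [a, dy]. One of the two is
    known by now, so this and the next three lemmas solve for the other. *)
Let d0c : com b0 c = lam *: (c * dc).
Proof.
apply: (@solve _ (com a0 dc)); rewrite -dif_com0 // (Poinc_a0c rP) expr2 difZ dif0M // e0dc.
by rewrite -/ds sds cdc scalerDr.
Qed.
Let d0s : com b0 s = lam *: (c * ds).
Proof.
apply: (@solve _ (com a0 ds)); rewrite -dif_com0 // (Poinc_a0s rP) difZ dif0M // e0ds.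
by rewrite -/ds -/dc dsc scalerDr.
Qed.
Let e1dc : com a1 dc = lam *: ((c - 1) * ds).
Proof.
apply: (@solve _ (com b1 c)); rewrite addrC -dif_com0 // (Poinc_a1c rP) difZ dif0M // d1c'.
by rewrite dif_c1 dcs scalerDr addrC.
Qed.
Let e1ds : com a1 ds = lam *: ((c - 1) * dc).
Proof.
apply: (@solve _ (com b1 s)); rewrite addrC -dif_com0 // (Poinc_a1s rP) difZ dif0M // d1s'.
by rewrite dif_c1 ccd scalerDr addrC.
Qed.
Let dsds : ds * ds = 0. Proof. exact: OSO_dsds rS. Qed.
Let dcdc : dc * dc = 0. Proof. exact: OSO_dcdc rS. Qed.
Let dcds : dc * ds = 0. Proof. exact: OSO_dcds rS. Qed.

Let nrm := (comE (Poinc_a1c rP), comE (Poinc_a1s rP), comE (Poinc_a0c rP), comE (Poinc_a0s rP),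
  comE d1c', comE d1s', comE e1dc, comE e1ds, cdc, dcs, dsc, sds, ccd, cs, c2).
Let dcE : s * (c * ds - s * dc) = dc. Proof. exact: OSO_dcE rS. Qed.
Let ssdc : s * s * dc = c * (s * ds) - dc.
Proof.
have -> : s * s = c * c - 1 by rewrite c2 addrK.
by rewrite mulrBl mul1r -mulrA cdc.
Qed.
Let thE : lam *: th = b1 * a1 - a1 * b1. Proof. by rewrite -(OUb_d1_1 rU). Qed.
(** The Jacobi identity for lam theta' = [da_1, a_1], with z = [a_1, y] and z' = [da_1, y]. *)
Let thM y z z' : a1 * y = y * a1 + z -> b1 * y = y * b1 + z' ->
  lam *: com th y = com b1 z - com a1 z'.
Proof.
move=> e1 e2.
have e : a1 * b1 = b1 * a1 - lam *: th by rewrite thE opprB addrC subrK.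
rewrite /com scalerBr scalerAl scalerAr thE !mulrBl mulrBr -!mulrA e1 e2.
rewrite !mulrDr ![_ * (_ * a1)]mulrA ![_ * (_ * b1)]mulrA e1 e2 !mulrDl -!mulrA.
by apply: scalar_ext => psi; ring.
Qed.
Let comZ (u v : W) k : com u (k *: v) = k *: com u v.
Proof. by rewrite /com -scalerAr -scalerAl scalerBr. Qed.
Let comB1 (u : W) : com u (c - 1) = com u c.
Proof. by rewrite /com mulrBr mulrBl mulr1 mul1r opprB addrA subrK. Qed.
Let ccds : c * (c * ds) = c * (s * dc) + ds.
Proof.
have e : c * (c * ds - s * dc) = ds by exact: OSO_dsE rS.
by rewrite -[X in _ = _ + X]e mulrBr addrC subrK.
Qed.
Let sdc_s : s * (dc * s) = c * (c * dc) - dc.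
Proof. by rewrite dcs mulrA ssdc cdc. Qed.

Let thc : com th c = lam *: ((c - 1) * dc).
Proof.
apply: (scalerI lam0); rewrite (thM (comE (Poinc_a1c rP)) (comE d1c')).
rewrite !comZ !comM comB1 d1c' d1s' e1dc (Poinc_a1s rP) -/dc -/ds.
rewrite -!(scalerAl, scalerAr) !(mulrBl, mulrBr, mul1r, mulr1) -!mulrA sdc_s -?cdc.
rewrite ?[s * (c * _)]mulrA -?cs -?[c * s * _]mulrA -?cdc.
by apply: scalar_ext => psi; ring.
Qed.
Let ths : com th s = lam *: ((c - 1) * ds).
Proof.
apply: (scalerI lam0); rewrite (thM (comE (Poinc_a1s rP)) (comE d1s')).
rewrite !comZ !comM comB1 d1c' e1ds (Poinc_a1s rP) -/dc -/ds.
rewrite -!(scalerAl, scalerAr) !(mulrBl, mulrBr, mul1r, mulr1) -!mulrA ccd -cdc.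
rewrite ?[s * (c * _)]mulrA -?cs -?[c * s * _]mulrA ccds.
by apply: scalar_ext => psi; ring.
Qed.

Lemma OmegaPoinc_coact : OmegaPoinc_rel lam c s a0 a1 coact_th.
Proof.
(* Differentiating [a, dy] gives {da, dy}, so the degree 2 relations follow from those of degree
   1. *)
have dz (u v : W) k z : com u (dif v) = k *: z -> homog 0 u -> homog 0 v ->
    anticom (dif u) (dif v) = k *: dif z.
  by move=> e hu hv; rewrite -dif_com1 // e difZ.
split.
- exact: rP.
- exact: rU.
- exact: rS.
- exact: d0c.
- exact: d0s.
- exact: d1c'.
- exact: d1s'.
- exact: e0dc.
- exact: e0ds.
- exact: e1dc.
- exact: e1ds.
- exact: thc.
- exact: ths.
- by rewrite (dz _ _ _ _ e0dc) // dif0M // difK mulr0 addr0 [dif s * _]dsds scaler0.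
- by rewrite (dz _ _ _ _ e0ds) // dif0M // difK mulr0 addr0.
- by rewrite (dz _ _ _ _ e1dc) // dif0M // difK mulr0 addr0 dif_c1.
- by rewrite (dz _ _ _ _ e1ds) // dif0M // difK mulr0 addr0 dif_c1 dcdc scaler0.
Qed.
End Universality.

(** * Coproducts *)

Lemma tmap0E (K : fieldType) (A B : algType K) (V W : dgaType K) (f : {lrmorphism A -> V})
  (g : {lrmorphism B -> W}) (hf : forall a, homog 0 (f a)) (hg : forall b, homog 0 (g b)) a b :
  tmap0 hf hg (a \ox b) = f a \ox g b.
Proof. exact: tmapE. Qed.

Section Coproducts.
Variables (K : fieldType) (lam : K).
Hypotheses (lam0 : lam != 0) (two_neq0 : 2%:R != 0 :> K).
Local Notation SO := (SO K).
Local Notation Ub := (Ub lam).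
Local Notation Poinc := (Poinc lam).
Local Notation OSO := (OmegaSO K).
Local Notation OUb := (OmegaUb lam).
Local Notation OP := (OmegaPoinc lam).
Local Notation gP := (@pgen K (Poinc_pres lam)).
Local Notation gS := (@pgen K (SO_pres K)).
Local Notation t := (oua0 lam).
Local Notation x := (oua1 lam).
Local Notation c := (opc lam).
Local Notation s := (ops lam).
Local Notation a0 := (opa0 lam).
Local Notation a1 := (opa1 lam).
Local Notation th := (opth lam).

Lemma SO_rel_map (A B : algType K) (f : {lrmorphism A -> B}) c' s' :
  SO_rel c' s' -> SO_rel (f c') (f s').
Proof.
by rewrite /SO_rel !expr2 => -[e1 e2]; rewrite -!lrmM -lrmB e1 e2 lrm1.
Qed.
Lemma Poinc_rel_map (A B : algType K) (f : {lrmorphism A -> B}) c' s' a0' a1' :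
  Poinc_rel lam c' s' a0' a1' -> Poinc_rel lam (f c') (f s') (f a0') (f a1').
Proof.
case; rewrite /Ub_rel /com ?expr2 => r e3 e4 e5 e6 e7.
split; rewrite /Ub_rel /com; first exact: SO_rel_map.
all: rewrite ?expr2 -?(lrm1 f) -?(lrmM, lrmB) -?(lrmM, lrmB) -?(lrmM, lrmB) -lrmZ; by congr (f _).
Qed.

Lemma homog_coact0 (V W : dgaType K) (u v : V) (c' s' b : W) : homog 0 u -> homog 0 v ->
  homog 0 c' -> homog 0 s' -> homog 0 b -> homog 0 (1 \ox b + u \ox c' + v \ox s' : stensor V W).
Proof.
move=> hu hv hc hs hb; apply: homogD; first apply: homogD.
- exact: homog_tens (homog1 V) hb.
- exact: homog_tens hu hc.
- exact: homog_tens hv hs.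
Qed.
Lemma homog_coactth (V W : dgaType K) (u v w : V) (c' s' b : W) : homog 0 u -> homog 0 v ->
  homog 1 w -> homog 0 c' -> homog 0 s' -> homog 1 b -> homog 1 (coactth u v w c' s' b).
Proof.
move=> hu hv hw hc hs hb; rewrite /coactth -scaleN1r.
do ![apply: homogD|apply: homogZ].
- exact: homog_tens (homog1 V) hb.
- exact: homog_tens hw (homog1 W).
- exact: homog_tens (homog_dif hu) (homog1 W).
- exact: homog_tens (homog_dif hu) hc.
- exact: homog_tens (homog_dif hv) hs.
- exact: homog_tens hu (homog_dif hc).
- exact: homog_tens hv (homog_dif hs).
Qed.

Let hc := homog_opc lam. Let hs := homog_ops lam.
Let h0 := homog_opa0 lam. Let h1 := homog_opa1 lam. Let hth := homog_opth lam.
Let ht := homog_oua0 lam. Let hx := homog_oua1 lam. Let hv := homog_outh lam.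
Let rP := OmegaPoinc_sat lam.
Let rU := OmegaUb_sat lam.

Definition OUb_coaction : {lrmorphism OUb -> stensor OUb OP} :=
  dlift (@OUb_dsat K lam (stensor OUb OP) _ _ _
   (homog_coact0 ht hx hc hs h0) (homog_coact0 ht hx hs hc h1) (homog_coactth ht hx hv hc hs hth)
   (OmegaUb_coact two_neq0 ht hx hv hc hs h0 h1 hth rU rP)).
Lemma OUb_coaction_dga : dga_map OUb_coaction. Proof. exact: dlift_dga_map. Qed.
Lemma OUb_coactionE k : OUb_coaction (pdgen k) = match k with OUa0 => coact0 t x c s a0
  | OUa1 => coact1 t x c s a1 | OUth => coactth t x (outh lam) c s th end.
Proof. by rewrite [LHS]dlift_gen; case: k. Qed.

(** The coproduct of C_lam[Poinc] viewed in degree 0 of the super tensor product; it transports the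
    degree 0 relations there without a new computation. *)
Let Pcop : {lrmorphism Poinc -> stensor OP OP} :=
  lcomp (tmap0 (Poinc_inc_homog (lam := lam)) (Poinc_inc_homog (lam := lam))) (Poinc_cop lam).
Let C : stensor OP OP := c \ox c + s \ox s.
Let S : stensor OP OP := c \ox s + s \ox c.
Let A0 : stensor OP OP := coact0 a0 a1 c s a0.
Let A1 : stensor OP OP := coact1 a0 a1 c s a1.
Lemma Poinc_inc_c : Poinc_inc lam (pc lam) = c. Proof. exact: Poinc_incE Pc. Qed.
Lemma Poinc_inc_s : Poinc_inc lam (ps lam) = s. Proof. exact: Poinc_incE Ps. Qed.
Lemma Poinc_inc_a0 : Poinc_inc lam (pa0 lam) = a0. Proof. exact: Poinc_incE Pa0. Qed.
Lemma Poinc_inc_a1 : Poinc_inc lam (pa1 lam) = a1. Proof. exact: Poinc_incE Pa1. Qed.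
Let PcopE k : Pcop (gP k) = match k with Pc => C | Ps => S | Pa0 => A0 | Pa1 => A1 end.
Proof.
rewrite lcompE [Poinc_cop _ _]alift_gen.
by case: k; rewrite !lrmD !tmap0E ?(lrm1 (Poinc_inc lam)) ?Poinc_inc_c ?Poinc_inc_s
  ?Poinc_inc_a0 ?Poinc_inc_a1.
Qed.
Let rPC : Poinc_rel lam C S A0 A1.
Proof.
have := Poinc_rel_map Pcop (Poinc_sat lam).
rewrite [Pcop (pc _)](PcopE Pc) [Pcop (ps _)](PcopE Ps) [Pcop (pa0 _)](PcopE Pa0).
by rewrite [Pcop (pa1 _)](PcopE Pa1).
Qed.
Let hC : homog 0 C. Proof. by apply: homogD; [exact: homog_tens hc hc|exact: homog_tens hs hs]. Qed.
Let hS : homog 0 S. Proof. by apply: homogD; [exact: homog_tens hc hs|exact: homog_tens hs hc]. Qed.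
Let hA0 : homog 0 A0. Proof. exact: homog_coact0. Qed.
Let hA1 : homog 0 A1. Proof. exact: homog_coact0. Qed.

(** On t and x it has again the shape of the coaction, with c, s, a_0, a_1 replaced by their
    coproducts, so [OmegaPoinc_coact] applies with coefficients in the super tensor square. *)
Let rs2 : {lrmorphism OUb -> stensor OUb (stensor OP OP)} :=
  lcomp (stassoc OUb OP OP) (lcomp (stmap OUb_coaction_dga (idlrm_dga OP)) OUb_coaction).
Let rs2_dga : dga_map rs2.
Proof. exact: lcomp_dga (stassoc_dga _ _ _) (lcomp_dga (stmap_dga _ _) OUb_coaction_dga). Qed.
Let rs2_t : rs2 t = coact0 t x C S A0.
Proof.
rewrite !lcompE [OUb_coaction t](OUb_coactionE OUa0) !lrmD !stmapE [OUb_coaction t](OUb_coactionE OUa0) [OUb_coaction x](OUb_coactionE OUa1) lrm1.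
rewrite !tensDl !lrmD !stassocE /coact0 !tensDr.
by apply: scalar_ext => phi; ring.
Qed.
Let rs2_x : rs2 x = coact1 t x C S A1.
Proof.
rewrite !lcompE [OUb_coaction x](OUb_coactionE OUa1) !lrmD !stmapE [OUb_coaction t](OUb_coactionE OUa0) [OUb_coaction x](OUb_coactionE OUa1) lrm1.
rewrite !tensDl !lrmD !stassocE /coact1 !tensDr.
by apply: scalar_ext => phi; ring.
Qed.
Let TH : stensor OP OP := coact_th rs2.
Let rC : OmegaPoinc_rel lam C S A0 A1 TH.
Proof. exact: OmegaPoinc_coact lam0 two_neq0 hC hS hA0 hA1 rPC rs2 rs2_dga rs2_t rs2_x. Qed.

Definition OP_cop : {lrmorphism OP -> stensor OP OP} :=
  dlift (OP_dsat hC hS hA0 hA1 (homog_coact_th rs2_dga) rC).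
Lemma OP_cop_dga : dga_map OP_cop. Proof. exact: dlift_dga_map. Qed.
Lemma OP_cop_c : OP_cop c = c \ox c + s \ox s. Proof. exact: dlift_gen. Qed.
Lemma OP_cop_s : OP_cop s = c \ox s + s \ox c. Proof. exact: dlift_gen. Qed.
Lemma OP_cop_0 : OP_cop a0 = 1 \ox a0 + a0 \ox c + a1 \ox s. Proof. exact: dlift_gen. Qed.
Lemma OP_cop_1 : OP_cop a1 = 1 \ox a1 + a0 \ox s + a1 \ox c. Proof. exact: dlift_gen. Qed.
(** So far the coproduct of theta' is known only as a counit slice; after multiplication by lam both
    sides are the commutator [da_1, a_1] of coproducts. *)
Lemma OP_cop_th : OP_cop th = coactth a0 a1 th c s th.
Proof.
apply: (scalerI lam0).
have <- := OUb_d1_1 (OmegaUb_coact two_neq0 h0 h1 hth hc hs h0 h1 hth (OP_Ub rP) rP).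
rewrite -lrmZ -(OUb_d1_1 (OP_Ub rP)) /com lrmB !lrmM OP_cop_dga.2.
by rewrite -/(coact1 a0 a1 c s a1) OP_cop_1.
Qed.
Lemma OP_cop_inc a : OP_cop (Poinc_inc lam a) = tmap (Poinc_inc lam) (Poinc_inc lam) (Poinc_cop lam a).
Proof.
rewrite -[RHS]/(Pcop a); apply: (@alg_generated_ext K _ _ _ _ (lcomp OP_cop (Poinc_inc lam)) Pcop
   (@Poinc_generated K lam)) => k.
by rewrite lcompE PcopE Poinc_incE; case: k; rewrite ?OP_cop_c ?OP_cop_s ?OP_cop_0 ?OP_cop_1.
Qed.

End Coproducts.

Section CounitSliceRight.
Variables (K : fieldType) (V W : dgaType K) (e : {lrmorphism W -> K^o}).
Hypothesis e_homog : forall n v, homog n.+1 v -> e v = 0.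
Let b : bilin (fun (v : V) (w : W) => (e w : K) *: v).
Proof.
split=> z k x y /=; first by rewrite scalerDr !scalerA mulrC.
by rewrite lrmP scalerDl scalerA.
Qed.
Let cut : stensor V W -> V := tlift (fun v w => (e w : K) *: v).
Let l : linear cut. Proof. exact: tlift_linear. Qed.
Let sE v w : cut (v \ox w) = (e w : K) *: v. Proof. exact: tlift_tens. Qed.
Let m : monoid_morphism cut.
Proof.
apply: stensor_monoid; first exact: l.
  by rewrite [LHS]sE lrm1 scale1r.
move=> p n a z p' n' a' z' ha hz ha' hz'.
rewrite (stensM _ _ hz ha') (linZ _ _ l) !sE lrmM.
case: n hz => [|n] hz; first by rewrite mul0n scale1r -scalerAl -scalerAr scalerA.
by rewrite (e_homog hz) mul0r !scale0r scaler0 mul0r.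
Qed.
Definition counit_slicer : {lrmorphism stensor V W -> V} := lrm_of l m.
Lemma counit_slicerE v w : counit_slicer (v \ox w) = (e w : K) *: v.
Proof. exact: sE. Qed.
Lemma counit_slicer_dga : dga_map counit_slicer.
Proof.
apply: stensor_dga_map => p n a z ha hz; rewrite ?counit_slicerE.
  case: n hz => [|n] hz; first by rewrite addn0; apply: homogZ.
  by rewrite (e_homog hz) scale0r; exact: homog0.
rewrite (stens_dif _ ha) lrmD lrmZ !counit_slicerE (e_homog (homog_dif hz)) scale0r scaler0 addr0.
by rewrite difZ.
Qed.
End CounitSliceRight.

Section Coalgebras.
Variables (K : fieldType) (W : dgaType K) (D : {lrmorphism W -> stensor W W})
  (e : {lrmorphism W -> K^o}) (X : Type) (g : X -> W).
Hypotheses (dD : dga_map D) (e_homog : forall n v, homog n.+1 v -> e v = 0).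
Hypotheses (gen : dga_generated g).
Let D2l := lcomp (stassoc W W W) (lcomp (stmap dD (idlrm_dga W)) D).
Let D2r := lcomp (stmap (idlrm_dga W) dD) D.
(** Both sides of each coalgebra axiom are DGA maps, so agreement on generators suffices. *)
Lemma dga_coalgebra :
  (forall k, stassoc W W W (stmap dD (idlrm_dga W) (D (g k))) = stmap (idlrm_dga W) dD (D (g k))) ->
  (forall k, @counit_slice K W W e e_homog (D (g k)) = g k) ->
  (forall k, @counit_slicer K W W e e_homog (D (g k)) = g k) ->
  coalgebra D e.
Proof.
move=> h1 h2 h3; split.
- apply: (@dga_generated_ext K _ _ _ _ D2l D2r _ _ gen) => //.
    exact: lcomp_dga (stassoc_dga _ _ _) (lcomp_dga (stmap_dga _ _) dD).
  exact: lcomp_dga (stmap_dga _ _) dD.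
- apply: (@dga_generated_ext K _ _ _ _ (lcomp (@counit_slice K W W e e_homog) D) (idlrm W) _ _ gen) => //.
  exact: lcomp_dga (@counit_slice_dga K W W e e_homog) dD.
- apply: (@dga_generated_ext K _ _ _ _ (lcomp (@counit_slicer K W W e e_homog) D) (idlrm W) _ _ gen) => //.
  exact: lcomp_dga (@counit_slicer_dga K W W e e_homog) dD.
Qed.
End Coalgebras.

(** * Coproducts of the two factors and their compatibility with the inclusions and the quotient *)

Section HopfMaps.
Variables (K : fieldType) (lam : K).
Hypotheses (lam0 : lam != 0) (two_neq0 : 2%:R != 0 :> K).
Local Notation SO := (SO K).
Local Notation Ub := (Ub lam).
Local Notation OSO := (OmegaSO K).
Local Notation OUb := (OmegaUb lam).
Local Notation OP := (OmegaPoinc lam).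
Local Notation gU := (@pgen K (Ub_pres lam)).
Local Notation gS := (@pgen K (SO_pres K)).
Local Notation t := (oua0 lam).
Local Notation x := (oua1 lam).
Local Notation oc := (osoc K).
Local Notation os := (osos K).
Local Notation c := (opc lam).
Local Notation s := (ops lam).
Local Notation a0 := (opa0 lam).
Local Notation a1 := (opa1 lam).
Local Notation th := (opth lam).
Local Notation D := (OP_cop lam0 two_neq0).
Local Notation jS := (jS lam).
Local Notation jU := (jU lam).
Local Notation qU := (qU lam).
Local Notation eS := (OSO_counit K).
Local Notation eU := (OUb_counit lam).
Local Notation eP := (OP_counit lam).

Lemma OSO_counit_homog n v : homog n.+1 v -> eS v = 0.
Proof. by move=> <-; rewrite counit_gprS. Qed.
Lemma OUb_counit_homog n v : homog n.+1 v -> eU v = 0.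
Proof. by move=> <-; rewrite counit_gprU. Qed.
Lemma OP_counit_homog n v : homog n.+1 v -> eP v = 0.
Proof. by move=> <-; rewrite counit_gprP. Qed.

Lemma jS_c : jS oc = c. Proof. exact: (@jSE K lam Sc). Qed.
Lemma jS_s : jS os = s. Proof. exact: (@jSE K lam Ss). Qed.
Lemma jU_0 : jU t = a0. Proof. exact: (@jUE K lam OUa0). Qed.
Lemma jU_1 : jU x = a1. Proof. exact: (@jUE K lam OUa1). Qed.
Lemma jU_th : jU (outh lam) = th. Proof. exact: (@jUE K lam OUth). Qed.
Lemma qU_c : qU c = 1. Proof. exact: (@qUE K lam OPc). Qed.
Lemma qU_s : qU s = 0. Proof. exact: (@qUE K lam OPs). Qed.
Lemma qU_0 : qU a0 = t. Proof. exact: (@qUE K lam OPa0). Qed.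
Lemma qU_1 : qU a1 = x. Proof. exact: (@qUE K lam OPa1). Qed.
Lemma qU_th : qU th = outh lam. Proof. exact: (@qUE K lam OPth). Qed.
Lemma eP_c : eP c = 1. Proof. exact: (@OP_counitE K lam OPc). Qed.
Lemma eP_s : eP s = 0. Proof. exact: (@OP_counitE K lam OPs). Qed.
Lemma eP_0 : eP a0 = 0. Proof. exact: (@OP_counitE K lam OPa0). Qed.
Lemma eP_1 : eP a1 = 0. Proof. exact: (@OP_counitE K lam OPa1). Qed.
Lemma eS_c : eS oc = 1. Proof. exact: (@OSO_counitE K Sc). Qed.
Lemma eS_s : eS os = 0. Proof. exact: (@OSO_counitE K Ss). Qed.
Lemma eU_0 : eU t = 0. Proof. exact: (@OUb_counitE K lam OUa0). Qed.
Lemma eU_1 : eU x = 0. Proof. exact: (@OUb_counitE K lam OUa1). Qed.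
Lemma SO_inc_c : SO_inc K (soc K) = oc. Proof. exact: (@SO_incE K Sc). Qed.
Lemma SO_inc_s : SO_inc K (sos K) = os. Proof. exact: (@SO_incE K Ss). Qed.
Lemma Ub_inc_0 : Ub_inc lam (ua0 lam) = t. Proof. exact: (@Ub_incE K lam Ua0). Qed.
Lemma Ub_inc_1 : Ub_inc lam (ua1 lam) = x. Proof. exact: (@Ub_incE K lam Ua1). Qed.

Lemma OP_ext (B : dgaType K) (f h : {lrmorphism OP -> B}) : dga_map f -> dga_map h ->
  f c = h c -> f s = h s -> f a0 = h a0 -> f a1 = h a1 -> forall y, f y = h y.
Proof.
move=> df dh ec es e0 e1; apply: (dga_generated_ext df dh (OP_generated lam0)) => k.
by rewrite Poinc_incE; case: k.
Qed.
Lemma OUb_ext (B : dgaType K) (f h : {lrmorphism OUb -> B}) : dga_map f -> dga_map h ->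
  f t = h t -> f x = h x -> forall y, f y = h y.
Proof.
move=> df dh e0 e1; apply: (dga_generated_ext df dh (OUb_generated lam0)) => k.
by rewrite Ub_incE; case: k.
Qed.
Lemma OSO_ext (B : dgaType K) (f h : {lrmorphism OSO -> B}) : dga_map f -> dga_map h ->
  f oc = h oc -> f os = h os -> forall y, f y = h y.
Proof.
move=> df dh e0 e1; apply: (dga_generated_ext df dh (OSO_generated (K := K))) => k.
by rewrite SO_incE; case: k.
Qed.

Let dJS := jS_dga lam. Let dJU := jU_dga lam. Let dQ := qU_dga lam.
Let dD := OP_cop_dga lam0 two_neq0.

Let hoc := homog_osoc K. Let hos := homog_osos K.
Let C : stensor OSO OSO := oc \ox oc + os \ox os.
Let S : stensor OSO OSO := oc \ox os + os \ox oc.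
Let hC : homog 0 C. Proof. by apply: homogD; [exact: homog_tens hoc hoc|exact: homog_tens hos hos]. Qed.
Let hS : homog 0 S. Proof. by apply: homogD; [exact: homog_tens hoc hos|exact: homog_tens hos hoc]. Qed.
Let Scop : {lrmorphism SO -> stensor OSO OSO} :=
  lcomp (tmap0 (@SO_inc_homog K) (@SO_inc_homog K)) (SO_cop K).
Let ScopE k : Scop (gS k) = match k with Sc => C | Ss => S end.
Proof.
rewrite lcompE [SO_cop _ _]alift_gen.
by case: k; rewrite !lrmD !tmap0E ?SO_inc_c ?SO_inc_s.
Qed.
Let dcE : dif C = (dif oc \ox oc + oc \ox dif oc) + (dif os \ox os + os \ox dif os).
Proof. by rewrite difD (stens_dif0 _ hoc) (stens_dif0 _ hos). Qed.
Let dsE : dif S = (dif oc \ox os + oc \ox dif os) + (dif os \ox oc + os \ox dif oc).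
Proof. by rewrite difD (stens_dif0 _ hoc) (stens_dif0 _ hos). Qed.
Let rS := OmegaSO_sat K.
Let nrm : (oc * os = os * oc) * (oc * oc = os * os + 1) * (dif oc * os = os * dif oc) *
 (dif os * oc = oc * dif os) * (dif oc * oc = oc * dif oc) * (dif os * os = oc * dif oc) *
 (os * dif os = oc * dif oc).
Proof.
case: rS => -[e0 e1] e2 e3 e4 e5 e6; rewrite -e6 -e5 e0 -(e1) !expr2 addrC subrK.
by [].
Qed.
Let M0 := (fun a e f => @stensM0l K OSO OSO a e oc f hoc, fun a e f => @stensM0l K OSO OSO a e os f hos,
  fun a b f => @stensM0r K OSO OSO a oc b f hoc, fun a b f => @stensM0r K OSO OSO a os b f hos).
Let rSS : OmegaSO_rel C S.
Proof.
split.
- have := SO_rel_map Scop (SO_sat K).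
  by rewrite [Scop (soc K)](ScopE Sc) [Scop (sos K)](ScopE Ss).
all: rewrite ?dcE ?dsE /C /S ?(mulrDl, mulrDr, M0) ?nrm ?(tensDl, tensDr).
all: by apply: scalar_ext => phi; ring.
Qed.
Definition OSO_cop : {lrmorphism OSO -> stensor OSO OSO} := dlift (OSO_dsat hC hS rSS).
Lemma OSO_cop_dga : dga_map OSO_cop. Proof. exact: dlift_dga_map. Qed.
Lemma OSO_cop_c : OSO_cop oc = oc \ox oc + os \ox os. Proof. exact: dlift_gen. Qed.
Lemma OSO_cop_s : OSO_cop os = oc \ox os + os \ox oc. Proof. exact: dlift_gen. Qed.
Lemma OSO_cop_inc a : OSO_cop (SO_inc K a) = tmap (SO_inc K) (SO_inc K) (SO_cop K a).
Proof.
rewrite -[RHS]/(Scop a); apply: (@alg_generated_ext K _ _ _ _ (lcomp OSO_cop (SO_inc K)) Scop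
   (@SO_generated K)) => k.
by rewrite lcompE ScopE SO_incE; case: k; rewrite ?[OSO_cop _]OSO_cop_c ?[OSO_cop _]OSO_cop_s.
Qed.
Lemma OSO_coalgebra : coalgebra OSO_cop eS.
Proof.
apply: (dga_coalgebra (dD := OSO_cop_dga) (e_homog := OSO_counit_homog) (OSO_generated (K := K))) => k;
  rewrite SO_incE; case: k; rewrite -/oc -/os ?OSO_cop_c ?OSO_cop_s !lrmD.
1,2: rewrite !stmapE ?OSO_cop_c ?OSO_cop_s !tensDl !lrmD !stassocE !tensDr;
     apply: scalar_ext => phi; ring.
all: rewrite ?counit_sliceE ?counit_slicerE ?eS_c ?eS_s ?scale1r ?scale0r ?addr0 ?add0r //.
Qed.

(** Obtained by pushing the coproduct of the large algebra through the quotient, so that no relation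
    has to be checked in the super tensor square of Omega(U(b_+)). *)
Definition OUb_cop : {lrmorphism OUb -> stensor OUb OUb} :=
  lcomp (stmap dQ dQ) (lcomp D jU).
Lemma OUb_cop_dga : dga_map OUb_cop.
Proof. exact: lcomp_dga (stmap_dga _ _) (lcomp_dga dD dJU). Qed.
Lemma OUb_cop_0 : OUb_cop t = 1 \ox t + t \ox 1.
Proof.
by rewrite !lcompE jU_0 OP_cop_0 !lrmD !stmapE !lrm1 qU_0 qU_1 qU_c qU_s tens0r addr0.
Qed.
Lemma OUb_cop_1 : OUb_cop x = 1 \ox x + x \ox 1.
Proof.
by rewrite !lcompE jU_1 OP_cop_1 !lrmD !stmapE !lrm1 qU_0 qU_1 qU_c qU_s tens0r addr0.
Qed.
Lemma OUb_cop_inc a : OUb_cop (Ub_inc lam a) = tmap (Ub_inc lam) (Ub_inc lam) (Ub_cop lam a).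
Proof.
set f := lcomp (tmap0 (@Ub_inc_homog K lam) (@Ub_inc_homog K lam)) (Ub_cop lam).
rewrite -[RHS]/(f a); apply: (@alg_generated_ext K _ _ _ _ (lcomp OUb_cop (Ub_inc lam)) f
   (@Ub_generated K lam)) => k.
rewrite /f !lcompE [Ub_cop _ _]alift_gen Ub_incE.
by case: k; rewrite lrmD !tmap0E lrm1 ?Ub_inc_0 ?Ub_inc_1 -!lcompE -/OUb_cop ?OUb_cop_0 ?OUb_cop_1 addrC.
Qed.

Lemma qU_jU h : qU (jU h) = h.
Proof.
apply: (OUb_ext (f := lcomp qU jU) (h := idlrm OUb)) => //; rewrite ?lcompE.
- exact: lcomp_dga.
- by rewrite jU_0 qU_0.
- by rewrite jU_1 qU_1.
Qed.
Lemma OP_cop_jS w : D (jS w) = stmap dJS dJS (OSO_cop w).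
Proof.
apply: (OSO_ext (f := lcomp D jS) (h := lcomp (stmap dJS dJS) OSO_cop)); rewrite ?lcompE.
- exact: lcomp_dga.
- exact: lcomp_dga (stmap_dga _ _) OSO_cop_dga.
- by rewrite jS_c OP_cop_c OSO_cop_c lrmD !stmapE jS_c jS_s.
- by rewrite jS_s OP_cop_s OSO_cop_s lrmD !stmapE jS_c jS_s.
Qed.
Lemma OP_cop_jU h : stmap (idlrm_dga OP) dQ (D (jU h)) = stmap dJU (idlrm_dga OUb) (OUb_cop h).
Proof.
apply: (OUb_ext (f := lcomp (stmap (idlrm_dga OP) dQ) (lcomp D jU))
  (h := lcomp (stmap dJU (idlrm_dga OUb)) OUb_cop)).
- exact: lcomp_dga (stmap_dga _ _) (lcomp_dga dD dJU).
- exact: lcomp_dga (stmap_dga _ _) OUb_cop_dga.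
- rewrite lcompE [RHS]lcompE OUb_cop_0 lcompE jU_0 OP_cop_0 !lrmD !stmapE qU_0 qU_c qU_s.
  by rewrite tens0r addr0 jU_0 !lrm1.
- rewrite lcompE [RHS]lcompE OUb_cop_1 lcompE jU_1 OP_cop_1 !lrmD !stmapE qU_1 qU_c qU_s.
  by rewrite tens0r addr0 jU_1 !lrm1.
Qed.
(** The first leg of the coproduct of an element of Omega(U(b_+)) stays in the image of [jU], on
    which [lcomp jU qU] is the identity. *)
Lemma OP_cop_jU_left h :
  stmap (lcomp_dga dJU dQ) (idlrm_dga OP) (D (jU h)) = D (jU h).
Proof.
apply: (OUb_ext (f := lcomp (stmap (lcomp_dga dJU dQ) (idlrm_dga OP)) (lcomp D jU))
  (h := lcomp D jU)).
- exact: lcomp_dga (stmap_dga _ _) (lcomp_dga dD dJU).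
- exact: lcomp_dga.
- by rewrite !lcompE jU_0 OP_cop_0 !lrmD !stmapE !lcompE qU_0 qU_1 jU_0 jU_1 !lrm1.
- by rewrite !lcompE jU_1 OP_cop_1 !lrmD !stmapE !lcompE qU_0 qU_1 jU_0 jU_1 !lrm1.
Qed.
Lemma qU_cop y : stmap dQ dQ (D y) = OUb_cop (qU y).
Proof.
apply: (OP_ext (f := lcomp (stmap dQ dQ) D) (h := lcomp OUb_cop qU)).
- exact: lcomp_dga (stmap_dga _ _) dD.
- exact: lcomp_dga OUb_cop_dga dQ.
- by rewrite !lcompE OP_cop_c lrmD !stmapE qU_c qU_s !lrm1 tens0r addr0.
- by rewrite !lcompE OP_cop_s lrmD !stmapE qU_c qU_s !lrm0 tens0r tens0l addr0.
- by rewrite lcompE [RHS]lcompE qU_0 OUb_cop_0 OP_cop_0 !lrmD !stmapE !lrm1 qU_0 qU_c qU_s tens0r addr0.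
- by rewrite lcompE [RHS]lcompE qU_1 OUb_cop_1 OP_cop_1 !lrmD !stmapE !lrm1 qU_1 qU_c qU_s tens0r addr0.
Qed.
Lemma OP_coalgebra : coalgebra D eP.
Proof.
apply: (dga_coalgebra (dD := dD) (e_homog := OP_counit_homog) (OP_generated lam0)) => k;
  rewrite Poinc_incE; case: k; rewrite ?OP_cop_c ?OP_cop_s ?OP_cop_0 ?OP_cop_1 !lrmD.
1-4: rewrite !stmapE ?lrm1 ?OP_cop_c ?OP_cop_s ?OP_cop_0 ?OP_cop_1 !tensDl !lrmD !stassocE !tensDr;
     apply: scalar_ext => phi; ring.
all: rewrite ?counit_sliceE ?counit_slicerE ?lrm1 ?eP_c ?eP_s ?eP_0 ?eP_1 ?scale1r ?scale0r ?addr0 ?add0r //.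
Qed.
Lemma eU_qU y : eU (qU y) = eP y.
Proof.
elim/(OP_generated lam0): y => [||k u v eu ev|k u eu|k u eu]; rewrite ?lrm0 ?lrm1 //.
- by rewrite !lrmP eu ev.
- rewrite !lrmM eu Poinc_incE; congr (_ * _).
  by case: k; rewrite ?qU_c ?qU_s ?qU_0 ?qU_1 ?eP_c ?eP_s ?eP_0 ?eP_1 ?eU_0 ?eU_1 ?lrm1 ?lrm0.
- by rewrite !lrmM dQ.2 counit_difU counit_difP [LHS]mul0r [RHS]mul0r.
Qed.
Lemma eP_jS w : eP (jS w) = eS w.
Proof.
elim/(@OSO_generated K): w => [||k u v eu ev|k u eu|k u eu]; rewrite ?lrm0 ?lrm1 //.
- by rewrite !lrmP eu ev.
- by rewrite !lrmM eu SO_incE; congr (_ * _); case: k; rewrite ?jS_c ?jS_s ?eP_c ?eP_s ?eS_c ?eS_s.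
- by rewrite !lrmM dJS.2 counit_difS counit_difP [LHS]mul0r [RHS]mul0r.
Qed.
Lemma qU_jS w : qU (jS w) = (eS w : K)%:A.
Proof.
elim/(@OSO_generated K): w => [||k u v eu ev|k u eu|k u eu]; rewrite ?lrm0 ?lrm1 ?scale0r ?scale1r //.
- by rewrite !lrmP eu ev scalerDl scalerA.
- rewrite !lrmM eu SO_incE; case: k.
  + by rewrite jS_c qU_c [eS oc]eS_c !mul1r.
  + by rewrite jS_s qU_s [eS os]eS_s !mul0r scale0r.
- rewrite !lrmM dJS.2 dQ.2 counit_difS SO_incE [0 * _]mul0r scale0r.
  by case: k; rewrite ?jS_c ?jS_s ?qU_c ?qU_s ?dif1 ?dif0 mul0r.
Qed.
End HopfMaps.

(** * Recognising super bicrossproducts *)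

Section TensorCalculus.
Variable K : fieldType.
Implicit Types U V W P Q : lmodType K.

Lemma eq_tlift V W U (F G : V -> W -> U) : (forall v w, F v w = G v w) ->
  forall z, tlift F z = tlift G z.
Proof. by move=> e z; congr (tlift _ z); apply/funext => v; apply/funext => w. Qed.

Lemma tmap_bil V W V' W' (f : V -> V') (g : W -> W') : linear f -> linear g ->
  bilin (fun v w => f v \ox g w).
Proof. exact: bilin_comp (tens_bilin _ _). Qed.
Lemma tmap_tens V W V' W' (f : V -> V') (g : W -> W') v w : linear f -> linear g ->
  tmap f g (v \ox w) = f v \ox g w.
Proof. by move=> lf lg; rewrite /tmap tlift_tens //; exact: tmap_bil. Qed.
Lemma tmap_lin V W V' W' (f : V -> V') (g : W -> W') : linear f -> linear g ->
  linear (tmap f g).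
Proof. by move=> lf lg; exact/tlift_linear/tmap_bil. Qed.

Lemma tlift_tmap V W V' W' U (F : V' -> W' -> U) (f : V -> V') (g : W -> W') z :
  bilin F -> linear f -> linear g ->
  tlift F (tmap f g z) = tlift (fun v w => F (f v) (g w)) z.
Proof.
move=> bF lf lg; have b2 := bilin_comp bF lf lg; move: z; apply: tlift_ext.
- exact: lin_comp (tlift_linear bF) (tmap_lin lf lg).
- exact: tlift_linear.
- by move=> v w; rewrite tmap_tens // !tlift_tens.
Qed.

Lemma tlift_lin V W U P (h : U -> P) (F : V -> W -> U) z : linear h -> bilin F ->
  h (tlift F z) = tlift (fun v w => h (F v w)) z.
Proof.
move=> lh bF; have b2 := lin_bilin bF lh; move: z; apply: tlift_ext.
- exact: lin_comp lh (tlift_linear bF).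
- exact: tlift_linear.
- by move=> v w; rewrite !tlift_tens.
Qed.

Lemma tmap_comp V W V' W' V'' W'' (f' : V' -> V'') (g' : W' -> W'') (f : V -> V') (g : W -> W') z :
  linear f' -> linear g' -> linear f -> linear g ->
  tmap f' g' (tmap f g z) = tmap (fun v => f' (f v)) (fun w => g' (g w)) z.
Proof. by move=> lf' lg' lf lg; rewrite {1}/tmap tlift_tmap //; exact: tmap_bil. Qed.

Lemma eq_tmap V W V' W' (f f' : V -> V') (g g' : W -> W') z :
  (forall v, f v = f' v) -> (forall w, g w = g' w) -> tmap f g z = tmap f' g' z.
Proof. by move=> e1 e2; apply: eq_tlift => v w; rewrite e1 e2. Qed.

Lemma tmap_id V W (z : tensor V W) : tmap id id z = z.
Proof.
move: z; apply: tlift_ext => [||v w]; [exact: tmap_lin| by []|exact: tmap_tens].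
Qed.

Lemma tassoc_tmap U V W U' V' W' P Q (D : P -> tensor U V) (h : Q -> W)
    (f : U -> U') (g : V -> V') (k : W -> W') z :
  linear D -> linear h -> linear f -> linear g -> linear k ->
  tassoc (tmap (fun x => tmap f g (D x)) (fun y => k (h y)) z)
    = tmap f (tmap g k) (tassoc (tmap D h z)).
Proof.
move=> lD lh lf lg lk; have lfg := tmap_lin lf lg; have lgk := tmap_lin lg lk.
have nat (y : tensor (tensor U V) W) :
    tassoc (tmap (tmap f g) k y) = tmap f (tmap g k) (tassoc y).
  move: y; apply: tensor3_ext.
  - exact: lin_comp (@tassoc_linear K _ _ _) (tmap_lin lfg lk).
  - exact: lin_comp (tmap_lin lf lgk) (@tassoc_linear K _ _ _).
  - by move=> u v w; rewrite tmap_tens // tmap_tens // !tassocE !tmap_tens.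
by rewrite -nat tmap_comp.
Qed.

Definition tassocV U V W : tensor U (tensor V W) -> tensor (tensor U V) W :=
  tlift (fun u z => tlift (fun v w => (u \ox v) \ox w) z).
Lemma tassocV_bil1 U V W (u : U) : bilin (fun (v : V) (w : W) => (u \ox v) \ox w).
Proof.
split=> z k a b; last by rewrite tensDr tensZr.
by rewrite tensDr tensZr tensDl tensZl.
Qed.
Lemma tassocV_bil U V W :
  bilin (fun (u : U) z => tlift (fun (v : V) (w : W) => (u \ox v) \ox w) z).
Proof.
split=> [z|u]; last exact: tlift_linear (tassocV_bil1 V W u).
move=> k a b /=; elim/tensor_ind: z => [|v w z IH].
  by rewrite !(lin0 (tlift_linear (tassocV_bil1 V W _))) scaler0 addr0.
rewrite !(linD (tlift_linear (tassocV_bil1 V W _))) IH !(tlift_tens _ _ (tassocV_bil1 V W _)).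
by rewrite !(tensDl, tensZl) scalerDr addrACA.
Qed.
Lemma tassocK U V W : cancel (@tassoc K U V W) (@tassocV U V W).
Proof.
apply: tensor3_ext.
- exact: lin_comp (tlift_linear (tassocV_bil _ _ _)) (@tassoc_linear K _ _ _).
- by [].
- move=> u v w; rewrite tassocE /tassocV (tlift_tens _ _ (tassocV_bil _ _ _)).
  by rewrite (tlift_tens _ _ (tassocV_bil1 V W _)).
Qed.

Section GradedTmap.
Variables (A B A' B' : dgaType K) (f : A -> A') (g : B -> B').
Hypotheses (lf : linear f) (lg : linear g).
Hypotheses (gf : forall n x, f (gpr n x) = gpr n (f x)) (gg : forall n x, g (gpr n x) = gpr n (g x)).
Let t : stensor A B -> stensor A' B' := tmap f g.
Let lt : linear t. Proof. exact: tmap_lin. Qed.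
Let hf n x : homog n x -> homog n (f x). Proof. by move=> hx; rewrite /homog -gf hx. Qed.
Let hg n x : homog n x -> homog n (g x). Proof. by move=> hx; rewrite /homog -gg hx. Qed.
Lemma tmap_gpr n (z : stensor A B) : tmap f g (gpr n z) = gpr n (tmap f g z : stensor A' B').
Proof.
rewrite -/(t _) -/(t z); move: z; apply: stens_ext.
- exact: lin_comp lt (gpr_linear n).
- exact: lin_comp (gpr_linear n) lt.
- move=> p r a b ha hb; rewrite (stens_gpr _ ha hb) /t (tmap_tens _ _ lf lg).
  rewrite (stens_gpr _ (hf ha) (hg hb)); case: eqP => _; first exact: tmap_tens.
  exact: lin0 lt.
Qed.
Hypotheses (df : forall x, f (dif x) = dif (f x)) (dg : forall x, g (dif x) = dif (g x)).
Lemma tmap_dif (z : stensor A B) : tmap f g (dif z) = dif (tmap f g z : stensor A' B').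
Proof.
rewrite -/(t _) -/(t z); move: z; apply: stens_ext.
- exact: lin_comp lt dif_linear.
- exact: lin_comp dif_linear lt.
- move=> p r a b ha hb; rewrite (stens_dif _ ha) (linD lt) (linZ _ _ lt) /t !(tmap_tens _ _ lf lg).
  by rewrite (stens_dif _ (hf ha)) df dg.
Qed.
End GradedTmap.
End TensorCalculus.

Section KoszulCalculus.
Variables (K : fieldType).

Lemma koszul_lin (A B : dgaType K) (U P : lmodType K) (g : U -> P) (F : A -> B -> U) x y :
  linear g -> g (koszul F x y) = koszul (fun x y => g (F x y)) x y.
Proof.
move=> lg; rewrite /koszul /hsum (big_morph g (linD lg) (lin0 lg)).
apply: eq_bigr => i _; rewrite (big_morph g (linD lg) (lin0 lg)).
by apply: eq_bigr => j _; rewrite (linZ _ _ lg).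
Qed.

Lemma eq_koszul (A B : dgaType K) (U : lmodType K) (F G : A -> B -> U) x y :
  (forall x y, F x y = G x y) -> koszul F x y = koszul G x y.
Proof. by move=> e; congr (koszul _ x y); apply/funext => a; apply/funext => b; exact: e. Qed.

Lemma koszul_param (A B : dgaType K) (U P : lmodType K) (F : P -> A -> B -> U) :
  (forall x y, linear (fun a => F a x y)) -> forall x y, linear (fun a => koszul (F a) x y).
Proof.
move=> lF x y k a b; rewrite /koszul /hsum scaler_sumr -big_split /=; apply: eq_bigr => i _.
rewrite scaler_sumr -big_split /=; apply: eq_bigr => j _.
by rewrite lF scalerDr !scalerA mulrC.
Qed.

Lemma tlift_param (V W U P : lmodType K) (F : P -> V -> W -> U) :
  (forall x y, linear (fun a => F a x y)) -> forall z, linear (fun a => tlift (F a) z).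
Proof.
move=> lF z k a b; rewrite /tlift /fsum scaler_sumr -big_split /=; apply: eq_bigr => i _.
exact: lF.
Qed.

Lemma koszul_bilin3 (A B : dgaType K) (U P : lmodType K) (F : P -> A -> B -> U) y :
  (forall a, bilin (F a)) -> (forall x y, linear (fun a => F a x y)) ->
  bilin (fun a x => koszul (F a) x y).
Proof.
by move=> bF lF; split=> [x|a]; [exact: koszul_param|exact: (koszul_bilin (bF a)).1].
Qed.

Lemma bilin_sym (V W U : lmodType K) (F : V -> W -> U) : bilin F -> bilin (fun w v => F v w).
Proof. by case. Qed.
End KoszulCalculus.

(* H has a subalgebra S, a quotient q onto U split by jU, and a left S-linear
   projection p onto S that kills the augmentation ideal of U on the right; then
   [(p \ox q) D] inverts multiplication S \ox U -> H, and U acts on S by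
   [h, w |-> p (jU h * jS w)] and is coacted on by S through [(q \ox p) D jU]. *)
Section AbstractBicross.
Variables (K : fieldType) (S U H : dgaType K).
Variables (jS : {lrmorphism S -> H}) (jU : {lrmorphism U -> H}) (q : {lrmorphism H -> U})
  (p : H -> S).
Variables (D : {lrmorphism H -> stensor H H}) (DS : {lrmorphism S -> stensor S S})
  (DU : {lrmorphism U -> stensor U U}).
Variables (eH : {lrmorphism H -> K^o}) (eS : {lrmorphism S -> K^o}) (eU : {lrmorphism U -> K^o}).
Hypotheses (dJS : dga_map jS) (dJU : dga_map jU) (dQ : dga_map q).
Hypotheses (dD : dga_map D) (dDS : dga_map DS) (dDU : dga_map DU).
Hypotheses (coH : coalgebra D eH) (coS : coalgebra DS eS) (coU : coalgebra DU eU).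
Hypothesis D_jS : forall w, D (jS w) = tmap jS jS (DS w).
Hypothesis D_jU : forall h, tmap id q (D (jU h)) = tmap jU id (DU h).
Hypothesis D_jUl : forall h, tmap (fun y => jU (q y)) id (D (jU h)) = D (jU h).
Hypothesis q_jU : forall h, q (jU h) = h.
Hypothesis q_jS : forall w, q (jS w) = (eS w : K)%:A.
Hypothesis q_D : forall y, tmap q q (D y) = DU (q y).
Hypothesis eU_q : forall y, eU (q y) = eH y.
Hypothesis eH_jS : forall w, eH (jS w) = eS w.
Hypothesis eS_homog : forall n w, homog n.+1 w -> eS w = 0.
Hypothesis eU_homog : forall n h, homog n.+1 h -> eU h = 0.
Hypothesis p_linear : linear p.
Hypothesis p1 : p 1 = 1.
Hypothesis p_jS : forall w y, p (jS w * y) = w * p y.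
Hypothesis p_jU : forall y h, p (y * jU h) = (eU h : K) *: p y.
Hypothesis p_gpr : forall n y, p (gpr n y) = gpr n (p y).
Hypothesis p_dif : forall y, p (dif y) = dif (p y).
Hypothesis span : forall y, exists z : tensor S U, y = mul_map jS jU z.

Let ljS : linear jS := lrm_linear jS.
Let ljU : linear jU := lrm_linear jU.
Let lq : linear q := lrm_linear q.
Let lD : linear D := lrm_linear D.
Let lDS : linear DS := lrm_linear DS.
Let lDU : linear DU := lrm_linear DU.
Let leS : linear eS := lrm_linear eS.
Let leU : linear eU := lrm_linear eU.
Let leH : linear eH := lrm_linear eH.
Let lid (V : lmodType K) : linear (@id V) := @lin_id K V.
Let ljUq : linear (fun y => jU (q y)) := lin_comp ljU lq.
Let hjS n w : homog n w -> homog n (jS w) := @dga_map_homog _ _ _ jS n w dJS.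
Let hjU n w : homog n w -> homog n (jU w) := @dga_map_homog _ _ _ jU n w dJU.
Let hq n w : homog n w -> homog n (q w) := @dga_map_homog _ _ _ q n w dQ.
Let hp n y : homog n y -> homog n (p y). Proof. by move=> hy; rewrite /homog -p_gpr hy. Qed.

Local Notation mu := (mul_map jS jU).
Lemma mu_bilin : bilin (fun w h => jS w * jU h).
Proof. exact: bilin_comp (mul_bilin H) ljS ljU. Qed.
Lemma muE w h : mu (w \ox h) = jS w * jU h. Proof. exact: tlift_tens mu_bilin. Qed.
Lemma mu_linear : linear mu. Proof. exact: tlift_linear mu_bilin. Qed.

Lemma p_jSjU w h : p (jS w * jU h) = (eU h : K) *: w.
Proof. by rewrite p_jU -[jS w]mulr1 p_jS p1 mulr1. Qed.
Lemma p_of_jU h : p (jU h) = (eU h : K)%:A.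
Proof. by rewrite -[jU h]mul1r p_jU p1. Qed.

Lemma span_ext (V : lmodType K) (f g : H -> V) : linear f -> linear g ->
  (forall w h, f (jS w * jU h) = g (jS w * jU h)) -> forall y, f y = g y.
Proof.
move=> lf lg e y; have [z ->] := span y; move: z.
apply: (tlift_ext (f := fun z => f (mu z)) (g := fun z => g (mu z))).
- exact: lin_comp lf mu_linear.
- exact: lin_comp lg mu_linear.
- by move=> w h; rewrite muE.
Qed.

Lemma eS_p y : eS (p y) = eH y.
Proof.
move: y; apply: span_ext => [||w h]; [exact: lin_comp leS p_linear|exact: leH|].
by rewrite p_jSjU lrmM eH_jS -eU_q q_jU lrmZ mulrC.
Qed.

(** The kernel of [p] is a left ideal; this is what makes [bact] an action. *)
Lemma p_mulr x y : p (x * y) = p (x * jS (p y)).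
Proof.
have lm (a : H) := @mull_linear K H a.
move: y; apply: span_ext => [||w h].
- exact: lin_comp p_linear (lm x).
- exact: lin_comp (lin_comp p_linear (lm x)) (lin_comp ljS p_linear).
- by rewrite p_jSjU mulrA p_jU lrmZ -scalerAr (linZ _ _ p_linear).
Qed.

(** The right coaction of U on H. It is multiplicative, the elements of S are coinvariant and [jU]
    is colinear. *)
Let Z : {lrmorphism H -> stensor H U} := lcomp (stmap (idlrm_dga H) dQ) D.
Let Z_E y : Z y = tmap id q (D y). Proof. by []. Qed.
Let Z_jU h : Z (jU h) = tmap jU id (DU h). Proof. exact: D_jU. Qed.
Let Z_jS w : Z (jS w) = jS w \ox 1.
Proof.
rewrite Z_E D_jS -{2}(counitr coS w).
have b : bilin (fun a b : S => (eS b : K) *: a).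
  split=> z k x y /=; first by rewrite scalerDr !scalerA mulrC.
  by rewrite lrmP scalerDl scalerA.
have lt : linear (fun x => jS x \ox (1 : U)).
  by move=> k x y; rewrite lrmP tensDl tensZl.
rewrite tmap_comp //.
move: (DS w : tensor S S); apply: tlift_ext.
- exact/tmap_lin/lin_comp.
- exact: lin_comp lt (tlift_linear b).
- move=> a a'; rewrite tmap_tens //; last exact: lin_comp.
  by rewrite tlift_tens // q_jS tensZr lrmZ tensZl.
Qed.
Let lp' : linear (tmap p (@id U)). Proof. exact: tmap_lin. Qed.
Definition unmul (y : H) : tensor S U := tmap p id (tmap id q (D y)).
Let unmulE y : unmul y = tmap p id (Z y). Proof. by []. Qed.
Let unmul_linear : linear unmul.
Proof. exact: lin_comp lp' (lrm_linear Z). Qed.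

(** Z sends jS w jU h to jS w jU h1 \ox h2; [p] reduces the first leg to eU(h1) w, and the counit
    axiom restores h. *)
Lemma unmulK z : unmul (mu z) = z.
Proof.
move: z; apply: tlift_ext => [||w h].
- exact: lin_comp unmul_linear mu_linear.
- by [].
rewrite muE unmulE lrmM Z_jS Z_jU -{2}(counitl coU h).
have b : bilin (fun a b : U => (eU a : K) *: b).
  split=> z k x y /=; last by rewrite scalerDr !scalerA mulrC.
  by rewrite lrmP scalerDl scalerA.
have lt : linear (fun x : U => w \ox x).
  by move=> k x y; rewrite tensDr tensZr.
have lm : linear (fun v : tensor U U => tmap p id ((jS w \ox 1 : stensor H U) * tmap jU id v)).
  by move=> k x y; rewrite (tmap_lin ljU (@lid _) k x y) mulrDr -scalerAr lp'.
move: (DU h : tensor U U); apply: tlift_ext.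
- exact: lm.
- exact: lin_comp lt (tlift_linear b).
- move=> a a'; rewrite tmap_tens // stensM0l; last exact: homog1.
  by rewrite mul1r tmap_tens // tlift_tens // p_jSjU tensZl tensZr.
Qed.
Lemma mulK y : mu (unmul y) = y.
Proof. by have [z ->] := span y; rewrite unmulK. Qed.
Lemma mu_bij : bijective mu. Proof. exact: Bijective unmulK mulK. Qed.

Definition bact (h : U) (w : S) : S := p (jU h * jS w).
Lemma bact_bilin : bilin bact.
Proof. exact: lin_bilin (bilin_comp (mul_bilin H) ljU ljS) p_linear. Qed.

Let cross_term (h1 h2 : U) (w : S) := jS (bact h1 w) * jU h2.
Let cross_bil h1 : bilin (cross_term h1).
Proof.
by have := bilin_comp (mul_bilin H) (lin_comp ljS (bact_bilin.2 h1)) ljU; apply: bilin_sym.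
Qed.
Let cross_lin h2 w : linear (fun h1 => cross_term h1 h2 w).
Proof. by move=> k x y; rewrite /cross_term (bact_bilin.1 w) lrmP mulrDl scalerAl. Qed.
Let cross_bil2 w : bilin (fun h1 h2 => koszul (cross_term h1) h2 w).
Proof. exact: koszul_bilin3. Qed.

(** Apply [mulK] to jU h jS w: multiplicativity of [Z] gives jU h1 jS w \ox h2 up to the Koszul
    sign, and [p] of the first leg is the action of h1 on w. *)
Lemma cross h w : jU h * jS w =
  tlift (fun h1 h2 => koszul (cross_term h1) h2 w) (DU h).
Proof.
rewrite -[LHS]mulK unmulE lrmM Z_jU Z_jS.
have lm : linear (fun v : tensor U U => mu (tmap p id ((tmap jU id v : stensor H U) * (jS w \ox 1)))).
  by move=> k x y; rewrite (tmap_lin ljU (@lid _) k x y) mulrDl -scalerAl lp' mu_linear.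
have b1 := cross_bil; have b2 := cross_bil2 w.
move: (DU h : tensor U U); apply: tlift_ext.
- exact: lm.
- exact: tlift_linear b2.
move=> h1 h2; rewrite tmap_tens // (tlift_tens _ _ b2).
have [bl br] := koszul_bilin (b1 h1).
have e : forall m n h2 w, homog m h2 -> homog n w ->
  mu (tmap p id ((jU h1 \ox h2 : stensor H U) * (jS w \ox 1))) =
  koszul (cross_term h1) h2 w.
  move=> m n k v hk hv; rewrite (stensM _ _ hk (hjS hv)) (linZ _ _ lp') mulr1 tmap_tens //.
  by rewrite (linZ _ _ mu_linear) muE (koszulE (b1 h1) hk hv).
elim/(@homog_ind K U): h2 => [|m h2 h2' hh2 IH2].
  by rewrite tens0r mul0r (lin0 lp') (lin0 mu_linear) (lin0 (bl _)).
rewrite tensDr mulrDl (linD lp') (linD mu_linear) IH2 (linD (bl _)); congr (_ + _).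
elim/(@homog_ind K S): w {lm b2 IH2} => [|n w w' hw IH].
  by rewrite lrm0 tens0l mulr0 (lin0 lp') (lin0 mu_linear) (lin0 (br _)).
rewrite lrmD tensDl mulrDr (linD lp') (linD mu_linear) IH (linD (br _)); congr (_ + _).
exact: e hh2 hw.
Qed.

Lemma bicross_module_algebra : super_module_algebra DU eU bact.
Proof.
split.
- exact: bact_bilin.
- by move=> w; rewrite /bact lrm1 mul1r -[jS w]mulr1 p_jS p1 mulr1.
- by move=> h g w; rewrite /bact lrmM -mulrA p_mulr.
- by move=> h; rewrite /bact lrm1 mulr1 p_of_jU.
- move=> h w v; rewrite /bact lrmM mulrA cross.
  have lp2 : linear (fun y => p (y * jS v)).
    by move=> k x y; rewrite mulrDl -scalerAl p_linear.
  rewrite (tlift_lin (h := fun y => p (y * jS v)) _ lp2 (cross_bil2 w)).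
  apply: eq_tlift => h1 h2; rewrite (koszul_lin (g := fun y => p (y * jS v)) _ _ _ lp2).
  by apply: eq_koszul => h2' w'; rewrite /cross_term -mulrA p_jS.
- by move=> m n h w hh hw; apply/hp/homogM; [exact: hjU|exact: hjS].
- move=> m h w hh; rewrite /bact -p_dif (difMh _ (hjU hh)) dJU.2 dJS.2 (linD p_linear).
  by rewrite (linZ _ _ p_linear).
Qed.

Let prod_term (w : S) (g : U) (h1 h2 : U) (v : S) : tensor S U := (w * bact h1 v) \ox (h2 * g).
Let prod_bil w g h1 : bilin (prod_term w g h1).
Proof.
split=> z k x y; rewrite /prod_term.
  by rewrite mulrDl -scalerAl tensDr tensZr.
by rewrite (bact_bilin.2 h1) mulrDr -scalerAr tensDl tensZl.
Qed.
Let prod_lin w g h2 v : linear (fun h1 => prod_term w g h1 h2 v).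
Proof.
by move=> k x y; rewrite /prod_term (bact_bilin.1 v) mulrDr -scalerAr tensDl tensZl.
Qed.
Let prod_bil2 w g v : bilin (fun h1 h2 => koszul (prod_term w g h1) h2 v).
Proof. exact: koszul_bilin3. Qed.

Lemma bicross_mulE_abs y z : mu (bicross_mul DU bact y z) = mu y * mu z.
Proof.
pose F w h v g := tlift (fun h1 h2 => koszul (prod_term w g h1) h2 v) (DU h).
have fr w h : bilin (F w h).
  split=> [g|v].
    apply: (@tlift_param K U U (tensor S U) S (fun v h1 h2 => koszul (prod_term w g h1) h2 v)).
    by move=> h1 h2; exact: (koszul_bilin (prod_bil w g h1)).2.
  apply: (@tlift_param K U U (tensor S U) U (fun g h1 h2 => koszul (prod_term w g h1) h2 v)) => h1 h2.
  apply: (@koszul_param K U S (tensor S U) U (fun g => prod_term w g h1)) => a b k x x'.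
  by rewrite /prod_term mulrDr -scalerAr tensDr tensZr.
have fl v g : bilin (fun w h => F w h v g).
  split=> [h|w]; last exact: lin_comp (tlift_linear (prod_bil2 w g v)) lDU.
  apply: (@tlift_param K U U (tensor S U) S (fun w h1 h2 => koszul (prod_term w g h1) h2 v)) => h1 h2.
  apply: (@koszul_param K U S (tensor S U) S (fun w => prod_term w g h1)) => a b k x x'.
  by rewrite /prod_term mulrDl -scalerAl tensDl tensZl.
have bm := tlift2_bilin fr fl.
move: y; apply: (tlift_ext (f := fun y => mu (tlift2 F y z)) (g := fun y => mu y * mu z)).
- exact: lin_comp mu_linear (bm.1 z).
- by move=> k a b; rewrite mu_linear mulrDl scalerAl.
move=> w h; move: z; apply: (tlift_ext (f := fun z => mu (tlift2 F (w \ox h) z))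
  (g := fun z => mu (w \ox h) * mu z)).
- exact: lin_comp mu_linear (bm.2 (w \ox h)).
- by move=> k a b; rewrite mu_linear mulrDr scalerAr.
move=> v g; rewrite (tlift2E fr fl) !muE /F (tlift_lin _ mu_linear (prod_bil2 w g v)).
rewrite mulrA -[_ * jU h * _]mulrA cross.
have l2 : linear (fun y => jS w * y * jU g).
  by move=> k x y; rewrite mulrDr mulrDl -scalerAr -scalerAl.
rewrite (tlift_lin (h := fun y => jS w * y * jU g) _ l2 (cross_bil2 v)).
apply: eq_tlift => h1 h2; rewrite (koszul_lin _ _ _ mu_linear).
rewrite (koszul_lin (g := fun y => jS w * y * jU g) _ _ _ l2).
by apply: eq_koszul => h2' v'; rewrite /prod_term /cross_term muE !lrmM !mulrA.
Qed.

Lemma mu_gpr n (z : stensor S U) : mu (gpr n z) = gpr n (mu z).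
Proof.
move: z; apply: stens_ext.
- by move=> k x y; rewrite (gpr_linear n k (x : stensor S U)) mu_linear.
- by move=> k x y; rewrite mu_linear gpr_linear.
move=> a b w h hw hh; rewrite (stens_gpr _ hw hh) muE (gprE _ (homogM (hjS hw) (hjU hh))).
by case: eqP => _; [rewrite muE|rewrite (lin0 mu_linear)].
Qed.
Lemma mu_dif (z : stensor S U) : mu (dif z) = dif (mu z).
Proof.
move: z; apply: stens_ext.
- by move=> k x y; rewrite (dif_linear k (x : stensor S U)) mu_linear.
- by move=> k x y; rewrite mu_linear dif_linear.
move=> a b w h hw hh; rewrite (stens_dif _ hw) (linD mu_linear) (linZ _ _ mu_linear) !muE.
by rewrite (difMh _ (hjS hw)) dJS.2 dJU.2.
Qed.

Let eH_homog n y : homog n.+1 y -> eH y = 0.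
Proof. by move=> hy; rewrite -eU_q; exact: eU_homog (hq hy). Qed.
Let cl_bil (V : lmodType K) (e : H -> K^o) : linear e -> bilin (fun x (v : V) => (e x : K) *: v).
Proof.
by move=> le; split=> z k x y /=; [rewrite le scalerDl scalerA|rewrite scalerDr !scalerA mulrC].
Qed.
Let cr_bil (V : lmodType K) (e : H -> K^o) : linear e -> bilin (fun (v : V) x => (e x : K) *: v).
Proof. by move=> le; apply/bilin_sym/cl_bil. Qed.
Let cl := fun z : tensor H H => tlift (fun x y => (eH x : K) *: y) z.
Let lcl : linear cl := tlift_linear (cl_bil H leH).

Let pp_key n a b z : homog n b ->
  tmap p p ((jS a \ox jS b : stensor H H) * tmap (fun y => jU (q y)) id z) = a \ox (b * p (cl z)).
Proof.
move=> hb; have lpp := tmap_lin p_linear p_linear.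
move: z; apply: stens_ext.
- by move=> k x y; rewrite (tmap_lin ljUq (@lid _) k x y) mulrDr -scalerAr lpp.
- by move=> k x y; rewrite lcl p_linear mulrDr -scalerAr tensDr tensZr.
move=> m m' x y hx hy; rewrite tmap_tens // (stensM _ _ (hjS hb) (hjU (hq hx))) (linZ _ _ lpp).
rewrite tmap_tens // p_jSjU p_jS eU_q /cl (tlift_tens _ _ (cl_bil H leH)) (linZ _ _ p_linear).
rewrite -scalerAr tensZr tensZl; case: m hx => [|m] hx; first by rewrite muln0 scale1r.
by rewrite (eH_homog hx) scale0r scaler0.
Qed.

(** On jS w jU h the first leg of D (jU h) lies in U by [D_jUl], so [p] replaces it by its counit;
    what remains is DS w scaled by eU h. *)
Lemma DS_p y : DS (p y) = tmap p p (D y).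
Proof.
have lpp := tmap_lin p_linear p_linear.
move: y; apply: span_ext => [||w h]; [exact: lin_comp lDS p_linear|exact: lin_comp lpp lD|].
rewrite p_jSjU lrmZ lrmM D_jS -(D_jUl h).
have lS := tmap_lin ljS ljS.
suff e v : tmap p p ((tmap jS jS v : stensor H H) * tmap (fun y => jU (q y)) id (D (jU h)))
   = (eU h : K) *: v by rewrite e.
move: v; apply: stens_ext.
- by move=> k x y; rewrite (lS k x y) mulrDl -scalerAl lpp.
- by move=> k x y; rewrite scalerDr !scalerA mulrC.
move=> m n a b ha hb; rewrite tmap_tens // (pp_key _ _ hb).
by rewrite [cl _](counitl coH) p_of_jU -scalerAr mulr1 tensZr.
Qed.

Definition bbeta (h : U) : stensor U S := tmap q p (D (jU h)).
Let lqp : linear (tmap q p) := tmap_lin lq p_linear.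
Let lbeta : linear bbeta := lin_comp lqp (lin_comp lD ljU).

Let bbeta_left h : tmap (fun x => tmap q p (D x)) p (D (jU h)) =
  tmap (fun x => bbeta (q x)) p (D (jU h)).
Proof. by rewrite -{1}D_jUl tmap_comp //; exact: lin_comp lqp lD. Qed.

Let coassocH y : tassoc (tmap D id (D y)) = tmap id D (D y). Proof. exact: coassoc coH y. Qed.

Let bbeta_comodule : comodule DS eS bbeta.
Proof.
split=> h.
- rewrite {2}/bbeta tmap_comp // -[LHS]/(tassoc (tmap (fun x => bbeta (q x)) p (D (jU h)))).
  rewrite -bbeta_left.
  rewrite (tassoc_tmap (D := D) (h := id) (f := q) (g := p) (k := p) _ lD (@lid _) lq p_linear p_linear).
  rewrite coassocH tmap_comp //; last exact: tmap_lin.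
  by rewrite tmap_comp //; apply: eq_tmap => // y; rewrite DS_p.
- have bS : bilin (fun (v : U) (c : S) => (eS c : K) *: v).
    by split=> z k x y /=; rewrite ?lrmP ?scalerDl ?scalerDr !scalerA // mulrC.
  rewrite /bbeta tlift_tmap //.
  rewrite (eq_tlift (G := fun x y => q ((eH y : K) *: x))); last first.
    by move=> x y; rewrite eS_p lrmZ.
  rewrite -(tlift_lin (h := q) _ lq (cr_bil H leH)).
  by rewrite [tlift _ _](counitr coH) q_jU.
Qed.

(** In Sweedler notation, beta(h1) followed by h2 in the second leg: the bicrossproduct coproduct of
    1 \ox h. *)
Let star_term (h1 h2 : U) : stensor H H :=
  (tmap jU jS (bbeta h1) : stensor H H) * (1 \ox jU h2 : stensor H H).
Let lUS : linear (tmap jU jS) := tmap_lin ljU ljS.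
Let star_bil : bilin star_term.
Proof.
split=> z k x y; rewrite /star_term.
  by rewrite lbeta (lUS k (bbeta x) (bbeta y)) mulrDl -scalerAl.
by rewrite lrmP tensDr tensZr [LHS]mulrDr -scalerAr.
Qed.

(** Split the second leg of the coproduct into its S and U parts by [mulK]; coassociativity and
    [D_jU] then turn the U part into the second leg of [DU h]. *)
Lemma D_jU_star h : D (jU h) = tlift star_term (DU h).
Proof.
pose M (y : tensor H H) := tlift (fun x y => jS (p x) * jU (q y)) y.
have bM : bilin (fun x y => jS (p x) * jU (q y)).
  exact: bilin_comp (mul_bilin H) (lin_comp ljS p_linear) ljUq.
have lM : linear M := tlift_linear bM.
have ME y : M (D y) = y.
  rewrite -[RHS]mulK /unmul tmap_comp // /mul_map tlift_tmap //; exact: mu_bilin.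
have ljSp : linear (fun y => jS (p y)) := lin_comp ljS p_linear.
have lI : linear (tmap (@id H) (fun y => jS (p y))) := tmap_lin (@lid _) ljSp.
pose F (z : tensor H H) (y' : H) : stensor H H :=
  (tmap id (fun y => jS (p y)) z : stensor H H) * (1 \ox jU (q y') : stensor H H).
have bF : bilin F.
  split=> z k x y; rewrite /F; first by rewrite (lI k x y) mulrDl -scalerAl.
  by rewrite ljUq tensDr tensZr [LHS]mulrDr -scalerAr.
have A v : tmap id M (tassoc v) = tlift F v.
  move: v; apply: tensor3_ext.
  - exact: lin_comp (tmap_lin (@lid _) lM) (@tassoc_linear K _ _ _).
  - exact: tlift_linear.
  - move=> x y y'; rewrite tassocE tmap_tens // (tlift_tens _ _ bF) /F tmap_tens //.
    by rewrite /M tlift_tens // (stensM0r _ _ _ (homog1 H)) mulr1.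
rewrite -[LHS]tmap_id -[LHS](eq_tmap (f := id) (g := fun y => M (D y))) //.
rewrite -(tmap_comp (f' := id) (g' := M) (f := id) (g := D)) // -coassocH A.
rewrite tlift_tmap //.
pose F2 (x : H) (h2 : U) : stensor H H :=
  (tmap id (fun y => jS (p y)) (D x) : stensor H H) * (1 \ox jU h2 : stensor H H).
have bF2 : bilin F2.
  split=> z k x y; rewrite /F2; first by rewrite lrmP (lI k (D x) (D y)) mulrDl -scalerAl.
  by rewrite lrmP tensDr tensZr [LHS]mulrDr -scalerAr.
rewrite -[LHS](tlift_tmap (F := F2) (f := id) (g := q)) // D_jU tlift_tmap //.
apply: eq_tlift => h1 h2; rewrite /F2 /star_term; congr (_ * _).
by rewrite /bbeta tmap_comp // -{1}D_jUl tmap_comp.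
Qed.

(** The quotient [q] reduces the first leg of D (jS v) to its counit, leaving v in front of the
    second leg. *)
Let qp_jS v y : tmap q p (D (jS v * y)) = (1 \ox v : stensor U S) * (tmap q p (D y) : stensor U S).
Proof.
have bS : bilin (fun (a b : S) => (eS a : K) *: b).
  by split=> z k a b /=; rewrite ?lrmP ?scalerDl ?scalerDr !scalerA // mulrC.
have lS := tmap_lin ljS ljS.
suff key z z' : tmap q p ((tmap jS jS z : stensor H H) * z') =
    (1 \ox tlift (fun a b => (eS a : K) *: b) z : stensor U S) * (tmap q p z' : stensor U S).
  by rewrite lrmM D_jS key [tlift _ _](counitl coS).
move: z; apply: stens_ext.
- by move=> k a b; rewrite (lS k a b) mulrDl -scalerAl lqp.
- by move=> k a b; rewrite (tlift_linear bS) tensDr tensZr [LHS]mulrDl -scalerAl.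
move=> m n a b ha hb; rewrite tmap_tens // tlift_tens //.
move: z'; apply: stens_ext.
- by move=> k x x'; rewrite mulrDr -scalerAr lqp.
- by move=> k x x'; rewrite (lqp k x x') mulrDr -scalerAr.
move=> m' n' x x' hx hx'; rewrite (stensM _ _ (hjS hb) hx) (linZ _ _ lqp) !tmap_tens //.
rewrite (stensM _ _ (homogZ _ hb) (hq hx)) lrmM q_jS p_jS mul1r -!scalerAl mul1r.
by rewrite tensZl tensZr.
Qed.

Let cop_term (u : U) (v : S) (u' : U) (v' : S) : tensor (tensor U U) S :=
  koszul (fun v u' => (u \ox u') \ox (v * v')) v u'.
Let cop_bil u v' : bilin (fun v u' => (u \ox u') \ox (v * v') : tensor (tensor U U) S).
Proof.
split=> z k x y; first by rewrite mulrDl -scalerAl tensDr tensZr.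
by rewrite tensDr tensZr tensDl tensZl.
Qed.
Let cop_fr u v : bilin (cop_term u v).
Proof.
split=> [v'|u']; first exact: (koszul_bilin (cop_bil u v')).2.
apply: (@koszul_param K S U _ S (fun v' v u' => (u \ox u') \ox (v * v'))) => a b k x y.
by rewrite mulrDr -scalerAr tensDr tensZr.
Qed.
Let cop_fl u' v' : bilin (fun u v => cop_term u v u' v').
Proof.
split=> [v|u]; last exact: (koszul_bilin (cop_bil u v')).1.
apply: (@koszul_param K S U _ U (fun u v u' => (u \ox u') \ox (v * v'))) => a b k x y.
by rewrite tensDl tensZl tensDl tensZl.
Qed.

(** After reassociation the left side is q \ox ((q \ox p) D) applied to D (jU h); substituting
    [D_jU_star] and pulling S out by [qp_jS] gives the right side. *)
Let bbeta_coprod h : tmap DU id (bbeta h) =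
  tlift (fun h1 h2 => tlift2 cop_term (bbeta h1) (bbeta h2)) (DU h).
Proof.
apply: (can_inj (@tassocK K U U S)).
have lN : linear (fun y => tmap q p (D y)) := lin_comp lqp lD.
have bT := tlift2_bilin cop_fr cop_fl.
have bR := bilin_comp bT lbeta lbeta.
rewrite (tlift_lin _ (@tassoc_linear K _ _ _) bR) {1}/bbeta tmap_comp //.
rewrite (eq_tmap (f' := fun x => tmap q q (D x)) (g' := p)) //; last first.
rewrite (tassoc_tmap (D := D) (h := id) (f := q) (g := q) (k := p) _ lD (@lid _) lq lq p_linear).
rewrite coassocH tmap_comp // D_jU_star (tlift_lin _ (tmap_lin lq lN) star_bil).
apply: eq_tlift => h1 h2; rewrite /star_term; move: (bbeta h1 : tensor U S).
have lqN := tmap_lin lq lN.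
apply: tlift_ext.
- by move=> k x y; rewrite (lUS k x y) mulrDl -scalerAl lqN.
- exact: lin_comp (@tassoc_linear K _ _ _) (bT.1 _).
move=> u v; rewrite tmap_tens // stensM0r; last exact: homog1.
rewrite mulr1 tmap_tens // q_jU qp_jS -/(bbeta h2).
move: (bbeta h2 : tensor U S).
have lu : linear (fun y : tensor U S => u \ox y).
  by move=> k x y; rewrite tensDr tensZr.
apply: tlift_ext.
- by move=> k x y; rewrite -lu mulrDr -scalerAr.
- exact: lin_comp (@tassoc_linear K _ _ _) (bT.2 _).
move=> u' v'; rewrite (tlift2E cop_fr cop_fl).
elim/(@homog_ind K S): v => [|m v v1 hv IHv].
  by rewrite tens0r mul0r (lin0 lu) (lin0 ((cop_fl u' v').2 u)) (lin0 (@tassoc_linear K _ _ _)).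
rewrite tensDr mulrDl (linD lu) IHv (linD ((cop_fl u' v').2 u)) (linD (@tassoc_linear K _ _ _)).
congr (_ + _); move=> {IHv}.
elim/(@homog_ind K U): u' => [|n u' u1 hu IHu].
  by rewrite tens0l mulr0 (lin0 lu) (lin0 ((cop_fr u v).1 v')) (lin0 (@tassoc_linear K _ _ _)).
rewrite tensDl mulrDr (linD lu) IHu (linD ((cop_fr u v).1 v')) (linD (@tassoc_linear K _ _ _)).
congr (_ + _); rewrite (stensM _ _ hv hu) mul1r /cop_term (koszulE (cop_bil u v') hv hu).
by rewrite (linZ _ _ (@tassoc_linear K _ _ _)) tassocE (linZ _ _ lu).
Qed.

Lemma bicross_comodule_coalgebra : super_comodule_coalgebra DS DU eS eU bbeta.
Proof.
split.
- exact: lbeta.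
- exact: bbeta_comodule.
- exact: bbeta_coprod.
- move=> h; have bU : bilin (fun (a : U) (b : S) => (eU a : K) *: b).
    by split=> z k a b /=; rewrite ?lrmP ?scalerDl ?scalerDr !scalerA // mulrC.
  rewrite /bbeta tlift_tmap //.
  rewrite (eq_tlift (G := fun x y => p ((eH x : K) *: y))); last first.
    by move=> x y; rewrite eU_q (linZ _ _ p_linear).
  by rewrite -(tlift_lin (h := p) _ p_linear (cl_bil H leH)) [tlift _ _](counitl coH) p_of_jU.
- by move=> n h; rewrite /bbeta dJU.1 dD.1 (tmap_gpr lq p_linear dQ.1 p_gpr).
- by move=> h; rewrite /bbeta dJU.2 dD.2 (tmap_dif lq p_linear dQ.1 dQ.2 p_dif).
Qed.

Let SU_bil (w1 : S) (h2 : U) (v : S) : bilin (fun (w2 : S) (u : U) => (w1 \ox u) \ox ((w2 * v) \ox h2)).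
Proof.
split=> z k x y; first by rewrite mulrDl -scalerAl tensDl tensZl tensDr tensZr.
by rewrite tensDr tensZr tensDl tensZl.
Qed.
Let cop2 (w1 w2 : S) (h2 u : U) (v : S) : tensor (tensor S U) (tensor S U) :=
  koszul (fun w2 u => (w1 \ox u) \ox ((w2 * v) \ox h2)) w2 u.
Let cop2_bil w1 w2 h2 : bilin (cop2 w1 w2 h2).
Proof.
split=> [v|u]; first exact: (koszul_bilin (SU_bil w1 h2 v)).2.
apply: (@koszul_param K S U _ S (fun v w2 u => (w1 \ox u) \ox ((w2 * v) \ox h2))) => a b k x y.
by rewrite mulrDr -scalerAr tensDl tensZl tensDr tensZr.
Qed.
Let cop4 (w1 w2 : S) (h1 h2 : U) := tlift (cop2 w1 w2 h2) (bbeta h1).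
Let cop4_fr w1 w2 : bilin (cop4 w1 w2).
Proof.
split=> [h2|h1]; first exact: lin_comp (tlift_linear (cop2_bil w1 w2 h2)) lbeta.
apply: (@tlift_param K U S _ U (fun h2 => cop2 w1 w2 h2)) => u v.
apply: (@koszul_param K S U _ U (fun h2 w2 u => (w1 \ox u) \ox ((w2 * v) \ox h2))) => a b k x y.
by rewrite !tensDr !tensZr.
Qed.
Let cop4_fl h1 h2 : bilin (fun w1 w2 => cop4 w1 w2 h1 h2).
Proof.
split=> [w2|w1].
  apply: (@tlift_param K U S _ S (fun w1 => cop2 w1 w2 h2)) => u v.
  apply: (@koszul_param K S U _ S (fun w1 w2 u => (w1 \ox u) \ox ((w2 * v) \ox h2))) => a b k x y.
  by rewrite !tensDl !tensZl.
apply: (@tlift_param K U S _ S (fun w2 => cop2 w1 w2 h2)) => u v.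
exact: (koszul_bilin (SU_bil w1 h2 v)).1.
Qed.

Lemma bicross_copE_abs z : D (mu z) = tmap mu mu (bicross_cop DS DU bbeta z).
Proof.
have b4 := tlift2_bilin cop4_fr cop4_fl.
have bC := bilin_comp b4 lDS lDU.
have lmm := tmap_lin mu_linear mu_linear.
move: z; apply: tlift_ext; first exact: lin_comp lD mu_linear.
  exact: lin_comp lmm (tlift_linear bC).
move=> w h; rewrite muE lrmM D_jS D_jU_star.
rewrite [bicross_cop _ _ _ _](tlift_tens w h bC).
have lS := tmap_lin ljS ljS.
suff key zS zU : (tmap jS jS zS : stensor H H) * tlift star_term zU =
  tmap mu mu (tlift2 cop4 zS zU) by exact: key.
move: zS; apply: stens_ext.
- by move=> k x y; rewrite (lS k x y) mulrDl -scalerAl.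
- exact: lin_comp lmm (b4.1 zU).
move=> m n w1 w2 hw1 hw2; rewrite tmap_tens //.
move: zU; apply: tlift_ext.
- by move=> k x y; rewrite (tlift_linear star_bil) mulrDr -scalerAr.
- exact: lin_comp lmm (b4.2 _).
move=> h1 h2; rewrite (tlift_tens _ _ star_bil) (tlift2E cop4_fr cop4_fl) /star_term /cop4.
move: (bbeta h1 : tensor U S); apply: stens_ext.
- by move=> k x y; rewrite (lUS k x y) mulrDl mulrDr -scalerAl -scalerAr.
- exact: lin_comp lmm (tlift_linear (cop2_bil w1 w2 h2)).
move=> m' n' u v hu hv; rewrite tmap_tens // (tlift_tens _ _ (cop2_bil w1 w2 h2)) /cop2.
rewrite (koszulE (SU_bil w1 h2 v) hw2 hu) (linZ _ _ lmm) tmap_tens; [|exact: mu_linear|exact: mu_linear].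
rewrite !muE stensM0r; last exact: homog1.
by rewrite mulr1 (stensM _ _ (hjS hw2) (hjU hu)) lrmM mulrA.
Qed.

(* The antipode of H is the convolution product of those of U and S. *)
Let mulf (f g : H -> H) (a b : H) : H := f a * g b.
Let mulf_bil f g : linear f -> linear g -> bilin (mulf f g).
Proof. exact: bilin_comp (mul_bilin H). Qed.
Let conv (f g : H -> H) (x : H) : H := tlift (mulf f g) (D x).
Let conv_linear f g : linear f -> linear g -> linear (conv f g).
Proof. by move=> lf lg; exact: lin_comp (tlift_linear (mulf_bil lf lg)) lD. Qed.
Let eq_conv f f' g g' x : (forall y, f y = f' y) -> (forall y, g y = g' y) ->
  conv f g x = conv f' g' x.
Proof. by move=> e1 e2; apply: eq_tlift => a b; rewrite /mulf e1 e2. Qed.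

Let convA f g h x : linear f -> linear g -> linear h ->
  conv (conv f g) h x = conv f (conv g h) x.
Proof.
move=> lf lg lh; have bfg := mulf_bil lf lg; have bgh := mulf_bil lg lh.
have bL := bilin_comp (mul_bilin H) (tlift_linear bfg) lh.
have bR := bilin_comp (mul_bilin H) lf (tlift_linear bgh).
rewrite /conv -[LHS](tlift_tmap (F := fun z b => tlift (mulf f g) z * h b) (f := D) (g := id)) //.
rewrite -[RHS](tlift_tmap (F := fun a z => f a * tlift (mulf g h) z) (f := id) (g := D)) //.
rewrite -coassocH; move: (tmap D id (D x)); apply: tensor3_ext.
- exact: tlift_linear.
- exact: lin_comp (tlift_linear bR) (@tassoc_linear K _ _ _).
move=> a b c; rewrite tassocE (tlift_tens _ _ bL) (tlift_tens _ _ bR).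
by rewrite (tlift_tens _ _ bfg) (tlift_tens _ _ bgh) /mulf mulrA.
Qed.
Let cunit (x : H) : H := (eH x : K)%:A.
Let lcunit : linear cunit.
Proof. by move=> k x y; rewrite /cunit lrmP scalerDl scalerA. Qed.
Let convul f x : linear f -> conv cunit f x = f x.
Proof.
move=> lf; rewrite -{2}[x](counitl coH) (tlift_lin _ lf (cl_bil H leH)).
by apply: eq_tlift => a b; rewrite /mulf /cunit -scalerAl mul1r (linZ _ _ lf).
Qed.

Section ConvMap.
Variables (X : dgaType K) (r : H -> X) (j : {lrmorphism X -> H}) (DX : {lrmorphism X -> stensor X X})
  (eX : {lrmorphism X -> K^o}).
Hypotheses (lr : linear r) (r_D : forall y, tmap r r (D y) = DX (r y))
  (eX_r : forall y, eX (r y) = eH y).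
Let conv_map (F G : X -> X) x : linear F -> linear G ->
  conv (fun y => j (F (r y))) (fun y => j (G (r y))) x = j (tlift (fun a b => F a * G b) (DX (r x))).
Proof.
move=> lF lG; have b := bilin_comp (mul_bilin X) lF lG.
rewrite -r_D tlift_tmap // (tlift_lin _ (lrm_linear j)); last exact: bilin_comp b lr lr.
by apply: eq_tlift => y y'; rewrite /mulf lrmM.
Qed.
(** For a coalgebra map r and an algebra map j, composing the antipode of X with both yields the
    convolution inverse of j r. *)
Lemma conv_antipode (A : X -> X) x : linear A -> antipode DX eX A ->
  conv (fun y => j (A (r y))) (fun y => j (r y)) x = cunit x /\
  conv (fun y => j (r y)) (fun y => j (A (r y))) x = cunit x.
Proof.
move=> lA hA; rewrite (@conv_map A id) // (@conv_map id A) //.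
by have [-> ->] := hA (r x); rewrite lrmZ lrm1 eX_r.
Qed.
End ConvMap.

Lemma mul_proj y : tlift (fun a b => jS (p a) * jU (q b)) (D y) = y.
Proof.
by rewrite -[RHS]mulK /unmul tmap_comp // /mul_map tlift_tmap //; exact: mu_bilin.
Qed.

Let graded_conv f g : linear f -> linear g -> (forall n x, homog n x -> homog n (f x)) ->
  (forall n x, homog n x -> homog n (g x)) -> forall n x, homog n x -> homog n (conv f g x).
Proof.
move=> lf lg hf hg n x hx; have b := mulf_bil lf lg; have lt := tlift_linear b.
have e z : tlift (mulf f g) (gpr n (z : stensor H H)) = gpr n (tlift (mulf f g) z).
  move: z; apply: stens_ext.
  - by move=> k y y'; rewrite (gpr_linear n k (y : stensor H H)) lt.
  - exact: lin_comp (gpr_linear n) lt.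
  move=> m m' a c ha hc; rewrite (stens_gpr _ ha hc) (tlift_tens _ _ b).
  rewrite (gprE _ (homogM (hf _ _ ha) (hg _ _ hc))).
  by case: eqP => _; [rewrite (tlift_tens _ _ b)|rewrite (lin0 lt)].
by rewrite /homog /conv -e (dga_map_homog dD hx).
Qed.

(** By [mul_proj] the identity is the convolution product [B0] [A0], so its inverse is [A1] [B1],
    where [A1] and [B1] are the convolution inverses of [A0] and [B0]. *)
Lemma bicross_antipode (AS : {linear S -> S}) (AU : {linear U -> U}) :
  antipode DS eS AS -> antipode DU eU AU ->
  (forall n x, homog n x -> homog n (AS x)) -> (forall n x, homog n x -> homog n (AU x)) ->
  exists2 A : {linear H -> H}, antipode D eH A & forall n x, homog n x -> homog n (A x).
Proof.
move=> hAS hAU gS gU.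
have lAS : linear AS := linearP AS. have lAU : linear AU := linearP AU.
pose A1 y := jU (AU (q y)). pose B1 y := jS (AS (p y)).
pose A0 y := jU (q y). pose B0 y := jS (p y).
have lA1 : linear A1 := lin_comp ljU (lin_comp lAU lq).
have lB1 : linear B1 := lin_comp ljS (lin_comp lAS p_linear).
have lB0 : linear B0 := lin_comp ljS p_linear.
have lA0 : linear A0 := ljUq.
have eid x : conv B0 A0 x = x by exact: mul_proj.
have [cA cA'] : (forall x, conv A1 A0 x = cunit x) /\ (forall x, conv A0 A1 x = cunit x).
  by split=> x; have [] := @conv_antipode U q jU DU eU lq q_D eU_q AU x lAU hAU.
have DSp y : tmap p p (D y) = DS (p y) by rewrite DS_p.
have [cB cB'] : (forall x, conv B1 B0 x = cunit x) /\ (forall x, conv B0 B1 x = cunit x).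
  by split=> x; have [] := @conv_antipode S p jS DS eS p_linear DSp eS_p AS x lAS hAS.
have lc := conv_linear.
exists (lin_of (lc _ _ lA1 lB1)) => [x|]; last first.
  apply: graded_conv => //; move=> n y hy; first exact/hjU/gU/hq.
  exact/hjS/gS/hp.
split.
- transitivity (conv (conv A1 B1) (conv B0 A0) x).
    by apply: eq_tlift => a b; rewrite /mulf eid.
  rewrite convA //; last exact: lc.
  rewrite -[RHS]cA; apply: eq_conv => // y; rewrite -convA //.
  by rewrite -[RHS](convul _ lA0); apply: eq_conv.
- transitivity (conv (conv B0 A0) (conv A1 B1) x).
    by apply: eq_tlift => a b; rewrite /mulf eid.
  rewrite convA //; last exact: lc.
  rewrite -[RHS]cB'; apply: eq_conv => // y; rewrite -convA //.
  by rewrite -[RHS](convul _ lB1); apply: eq_conv.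
Qed.

Lemma abstract_super_bicrossproduct : super_bicrossproduct DS DU bact bbeta D jS jU.
Proof.
split; [exact: mu_bij|exact: bicross_mulE_abs|exact: bicross_copE_abs|exact: mu_gpr|exact: mu_dif].
Qed.
End AbstractBicross.

(** * Antipodes *)

(* The super-opposite algebra: [x *' y = (-1)^(|x||y|) y * x]. *)
Definition sop (K : fieldType) (W : dgaType K) : Type := W.
HB.instance Definition _ (K : fieldType) (W : dgaType K) := GRing.Lmodule.on (sop W).

Section SuperOpposite.
Variables (K : fieldType) (W : dgaType K).
Local Notation T := (sop W).

Let mop (x y : W) : W := y * x.
Let mop_bil : bilin mop. Proof. by have [l r] := mul_bilin W; split. Qed.
Definition opmul : T -> T -> T := koszul mop.
Let opmul_bilin : bilin (opmul : W -> W -> W). Proof. exact: koszul_bilin. Qed.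
Lemma opmulE m n (x y : W) : homog m x -> homog n y -> opmul x y = (-1) ^+ (m * n) *: (y * x).
Proof. exact: koszulE. Qed.

Let homog_ext3 (U : lmodType K) (f g : W -> W -> W -> U) :
  (forall y z, linear (fun x => f x y z)) -> (forall y z, linear (fun x => g x y z)) ->
  (forall x z, linear (fun y => f x y z)) -> (forall x z, linear (fun y => g x y z)) ->
  (forall x y, linear (f x y)) -> (forall x y, linear (g x y)) ->
  (forall m n p x y z, homog m x -> homog n y -> homog p z -> f x y z = g x y z) ->
  forall x y z, f x y z = g x y z.
Proof.
move=> f1 g1 f2 g2 f3 g3 e x y z.
move: x; apply: homog_ext => // m x hx; move: y; apply: homog_ext => // n y hy.
by move: z; apply: homog_ext => // p z hz; exact: (e m n p).
Qed.

Let opA : associative opmul.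
Proof.
have [bl br] := opmul_bilin.
apply: (@homog_ext3 W (fun x y z => opmul x (opmul y z)) (fun x y z => opmul (opmul x y) z)).
- by move=> y z; exact: bl.
- by move=> y z; exact: lin_comp (bl z) (bl y).
- by move=> x z; exact: lin_comp (br x) (bl z).
- by move=> x z; exact: lin_comp (bl z) (br x).
- by move=> x y; exact: lin_comp (br x) (br y).
- by move=> x y; exact: br.
move=> m n p x y z hx hy hz.
rewrite (opmulE hy hz) (linZ _ _ (br x)) (opmulE hx (homogM hz hy)) (opmulE hx hy).
rewrite (linZ _ _ (bl z)) (opmulE (homogM hy hx) hz) !scalerA -!exprD mulrA.
by rewrite mulnDl mulnDr addnA addnC.
Qed.
Let op1l : left_id 1 opmul.
Proof.
have [bl br] := opmul_bilin.
by apply: (homog_ext (br 1) (@lin_id K W)) => n x hx; rewrite (opmulE (homog1 W) hx) scale1r mulr1.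
Qed.
Let op1r : right_id 1 opmul.
Proof.
have [bl br] := opmul_bilin.
by apply: (homog_ext (bl 1) (@lin_id K W)) => n x hx; rewrite (opmulE hx (homog1 W)) muln0 scale1r mul1r.
Qed.
Let opDl : left_distributive opmul +%R.
Proof. by move=> x y z; exact: (linD (opmul_bilin.1 z)). Qed.
Let opDr : right_distributive opmul +%R.
Proof. by move=> x y z; exact: (linD (opmul_bilin.2 x)). Qed.
Let op1_neq0 : (1 : W) != 0 :> T. Proof. exact: oner_neq0. Qed.

HB.instance Definition _ := GRing.Zmodule_isNzRing.Build T opA op1l op1r opDl opDr op1_neq0.

Let opAl k (x y : T) : k *: (opmul x y : T) = opmul (k *: x) y.
Proof. exact: (esym (linZ k x (opmul_bilin.1 y))). Qed.
Let opAr k (x y : T) : k *: (opmul x y : T) = opmul x (k *: y).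
Proof. exact: (esym (linZ k y (opmul_bilin.2 x))). Qed.
HB.instance Definition _ := GRing.Lmodule_isLalgebra.Build K T opAl.
HB.instance Definition _ := GRing.Lalgebra_isAlgebra.Build K T opAr.

Let g (n : nat) (x : T) : T := gpr n (x : W).
Let d (x : T) : T := dif (x : W).
Let g_linear n : linear (g n). Proof. exact: (@gpr_linear K W). Qed.
Let gK m n x : g m (g n x) = if m == n then g n x else 0. Proof. exact: (@gprK K W). Qed.
Let g_sum x : exists N, x = \sum_(n < N) g n x. Proof. exact: (@gpr_sum K W). Qed.
Let g1 : g 0 1 = 1. Proof. exact: (@gpr1 K W). Qed.
Let gM m n x y : g (m + n) (g m x * g n y) = g m x * g n y.
Proof.
rewrite [_ * _](opmulE (gpr_homog m (x : W)) (gpr_homog n (y : W))).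
by apply: homogZ; rewrite addnC; exact: homogM (gpr_homog _ _) (gpr_homog _ _).
Qed.
Let d_linear : linear d. Proof. exact: (@dif_linear K W). Qed.
Let g0d x : g 0 (d x) = 0. Proof. exact: (@gpr0_dif K W). Qed.
Let gSd n x : g n.+1 (d x) = d (g n x). Proof. exact: (@gprS_dif K W). Qed.
Let dK x : d (d x) = 0. Proof. exact: (@difK K W). Qed.
Let dM m x y : d (g m x * y) = d (g m x) * y + (-1) ^+ m *: (g m x * d y).
Proof.
have [bl br] := opmul_bilin; have hx := gpr_homog m (x : W); move: hx; rewrite -/(g m x).
move: (g m x) => {}x hx; move: y.
apply: (@homog_ext K W W (fun y => d (x * y)) (fun y => d x * y + (-1) ^+ m *: (x * d y))).
- exact: lin_comp d_linear (br x).
- move=> k a b; rewrite [d x * _](br (d x)) d_linear [x * _](br x) !scalerDr !scalerA.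
  by rewrite [_ * k]mulrC addrACA.
move=> n y hy; rewrite [x * y](opmulE hx hy) [d x * y](opmulE (homog_dif hx) hy).
rewrite [x * d y](opmulE hx (homog_dif hy)) /d difZ (difMh _ hy) scalerDr !scalerA -!exprD.
rewrite addrC mulSn mulnS addnC; congr (_ + _); congr (_ *: _).
by rewrite addnA addnn -mul2n exprD (exprM _ 2) sqrrN !expr1n mul1r.
Qed.
HB.instance Definition _ := Algebra_isDGA.Build K T g_linear gK g_sum g1 gM
  d_linear g0d gSd dK dM.

Lemma sopM m n (x y : W) : homog m x -> homog n y ->
  (x : T) * (y : T) = (-1) ^+ (m * n) *: (y * x) :> W.
Proof. exact: opmulE. Qed.
End SuperOpposite.

Section TotalDegree.
Variables (K : fieldType) (V W : dgaType K) (U : lmodType K).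
Lemma stens_homog_ext m (f g : stensor V W -> U) : linear f -> linear g ->
  (forall p q a b, (p + q)%N = m -> homog p a -> homog q b -> f (a \ox b) = g (a \ox b)) ->
  forall z : stensor V W, homog m z -> f z = g z.
Proof.
move=> lf lg e z hz.
have lG := @gpr_linear K (stensor V W) m.
rewrite -hz; move: z {hz}; apply: (@stens_ext K V W U (fun z => f (gpr m (z : stensor V W)))
  (fun z => g (gpr m (z : stensor V W)))).
- exact: lin_comp lf lG.
- exact: lin_comp lg lG.
move=> p q a b ha hb; rewrite (stens_gpr _ ha hb).
case: eqP => [em|_]; last by rewrite (lin0 lf) (lin0 lg).
by apply: (e p q).
Qed.
End TotalDegree.

(** * Antipodes from DGA maps to the super-opposite algebra *)

Section GradedAntipode.
Variables (K : fieldType) (W : dgaType K) (D : {lrmorphism W -> stensor W W})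
  (e : {lrmorphism W -> K^o}) (S : {lrmorphism W -> sop W}) (X : Type) (g : X -> W).
Hypotheses (dD : dga_map D) (e_homog : forall n v, homog n.+1 v -> e v = 0).
Hypotheses (dS : dga_map S) (gen : dga_generated g) (hg : forall k, homog 0 (g k)).
Let A (x : W) : W := S x.
Let lA : linear A := lrm_linear S.
Let hA n x : homog n x -> homog n (A x). Proof. by move=> hx; exact: (dga_map_homog dS hx). Qed.
Let dA x : A (dif x) = dif (A x). Proof. exact: dS.2. Qed.
Let AM m n x y : homog m x -> homog n y -> A (x * y) = (-1) ^+ (m * n) *: (A y * A x).
Proof. by move=> hx hy; rewrite /A lrmM; exact: (sopM (hA hx) (hA hy)). Qed.
Let bL : bilin (fun a b => A a * b). Proof. exact: bilin_comp (mul_bilin W) lA (@lin_id K W). Qed.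
Let bR : bilin (fun a b => a * A b). Proof. exact: bilin_comp (mul_bilin W) (@lin_id K W) lA. Qed.
Let L : stensor W W -> W := tlift (fun a b => A a * b).
Let R : stensor W W -> W := tlift (fun a b => a * A b).
Let lL : linear L. Proof. exact: tlift_linear. Qed.
Let lR : linear R. Proof. exact: tlift_linear. Qed.
Let LE a b : L (a \ox b) = A a * b. Proof. exact: tlift_tens. Qed.
Let RE a b : R (a \ox b) = a * A b. Proof. exact: tlift_tens. Qed.

Let mr (y : W) : linear (fun x : W => x * y). Proof. exact: (mul_bilin W).1. Qed.
Let ml (y : W) : linear (fun x : W => y * x). Proof. exact: (mul_bilin W).2. Qed.
Let mrT (y : stensor W W) : linear (fun x : stensor W W => x * y).
Proof. exact: (mul_bilin (stensor W W)).1. Qed.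
Let mlT (y : stensor W W) : linear (fun x : stensor W W => y * x).
Proof. exact: (mul_bilin (stensor W W)).2. Qed.

(** Super antimultiplicativity puts A a outside, so the convolution over the left factor collapses
    before the right factor is touched. *)
Let L_mul m p (z : stensor W W) a b : homog m z -> homog p a ->
  L (z * (a \ox b)) = (-1) ^+ (m * p) *: (A a * L z * b).
Proof.
move=> hz ha; move: hz; apply: (stens_homog_ext (f := fun z => L (z * (a \ox b)))
  (g := fun z => (-1) ^+ (m * p) *: (A a * L z * b))).
- exact: lin_comp lL (mrT _).
- have l1 := lin_comp (mr b) (lin_comp (ml (A a)) lL).
  by move=> k x y; rewrite l1 scalerDr !scalerA mulrC.
move=> q r u v <- hu hv; rewrite (stensM _ _ hv ha) (linZ _ _ lL) !LE (AM hu ha).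
by rewrite -!scalerAl scalerA -exprD -mulnDl addnC !mulrA.
Qed.
Let R_mul m q (z : stensor W W) a b : homog m z -> homog q b ->
  R ((a \ox b : stensor W W) * z) = (-1) ^+ (q * m) *: (a * R z * A b).
Proof.
move=> hz hb; move: hz; apply: (stens_homog_ext (f := fun z => R ((a \ox b : stensor W W) * z))
  (g := fun z => (-1) ^+ (q * m) *: (a * R z * A b))).
- exact: lin_comp lR (mlT _).
- have l1 := lin_comp (mr (A b)) (lin_comp (ml a) lR).
  by move=> k x y; rewrite l1 scalerDr !scalerA mulrC.
move=> p r u v <- hu hv; rewrite (stensM _ _ hb hu) (linZ _ _ lR) !RE (AM hb hv).
by rewrite -!scalerAr scalerA -exprD -mulnDr !mulrA.
Qed.

(** A sign depending on the degree of x is harmless next to e x, which vanishes in positive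
    degree. *)
Let eD0 m x z : homog m x -> ((-1) ^+ (m * z) * (e x : K) : K) = e x.
Proof. by case: m => [|m] hx; [rewrite mul1r|rewrite (e_homog hx) mulr0]. Qed.

Let good (x : W) := L (D x) = (e x : K)%:A /\ R (D x) = (e x : K)%:A.
Let goodM m n x y : homog m x -> homog n y -> good x -> good y -> good (x * y).
Proof.
move=> hx hy [Lx Rx] [Ly Ry]; have hDx := dga_map_homog dD hx; have hDy := dga_map_homog dD hy.
split; rewrite lrmM lrmM -[in RHS]scalerA.
- rewrite -Ly; move: (D y); apply: (@stens_ext K W W _ (fun z => L (D x * z)) (fun z => (e x : K) *: L z)).
  + exact: lin_comp lL (mlT _).
  + by move=> k u v; rewrite lL scalerDr !scalerA mulrC.
  move=> p q a b ha hb; rewrite (L_mul _ hDx ha) Lx LE.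
  by rewrite -scalerAr -scalerAl scalerA mulr1 eD0.
- rewrite scalerA mulrC -scalerA -Rx; move: (D x).
  apply: (@stens_ext K W W _ (fun z => R ((z : stensor W W) * D y)) (fun z => (e y : K) *: R z)).
  + exact: lin_comp lR (mrT _).
  + by move=> k u v; rewrite lR scalerDr !scalerA mulrC.
  move=> p q a b ha hb; rewrite (R_mul _ hDy hb) Ry RE.
  by rewrite -scalerAr -scalerAl scalerA mulr1 mulnC eD0.
Qed.
Let L_dif z : L (dif z) = dif (L z).
Proof.
move: z; apply: stens_ext.
- exact: lin_comp lL (@dif_linear K (stensor W W)).
- exact: lin_comp (@dif_linear K W) lL.
move=> p q a b ha hb; rewrite (stens_dif _ ha) (linD lL) (linZ _ _ lL) !LE dA.
by rewrite (difMh _ (hA ha)).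
Qed.
Let R_dif z : R (dif z) = dif (R z).
Proof.
move: z; apply: stens_ext.
- exact: lin_comp lR (@dif_linear K (stensor W W)).
- exact: lin_comp (@dif_linear K W) lR.
move=> p q a b ha hb; rewrite (stens_dif _ ha) (linD lR) (linZ _ _ lR) !RE dA.
by rewrite (difMh _ ha).
Qed.
Let good_lin : lin_closed good.
Proof.
move=> k x y [Lx Rx] [Ly Ry].
by split; rewrite lrmP (lL, lR) ?Lx ?Ly ?Rx ?Ry lrmP scalerDl scalerA.
Qed.
Let good0 : good 0. Proof. by split; rewrite !lrm0 scale0r ?(lin0 lL) ?(lin0 lR). Qed.
Let good_dif x : homog 0 x -> good x -> good (dif x).
Proof.
move=> hx [Lx Rx]; rewrite /good (e_homog (homog_dif hx)) scale0r dD.2 L_dif R_dif Lx Rx.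
by rewrite difZ dif1 scaler0.
Qed.

Lemma graded_antipode :
  (forall k, tlift (fun a b => A a * b) (D (g k)) = (e (g k) : K)%:A) ->
  (forall k, tlift (fun a b => a * A b) (D (g k)) = (e (g k) : K)%:A) ->
  exists2 S' : {linear W -> W}, antipode D e S' & forall n x, homog n x -> homog n (S' x).
Proof.
move=> hL hR; have gg k : good (g k) by split; [exact: hL|exact: hR].
(* The claim is made for every homogeneous component because [goodM] needs homogeneous factors. *)
have all n x : good (gpr n x).
  move: x n; apply: gen => [n|n|k x y hx hy n|k x hx n|k x hx n].
  - by rewrite (lin0 (gpr_linear _)).
  - case: n => [|n]; last by rewrite (gprE _ (homog1 W)).
    by rewrite gpr1; split; rewrite !lrm1 scale1r ?LE ?RE /A lrm1 mulr1.
  - by rewrite gpr_linear; apply: good_lin.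
  - rewrite (gpr_mull _ _ (hg k)) subn0; apply: goodM (hg k) (gpr_homog _ _) _ _ => //; exact: hx.
  - have h1 := homog_dif (hg k); rewrite (gpr_mull _ _ h1); case: leqP => _ //.
    by apply: goodM h1 (gpr_homog _ _) _ _; [exact: good_dif|exact: hx].
exists (lin_of lA) => [x|n x]; last exact: hA.
suff : good x by [].
rewrite (gbound_sum x); elim/big_ind: _ => // y z gy gz.
by rewrite -[y]scale1r; exact: good_lin.
Qed.
End GradedAntipode.

Lemma super_hopf_of (K : fieldType) (W : dgaType K) (D : {lrmorphism W -> stensor W W})
  (e : {lrmorphism W -> K^o}) : dga_map D -> (forall n v, homog n.+1 v -> e v = 0) ->
  coalgebra D e ->
  (exists2 S : {linear W -> W}, antipode D e S & forall n x, homog n x -> homog n (S x)) ->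
  super_hopf D e.
Proof.
move=> dD he co [S aS hS]; split=> // [x|x|].
- apply: (graded_parity (lrm_linear D)) => n y; exact: dga_map_homog.
- move: x; apply: homog_ext.
  + exact: lin_comp (lrm_linear e) (@parity_linear K W).
  + exact: lrm_linear.
  + by move=> [|n] x hx; rewrite (parityE hx) ?scale1r // lrmZ (he _ _ hx) scaler0.
- by exists S => //; apply: graded_parity => //; exact: linearP.
Qed.

Section Antipodes.
Variables (K : fieldType) (lam : K).
Hypotheses (lam0 : lam != 0) (two_neq0 : 2%:R != 0 :> K).
Local Notation OSO := (OmegaSO K).
Local Notation OUb := (OmegaUb lam).
Local Notation OP := (OmegaPoinc lam).
Local Notation t := (oua0 lam).
Local Notation x := (oua1 lam).
Local Notation th := (outh lam).
Local Notation c := (osoc K).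
Local Notation s := (osos K).
Local Notation D := (OP_cop lam0 two_neq0).

Lemma sop0l (W : dgaType K) (a b : W) : homog 0 a -> (a : sop W) * (b : sop W) = b * a :> W.
Proof.
move=> ha; move: b; apply: homog_ext.
- exact: (mull_linear (a : sop W)).
- exact: (mul_bilin W).1.
- by move=> n b hb; rewrite (sopM ha hb) scale1r.
Qed.
Lemma sop0r (W : dgaType K) (a b : W) : homog 0 b -> (a : sop W) * (b : sop W) = b * a :> W.
Proof.
move=> hb; move: a; apply: homog_ext.
- exact: ((mul_bilin (sop W)).1 b).
- exact: (mul_bilin W).2.
- by move=> n a ha; rewrite (sopM ha hb) muln0 scale1r.
Qed.
Lemma sop11 (W : dgaType K) (a b : W) : homog 1 a -> homog 1 b ->
  (a : sop W) * (b : sop W) = - (b * a) :> W.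
Proof. by move=> ha hb; rewrite (sopM ha hb) scaleN1r. Qed.

Lemma homogN (W : dgaType K) n (a : W) : homog n a -> homog n (- a).
Proof. by move=> ha; rewrite -scaleN1r; apply: homogZ. Qed.
Let hc := homog_osoc K. Let hs := homog_osos K.
Let rS := OmegaSO_sat K.
Let rSop : @OmegaSO_rel K (sop OSO) c (- s).
Proof.
have [[e0 e1] e2 e3 e4 e5 e6] := rS; have hn := homogN hs.
have dN : dif (- s : sop OSO) = - dif s :> OSO by exact: difN.
have ed y : @dif K (sop OSO) y = @dif K OSO y by [].
split; first split; rewrite ?expr2 ?(sop0l _ hc) ?(sop0l _ hn) ?(sop0r _ hc) ?(sop0r _ hn)
 ?dN ?(sop0l _ hc) ?(sop0l _ hn) ?(sop0r _ hc) ?(sop0r _ hn) ?ed ?(mulNr, mulrN) ?opprK -?expr2 //.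
- by rewrite e0.
- by rewrite e2.
- by rewrite e3.
- by rewrite -e6 -e5.
Qed.
(** Here theta' goes to - theta' as [dx, x] changes sign in the opposite order, and the relations of
    degree 2 survive because two one-forms pick up a sign in the super-opposite product. *)
Let rUop : @OmegaUb_rel K lam (sop OUb) (- t) (- x) (- th).
Proof.
have [r0 r1 r2 r3 r4 r5 r6 r7 r8 r9 r10 r11 r12] := OmegaUb_sat lam.
have h0 := homogN (homog_oua0 lam); have h1 := homogN (homog_oua1 lam).
have hth := homogN (homog_outh lam).
have hd0 := homog_dif h0; have hd1 := homog_dif h1.
have dN (y : OUb) : @dif K (sop OUb) (- y) = - dif y by exact: difN.
have hd (y : OUb) : homog 0 y -> homog 1 (- dif y) by move=> hy; apply/homogN/homog_dif.
rewrite /com ?expr2 in r1 r2 r3 r4 r5 r6 r8 r9 *; rewrite /Ub_rel /com in r0.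
split; rewrite /Ub_rel /com ?expr2 ?(sop0l _ h0) ?(sop0l _ h1) ?(sop0r _ h0) ?(sop0r _ h1)
 ?dN ?(sop0l _ h0) ?(sop0l _ h1) ?(sop0r _ h0) ?(sop0r _ h1).
all: rewrite ?(sop11 (hd _ (homog_oua0 lam)) (hd _ (homog_oua0 lam)))
  ?(sop11 (hd _ (homog_oua1 lam)) (hd _ (homog_oua1 lam)))
  ?(sop11 (hd _ (homog_oua1 lam)) (hd _ (homog_oua0 lam)))
  ?(sop11 (hd _ (homog_oua0 lam)) (hd _ (homog_oua1 lam)))
  ?(sop11 (hd _ (homog_oua0 lam)) hth) ?(sop11 hth (hd _ (homog_oua0 lam)))
  ?(sop11 (hd _ (homog_oua1 lam)) hth) ?(sop11 hth (hd _ (homog_oua1 lam))) ?mulrNN.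
- by rewrite -opprB r0 scalerN.
- by rewrite -opprB r1 scalerN.
- by rewrite -opprB r2 oppr0.
- by rewrite -opprB r3 scalerN.
- by rewrite -opprB r4 -scalerN opprD.
- by rewrite -opprB r5 oppr0.
- by rewrite -opprB r6 scalerN.
- by rewrite r7 oppr0.
- by rewrite r8 oppr0.
- by rewrite r9 oppr0.
- by rewrite r10 opprK.
- by rewrite r11 opprK.
- by rewrite r12 opprK.
Qed.

Definition OSO_anti : {lrmorphism OSO -> sop OSO} :=
  dlift (@OSO_dsat K (sop OSO) _ _ hc (homogN hs) rSop).
Definition OUb_anti : {lrmorphism OUb -> sop OUb} :=
  dlift (@OUb_dsat K lam (sop OUb) _ _ _ (homogN (homog_oua0 lam)) (homogN (homog_oua1 lam))
    (homogN (homog_outh lam)) rUop).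
Lemma OSO_anti_c : OSO_anti c = c. Proof. exact: dlift_gen. Qed.
Lemma OSO_anti_s : OSO_anti s = - s. Proof. exact: dlift_gen. Qed.
Lemma OUb_anti_0 : OUb_anti t = - t. Proof. exact: dlift_gen. Qed.
Lemma OUb_anti_1 : OUb_anti x = - x. Proof. exact: dlift_gen. Qed.

Lemma OSO_antipode : exists2 S : {linear OSO -> OSO}, antipode (OSO_cop K) (OSO_counit K) S &
  forall n y, homog n y -> homog n (S y).
Proof.
have bL := bilin_comp (mul_bilin OSO) (lrm_linear OSO_anti : linear (OSO_anti : OSO -> OSO)) (@lin_id K OSO).
have bR := bilin_comp (mul_bilin OSO) (@lin_id K OSO) (lrm_linear OSO_anti : linear (OSO_anti : OSO -> OSO)).
have [e0 e1] := OSO_SO rS; rewrite !expr2 in e1.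
have eL a b : tlift (fun a b : OSO => (OSO_anti a : OSO) * b) (a \ox b) = (OSO_anti a : OSO) * b.
  exact: tlift_tens bL.
have eR a b : tlift (fun a b : OSO => a * (OSO_anti b : OSO)) (a \ox b) = a * (OSO_anti b : OSO).
  exact: tlift_tens bR.
apply: (graded_antipode (S := OSO_anti) (OSO_cop_dga K) (OSO_counit_homog (K := K)) _
  (OSO_generated (K := K))).
- exact: dlift_dga_map.
- by move=> k; exact: SO_inc_homog.
- move=> k; rewrite SO_incE; case: k.
  + rewrite -/(osoc K) OSO_cop_c (linD (tlift_linear bL)) !eL OSO_anti_c OSO_anti_s eS_c.
    by rewrite mulNr e1 scale1r.
  + rewrite -/(osos K) OSO_cop_s (linD (tlift_linear bL)) !eL OSO_anti_c OSO_anti_s eS_s.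
    by rewrite mulNr e0 subrr scale0r.
- move=> k; rewrite SO_incE; case: k.
  + rewrite -/(osoc K) OSO_cop_c (linD (tlift_linear bR)) !eR OSO_anti_c OSO_anti_s eS_c.
    by rewrite mulrN e1 scale1r.
  + rewrite -/(osos K) OSO_cop_s (linD (tlift_linear bR)) !eR OSO_anti_c OSO_anti_s eS_s.
    by rewrite mulrN e0 addNr scale0r.
Qed.
Lemma OUb_antipode : exists2 S : {linear OUb -> OUb},
  antipode (OUb_cop lam0 two_neq0) (OUb_counit lam) S & forall n y, homog n y -> homog n (S y).
Proof.
have bL := bilin_comp (mul_bilin OUb) (lrm_linear OUb_anti : linear (OUb_anti : OUb -> OUb)) (@lin_id K OUb).
have bR := bilin_comp (mul_bilin OUb) (@lin_id K OUb) (lrm_linear OUb_anti : linear (OUb_anti : OUb -> OUb)).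
have eL a b : tlift (fun a b : OUb => (OUb_anti a : OUb) * b) (a \ox b) = (OUb_anti a : OUb) * b.
  exact: tlift_tens bL.
have eR a b : tlift (fun a b : OUb => a * (OUb_anti b : OUb)) (a \ox b) = a * (OUb_anti b : OUb).
  exact: tlift_tens bR.
apply: (graded_antipode (S := OUb_anti) (OUb_cop_dga lam0 two_neq0) (OUb_counit_homog (lam := lam)) _
  (OUb_generated lam0)).
- exact: dlift_dga_map.
- by move=> k; exact: Ub_inc_homog.
- move=> k; rewrite Ub_incE; case: k.
  + rewrite OUb_cop_0 (linD (tlift_linear bL)) !eL OUb_anti_0 lrm1 eU_0.
    by rewrite mul1r mulr1 subrr scale0r.
  + rewrite OUb_cop_1 (linD (tlift_linear bL)) !eL OUb_anti_1 lrm1 eU_1.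
    by rewrite mul1r mulr1 subrr scale0r.
- move=> k; rewrite Ub_incE; case: k.
  + rewrite OUb_cop_0 (linD (tlift_linear bR)) !eR OUb_anti_0 lrm1 eU_0.
    by rewrite mul1r mulr1 addNr scale0r.
  + rewrite OUb_cop_1 (linD (tlift_linear bR)) !eR OUb_anti_1 lrm1 eU_1.
    by rewrite mul1r mulr1 addNr scale0r.
Qed.

Lemma OUb_coalgebra : coalgebra (OUb_cop lam0 two_neq0) (OUb_counit lam).
Proof.
apply: (dga_coalgebra (dD := OUb_cop_dga lam0 two_neq0)
  (e_homog := OUb_counit_homog (lam := lam)) (OUb_generated lam0)) => k;
  rewrite Ub_incE; case: k; rewrite ?OUb_cop_0 ?OUb_cop_1 !lrmD.
1,2: rewrite !stmapE ?lrm1 ?OUb_cop_0 ?OUb_cop_1 !tensDl !lrmD !stassocE !tensDr;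
     apply: scalar_ext => phi; ring.
all: rewrite ?counit_sliceE ?counit_slicerE ?lrm1 ?eU_0 ?eU_1 ?scale1r ?scale0r ?addr0 ?add0r //.
Qed.
End Antipodes.

(** * Normal ordering: every form is a sum of products of the two factors *)

Section Span.
Variables (K : fieldType) (lam : K).
Hypotheses (lam0 : lam != 0) (two_neq0 : 2%:R != 0 :> K).
Local Notation OSO := (OmegaSO K).
Local Notation OUb := (OmegaUb lam).
Local Notation OP := (OmegaPoinc lam).
Local Notation t := (oua0 lam).
Local Notation x := (oua1 lam).
Local Notation oc := (osoc K).
Local Notation os := (osos K).
Local Notation jS := (jS lam).
Local Notation jU := (jU lam).
Local Notation mu := (mul_map jS jU).

Let bm : bilin (fun w h => jS w * jU h).
Proof. exact: bilin_comp (mul_bilin OP) (lrm_linear jS) (lrm_linear jU). Qed.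
Let lm : linear mu := tlift_linear bm.
Let mE w h : mu (w \ox h) = jS w * jU h. Proof. exact: tlift_tens. Qed.

(** Moving h to the right of w costs only a correction inside Omega(C[SO_{1,1}]). As a mere
    existence statement it is stable under products in w, so generators suffice. *)
Let passes (h : OP) (w : OSO) := exists w' w'', h * jS w = jS w' * h + jS w''.
Let passes_all h : passes h oc -> passes h os -> passes h (dif oc) -> passes h (dif os) ->
  forall w, passes h w.
Proof.
move=> pc ps pdc pds.
have pM g w : passes h g -> passes h w -> passes h (g * w).
  move=> [g' [g'' eg]] [w' [w'' ew]]; exists (g' * w'), (g' * w'' + g'' * w).
  by rewrite lrmD !lrmM mulrA eg mulrDl -!mulrA ew mulrDr !mulrA addrA.
apply: (OSO_generated (K := K)) => [||k u v [u' [u'' eu]] [v' [v'' ev]]|k w hw|k w hw].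
- by exists 0, 0; rewrite !lrm0 mulr0 mul0r addr0.
- by exists 1, 0; rewrite lrm1 lrm0 mulr1 mul1r addr0.
- exists (k *: u' + v'), (k *: u'' + v''); rewrite !lrmP mulrDr mulrDl -scalerAr -scalerAl eu ev.
  by rewrite scalerDr addrACA.
- by apply: pM => //; rewrite SO_incE; case: k.
- by apply: pM => //; rewrite SO_incE; case: k.
Qed.

Let dS := jS_dga lam.
Let dU := jU_dga lam.
Let rP := OmegaPoinc_sat lam.
Let com_passes (h : OP) g v w : com h v = w -> jS g = v -> (exists w', w = jS w') -> passes h g.
Proof.
move=> e eg [w' ew]; exists g, w'; rewrite eg -ew -e.
by rewrite /com addrC subrK.
Qed.
Let anti_passes (h : OP) g v w : anticom h v = w -> jS g = v -> (exists w', w = jS w') -> passes h g.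
Proof.
move=> e eg [w' ew]; exists (- g), w'; rewrite lrmN eg -ew -e.
by rewrite /anticom mulNr addrC addrK.
Qed.
Let jdc : jS (dif oc) = dif (opc lam). Proof. by rewrite dS.2 jS_c. Qed.
Let jds : jS (dif os) = dif (ops lam). Proof. by rewrite dS.2 jS_s. Qed.

Let jE := (lrmZ jS, lrmB jS, lrmM jS, lrm1 jS, lrm0 jS, jdc, jds, jS_c lam, jS_s lam).
Let passes_0 w : passes (opa0 lam) w.
Proof.
apply: passes_all.
- apply: (com_passes (Poinc_a0c (OP_Poinc rP))); rewrite ?jE //.
  by exists (lam *: (os * os)); rewrite !jE expr2.
- apply: (com_passes (Poinc_a0s (OP_Poinc rP))); rewrite ?jE //.
  by exists (lam *: (os * oc)); rewrite !jE.
- apply: (com_passes (OP_0_dc rP)); rewrite ?jE //.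
  by exists (lam *: (os * dif os)); rewrite !jE.
- apply: (com_passes (OP_0_ds rP)); rewrite ?jE //.
  by exists (lam *: (os * dif oc)); rewrite !jE.
Qed.
Let passes_1 w : passes (opa1 lam) w.
Proof.
apply: passes_all.
- apply: (com_passes (Poinc_a1c (OP_Poinc rP))); rewrite ?jE //.
  by exists (lam *: ((oc - 1) * os)); rewrite !jE.
- apply: (com_passes (Poinc_a1s (OP_Poinc rP))); rewrite ?jE //.
  by exists (lam *: ((oc - 1) * oc)); rewrite !jE.
- apply: (com_passes (OP_1_dc rP)); rewrite ?jE //.
  by exists (lam *: ((oc - 1) * dif os)); rewrite !jE.
- apply: (com_passes (OP_1_ds rP)); rewrite ?jE //.
  by exists (lam *: ((oc - 1) * dif oc)); rewrite !jE.
Qed.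
Let passes_d0 w : passes (dif (opa0 lam)) w.
Proof.
apply: passes_all.
- apply: (com_passes (OP_d0_c rP)); rewrite ?jE //.
  by exists (lam *: (oc * dif oc)); rewrite !jE.
- apply: (com_passes (OP_d0_s rP)); rewrite ?jE //.
  by exists (lam *: (oc * dif os)); rewrite !jE.
- apply: (anti_passes (OP_d0_dc rP)); rewrite ?jE //.
  by exists 0; rewrite !jE.
- apply: (anti_passes (OP_d0_ds rP)); rewrite ?jE //.
  by exists (lam *: (dif os * dif oc)); rewrite !jE.
Qed.
Let passes_d1 w : passes (dif (opa1 lam)) w.
Proof.
apply: passes_all.
- apply: (com_passes (OP_d1_c rP)); rewrite ?jE //.
  by exists (lam *: (os * dif oc)); rewrite !jE.
- apply: (com_passes (OP_d1_s rP)); rewrite ?jE //.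
  by exists (lam *: (os * dif os)); rewrite !jE.
- apply: (anti_passes (OP_d1_dc rP)); rewrite ?jE //.
  by exists (lam *: (dif oc * dif os)); rewrite !jE.
- apply: (anti_passes (OP_d1_ds rP)); rewrite ?jE //.
  by exists 0; rewrite !jE.
Qed.

Lemma OP_span y : exists z : tensor OSO OUb, y = mu z.
Proof.
have mulS w (z : tensor OSO OUb) : exists z', jS w * mu z = mu z'.
  elim/tensor_ind: z => [|v u z [z' e]]; first by exists 0; rewrite (lin0 lm) mulr0.
  exists ((w * v) \ox u + z').
  by rewrite !(linD lm) !mE mulrDr e lrmM mulrA.
have mulU h (z : tensor OSO OUb) : (forall w, passes (jU h) w) -> exists z', jU h * mu z = mu z'.
  move=> ph; elim/tensor_ind: z => [|v u z [z' e]]; first by exists 0; rewrite (lin0 lm) mulr0.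
  have [v' [v'' ev]] := ph v.
  exists (v' \ox (h * u) + v'' \ox u + z').
  by rewrite !(linD lm) !mE mulrDr e lrmM mulrA ev mulrDl !mulrA.
move: y; apply: (OP_generated lam0) => [||k u v [zu ->] [zv ->]|k u [z ->]|k u [z ->]].
- by exists 0; rewrite (lin0 lm).
- by exists (1 \ox 1); rewrite mE !lrm1 mulr1.
- by exists (k *: zu + zv); rewrite lm.
- rewrite Poinc_incE; case: k.
  + by rewrite -(jS_c lam); exact: mulS.
  + by rewrite -(jS_s lam); exact: mulS.
  + by rewrite -(jU_0 lam); apply: mulU => w; rewrite jU_0.
  + by rewrite -(jU_1 lam); apply: mulU => w; rewrite jU_1.
- rewrite Poinc_incE; case: k.
  + by rewrite -(jS_c lam) -dS.2; exact: mulS.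
  + by rewrite -(jS_s lam) -dS.2; exact: mulS.
  + by rewrite -(jU_0 lam) -dU.2; apply: mulU => w; rewrite dU.2 jU_0.
  + by rewrite -(jU_1 lam) -dU.2; apply: mulU => w; rewrite dU.2 jU_1.
Qed.
End Span.

(** * Descent to degree 0 *)

(* A structure on the degree 0 part A of a differential graded algebra W, split
   off by a retraction r, is inherited from W. *)
Section Retract.
Variables (K : fieldType) (A : algType K) (W : dgaType K) (i : {lrmorphism A -> W})
  (r : {lrmorphism W -> conc0 A}).
Variables (D : {lrmorphism W -> stensor W W}) (e : {lrmorphism W -> K^o})
  (DA : {lrmorphism A -> atensor A A}) (eA : {lrmorphism A -> K^o}).
Hypotheses (riK : forall a, r (i a) = a :> A) (DE : forall a, D (i a) = tmap i i (DA a))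
  (eE : forall a, e (i a) = eA a).
Let li : linear i := lrm_linear i.
Let lr : linear (r : W -> A) := lrm_linear r.
Let lDA : linear (DA : A -> tensor A A) := lrm_linear DA.
Let lD : linear (D : W -> tensor W W) := lrm_linear D.

Section RetractComodule.
Variables (B : algType K) (V : dgaType K) (j : {lrmorphism B -> V}) (q : {lrmorphism V -> conc0 B})
  (c : {lrmorphism V -> stensor V W}) (cB : {lrmorphism B -> atensor B A}).
Hypotheses (qjK : forall b, q (j b) = b :> B) (cE : forall b, c (j b) = tmap j i (cB b)).
Let lj : linear j := lrm_linear j.
Let lq : linear (q : V -> B) := lrm_linear q.
Let lc : linear (c : V -> tensor V W) := lrm_linear c.
Let lcB : linear (cB : B -> tensor B A) := lrm_linear cB.
Lemma retract_coassoc b : tassoc (tmap c id (c (j b))) = tmap id D (c (j b)) ->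
  tassoc (tmap cB id (cB b)) = tmap id DA (cB b).
Proof.
(* The identity is tested after the inclusion of all three legs, which is injective because the
   retractions give a left inverse. *)
move=> h; apply: (@can_inj _ _ (tmap j (tmap i i)) (tmap (q : V -> B) (tmap (r : W -> A) (r : W -> A)))).
  have lii := tmap_lin li li. have lrr := tmap_lin lr lr.
  move=> z; rewrite tmap_comp // -[RHS]tmap_id; apply: eq_tmap => // w.
  by rewrite tmap_comp // -[RHS]tmap_id; apply: eq_tmap.
rewrite -(@tassoc_tmap K _ _ _ _ _ _ _ _ (cB : B -> tensor B A) (@id A) j i i) //.
have lii := tmap_lin li li.
rewrite [RHS]tmap_comp //.
rewrite (@eq_tmap K _ _ _ _ j (fun x => id (j x)) _ (fun x => D (i x))) //.
rewrite -(@tmap_comp K _ _ _ _ _ _ id D j i) //.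
rewrite -cE -h cE; congr tassoc; rewrite [RHS]tmap_comp //.
by apply: eq_tmap.
Qed.
Lemma retract_comodule : comodule D e c -> comodule DA eA cB.
Proof.
move=> [h1 h2]; split=> b; first exact: retract_coassoc.
have bV : bilin (fun (v : V) (w : W) => (e w : K) *: v).
  split=> z k u v /=; first by rewrite scalerDr !scalerA mulrC.
  by rewrite lrmP scalerDl scalerA.
have bB : bilin (fun (v : B) (w : A) => (eA w : K) *: v).
  split=> z k u v /=; first by rewrite scalerDr !scalerA mulrC.
  by rewrite lrmP scalerDl scalerA.
apply: (can_inj qjK); rewrite -[RHS]h2 cE (tlift_lin _ lj bB) tlift_tmap //.
by apply: eq_tlift => v w; rewrite lrmZ eE.
Qed.
End RetractComodule.

Lemma retract_hopf : coalgebra D e -> (exists S : {linear W -> W}, antipode D e S) -> hopf DA eA.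
Proof.
move=> [h1 h2 h3] [S aS]; split.
  have [cb cu] := @retract_comodule A W i r D DA riK DE (Build_comodule h1 h3).
  split=> // x.
  have bW : bilin (fun (v w : W) => (e v : K) *: w).
    split=> z k u v /=; last by rewrite scalerDr !scalerA mulrC.
    by rewrite lrmP scalerDl scalerA.
  have bA : bilin (fun (v w : A) => (eA v : K) *: w).
    split=> z k u v /=; last by rewrite scalerDr !scalerA mulrC.
    by rewrite lrmP scalerDl scalerA.
  apply: (can_inj riK); rewrite -[RHS]h2 DE (tlift_lin _ li bA) tlift_tmap //.
  by apply: eq_tlift => v w; rewrite lrmZ eE.
have lS : linear S := linearP S.
(* The antipode of [A] is r S i: a retraction is an algebra map, so the antipode equations pass
   through it. *)
have lSA : linear (fun a => r (S (i a)) : A) := lin_comp lr (lin_comp lS li).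
have bL := bilin_comp (mul_bilin W) lS (@lin_id K W).
have bR := bilin_comp (mul_bilin W) (@lin_id K W) lS.
exists (lin_of lSA) => a; have [e1 e2] := aS (i a).
have eM (x y : W) : r (x * y) = (r x : A) * (r y : A) :> A by exact: lrmM.
have e3 : (eA a : K)%:A = r ((e (i a) : K)%:A) :> A by rewrite lrmZ lrm1 eE.
rewrite e3 -{1}e1 -e2 DE !(tlift_lin _ lr) // !tlift_tmap //.
- by split; apply: eq_tlift => v w; rewrite eM riK.
- exact: lin_bilin bR lr.
- exact: lin_bilin bL lr.
Qed.
End Retract.

(** * The structure of Omega(C_lam[Poinc]) *)

Section Main.
Variables (K : fieldType) (lam : K).
Hypotheses (lam0 : lam != 0) (two_neq0 : 2%:R != 0 :> K).
Local Notation SO := (SO K).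
Local Notation Ub := (Ub lam).
Local Notation Poinc := (Poinc lam).
Local Notation OSO := (OmegaSO K).
Local Notation OUb := (OmegaUb lam).
Local Notation OP := (OmegaPoinc lam).
Local Notation gU := (@pgen K (Ub_pres lam)).
Local Notation gS := (@pgen K (SO_pres K)).
Local Notation gP := (@pgen K (Poinc_pres lam)).
Local Notation t := (oua0 lam).
Local Notation x := (oua1 lam).
Local Notation oc := (osoc K).
Local Notation os := (osos K).
Local Notation c := (opc lam).
Local Notation s := (ops lam).
Local Notation a0 := (opa0 lam).
Local Notation a1 := (opa1 lam).
Local Notation th := (opth lam).
Local Notation D := (OP_cop lam0 two_neq0).
Local Notation DS := (OSO_cop K).
Local Notation DU := (OUb_cop lam0 two_neq0).
Local Notation jS := (jS lam).
Local Notation jU := (jU lam).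
Local Notation qU := (qU lam).
Local Notation eS := (OSO_counit K).
Local Notation eU := (OUb_counit lam).
Local Notation eP := (OP_counit lam).
Local Notation proj := (@proj K lam).
Local Notation OUb_coaction := (OUb_coaction lam two_neq0).
Local Notation act := (bact jS jU proj).
Local Notation beta := (bbeta jU qU proj D).

Let dJS := jS_dga lam. Let dJU := jU_dga lam. Let dQ := qU_dga lam.
Let dD := OP_cop_dga lam0 two_neq0.
Let D_jS w : D (jS w) = tmap jS jS (DS w). Proof. exact: OP_cop_jS. Qed.
Let D_jU h : tmap id qU (D (jU h)) = tmap jU id (DU h). Proof. exact: OP_cop_jU. Qed.
Let D_jUl h : tmap (fun y => jU (qU y)) id (D (jU h)) = D (jU h).
Proof. exact: OP_cop_jU_left. Qed.
Let q_D y : tmap qU qU (D y) = DU (qU y). Proof. exact: qU_cop. Qed.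
Let coP := OP_coalgebra lam0 two_neq0.
Let coS := OSO_coalgebra K.
Let coU := OUb_coalgebra lam0 two_neq0.
Let qj := qU_jU lam0.
Let qjS := @qU_jS K lam.
Let eqU := eU_qU lam0.
Let ejS := @eP_jS K lam.
Let heU := @OUb_counit_homog K lam.
Let lP := @proj_linear K lam.
Let pS := @proj_jS K lam two_neq0.
Let pU := @proj_jU K lam lam0.
Let pg := @proj_gpr K lam.
Let pd := @proj_dif K lam two_neq0.
Let sp := OP_span lam0.

Lemma OP_module_algebra : super_module_algebra DU eU act.
Proof. exact: (bicross_module_algebra dJS dJU dQ coS coU D_jS D_jU qjS lP (proj1 lam)). Qed.
Lemma OP_comodule_coalgebra : super_comodule_coalgebra DS DU eS eU beta.
Proof.
exact: (bicross_comodule_coalgebra dJS dJU dQ dD coP coS coU D_jS D_jU D_jUl qj qjS q_D eqU ejS heU lP (proj1 lam)).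
Qed.
Lemma OP_super_bicrossproduct : super_bicrossproduct DS DU act beta D jS jU.
Proof.
exact: (abstract_super_bicrossproduct dJS dJU dQ coP coS coU D_jS D_jU D_jUl qjS lP (proj1 lam)).
Qed.
Lemma OP_antipode : exists2 A : {linear OP -> OP}, antipode D eP A &
  forall n y, homog n y -> homog n (A y).
Proof.
have [AS aS hS] := OSO_antipode K; have [AU aU hU] := OUb_antipode lam0 two_neq0.
exact: (bicross_antipode dJS dJU dQ dD coP coS coU D_jS D_jU D_jUl qj qjS q_D eqU ejS heU lP
  (proj1 lam) pS pU pg sp aS aU hS hU).
Qed.

Lemma OSO_bicovariant : strongly_bicovariant (SO_cop K) (SO_inc K) DS eS.
Proof.
split; [|exact: OSO_cop_inc|exact: OSO_cop_dga].
exact: super_hopf_of (OSO_cop_dga K) (@OSO_counit_homog K) coS (OSO_antipode K).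
Qed.
Lemma OUb_bicovariant : strongly_bicovariant (Ub_cop lam) (Ub_inc lam) DU eU.
Proof.
split; [|exact: OUb_cop_inc|exact: OUb_cop_dga].
exact: super_hopf_of (OUb_cop_dga lam0 two_neq0) heU coU (OUb_antipode lam0 two_neq0).
Qed.
Lemma OP_bicovariant : strongly_bicovariant (Poinc_cop lam) (Poinc_inc lam) D eP.
Proof.
split; [|exact: OP_cop_inc|exact: OP_cop_dga].
exact: super_hopf_of dD (@OP_counit_homog K lam) coP OP_antipode.
Qed.

Lemma eS_inc a : eS (SO_inc K a) = SO_counit K a.
Proof.
apply: (@alg_generated_ext K _ _ _ _ (lcomp eS (SO_inc K)) (SO_counit K) (@SO_generated K)) => k.
by rewrite lcompE SO_incE [RHS]alift_gen; case: k; [exact: eS_c|exact: eS_s].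
Qed.
Lemma eU_inc a : eU (Ub_inc lam a) = Ub_counit lam a.
Proof.
apply: (@alg_generated_ext K _ _ _ _ (lcomp eU (Ub_inc lam)) (Ub_counit lam) (@Ub_generated K lam)) => k.
by rewrite lcompE Ub_incE [RHS]alift_gen; case: k; [exact: eU_0|exact: eU_1].
Qed.
Lemma eP_inc a : eP (Poinc_inc lam a) = Poinc_counit lam a.
Proof.
apply: (@alg_generated_ext K _ _ _ _ (lcomp eP (Poinc_inc lam)) (Poinc_counit lam) (@Poinc_generated K lam)) => k.
by rewrite lcompE Poinc_incE [RHS]alift_gen; case: k;
  [exact: eP_c|exact: eP_s|exact: eP_0|exact: eP_1].
Qed.

Lemma SO_hopf : hopf (SO_cop K) (SO_counit K).
Proof.
apply: (retract_hopf (r := SO_ret K) (@SO_retK K) (@OSO_cop_inc K) eS_inc coS).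
by have [A aA _] := OSO_antipode K; exists A.
Qed.
Lemma Ub_hopf : hopf (Ub_cop lam) (Ub_counit lam).
Proof.
apply: (retract_hopf (r := Ub_ret lam) (@Ub_retK K lam) (OUb_cop_inc lam0 two_neq0) eU_inc coU).
by have [A aA _] := OUb_antipode lam0 two_neq0; exists A.
Qed.
Lemma Poinc_hopf : hopf (Poinc_cop lam) (Poinc_counit lam).
Proof.
apply: (retract_hopf (r := Poinc_ret lam) (@Poinc_retK K lam) (OP_cop_inc lam0 two_neq0) eP_inc coP).
by have [A aA _] := OP_antipode; exists A.
Qed.

Let dR := OUb_coaction_dga lam two_neq0.
Lemma OUb_coaction_0 : OUb_coaction t = 1 \ox a0 + t \ox c + x \ox s. Proof. exact: (@OUb_coactionE K lam two_neq0 OUa0). Qed.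
Lemma OUb_coaction_1 : OUb_coaction x = 1 \ox a1 + t \ox s + x \ox c. Proof. exact: (@OUb_coactionE K lam two_neq0 OUa1). Qed.

Lemma DeltaR_inc (W : dgaType K) (i : {lrmorphism Poinc -> W}) (hi : forall a, homog 0 (i a))
  (f : {lrmorphism OUb -> stensor OUb W}) :
  f t = coact0 t x (i (pc lam)) (i (ps lam)) (i (pa0 lam)) ->
  f x = coact1 t x (i (pc lam)) (i (ps lam)) (i (pa1 lam)) ->
  forall b, f (Ub_inc lam b) = tmap (Ub_inc lam) i (DeltaR lam b).
Proof.
move=> f0 f1 b; set g := lcomp (tmap0 (@Ub_inc_homog K lam) hi) (DeltaR lam).
rewrite -[RHS]/(g b); apply: (@alg_generated_ext K _ _ _ _ (lcomp f (Ub_inc lam)) g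
   (@Ub_generated K lam)) => k.
rewrite /g !lcompE [DeltaR _ _]alift_gen Ub_incE.
by case: k; rewrite !lrmD !tmap0E lrm1 ?Ub_inc_0 ?Ub_inc_1 ?f0 ?f1.
Qed.
Lemma OUb_coaction_inc b : OUb_coaction (Ub_inc lam b) = tmap (Ub_inc lam) (Poinc_inc lam) (DeltaR lam b).
Proof.
apply: DeltaR_inc; first exact: Poinc_inc_homog.
- by rewrite OUb_coaction_0 Poinc_inc_c Poinc_inc_s Poinc_inc_a0.
- by rewrite OUb_coaction_1 Poinc_inc_c Poinc_inc_s Poinc_inc_a1.
Qed.
Lemma OUb_coaction_comodule : comodule D eP OUb_coaction.
Proof.
have hP := @OP_counit_homog K lam.
split.
- move=> h; apply: (OUb_ext lam0 (f := lcomp (stassoc OUb OP OP) (lcomp (stmap dR (idlrm_dga OP)) OUb_coaction))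
    (h := lcomp (stmap (idlrm_dga OUb) dD) OUb_coaction)).
  + exact: lcomp_dga (stassoc_dga _ _ _) (lcomp_dga (stmap_dga _ _) dR).
  + exact: lcomp_dga (stmap_dga _ _) dR.
  + rewrite lcompE [RHS]lcompE lcompE OUb_coaction_0 !lrmD !stmapE lrm1 OUb_coaction_0 OUb_coaction_1 OP_cop_0 OP_cop_c OP_cop_s.
    by rewrite !tensDl !lrmD !stassocE !tensDr; apply: scalar_ext => phi; ring.
  + rewrite lcompE [RHS]lcompE lcompE OUb_coaction_1 !lrmD !stmapE lrm1 OUb_coaction_0 OUb_coaction_1 OP_cop_1 OP_cop_c OP_cop_s.
    by rewrite !tensDl !lrmD !stassocE !tensDr; apply: scalar_ext => phi; ring.
- move=> h; apply: (OUb_ext lam0 (f := lcomp (counit_slicer OUb hP) OUb_coaction) (h := idlrm OUb)).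
  + exact: lcomp_dga (counit_slicer_dga _ hP) dR.
  + exact: idlrm_dga.
  + by rewrite lcompE OUb_coaction_0 !lrmD !counit_slicerE eP_0 eP_c eP_s !scale0r scale1r add0r addr0.
  + by rewrite lcompE OUb_coaction_1 !lrmD !counit_slicerE eP_1 eP_c eP_s !scale0r scale1r !add0r.
Qed.
Lemma DeltaR_comodule : comodule (Poinc_cop lam) (Poinc_counit lam) (DeltaR lam).
Proof.
exact: (retract_comodule (r := Poinc_ret lam) (@Poinc_retK K lam) (OP_cop_inc lam0 two_neq0) eP_inc
  (q := Ub_ret lam) (@Ub_retK K lam) OUb_coaction_inc OUb_coaction_comodule).
Qed.
Lemma Poinc_inc_differentiable : differentiable (DeltaR lam) (Ub_inc lam) (Poinc_inc lam).
Proof. by exists OUb_coaction; [exact: dR|exact: OUb_coaction_inc]. Qed.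

(** The presentation provides the map, since differentiability forces every relation in [W]; it is
    surjective because an exterior algebra is generated by its degrees 0 and 1, which are visibly in
    the image. *)
Lemma OP_universal (W : dgaType K) (i : {lrmorphism Poinc -> W}) :
  exterior i -> differentiable (DeltaR lam) (Ub_inc lam) i ->
  exists p : {lrmorphism OP -> W},
    [/\ dga_map p, forall a, p (Poinc_inc lam a) = i a & forall y, exists z, p z = y].
Proof.
move=> ex [f df fE].
have hi a : homog 0 (i a) by apply/(exterior_deg0 ex); exists a.
pose m := tmap0 (@Ub_inc_homog K lam) hi.
have mE b b' : tmap (Ub_inc lam) i (b \ox b') = Ub_inc lam b \ox i b' by exact: (tmap0E (@Ub_inc_homog K lam) hi).
have f0 : f t = coact0 t x (i (pc lam)) (i (ps lam)) (i (pa0 lam)).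
  rewrite -{1}Ub_inc_0 fE [DeltaR _ _]alift_gen -[LHS]/(m _) !lrmD /m !tmap0E lrm1.
  by rewrite Ub_inc_0 Ub_inc_1.
have f1 : f x = coact1 t x (i (pc lam)) (i (ps lam)) (i (pa1 lam)).
  rewrite -{1}Ub_inc_1 fE [DeltaR _ _]alift_gen -[LHS]/(m _) !lrmD /m !tmap0E lrm1.
  by rewrite Ub_inc_0 Ub_inc_1.
have r := OmegaPoinc_coact lam0 two_neq0 (hi _) (hi _) (hi _) (hi _)
  (Poinc_rel_map i (Poinc_sat lam)) df f0 f1.
pose p : {lrmorphism OP -> W} := dlift (OP_dsat (hi _) (hi _) (hi _) (hi _) (homog_coact_th df) r).
have dp : dga_map p by exact: dlift_dga_map.
have pi a : p (Poinc_inc lam a) = i a.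
  apply: (@alg_generated_ext K _ _ _ _ (lcomp p (Poinc_inc lam)) i (@Poinc_generated K lam)) => k.
  by rewrite lcompE Poinc_incE; case: k; exact: dlift_gen.
exists p; split=> //; apply: (exterior_gen ex) => [y|y|k y z [y' <-] [z' <-]|y z [y' <-] [z' <-]].
- by move=> /(exterior_deg0 ex)[a ->]; exists (Poinc_inc lam a).
- move=> /(exterior_deg1 ex)[l ->].
  exists (\sum_(q <- l) Poinc_inc lam q.1 * dif (Poinc_inc lam q.2)).
  rewrite (big_morph p (lrmD p) (lrm0 p)); apply: eq_bigr => q _.
  by rewrite lrmM dp.2 !pi.
- by exists (k *: y' + z'); rewrite lrmP.
- by exists (y' * z'); rewrite lrmM.
Qed.

Let proj_of_jS w : proj (jS w) = w. Proof. by rewrite -[jS w]mulr1 pS proj1 mulr1. Qed.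
Let proj_of_jU h : proj (jU h) = (eU h : K)%:A. Proof. by rewrite -[jU h]mul1r pU proj1. Qed.
Lemma jS_inj : injective jS. Proof. exact: can_inj proj_of_jS. Qed.
Lemma jU_inj : injective jU. Proof. exact: can_inj qj. Qed.

(** The action reads off cross relations: jU h jS v is jS v jU h plus the commutator, and [proj]
    kills the first term when the counit of h is 0. *)
Let act_com h v w : eU h = 0 -> com (jU h) (jS v) = jS w -> act h v = w.
Proof.
move=> eh e; rewrite /bact; have -> : jU h * jS v = jS v * jU h + jS w.
  by rewrite -e /com addrC subrK.
by rewrite (linD lP) pU eh scale0r add0r proj_of_jS.
Qed.
Let jE := (lrmZ jS, lrmB jS, lrmM jS, lrm1 jS, lrm0 jS, dJS.2, jS_c lam, jS_s lam).
Let kE := (jU_0 lam, jU_1 lam, jU_th lam, dJU.2).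
Lemma OP_extended_action : extended_action act.
Proof.
have r := OmegaPoinc_sat lam.
have e0 := eU_0 lam; have e1 := eU_1 lam.
have d0 : eU (dif t) = 0 := counit_difU _; have d1 : eU (dif x) = 0 := counit_difU _.
have eth : eU (outh lam) = 0 := heU (homog_outh lam).
have rr := OP_Poinc r.
split; apply: act_com => //; rewrite ?expr2 ?jE ?kE ?jE.
- by rewrite (Poinc_a0c rr) expr2.
- exact: Poinc_a0s rr.
- by rewrite (Poinc_a1c rr) mulrBl mul1r.
- by rewrite (Poinc_a1s rr) mulrBl mul1r.
- exact: OP_d0_c r.
- exact: OP_d0_s r.
- exact: OP_d1_c r.
- exact: OP_d1_s r.
- exact: OP_0_dc r.
- exact: OP_0_ds r.
- exact: OP_1_dc r.
- exact: OP_1_ds r.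
- exact: OP_th_c r.
- exact: OP_th_s r.
Qed.

Let sd (a b : OP) : homog 0 a -> dif (a \ox b : stensor OP OP) = dif a \ox b + a \ox dif b.
Proof. exact: stens_dif0. Qed.
Lemma OP_cop_dc : D (dif c) = dif c \ox c + dif s \ox s + c \ox dif c + s \ox dif s.
Proof.
by rewrite dD.2 OP_cop_c difD (sd _ (homog_opc lam)) (sd _ (homog_ops lam)) addrACA !addrA.
Qed.
Lemma OP_cop_ds : D (dif s) = dif c \ox s + dif s \ox c + c \ox dif s + s \ox dif c.
Proof.
by rewrite dD.2 OP_cop_s difD (sd _ (homog_opc lam)) (sd _ (homog_ops lam)) addrACA !addrA.
Qed.
Lemma OP_cop_d0 : D (dif a0) = 1 \ox dif a0 + dif a0 \ox c + dif a1 \ox s + a0 \ox dif c + a1 \ox dif s.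
Proof. by rewrite dD.2 OP_cop_0 dif_coact0 //; [exact: homog_opa0|exact: homog_opa1]. Qed.
Lemma OP_cop_d1 : D (dif a1) = 1 \ox dif a1 + dif a0 \ox s + dif a1 \ox c + a0 \ox dif s + a1 \ox dif c.
Proof. by rewrite dD.2 OP_cop_1 dif_coact1 //; [exact: homog_opa0|exact: homog_opa1]. Qed.
Lemma OP_cop_theta : D th = 1 \ox th + th \ox 1 - 1 \ox dif a0 - dif a0 \ox 1 + D (dif a0).
Proof.
rewrite OP_cop_th /coactth OP_cop_d0; apply: scalar_ext => phi; ring.
Qed.

(** Applying [qU] and [proj] to the legs of the coproducts: [proj] kills a_0, a_1, theta' and their
    differentials, which removes exactly the terms 1 \ox a_i, 1 \ox da_i and 1 \ox theta'. *)
Lemma OP_extended_coaction : extended_coaction beta.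
Proof.
have lt : linear (tmap qU proj) := tmap_lin (lrm_linear qU) lP.
have tE (a b : OP) : tmap qU proj (a \ox b) = qU a \ox proj b := tmap_tens a b (lrm_linear qU) lP.
have pc : proj c = oc by rewrite -(jS_c lam) proj_of_jS.
have ps : proj s = os by rewrite -(jS_s lam) proj_of_jS.
have p0 : proj a0 = 0 by rewrite -(jU_0 lam) proj_of_jU eU_0 scale0r.
have p1 : proj a1 = 0 by rewrite -(jU_1 lam) proj_of_jU eU_1 scale0r.
have pth : proj th = 0 by rewrite -(jU_th lam) proj_of_jU (heU (homog_outh lam)) scale0r.
have tN y : tmap qU proj (- y) = - tmap qU proj y by rewrite -!scaleN1r (linZ _ _ lt).
have E := (qU_0 lam, qU_1 lam, qU_th lam, qU_c lam, qU_s lam, dQ.2, pd, pc, ps, p0, p1, pth,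
  dif0, proj1 lam).
have ec0 : beta t = t \ox oc + x \ox os.
  by rewrite /bbeta jU_0 OP_cop_0 !(linD lt) !tE !E tens0r add0r.
have ec1 : beta x = t \ox os + x \ox oc.
  by rewrite /bbeta jU_1 OP_cop_1 !(linD lt) !tE !E tens0r add0r.
have ed0 : beta (dif t) = dif t \ox oc + dif x \ox os + t \ox dif oc + x \ox dif os.
  by rewrite /bbeta dJU.2 jU_0 OP_cop_d0 !(linD lt) !tE !E tens0r add0r.
have ed1 : beta (dif x) = dif t \ox os + dif x \ox oc + t \ox dif os + x \ox dif oc.
  by rewrite /bbeta dJU.2 jU_1 OP_cop_d1 !(linD lt) !tE !E tens0r add0r.
split=> //.
rewrite ed0 /bbeta jU_th OP_cop_th /coactth !(linD lt) tN !tE !E tens0r add0r.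
by rewrite !addrA.
Qed.
End Main.

Import Num.Theory.
(** The universal clause determines [Om] up to isomorphism: a DGA map out of an exterior algebra is
    determined by its restriction to degree 0, so the maps between two such algebras are mutually
    inverse. *)
Theorem proposition5p5 (R : realType) (lam : R[i]) (lam_neq0 : lam != 0) :
  (* the standing structures *)
  [/\ [/\ hopf (SO_cop R[i]) (SO_counit R[i]),
          hopf (Ub_cop lam) (Ub_counit lam),
          hopf (Poinc_cop lam) (Poinc_counit lam)
        & comodule (Poinc_cop lam) (Poinc_counit lam) (DeltaR lam)],
      exterior (SO_inc R[i]) /\ exterior (Ub_inc lam)
  & exists (Om : dgaType R[i]) (i : {lrmorphism Poinc lam -> Om})
      (D : {lrmorphism Om -> stensor Om Om}) (e : {lrmorphism Om -> R[i]^o})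
      (jS : {lrmorphism OmegaSO R[i] -> Om}) (jU : {lrmorphism OmegaUb lam -> Om})
      (th : Om),
      let c := i (pc lam) in let s := i (ps lam) in
      let a0 := i (pa0 lam) in let a1 := i (pa1 lam) in
      [/\ (* a strongly bicovariant exterior algebra making DeltaR differentiable *)
          [/\ exterior i,
              strongly_bicovariant (Poinc_cop lam) i D e
            & differentiable (DeltaR lam) (Ub_inc lam) i],
          (* universal: any other one making DeltaR differentiable is a quotient *)
          forall (Om' : dgaType R[i]) (i' : {lrmorphism Poinc lam -> Om'}),
            exterior i' -> differentiable (DeltaR lam) (Ub_inc lam) i' ->
            exists p : {lrmorphism Om -> Om'},
              [/\ dga_map p, forall a, p (i a) = i' a & forall y, exists x, p x = y],
          (* Omega(U(b_+)) and Omega(C[SO_{1,1}]) are sub-exterior algebras *)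
          ([/\ dga_map jU, injective jU
             & [/\ jU (oua0 lam) = a0, jU (oua1 lam) = a1 & jU (outh lam) = th]] /\
           [/\ dga_map jS, injective jS
             & jS (osoc R[i]) = c /\ jS (osos R[i]) = s]),
          (* the relations, which present Om over the generators *)
          (OmegaPoinc_rel lam c s a0 a1 th /\
           forall (W : dgaType R[i]) (c' s' a0' a1' th' : W),
             [/\ homog 0 c', homog 0 s', homog 0 a0', homog 0 a1' & homog 1 th'] ->
             OmegaPoinc_rel lam c' s' a0' a1' th' ->
             exists f : {lrmorphism Om -> W},
               dga_map f /\ [/\ f c = c', f s = s', f a0 = a0', f a1 = a1' & f th = th'])
        & (* the super bicrossproduct and the coproduct *)
          (exists (DS : {lrmorphism OmegaSO R[i] -> stensor (OmegaSO R[i]) (OmegaSO R[i])})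
             (eS : {lrmorphism OmegaSO R[i] -> R[i]^o})
             (DU : {lrmorphism OmegaUb lam -> stensor (OmegaUb lam) (OmegaUb lam)})
             (eU : {lrmorphism OmegaUb lam -> R[i]^o})
             (act : OmegaUb lam -> OmegaSO R[i] -> OmegaSO R[i])
             (beta : OmegaUb lam -> stensor (OmegaUb lam) (OmegaSO R[i])),
             [/\ strongly_bicovariant (SO_cop R[i]) (SO_inc R[i]) DS eS /\
                 strongly_bicovariant (Ub_cop lam) (Ub_inc lam) DU eU,
                 super_module_algebra DU eU act /\ extended_action act,
                 super_comodule_coalgebra DS DU eS eU beta /\ extended_coaction beta
               & super_bicrossproduct DS DU act beta D jS jU]) /\
          [/\ D (dif c) = dif c \ox c + dif s \ox s + c \ox dif c + s \ox dif s,
              D (dif s) = dif c \ox s + dif s \ox c + c \ox dif s + s \ox dif c,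
              D (dif a0) = 1 \ox dif a0 + dif a0 \ox c + dif a1 \ox s
                           + a0 \ox dif c + a1 \ox dif s,
              D (dif a1) = 1 \ox dif a1 + dif a0 \ox s + dif a1 \ox c
                           + a0 \ox dif s + a1 \ox dif c
            & D th = 1 \ox th + th \ox 1 - 1 \ox dif a0 - dif a0 \ox 1 + D (dif a0)]]].
Proof.
have two_neq0 : 2%:R != 0 :> R[i] by rewrite pnatr_eq0.
have [SG UG] := (SO_exterior R[i], Ub_exterior lam_neq0).
split; [|by []|].
  split; [exact: SO_hopf|exact: Ub_hopf|exact: Poinc_hopf|exact: DeltaR_comodule].
exists (OmegaPoinc lam), (Poinc_inc lam), (OP_cop lam_neq0 two_neq0), (OP_counit lam).
exists (jS lam), (jU lam), (opth lam).
rewrite /= Poinc_inc_c Poinc_inc_s Poinc_inc_a0 Poinc_inc_a1; split.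
- split; [exact: Poinc_exterior|exact: OP_bicovariant|exact: Poinc_inc_differentiable].
- exact: OP_universal.
- split; split; try exact: jU_dga; try exact: jS_dga; try exact: jU_inj; try exact: jS_inj.
    by split; [exact: jU_0|exact: jU_1|exact: jU_th].
  by split; [exact: jS_c|exact: jS_s].
- split; first exact: OmegaPoinc_sat.
  move=> W c' s' a0' a1' th' [hc hs h0 h1 hth] r.
  exists (dlift (OP_dsat hc hs h0 h1 hth r)); split; first exact: dlift_dga_map.
  by split; exact: dlift_gen.
- split; last first.
    split; [exact: OP_cop_dc|exact: OP_cop_ds|exact: OP_cop_d0|exact: OP_cop_d1|].
    exact: OP_cop_theta.
  exists (OSO_cop R[i]), (OSO_counit R[i]), (OUb_cop lam_neq0 two_neq0), (OUb_counit lam).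
  exists (bact (jS lam) (jU lam) (proj (lam := lam))).
  exists (bbeta (jU lam) (qU lam) (proj (lam := lam)) (OP_cop lam_neq0 two_neq0)).
  split; [split|split|split|exact: OP_super_bicrossproduct].
  + exact: OSO_bicovariant.
  + exact: OUb_bicovariant.
  + exact: OP_module_algebra.
  + exact: OP_extended_action.
  + exact: OP_comodule_coalgebra.
  + exact: OP_extended_coaction.
Qed.
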